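(* Let $0<s<1$, $W>0$, $\kappa>0$. Let $f:\mathbb R\to\mathbb R$ be a measurable function with $f(t)=0$ for $t\le 0$, such that $f$ is nonnegative and strictly increasing for $t>0$, and $$\lim_{t\to0_+}t^{-\frac1{1-s}}f(t)=+\infty,\qquad \lim_{t\to+\infty}t^{-\frac1{1-s}}f(t)=0 .$$ If $0<s<\frac12$, assume in addition $f\in C^{1-2s}$. Then there is $\varepsilon_0>0$ such that for any $\varepsilon\in(0,\varepsilon_0)$ the gSQG equation has a traveling-wave solution $\theta_\varepsilon(x,t)=\hat\omega_{tr,\varepsilon}(x+Wt\,\mathbf e_2)$ for some $\hat\omega_{tr,\varepsilon}\in L^\infty(\mathbb R^2)$, in the sense that $$\int_{\mathbb R^2}\hat\omega_{tr,\varepsilon}\,\nabla^\perp\big(\mathcal G_s\hat\omega_{tr,\varepsilon}-Wx_1\big)\cdot\nabla\varphi\,dx=0\qquad\forall\varphi\in C_0^\infty(\mathbb R^2).$$ Moreover: (i) $\hat\omega_{tr,\varepsilon}(-x_1,x_2)=-\hat\omega_{tr,\varepsilon}(x_1,x_2)$ and $\hat\omega_{tr,\varepsilon}(x_1,-x_2)=\hat\omega_{tr,\varepsilon}(x_1,x_2)$ for all $x\in\mathbb R^2$; (ii) for some constant $\mu_\varepsilon$, $\ \varepsilon^2\hat\omega_{tr,\varepsilon}=f\big(\varepsilon^{2-2s}(\mathcal G_s\hat\omega_{tr,\varepsilon}-Wx_1)-\mu_\varepsilon\big)$ in $\mathbb R^2_+$; (iii) as $\varepsilon\to0$, in the sense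 of measures, $$\hat\omega_{tr,\varepsilon}\rightharpoonup\kappa\,\delta(x-(d_0,0))-\kappa\,\delta(x+(d_0,0)),\qquad d_0=\left(\frac{(1-s)c_s\kappa}{2^{2-2s}W}\right)^{\frac1{3-2s}}.$$ Furthermore, there is a constant $R>0$ independent of $\varepsilon$ such that $\mathrm{spt}(\hat\omega_{tr,\varepsilon})\subset B((d_0,0),R\varepsilon)\cup B((-d_0,0),R\varepsilon)$.
   Context: The gSQG (generalized surface quasi-geostrophic) equation is $\partial_t\theta+\mathbf u\cdot\nabla\theta=0$, $\mathbf u=\nabla^\perp(-\Delta)^{-s}\theta$ in $\mathbb R^2\times(0,T)$, where $(a_1,a_2)^\perp=(a_2,-a_1)$ and $$(-\Delta)^{-s}\omega(x)=\mathcal G_s\omega(x)=\int_{\mathbb R^2}\frac{c_s}{|x-y|^{2-2s}}\omega(y)\,dy,\qquad c_s=\frac{\Gamma(1-s)}{2^{2s}\pi\Gamma(s)}.$$ $\mathbf e_2=(0,1)$, $\mathbb R^2_+=\{x\in\mathbb R^2: x_1>0\}$, $B(x,r)$ is the disk with center $x$ and radius $r$, $\delta$ is the Dirac mass at the origin, $\mathrm{spt}$ denotes support. $C^{1-2s}$ denotes the class of (locally) Hölder continuous functions with exponent $1-2s$. *)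

(* Defs.v *)
From HB Require Import structures.
From mathcomp Require Import all_boot all_order all_algebra.
From mathcomp Require Import all_classical all_reals all_analysis.

Set Implicit Arguments.
Unset Strict Implicit.
Unset Printing Implicit Defensive.

Import Order.TTheory GRing.Theory Num.Theory.
Import numFieldNormedType.Exports.

Local Open Scope classical_set_scope.
Local Open Scope ring_scope.

Section Plane.
Context (R : realType).

Definition mu2 : {measure set (measurableTypeR R * measurableTypeR R)%type -> \bar R} :=
  (lebesgue_measure \x lebesgue_measure)%E.

(* The library's norm on R * R is the sup norm, so the Euclidean one is
   spelled out. *)
Definition enorm (x : R * R) : R := Num.sqrt (x.1 ^+ 2 + x.2 ^+ 2).

Definition disk (c : R * R) (r : R) : set (R * R) :=
  [set x | enorm (x - c) < r].

Definition dot (a b : R * R) : R := a.1 * b.1 + a.2 * b.2.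

Definition perp (a : R * R) : R * R := (a.2, - a.1).

Definition spt (f : R * R -> R) : set (R * R) := closure [set x | f x != 0].

Definition e1 : R * R := (1, 0).
Definition e2 : R * R := (0, 1).

Definition grad (f : R * R -> R) (x : R * R) : R * R :=
  ('D_e1 f x, 'D_e2 f x).

Fixpoint Ck (n : nat) (f : R * R -> R) : Prop :=
  if n is k.+1 then
    [/\ continuous f,
        forall x, derivable f x e1 /\ derivable f x e2,
        Ck k (fun x => 'D_e1 f x) &
        Ck k (fun x => 'D_e2 f x)]
  else continuous f.

Definition test_function (phi : R * R -> R) : Prop :=
  (forall n, Ck n phi) /\ compact (spt phi).

Definition locally_integrable2 (f : R * R -> R) : Prop :=
  measurable_fun setT f /\
  forall K : set (R * R), compact K -> mu2.-integrable K (EFin \o f).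

Definition weak_gradient (f : R * R -> R) (g : R * R -> R * R) : Prop :=
  [/\ locally_integrable2 f,
      locally_integrable2 (fun x => (g x).1),
      locally_integrable2 (fun x => (g x).2) &
      forall phi, test_function phi ->
        (\int[mu2]_x (f x * (grad phi x).1)) =
          - (\int[mu2]_x ((g x).1 * phi x)) /\
        (\int[mu2]_x (f x * (grad phi x).2)) =
          - (\int[mu2]_x ((g x).2 * phi x))].

Definition Gamma (z : R) : R :=
  \int[@lebesgue_measure R]_(t in `]0, +oo[) (t `^ (z - 1) * expR (- t)).

Definition c_ (s : R) : R :=
  Gamma (1 - s) / (2 `^ (2 * s) * pi * Gamma s).

Definition riesz (s : R) (w : R * R -> R) (x : R * R) : R :=
  \int[mu2]_y (c_ s / enorm (x - y) `^ (2 - 2 * s) * w y).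

(* theta(x, t) = w(x + W t e2) solves the gSQG equation: substituting this
   ansatz turns it into div (w perp (grad (G_s w - W x_1))) = 0, taken in the
   sense of distributions.  For a merely bounded w the potential G_s w need not
   be differentiable (s <= 1/2), so its gradient is the weak one, and its
   existence in L^1_loc is part of the requirement. *)
Definition gsqg_traveling_wave (s W : R) (w : R * R -> R) : Prop :=
  exists2 g : R * R -> R * R,
    weak_gradient (fun x => riesz s w x - W * x.1) g &
    forall phi, test_function phi ->
      (\int[mu2]_x (w x * dot (perp (g x)) (grad phi x))) = 0.

Definition locally_hoelder (a : R) (f : R -> R) : Prop :=
  forall x : R, exists C : R,
    \forall y & z \near x, `|f y - f z| <= C * `|y - z| `^ a.

Definition d0 (s W kappa : R) : R :=
  ((1 - s) * c_ s * kappa / (2 `^ (2 - 2 * s) * W)) `^ (3 - 2 * s)^-1.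

End Plane.

(* Main.v *)
(* Put [e = 1 - s], [c = c_ s], [L = d0 / eps] and rescale [x = eps y].  Among the densities
   [0 <= h <= Lam] of mass [kappa] that are carried by a box around [(L, 0)] and symmetric
   decreasing in [x.2], maximize the energy [c/2 <h, K h> - speed L * <x.1, h> - int J (h)],
   where [K] has the kernel [|x - y|^(-2e)] minus its mirror image and [J] is the (truncated)
   Legendre transform of the primitive of [f].

   The potentials of a maximizing sequence are equicontinuous and converge to some [p].  The
   bathtub profile [f (p - mu)] of mass [kappa] beats every competitor for the problem
   linearized at [p], and the interaction form is positive definite, being a mixture of Gaussian
   forms, so the profile is itself a maximizer; the equality case of Young's inequality gives
   [zt = f (psi zt - mu)] on the box.  A trial density bounds the energy, hence [mu], from below
   uniformly in [L].  Then the potential is large at each point of the support, so that a fixed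
   amount of mass lies near it; as a large horizontal gap could be closed with a gain of energy,
   the diameter of the support is bounded independently of [L].  Optimality under horizontal
   translations keeps the support away from the sides of the box, and outside the box
   [psi < mu], so the equation holds in the whole half-plane.

   For the weak form, the strict monotonicity of [psi] in [|x.2|] controls the jumps of [f] and
   gives an [L^1] modulus of continuity of [zt] of order larger than [1 - 2 s].  With it the
   principal value integral for the gradient of the potential is locally integrable and is the
   limit of the mollified gradients.  For the mollified stream function [U] and a continuous
   approximation [f_n] of [f], the field [f_n (U) grad U = grad (prim f_n o U)] is curl free;
   removing first the mollification and then the approximation yields the claim. *)
From HB Require Import structures.
From mathcomp Require Import all_boot all_order all_algebra.
From mathcomp Require Import all_classical all_reals all_analysis.
From mathcomp Require Import measurable_realfun.
From mathcomp Require Import ring lra.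
Require Import Defs.

Set Implicit Arguments.
Unset Strict Implicit.
Unset Printing Implicit Defensive.
Import Order.TTheory GRing.Theory Num.Theory.
Import numFieldNormedType.Exports.
Local Open Scope classical_set_scope.
Local Open Scope ring_scope.

(** * Integration over the plane *)

Local Notation pushforward_measure :=
  (measure_function_pushforward__canonical__measure_function_Measure).

Section AffineInvariance.
Context (R : realType).
Local Notation leb := (@lebesgue_measure R).
Local Notation mR := (measurableTypeR R).

(** [speed L] is the velocity of a pair of point vortices of strengths [kappa] and [- kappa] at
    distance [2 L], and [d0] solves the equation that turns it into [W] after rescaling; so a
    concentrated maximizer has no reason to leave the neighbourhood of [(L, 0)]. The exponent
    [1 / e] in the growth conditions on [f] is the scale-invariant one. Slower growth at infinity
    yields a level [T] that the stream function of a density bounded by [f T] cannot reach, so the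
    truncations at [T] and [Lam = f T] are invisible. Faster growth at [0] lets a flat patch have
    positive energy, and lets the set where the stream function is large carry more mass than
    [kappa]. Two obstacles shape the rest. For [e <= 1/2] the function [f] may jump, while its
    equation is wanted at every point: densities are therefore produced as profiles of potentials,
    which ignore null sets. And the gradient kernel has size [|z|^(-(2 e + 1))], not integrable at
    the origin when [e >= 1/2]: there a bounded density is not enough, and the Hoelder exponent
    [1 - 2 s = 2 e - 1] of [f] feeds a bootstrap that produces a sufficient modulus. *)

Lemma measurable_affine (a b : R) :
  measurable_fun [set: mR] (fun x : mR => (a * x + b : mR)).
Proof.
have -> : (fun x : mR => (a * x + b : mR)) =
  ((fun x : R => (a * x)) \+ cst b) by [].
by apply: measurable_funD => //; exact: measurable_funM.
Qed.

(** By uniqueness of Lebesgue measure it suffices to compare both sides on half-open intervals. A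
    negative [a] exchanges the open and the closed end, which does not change the length. *)
Lemma lebesgue_measure_affine (a b : R) (A : set R) : a != 0 ->
  measurable A ->
  (`|a|%:E * leb ((fun x : R => (a * x + b)%R) @^-1` A) = leb A)%E.
Proof.
move=> a0 mA; have ma := measurable_affine a b.
pose m : {measure set mR -> \bar R} :=
  mscale (NngNum (normr_ge0 a)) (pushforward_measure leb ma).
suff -> : leb A = m A by [].
apply: lebesgue_measure_unique => // X /ocitvP[->|[[c d]] /= cd ->].
  by rewrite !measure0.
have [apos|aneg] : 0 < a \/ a < 0 by move: a0; rewrite neq_lt => /orP[]; auto.
- rewrite /m /= /mscale /= /pushforward/=.
  rewrite [X in (_ * leb X)%E](_ : _ =
            `](c - b) / a, (d - b) / a]%classic); last first.
    apply/seteqP; split=> x /=; rewrite !in_itv/= ltr_pdivrMr// ler_pdivlMr//;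
      rewrite (mulrC x) ltrBlDr lerBrDr => //.
  rewrite !lebesgue_measure_itv/= !lte_fin cd ltr_pM2r ?invr_gt0//.
  rewrite ltrD2r cd -!EFinB -EFinM gtr0_norm//; congr EFin; field.
  by rewrite gt_eqF.
- rewrite /m /= /mscale /= /pushforward/=.
  rewrite [X in (_ * leb X)%E](_ : _ =
            `[(d - b) / a, (c - b) / a[%classic); last first.
    apply/seteqP; split=> x /=; rewrite !in_itv/= ltr_ndivlMr// ler_ndivrMr//;
      rewrite (mulrC x) ltrBlDr lerBrDr; rewrite andbC => //.
  rewrite !lebesgue_measure_itv/= !lte_fin cd ltr_nM2r ?invr_lt0//.
  rewrite ltrD2r cd -!EFinB -EFinM ltr0_norm//; congr EFin; field.
  by rewrite lt_eqF.
Qed.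

(* A constant of its own, since the canonical sigma-finite structure on
   [_ \x _] is only found for subprobabilities. *)
Definition lam2 : set (mR * mR)%type -> \bar R := (leb \x leb)%E.

HB.instance Definition _ := Measure.on lam2.

Lemma lam2_sigma_finite : sigma_finite setT lam2.
Proof.
have /sigma_finiteP[F [TF ndF Foo]] := sigma_finiteT leb.
exists (fun n => F n `*` F n).
  rewrite -setXTT TF predeqE => -[x y]; split.
    move=> [/= [n _ Fnx] [k _ Fky]]; exists (maxn n k) => //; split.
    - by move: x Fnx; exact/subsetPset/ndF/leq_maxl.
    - by move: y Fky; exact/subsetPset/ndF/leq_maxr.
  by move=> [n _ []/= ? ?]; split; exists n.
move=> k; have [? ?] := Foo k.
split; first exact: measurableX.
by rewrite /lam2 product_measure1E// lte_mul_pinfty// ge0_fin_numE.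
Qed.

HB.instance Definition _ := Measure_isSigmaFinite.Build _ _ _ lam2
  lam2_sigma_finite.

Definition aff2 (a1 b1 a2 b2 : R) (x : R * R) : R * R :=
  (a1 * x.1 + b1, a2 * x.2 + b2).

Lemma measurable_aff2 a1 b1 a2 b2 :
  measurable_fun [set: mR * mR] (aff2 a1 b1 a2 b2 : mR * mR -> mR * mR).
Proof.
apply: measurable_fun_pair.
  exact: (measurableT_comp (measurable_affine a1 b1) measurable_fst).
exact: (measurableT_comp (measurable_affine a2 b2) measurable_snd).
Qed.

Lemma lam2_affine (a1 b1 a2 b2 : R) (A : set (R * R)) :
  a1 != 0 -> a2 != 0 -> measurable A ->
  (`|a1 * a2|%:E * (leb \x leb) (aff2 a1 b1 a2 b2 @^-1` A) = (leb \x leb) A)%E.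
Proof.
move=> a10 a20 mA.
have mm := measurable_aff2 a1 b1 a2 b2.
pose m : {measure set (mR * mR)%type -> \bar R} :=
  mscale (NngNum (normr_ge0 (a1 * a2))) (pushforward_measure (leb \x leb)%E mm).
suff -> : (leb \x leb)%E A = m A by [].
apply: product_measure_unique => // B C mB mC.
rewrite /m /= /mscale /= /pushforward/=.
rewrite [X in (_ * X)%E](_ : _ = (leb \x leb)%E
  (((fun x : R => a1 * x + b1) @^-1` B) `*` ((fun x : R => a2 * x + b2) @^-1` C)));
  last by [].
rewrite product_measure1E//=; last 2 first.
- by rewrite -[X in measurable X]setTI; apply: (measurable_affine a1 b1).
- by rewrite -[X in measurable X]setTI; apply: (measurable_affine a2 b2).
rewrite -(@lebesgue_measure_affine a1 b1 B)// -(@lebesgue_measure_affine a2 b2 C)//.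
by rewrite normrM EFinM muleACA.
Qed.

Lemma ge0_integral_affine (a1 b1 a2 b2 : R) (f : R * R -> \bar R) :
  a1 != 0 -> a2 != 0 -> measurable_fun [set: mR * mR] f ->
  (forall x, (0 <= f x)%E) ->
  (`|a1 * a2|%:E * \int[lam2]_x f (aff2 a1 b1 a2 b2 x) = \int[lam2]_x f x)%E.
Proof.
move=> a10 a20 mf f0.
have mm := measurable_aff2 a1 b1 a2 b2.
have := @ge0_integral_pushforward _ _ _ _ R _ mm lam2 setT f measurableT mf
  (fun y _ => f0 y).
rewrite preimage_setT => <-.
rewrite -[X in (X%:E * _)%E]/((NngNum (normr_ge0 (a1 * a2)))%:num).
rewrite -(@ge0_integral_mscale _ _ R (pushforward_measure lam2 mm) setT measurableT
  (NngNum (normr_ge0 (a1 * a2))) f mf (fun y _ => f0 y)).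
apply: eq_measure_integral => A mA _ /=.
exact: lam2_affine.
Qed.

End AffineInvariance.

Section PlaneIntegral.
Context (R : realType).
Local Notation leb := (@lebesgue_measure R).
Local Notation mR := (measurableTypeR R).
Local Notation mRR := (mR * mR)%type.
Implicit Types f g : R * R -> R.

Definition I2 f : R := \int[@lam2 R]_x f x.
Definition ig2 f : Prop := (@lam2 R).-integrable setT (EFin \o f).

Lemma ig2_meas f : ig2 f -> measurable_fun [set: R * R] f.
Proof. by move=> /measurable_int/measurable_EFinP. Qed.

Lemma ig2_le f g : measurable_fun [set: R * R] f ->
  (forall x, `|f x| <= g x) -> ig2 g -> ig2 f.
Proof.
move=> mf fg; apply: le_integrable => //; first exact/measurable_EFinP.
by move=> x _ /=; rewrite lee_fin (le_trans (fg x))// ler_norm.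
Qed.

Lemma ig2D f g : ig2 f -> ig2 g -> ig2 (fun x => f x + g x).
Proof.
move=> If Ig; have := @integrableD _ _ _ (@lam2 R) setT measurableT _ _ If Ig.
by apply: eq_integrable => // x _ /=.
Qed.

Lemma ig2Z (r : R) f : ig2 f -> ig2 (fun x => r * f x).
Proof.
move=> If; have := @integrableZl _ _ _ (@lam2 R) setT measurableT r _ If.
by apply: eq_integrable => // x _ /=.
Qed.

Lemma ig2N f : ig2 f -> ig2 (fun x => - f x).
Proof.
move=> /(@ig2Z (-1)); congr ig2.
by apply/funext => x; rewrite mulN1r.
Qed.

Lemma ig2B f g : ig2 f -> ig2 g -> ig2 (fun x => f x - g x).
Proof. by move=> If /ig2N Ig; exact: ig2D. Qed.

Lemma ig2_abs f : ig2 f -> ig2 (fun x => `|f x|).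
Proof. by move=> If; exact: (@integrable_norm _ _ _ (@lam2 R) setT f If). Qed.

Lemma ig2_0 : ig2 (fun=> 0).
Proof.
have := @integrable0 _ _ _ (@lam2 R) setT.
by apply: eq_integrable.
Qed.

Lemma I2D f g : ig2 f -> ig2 g -> I2 (fun x => f x + g x) = I2 f + I2 g.
Proof. by move=> If Ig; rewrite /I2 RintegralD. Qed.

Lemma I2B f g : ig2 f -> ig2 g -> I2 (fun x => f x - g x) = I2 f - I2 g.
Proof. by move=> If Ig; rewrite /I2 RintegralB. Qed.

Lemma I2Z (r : R) f : ig2 f -> I2 (fun x => r * f x) = r * I2 f.
Proof. by move=> If; rewrite /I2 RintegralZl. Qed.

Lemma I2Zr (r : R) f : ig2 f -> I2 (fun x => f x * r) = I2 f * r.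
Proof. by move=> If; rewrite /I2 RintegralZr. Qed.

Lemma I2N f : ig2 f -> I2 (fun x => - f x) = - I2 f.
Proof.
move=> If; rewrite -mulN1r -I2Z//; congr I2; apply/funext => x.
by rewrite mulN1r.
Qed.

Lemma I2_0 : I2 (fun=> 0) = 0.
Proof. by rewrite /I2 /Rintegral integral0. Qed.

Lemma eq_I2 f g : f =1 g -> I2 f = I2 g.
Proof. by move=> fg; congr I2; apply/funext. Qed.

Lemma eq_ig2 f g : f =1 g -> ig2 f -> ig2 g.
Proof. by move=> /funext->. Qed.

Lemma le_I2 f g : ig2 f -> ig2 g -> (forall x, f x <= g x) -> I2 f <= I2 g.
Proof. by move=> If Ig fg; apply: le_Rintegral => // x _; exact: fg. Qed.

Lemma I2_ge0 f : (forall x, 0 <= f x) -> 0 <= I2 f.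
Proof. by move=> f0; exact: Rintegral_ge0. Qed.

Lemma I2_abs f : ig2 f -> `|I2 f| <= I2 (fun x => `|f x|).
Proof. by move=> If; exact: le_normr_Rintegral. Qed.

Lemma I2_abs_le f g : measurable_fun [set: R * R] f -> ig2 g ->
  (forall x, `|f x| <= g x) -> `|I2 f| <= I2 g.
Proof.
move=> mf Ig fg; have If := ig2_le mf fg Ig.
by rewrite (le_trans (I2_abs If))// le_I2//; exact: ig2_abs.
Qed.

Lemma I2E f : ig2 f -> ((I2 f)%:E = \int[@lam2 R]_x (f x)%:E)%E.
Proof.
by move=> If; rewrite /I2 /Rintegral fineK//; exact: integrable_fin_num.
Qed.

Lemma ig2P f : measurable_fun [set: R * R] f ->
  (\int[@lam2 R]_x (`|f x|)%:E < +oo)%E -> ig2 f.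
Proof. by move=> mf foo; apply/integrableP; split => //; exact/measurable_EFinP. Qed.

Lemma ig2_fin f : ig2 f -> (\int[@lam2 R]_x (`|f x|)%:E < +oo)%E.
Proof. by move=> /integrableP[]. Qed.

(** The change of variables for nonnegative functions is applied to the positive and negative parts.
    The translations, reflections and scalings of the plane used later are instances. *)
Lemma I2_aff (a1 b1 a2 b2 : R) f : a1 != 0 -> a2 != 0 -> ig2 f ->
  ig2 (fun x => f (aff2 a1 b1 a2 b2 x)) /\
  `|a1 * a2| * I2 (fun x => f (aff2 a1 b1 a2 b2 x)) = I2 f.
Proof.
move=> a10 a20 If.
have mf := ig2_meas If.
have mfT : measurable_fun [set: R * R] (fun x => f (aff2 a1 b1 a2 b2 x)).
  exact: (measurableT_comp mf (measurable_aff2 a1 b1 a2 b2)).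
have apos : 0 < `|a1 * a2| by rewrite normr_gt0 mulf_neq0.
have H (h : R * R -> R) : measurable_fun [set: R * R] h -> (forall x, 0 <= h x) ->
    (`|a1 * a2|%:E * \int[@lam2 R]_x (h (aff2 a1 b1 a2 b2 x))%:E =
     \int[@lam2 R]_x (h x)%:E)%E.
  move=> mh h0; apply: (@ge0_integral_affine R a1 b1 a2 b2 (EFin \o h)) => //.
  exact/measurable_EFinP.
have IfT : ig2 (fun x => f (aff2 a1 b1 a2 b2 x)).
  apply: ig2P => //; have := ig2_fin If.
  rewrite -(H (fun x => `|f x|))//; last exact: measurableT_comp.
  have : (0 <= \int[@lam2 R]_x (`|f (aff2 a1 b1 a2 b2 x)|)%:E)%E.
    by apply: integral_ge0 => x _; rewrite lee_fin.
  by case: integral => [r| |] // _; rewrite ?ltry// gt0_muley ?lte_fin.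
split=> //.
have mp : measurable_fun [set: R * R] (fun x => Num.max (f x) 0).
  exact: measurable_maxr.
have mn : measurable_fun [set: R * R] (fun x => Num.max (- f x) 0).
  by apply: measurable_maxr => //; exact: measurableT_comp.
have ipn h : measurable_fun [set: R * R] h -> ig2 h -> ig2 (fun x => Num.max (h x) 0).
  move=> mh Ih; apply: (ig2_le _ _ (ig2_abs Ih)) => [|x].
    exact: measurable_maxr.
  by rewrite /Num.max; case: ifPn => // _; rewrite normr0.
have fE x : f x = Num.max (f x) 0 - Num.max (- f x) 0.
  by rewrite /Num.max; case: ltP => ?; case: ltP => ?; lra.
have K h : ig2 h -> (forall x, 0 <= h x) ->
    ig2 (fun x => h (aff2 a1 b1 a2 b2 x)) ->
    `|a1 * a2| * I2 (fun x => h (aff2 a1 b1 a2 b2 x)) = I2 h.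
  move=> Ih h0 IhT; have := H h (ig2_meas Ih) h0.
  by rewrite -I2E// -I2E// -EFinM => -[].
have e1 : I2 (fun x => f (aff2 a1 b1 a2 b2 x)) =
   I2 (fun x => Num.max (f (aff2 a1 b1 a2 b2 x)) 0) -
   I2 (fun x => Num.max (- f (aff2 a1 b1 a2 b2 x)) 0).
  rewrite -I2B//; first by apply: eq_I2.
    exact: ipn.
  by apply: ipn; [exact: measurableT_comp|exact: ig2N].
rewrite e1 mulrBr (K (fun x => Num.max (f x) 0)); [|exact: ipn| |exact: ipn]; last first.
  by move=> x; rewrite le_max lexx orbT.
rewrite (K (fun x => Num.max (- f x) 0)).
- rewrite -I2B; first by apply: eq_I2.
    exact: ipn.
  by apply: ipn; [exact: measurableT_comp|exact: ig2N].
- by apply: ipn; [exact: measurableT_comp|exact: ig2N].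
- by move=> x; rewrite le_max lexx orbT.
- by apply: ipn; [exact: measurableT_comp|exact: ig2N].
Qed.

Lemma I2_translate (h : R * R) f : ig2 f ->
  ig2 (fun x => f (x + h)) /\ I2 (fun x => f (x + h)) = I2 f.
Proof.
move=> If; have [] := @I2_aff 1 h.1 1 h.2 f (oner_neq0 _) (oner_neq0 _) If.
rewrite mulr1 normr1 mul1r.
have -> : (fun x : R * R => f (aff2 1 h.1 1 h.2 x)) = (fun x => f (x + h)) => //.
by apply/funext => x; rewrite /aff2 !mul1r; congr f; case: x h => ? ? [].
Qed.

Lemma I2_refl (m : R * R) f : ig2 f ->
  ig2 (fun x => f (m - x)) /\ I2 (fun x => f (m - x)) = I2 f.
Proof.
have N : (-1 : R) != 0 by rewrite oppr_eq0 oner_neq0.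
move=> If; have [] := @I2_aff (-1) m.1 (-1) m.2 f N N If.
rewrite mulrNN mulr1 normr1 mul1r.
have -> : (fun x : R * R => f (aff2 (-1) m.1 (-1) m.2 x)) = (fun x => f (m - x)) => //.
by apply/funext => x; rewrite /aff2 !mulN1r; congr f;
  case: x m {N} => ? ? [? ?] /=; rewrite ![- _ + _]addrC.
Qed.

Lemma I2_scale (r : R) f : 0 < r -> ig2 f ->
  ig2 (fun x => f (r *: x)) /\ r ^+ 2 * I2 (fun x => f (r *: x)) = I2 f.
Proof.
move=> r0 If; have rn : r != 0 by rewrite gt_eqF.
have [] := @I2_aff r 0 r 0 f rn rn If.
rewrite -expr2 ger0_norm ?exprn_ge0 ?ltW//.
have -> : (fun x : R * R => f (aff2 r 0 r 0 x)) = (fun x => f (r *: x)) => //.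
by apply/funext => x; rewrite /aff2 !addr0; congr f; case: x.
Qed.

Lemma I2_eq_ae f g (N : set (R * R)) : (@lam2 R).-negligible N ->
  measurable_fun [set: R * R] f -> measurable_fun [set: R * R] g ->
  (forall x, ~ N x -> f x = g x) -> I2 f = I2 g.
Proof.
move=> N0 mf mg fg; congr fine; apply: ae_eq_integral => //.
- exact/measurable_EFinP.
- exact/measurable_EFinP.
case: N0 => A [mA A0 NA]; exists A; split => // x /= h; apply: NA.
by apply: contrapT => /fg fgx; apply: h => _; rewrite fgx.
Qed.

Lemma ig2_eq_ae f g (N : set (R * R)) : (@lam2 R).-negligible N ->
  measurable_fun [set: R * R] f -> measurable_fun [set: R * R] g ->
  (forall x, ~ N x -> f x = g x) -> ig2 f -> ig2 g.
Proof.
move=> N0 mf mg fg If; apply: ig2P => //.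
rewrite (_ : (\int[@lam2 R]_x (`|g x|)%:E = \int[@lam2 R]_x (`|f x|)%:E)%E).
  exact: ig2_fin.
apply: ae_eq_integral => //.
- by apply/measurable_EFinP; exact: measurableT_comp.
- by apply/measurable_EFinP; exact: measurableT_comp.
case: N0 => A [mA A0 NA]; exists A; split => // x /= h; apply: NA.
by apply: contrapT => /fg fgx; apply: h => _; rewrite fgx.
Qed.

Lemma lam2_prod (A B : set R) : measurable A -> measurable B ->
  @lam2 R (A `*` B) = (leb A * leb B)%E.
Proof. by move=> mA mB; exact: product_measure1E. Qed.

Lemma null_vline (a : R) : (@lam2 R).-negligible [set x : R * R | x.1 = a].
Proof.
have E : [set x : R * R | x.1 = a] = [set a] `*` setT.
  by apply/seteqP; split => x //= [].
exists [set x : R * R | x.1 = a]; split => //.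
  by rewrite E; exact: measurableX.
rewrite E; apply: (eq_trans (lam2_prod _ _)) => //.
by rewrite lebesgue_measure_set1 mul0e.
Qed.

Lemma null_hline (a : R) : (@lam2 R).-negligible [set x : R * R | x.2 = a].
Proof.
have E : [set x : R * R | x.2 = a] = setT `*` [set a].
  by apply/seteqP; split => x //= [].
exists [set x : R * R | x.2 = a]; split => //.
  by rewrite E; exact: measurableX.
rewrite E; apply: (eq_trans (lam2_prod _ _)) => //.
by rewrite lebesgue_measure_set1 mule0.
Qed.

End PlaneIntegral.

(** * Interchange of integrals and measurability in the plane *)

Section FubiniSwap.
Context (R : realType).
Local Notation leb := (@lebesgue_measure R).
Local Notation mR := (measurableTypeR R).
Local Notation mRR := (mR * mR)%type.
Local Notation l2 := (@lam2 R).
Implicit Types f g : R * R -> R.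

(** Fubini in the form used throughout: a majorant of the inner absolute integrals replaces
    integrability on the product, and the other sections are integrable only almost everywhere. *)
Lemma I2_swap (h : R * R -> R * R -> R) (b : R * R -> R) :
  measurable_fun [set: (R * R) * (R * R)] (fun p => h p.1 p.2) ->
  ig2 b -> (forall x, ig2 (h x)) -> (forall x, I2 (fun y => `|h x y|) <= b x) ->
  [/\ ig2 (fun x => I2 (h x)), ig2 (fun y => I2 (fun x => h x y)),
      I2 (fun x => I2 (h x)) = I2 (fun y => I2 (fun x => h x y)) &
      {ae @lam2 R, forall y, ig2 (fun x => h x y)}].
Proof.
move=> mh Ib Ih hb.
pose F : mRR * mRR -> \bar R := fun p => (h p.1 p.2)%:E.
have mF : measurable_fun [set: mRR * mRR] F by exact/measurable_EFinP.
have IF : (l2 \x l2)%E.-integrable setT F.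
  apply: (@integrable12ltyP _ _ _ _ R l2 l2 F mF).2.
  apply: le_lt_trans (ig2_fin Ib).
  apply: ge0_le_integral => //.
  - by move=> x _; apply: integral_ge0.
  - apply: (measurable_fun_fubini_tonelli_F (abse \o F)) => //.
      exact: measurableT_comp.
    by move=> p; exact: abse_ge0.
  - by apply/measurable_EFinP; apply: measurableT_comp => //; exact: (ig2_meas Ib).
  move=> x _; have := I2E (ig2_abs (Ih x)); rewrite /F /= => <-.
  by rewrite lee_fin (le_trans (hb x))// ler_norm.
have FE x : (\int[l2]_y F (x, y))%E = (I2 (h x))%:E.
  by rewrite I2E.
have iF := integrable_fubini_F IF.
have iG : l2.-integrable setT (fubini_G l2 F).
  have mG := measurable_fubini_G IF.
  apply/integrableP; split => //.
  apply: le_lt_trans ((@integrable21ltyP _ _ _ _ R l2 l2 F mF).1 IF).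
  have ma : measurable_fun [set: mRR * mRR] (abse \o F) by exact: measurableT_comp.
  apply: ge0_le_integral => //.
  - exact: measurableT_comp.
  - apply: (measurable_fun_fubini_tonelli_G (abse \o F)) => //.
    by move=> p; exact: abse_ge0.
  - move=> y _; apply: le_abse_integral => //.
    exact: (measurableT_comp mF (pair2_measurable y)).
have aeG := ae_integrable2 IF.
have mG : measurable_fun [set: R * R] (fun y => I2 (fun x => h x y)).
  apply: (measurableT_comp (@fine_measurable R setT measurableT)).
  exact: (measurable_int _ iG).
have EG : {ae @lam2 R, forall y, setT y -> ((I2 (fun x => h x y))%:E =
     \int[l2]_x F (x, y))%E}.
  by apply: filterS aeG => y Iy _; rewrite I2E.
have ig1 : ig2 (fun x => I2 (h x)).
  by apply: eq_integrable iF => // x _ /=; rewrite /fubini_F FE.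
have ig2' : ig2 (fun y => I2 (fun x => h x y)).
  apply: ig2P => //.
  rewrite (_ : (\int[l2]_y (`|I2 (h^~ y)|)%:E =
      \int[l2]_y `|\int[l2]_x F (x, y)|)%E); first by have /integrableP[] := iG.
  apply: ae_eq_integral => //.
  - by apply/measurable_EFinP; exact: measurableT_comp.
  - by apply: measurableT_comp => //; exact: (measurable_int _ iG).
  case: EG => N [mN N0 sN]; exists N; split=> // y /= hy; apply: sN => /= Ey.
  by apply: hy => Ty; rewrite -Ey.
split; [exact: ig1|exact: ig2'| |exact: aeG].
rewrite {1}/I2 /Rintegral.
rewrite (_ : (\int[@lam2 R]_x (I2 (h x))%:E =
   \int[@lam2 R]_x \int[l2]_y F (x, y))%E); last first.
  by apply: eq_integral => x _; rewrite FE.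
rewrite (Fubini IF) [RHS]/I2 /Rintegral.
congr fine; apply/esym/ae_eq_integral => //.
- exact/measurable_EFinP.
- exact: (measurable_int _ iG).
Qed.

(** The sigma-algebra on [R * R] is the product one, so an open set has to be exhibited as a
    countable union of squares with rational centres and radii. *)
Lemma open2_measurable (U : set (R * R)) : open U -> measurable U.
Proof.
move=> oU.
pose B (p q r : rat) : set (R * R) :=
  ball (ratr p : R) (ratr r : R) `*` ball (ratr q : R) (ratr r : R).
pose C p q r : set (R * R) := if `[< B p q r `<=` U >] then B p q r else set0.
have -> : U = \bigcup_p \bigcup_q \bigcup_r C p q r.
  apply/seteqP; split => [x Ux|x [p _ [q _ [r _]]]]; last first.
    by rewrite /C; case: asboolP => // BU; exact: BU.
  have /nbhs_ballP[e /= e0 eU] : nbhs x U by exact: open_nbhs_nbhs.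
  have [r] : exists r : rat, 0 < (ratr r : R) < e / 2.
    have /rat_in_itvoo[r] : 0 < e / 2 by rewrite divr_gt0.
    by rewrite in_itv/= => ?; exists r.
  move=> /andP[r0 re].
  have app (u : R) : exists p : rat, ball (ratr p : R) (ratr r) u.
    have /rat_in_itvoo[p] : u - ratr r < u + ratr r.
      by rewrite ltrBlDr -addrA ltrDl addr_gt0.
    rewrite in_itv/= => /andP[h1 h2]; exists p.
    by rewrite /ball/= ltr_distlC; apply/andP; split; lra.
  have [p px] := app x.1; have [q qx] := app x.2.
  exists p => //; exists q => //; exists r => //.
  rewrite /C; case: asboolP => // BU; exfalso; apply: BU => y [/= y1 y2].
  apply: eU; move: px qx y1 y2; rewrite /ball/= /prod_ball/= /ball/=.
  by rewrite !ltr_distlC => /andP[? ?] /andP[? ?] /andP[? ?] /andP[? ?];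
    split; apply/andP; split; lra.
apply: bigcupT_measurable_rat => p; apply: bigcupT_measurable_rat => q.
apply: bigcupT_measurable_rat => r; rewrite /C; case: asboolP => _ //.
by apply: measurableX; exact: measurable_ball.
Qed.

Lemma cont2_meas (f : R * R -> R) : continuous f -> measurable_fun [set: R * R] f.
Proof.
move=> /continuousP cf; apply: (measurability _ (RGenOpens.measurableE R)).
move=> _ [_ [a [b ->] <-]]; rewrite setTI; apply: open2_measurable.
exact/cf/interval_open.
Qed.

(** Tonelli for a product of one-variable weights; the singular kernel and the Gaussians are bounded
    by such products. *)
Lemma ig2_prod (p q : R -> R) : measurable_fun [set: R] p ->
  measurable_fun [set: R] q -> (forall t, 0 <= p t) -> (forall t, 0 <= q t) ->
  forall a b : R, (\int[leb]_t (p t)%:E <= a%:E)%E ->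
  (\int[leb]_t (q t)%:E <= b%:E)%E ->
  ig2 (fun x => p x.1 * q x.2) /\ I2 (fun x => p x.1 * q x.2) <= a * b.
Proof.
move=> mp mq p0 q0 a b pa qb.
have mpq : measurable_fun [set: R * R] (fun x => p x.1 * q x.2).
  by apply: measurable_funM; apply: measurableT_comp.
have E : (\int[@lam2 R]_x (p x.1 * q x.2)%:E =
          (\int[leb]_t (p t)%:E) * (\int[leb]_t (q t)%:E))%E.
  rewrite /lam2 (@fubini_tonelli1 _ _ _ _ R leb leb (fun x => (p x.1 * q x.2)%:E))//=.
  - transitivity (\int[leb]_x ((p x)%:E * \int[leb]_t (q t)%:E))%E.
      apply: eq_integral => x _; rewrite /fubini_F/=.
      under eq_integral do rewrite EFinM.
      rewrite ge0_integralZl//.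
      + exact/measurable_EFinP.
      + by move=> y _; rewrite lee_fin.
      + by rewrite lee_fin.
    rewrite ge0_integralZr//.
    + exact/measurable_EFinP.
    + by move=> y _; rewrite lee_fin.
    + by apply: integral_ge0 => y _; rewrite lee_fin.
  - exact/measurable_EFinP.
  - by move=> x; rewrite lee_fin mulr_ge0.
have pp : (0 <= \int[leb]_t (p t)%:E)%E by apply: integral_ge0 => y _; rewrite lee_fin.
have qq : (0 <= \int[leb]_t (q t)%:E)%E by apply: integral_ge0 => y _; rewrite lee_fin.
have L : (\int[@lam2 R]_x (p x.1 * q x.2)%:E <= (a * b)%:E)%E.
  by rewrite E EFinM lee_pmul.
have Ipq : ig2 (fun x => p x.1 * q x.2).
  apply: ig2P => //; apply: le_lt_trans (ltry (a * b)).
  apply: le_trans L; rewrite le_eqVlt; apply/orP; left; apply/eqP.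
  by apply: eq_integral => x _; rewrite ger0_norm// mulr_ge0.
by split=> //; rewrite -lee_fin I2E.
Qed.

End FubiniSwap.

(** * Integrals of powers and densities supported in a box *)

Section PowerIntegral.
Context (R : realType).
Local Notation leb := (@lebesgue_measure R).

Lemma powR_integral_pos (s r : R) : 0 < s -> 0 < r ->
  (\int[leb]_(t in `]0%R, r%R]%classic) (t `^ (s - 1))%:E <= (r `^ s / s)%:E)%E.
Proof.
move=> s0 r0.
(* [n.+2] keeps the left end strictly below [r]; the singularity at [0] is reached by monotone
   convergence. *)
pose F (n : nat) : set (measurableTypeR R) := `[r / n.+2%:R, r]%classic.
have FU : \bigcup_n F n = `]0, r]%classic.
  apply/seteqP; split => [t [n _]|t]; rewrite /F /= !in_itv/=.
    by move=> /andP[h ->]; rewrite andbT (lt_le_trans _ h)// divr_gt0.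
  move=> /andP[t0 tr].
  have [n nt] : exists n : nat, r / t <= n.+2%:R.
    exists (Num.truncn (r / t)).
    have := truncnS_gt (r / t); rewrite -natr1 => h.
    by rewrite (le_trans (ltW h))// natr1 ler_nat.
  exists n => //=; rewrite in_itv/= tr andbT.
  by rewrite ler_pdivrMr// mulrC -ler_pdivrMr.
have mf n : measurable_fun (F n) (fun t : measurableTypeR R => (t `^ (s - 1))%:E).
  apply: measurable_funTS; apply/measurable_EFinP; exact: measurable_powR.
rewrite -FU; apply: (closed_cvg (fun x => x <= (r `^ s / s)%:E)%E); last first.
  apply: (@ge0_nondecreasing_set_cvg_integral _ _ R F
    (fun t : measurableTypeR R => (t `^ (s - 1))%:E) leb) => //.
  - apply/nondecreasing_seqP => n; rewrite subsetEset /F => t /=.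
    rewrite !in_itv/= => /andP[h ->]; rewrite andbT (le_trans _ h)//.
    by rewrite ler_pM2l// lef_pV2 ?posrE// ler_nat.
  - by move=> n; exact: measurable_itv.
  - by move=> n t _; rewrite lee_fin powR_ge0.
- apply: nearW => n.
  have an : 0 < r / n.+2%:R by rewrite divr_gt0.
  have ar : r / n.+2%:R < r.
    by rewrite ltr_pdivrMr// ltr_pMr// ltr1n.
  have pos x : x \in `[r / n.+2%:R, r] -> 0 < x.
    by rewrite in_itv/= => /andP[h _]; exact: lt_le_trans h.
  have posc x : x \in `]r / n.+2%:R, r[ -> 0 < x.
    by rewrite in_itv/= => /andP[h _]; exact: lt_trans h.
  have cpow (q x : R) : 0 < x -> {for x, continuous (fun t : R => t `^ q)}.
    move=> x0; apply: differentiable_continuous; apply/derivable1_diffP.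
    by apply: derivable_powR; rewrite in_itv/= x0.
  have E : (\int[leb]_(x in `[(r / n.+2%:R)%R, r]%classic) (s * x `^ (s - 1))%:E =
      (r `^ s)%:E - ((r / n.+2%:R) `^ s)%:E)%E.
    apply: (@continuous_FTC2 _ _ (fun t : R => t `^ s)) => //.
    + apply: continuous_in_subspaceT => x /set_mem /= xin.
      apply: (@cvgM R R (nbhs x) _ (fun=> s) (fun t => t `^ (s - 1)) s _).
        exact: cvg_cst.
      exact: cpow (pos _ xin).
    + split=> [x xin| |].
      * by apply: derivable_powR; rewrite in_itv/= (posc _ xin).
      * by apply: cvg_at_right_filter; exact: cpow.
      * by apply: cvg_at_left_filter; exact: cpow.
    + move=> x xin; rewrite derive1E.
      exact: (@derive_val _ _ _ _ _ _ _ (@is_derive1_powR R s x (posc _ xin))).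
  have L : (s%:E * \int[leb]_(x in F n) (x `^ (s - 1))%:E <= (r `^ s)%:E)%E.
    rewrite -ge0_integralZl//.
    + rewrite -/(F n) in E.
      by under eq_integral do rewrite -EFinM; rewrite E -EFinB lee_fin gerBl powR_ge0.
    + exact: measurable_itv.
    + by move=> x _; rewrite lee_fin powR_ge0.
    + by rewrite lee_fin ltW.
  by rewrite mulrC EFinM lee_pdivlMl.
- exact: closed_ereal_ge_ereal.
- exact: _.
Qed.

Definition wpow (s r t : R) : R := if `|t| <= r then `|t| `^ (s - 1) else 0.

Lemma measurable_wpow s r : measurable_fun [set: R] (wpow s r).
Proof.
apply: measurable_fun_ifT.
- by apply: measurable_fun_ler => //; exact: measurableT_comp.
- by apply: measurableT_comp (@measurable_powR R _) _ => //; exact: measurableT_comp.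
- exact: measurable_cst.
Qed.

Lemma wpow_ge0 s r t : 0 <= wpow s r t.
Proof. by rewrite /wpow; case: ifP => // _; rewrite powR_ge0. Qed.

Lemma wpow_integral (s r : R) : 0 < s -> 0 < r ->
  (\int[leb]_t (wpow s r t)%:E <= (2 * r `^ s / s)%:E)%E.
Proof.
move=> s0 r0.
have mw := measurable_wpow s r.
have mE : measurable_fun [set: R] (EFin \o wpow s r) by exact/measurable_EFinP.
have E : (\int[leb]_(t in `[0%R, +oo[%classic) (wpow s r t)%:E =
    \int[leb]_(t in `]0%R, +oo[%classic) (wpow s r t)%:E)%E.
  by rewrite -integral_itv_obnd_cbnd//; exact: measurable_funTS.
have pos : (\int[leb]_(t in `]0%R, +oo[%classic) (wpow s r t)%:E <= (r `^ s / s)%:E)%E.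
  rewrite (le_trans _ (powR_integral_pos s0 r0))//.
  rewrite integral_mkcond [leRHS]integral_mkcond.
  apply: ge0_le_integral => //.
  - by move=> t _; rewrite patchE; case: ifP => // _; rewrite lee_fin wpow_ge0.
  - by apply/(measurable_restrictT _ _).1 => //; exact: measurable_funTS.
  - apply/(measurable_restrictT _ _).1 => //; apply: measurable_funTS.
    by apply/measurable_EFinP; exact: measurable_powR.
  move=> t _; rewrite !patchE !mem_setE !in_itv/= andbT /wpow.
  have [t0|t0] /= := ltP 0 t; last by [].
  by rewrite gtr0_norm//=; case: ifP => //.
have neg : (\int[leb]_(t in `]-oo, 0%R]%classic) (wpow s r t)%:E <= (r `^ s / s)%:E)%E.
  rewrite (le_trans _ pos)// -E (@ge0_integration_by_substitution0 R (EFin \o wpow s r))//.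
  - by rewrite le_eqVlt; apply/orP; left; apply/eqP/eq_integral => t _ /=; rewrite /wpow normrN.
  - by move=> t; rewrite lee_fin wpow_ge0.
have -> : (2 * r `^ s / s = r `^ s / s + r `^ s / s)%R by rewrite -mulrA mulrDl mul1r.
have -> : [set: measurableTypeR R] = `]-oo, 0%R]%classic `|` `]0%R, +oo[%classic.
  apply/seteqP; split => x // _ /=; rewrite !in_itv/= andbT.
  by case: (leP x 0); [left|right].
rewrite ge0_integral_setU//=.
- by rewrite EFinD; exact: leeD.
- exact: measurable_funTS.
- by move=> t _; rewrite lee_fin wpow_ge0.
- rewrite disj_set2E; apply/eqP/seteqP; split => x //= [].
  by rewrite !in_itv/= andbT leNgt => /negP.
Qed.

Definition ibox (r : R) (x : R * R) : R :=
  if (`|x.1| <= r) && (`|x.2| <= r) then 1 else 0.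

Lemma measurable_ibox r : measurable_fun [set: R * R] (ibox r).
Proof.
apply: measurable_fun_ifT; [|exact: measurable_cst|exact: measurable_cst].
by apply: measurable_and; apply: measurable_fun_ler => //; exact: measurableT_comp.
Qed.

Lemma ibox_ge0 r x : 0 <= ibox r x.
Proof. by rewrite /ibox; case: ifP. Qed.

Lemma ibox1 r x : `|x.1| <= r -> `|x.2| <= r -> ibox r x = 1.
Proof. by rewrite /ibox => -> ->. Qed.

Lemma wpow1 r t : 0 <= r -> wpow 1 r t = if `|t| <= r then 1 else 0.
Proof. by move=> r0; rewrite /wpow subrr powRr0. Qed.

Lemma ibox_wpow r x : 0 <= r -> ibox r x = wpow 1 r x.1 * wpow 1 r x.2.
Proof.
move=> r0; rewrite !wpow1// /ibox.
by case: (`|x.1| <= r); case: (`|x.2| <= r); rewrite /= ?mulr0 ?mul0r ?mulr1.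
Qed.

Lemma ig2_ibox r : ig2 (ibox r).
Proof.
have [r0|r0] := ltP 0 r; last first.
  apply: (@ig2_eq_ae R (fun=> 0) (ibox r) _ (null_vline 0)) => //.
  - exact: measurable_ibox.
  - move=> x /= /eqP x0; rewrite /ibox leNgt (le_lt_trans r0)//.
    by rewrite normr_gt0.
  - exact: ig2_0.
have [] := @ig2_prod R (wpow 1 r) (wpow 1 r) (measurable_wpow 1 r)
  (measurable_wpow 1 r) (wpow_ge0 1 r) (wpow_ge0 1 r) _ _
  (wpow_integral ltr01 r0) (wpow_integral ltr01 r0).
by move=> + _; apply: eq_ig2 => x; rewrite ibox_wpow// ltW.
Qed.

Definition bsup (M r : R) (f : R * R -> R) : Prop :=
  [/\ measurable_fun [set: R * R] f, forall x, `|f x| <= M &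
      forall x, f x != 0 -> `|x.1| <= r /\ `|x.2| <= r].

Lemma bsup_le M r f : bsup M r f -> forall x, `|f x| <= M * ibox r x.
Proof.
move=> [mf fM fr] x; have [->|/fr[h1 h2]] := eqVneq (f x) 0.
  by rewrite normr0 mulr_ge0 ?ibox_ge0// (le_trans _ (fM x)).
by rewrite ibox1// mulr1.
Qed.

Lemma bsup_ig2 M r f : bsup M r f -> ig2 f.
Proof.
move=> h; have [mf _ _] := h.
by apply: (ig2_le mf (bsup_le h)); apply: ig2Z; exact: ig2_ibox.
Qed.

End PowerIntegral.

(** * Riesz potentials *)

Section Kernel.
Context (R : realType).
Implicit Types (x y z : R * R) (f g : R * R -> R).

Definition nrm2 x : R := x.1 ^+ 2 + x.2 ^+ 2.

Lemma nrm2_ge0 x : 0 <= nrm2 x.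
Proof. by rewrite addr_ge0 ?sqr_ge0. Qed.

Lemma nrm2_eq0 x : nrm2 x = 0 -> x = 0.
Proof.
move/eqP; rewrite /nrm2 paddr_eq0 ?sqr_ge0// !sqrf_eq0 => /andP[/eqP h1 /eqP h2].
by case: x h1 h2 => a b /= -> ->.
Qed.

Lemma nrm2_gt0 x : x != 0 -> 0 < nrm2 x.
Proof.
move=> x0; rewrite lt_neqAle nrm2_ge0 andbT eq_sym; apply/eqP => /nrm2_eq0 /eqP.
by rewrite (negbTE x0).
Qed.

Lemma nrm2N x : nrm2 (- x) = nrm2 x.
Proof. by rewrite /nrm2 /= !sqrrN. Qed.

Lemma enorm_ge0 x : 0 <= enorm x. Proof. exact: sqrtr_ge0. Qed.

Lemma enorm_sqr x : enorm x ^+ 2 = nrm2 x.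
Proof. by rewrite sqr_sqrtr// nrm2_ge0. Qed.

Lemma enorm_gt0 x : x != 0 -> 0 < enorm x.
Proof. by move=> x0; rewrite sqrtr_gt0 nrm2_gt0. Qed.

Lemma enormN x : enorm (- x) = enorm x.
Proof. by rewrite /enorm -/(nrm2 (- x)) nrm2N. Qed.

Lemma enorm_distC x y : enorm (x - y) = enorm (y - x).
Proof. by rewrite -enormN opprB. Qed.

Lemma enorm_ge1 x : `|x.1| <= enorm x.
Proof. by rewrite -sqrtr_sqr ler_wsqrtr// lerDl sqr_ge0. Qed.

Lemma enorm_ge2 x : `|x.2| <= enorm x.
Proof. by rewrite -sqrtr_sqr ler_wsqrtr// lerDr sqr_ge0. Qed.

Lemma enorm_le x (r : R) : 0 <= r -> nrm2 x <= r ^+ 2 -> enorm x <= r.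
Proof. by move=> r0 h; rewrite -(ger0_norm r0) -sqrtr_sqr ler_wsqrtr. Qed.

Lemma enorm_le_sum x : enorm x <= `|x.1| + `|x.2|.
Proof.
apply: enorm_le; first by rewrite addr_ge0.
rewrite sqrrD /nrm2 !real_normK ?num_real//.
by have := mulr_ge0 (normr_ge0 x.1) (normr_ge0 x.2); rewrite mulr2n; lra.
Qed.

Lemma enormD x y : enorm (x + y) <= enorm x + enorm y.
Proof.
apply: enorm_le; first by rewrite addr_ge0 ?enorm_ge0.
rewrite sqrrD !enorm_sqr.
have cs : x.1 * y.1 + x.2 * y.2 <= enorm x * enorm y.
  rewrite (le_trans (ler_norm _))// -(@ler_pXn2r _ 2)// ?nnegrE ?mulr_ge0 ?enorm_ge0//.
  rewrite real_normK ?num_real// exprMn !enorm_sqr /nrm2.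
  have -> : (x.1 ^+ 2 + x.2 ^+ 2) * (y.1 ^+ 2 + y.2 ^+ 2) =
    (x.1 * y.1 + x.2 * y.2) ^+ 2 + (x.1 * y.2 - x.2 * y.1) ^+ 2 by ring.
  by rewrite lerDl sqr_ge0.
rewrite /nrm2 /= mulr2n.
move: cs; move: (enorm x * enorm y) => e cs.
have -> : (x.1 + y.1) ^+ 2 + (x.2 + y.2) ^+ 2 = x.1 ^+ 2 + x.2 ^+ 2 +
  (x.1 * y.1 + x.2 * y.2) + (x.1 * y.1 + x.2 * y.2) + (y.1 ^+ 2 + y.2 ^+ 2) by ring.
lra.
Qed.

Lemma enorm_dist x y : `|enorm x - enorm y| <= enorm (x - y).
Proof.
rewrite ler_distl; apply/andP; split.
  rewrite lerBlDr -[enorm y]enormN.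
  by rewrite (_ : - y = (x - y) + - x) ?(le_trans (enormD _ _)) ?enormN ?(addrC (enorm x))// addrAC subrr sub0r.
by rewrite -{1}(subrK y x) addrC (le_trans (enormD _ _))// addrC.
Qed.

Lemma enormZ (t : R) x : enorm (t *: x) = `|t| * enorm x.
Proof.
rewrite /enorm /= !exprMn -mulrDr sqrtrM ?sqr_ge0// sqrtr_sqr.
by [].
Qed.

Lemma powRN_le (e a b : R) : 0 <= e -> 0 < a -> a <= b -> b `^ (- e) <= a `^ (- e).
Proof.
move=> e0 a0 ab; have b0 := lt_le_trans a0 ab.
rewrite !powRN lef_pV2 ?posrE ?powR_gt0//.
by apply: ge0_ler_powR => //; rewrite nnegrE ltW.
Qed.

Definition kp (e : R) x : R := nrm2 x `^ (- e).

Lemma kp_ge0 e x : 0 <= kp e x. Proof. exact: powR_ge0. Qed.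

Lemma kpN e x : kp e (- x) = kp e x. Proof. by rewrite /kp nrm2N. Qed.

Lemma kpC e x y : kp e (x - y) = kp e (y - x).
Proof. by rewrite -kpN opprB. Qed.

Lemma kpE e x : kp e x = enorm x `^ (- (2 * e)).
Proof.
rewrite /kp -enorm_sqr -(powR_mulrn 2 (enorm_ge0 x)) -powRrM.
by rewrite mulrN.
Qed.

Lemma measurable_nrm2 : measurable_fun [set: R * R] nrm2.
Proof. by apply: measurable_funD; apply: measurable_funX. Qed.

Lemma measurable_kp e : measurable_fun [set: R * R] (kp e).
Proof.
have := measurableT_comp (@measurable_powR R (- e)) measurable_nrm2.
exact.
Qed.

Lemma measurable_sub2 :
  measurable_fun [set: (R * R) * (R * R)] (fun p => p.1 - p.2 : R * R).
Proof.
apply: measurable_fun_pair => /=.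
- apply: measurable_funB; apply: measurableT_comp => //; exact: measurable_fst.
- apply: measurable_funB; apply: measurableT_comp => //; exact: measurable_snd.
Qed.

Lemma measurable_kp2 e :
  measurable_fun [set: (R * R) * (R * R)] (fun p => kp e (p.1 - p.2)).
Proof. exact: (measurableT_comp (measurable_kp e) measurable_sub2). Qed.

Lemma measurable_subl x : measurable_fun [set: R * R] (fun y => x - y : R * R).
Proof.
by apply: measurable_fun_pair => /=; apply: measurable_funB => //; exact: measurable_cst.
Qed.

Lemma measurable_kpl e x : measurable_fun [set: R * R] (fun y => kp e (x - y)).
Proof. exact: (measurableT_comp (measurable_kp e) (measurable_subl x)). Qed.

Lemma I2_abs_le_ae f g (N : set (R * R)) : (@lam2 R).-negligible N ->
  measurable_fun [set: R * R] f -> ig2 g ->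
  (forall x, ~ N x -> `|f x| <= g x) -> ig2 f /\ `|I2 f| <= I2 g.
Proof.
move=> N0 mf Ig fg.
have mg := ig2_meas Ig.
(* The bound holds only off [N], so [|f|] is first cut down to a function that is dominated
   everywhere. *)
pose h x := Num.min `|f x| `|g x|.
have mh : measurable_fun [set: R * R] h by apply: measurable_minr; exact: measurableT_comp.
have Ih : ig2 h.
  apply: (ig2_le mh _ (ig2_abs Ig)) => x.
  by rewrite ger0_norm ?le_min ?normr_ge0// ge_min lexx orbT.
have Ia : ig2 (fun x => `|f x|).
  apply: (ig2_eq_ae N0 mh) Ih => //; first exact: measurableT_comp.
  move=> x Nx; rewrite /h; apply/min_idPl.
  by rewrite (le_trans (fg x Nx))// ler_norm.
have If : ig2 f by apply: (ig2_le mf _ Ia) => x.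
split=> //; rewrite (le_trans (I2_abs If))//.
rewrite (@I2_eq_ae _ _ (fun x => Num.min `|f x| (g x)) _ N0).
- apply: le_I2 => //.
    apply: (ig2_le _ _ (ig2D Ia (ig2_abs Ig))).
      by apply: measurable_minr => //; exact: measurableT_comp.
    move=> x; rewrite /Num.min; case: ifP => _; rewrite ?normr_id ?lerDl ?lerDr//.
  by move=> x; rewrite ge_min lexx orbT.
- exact: measurableT_comp.
- by apply: measurable_minr => //; exact: measurableT_comp.
- by move=> x Nx; apply/esym/min_idPl; exact: fg.
Qed.

(** Since [|y.1| |y.2| <= nrm2 y], the kernel is at most [|y.1|^(-e) |y.2|^(-e)] off the axes, a
    product of powers integrable for [e < 1]. *)
Lemma kp_box (e r : R) : 0 <= e -> e < 1 -> 0 < r ->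
  ig2 (fun y => kp e y * ibox r y) /\
  I2 (fun y => kp e y * ibox r y) <= (2 * r `^ (1 - e) / (1 - e)) ^+ 2.
Proof.
move=> e0 e1 r0; have se : 0 < 1 - e by rewrite subr_gt0.
have [Ip bp] := @ig2_prod R (wpow (1 - e) r) (wpow (1 - e) r) (measurable_wpow _ r)
  (measurable_wpow _ r) (wpow_ge0 _ r) (wpow_ge0 _ r) _ _
  (wpow_integral se r0) (wpow_integral se r0).
have N0 : (@lam2 R).-negligible ([set x : R * R | x.1 = 0] `|` [set x : R * R | x.2 = 0]).
  exact: negligibleU (null_vline 0) (null_hline 0).
have mk : measurable_fun [set: R * R] (fun y => kp e y * ibox r y).
  by apply: measurable_funM; [exact: measurable_kp|exact: measurable_ibox].
have [] := @I2_abs_le_ae (fun y => kp e y * ibox r y) _ _ N0 mk Ip.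
  move=> y /= /not_orP[/eqP y1 /eqP y2].
  rewrite ger0_norm ?mulr_ge0 ?kp_ge0 ?ibox_ge0// /ibox /wpow.
  case: (`|y.1| <= r); case: (`|y.2| <= r) => /=; rewrite ?mulr0 ?mul0r ?mulr1//.
  rewrite -powRM// /kp (_ : 1 - e - 1 = - e); last by ring.
  apply: powRN_le => //; first by rewrite mulr_gt0 ?normr_gt0.
  rewrite /nrm2 -(real_normK (num_real y.1)) -(real_normK (num_real y.2)).
  move: (`|y.1|) (`|y.2|) (normr_ge0 y.1) (normr_ge0 y.2) => a b a0 b0; nra.
move=> h1 h2; split => //.
rewrite -[leLHS]ger0_norm; last by apply: I2_ge0 => y; rewrite mulr_ge0 ?kp_ge0 ?ibox_ge0.
by rewrite (le_trans h2)// expr2.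
Qed.

Definition kbox (e r : R) : R := (2 * r `^ (1 - e) / (1 - e)) ^+ 2.

Lemma kp_boxl (e r : R) x : 0 <= e -> e < 1 -> 0 < r ->
  ig2 (fun y => kp e (x - y) * ibox r (x - y)) /\
  I2 (fun y => kp e (x - y) * ibox r (x - y)) <= kbox e r.
Proof.
move=> e0 e1 r0; have [Ik bk] := kp_box e0 e1 r0.
by have [? ->] := I2_refl x Ik.
Qed.

Lemma iboxP (r : R) x : ibox r x = 1 \/ ibox r x = 0.
Proof. by rewrite /ibox; case: ifP; [left|right]. Qed.

Lemma pot_dom (e M r : R) f : bsup M r f -> forall x (X : R),
  `|x.1| <= X -> `|x.2| <= X -> forall y,
  `|kp e (x - y) * f y| <= M * (kp e (x - y) * ibox (r + X) (x - y)).
Proof.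
move=> fM x X x1 x2 y; have h := bsup_le fM y.
have M0 : 0 <= M by case: fM => _ /(_ x) + _; exact: le_trans.
rewrite normrM (ger0_norm (kp_ge0 _ _)) mulrCA ler_wpM2l ?kp_ge0//.
rewrite (le_trans h)// ler_wpM2l// /ibox.
case: ifP => [/andP[y1 y2]|_]; last by case: ifP.
rewrite ifT//; apply/andP; split => /=.
  by rewrite (le_trans (ler_normB _ _))// addrC lerD.
by rewrite (le_trans (ler_normB _ _))// addrC lerD.
Qed.

Lemma measurable_pot_in (e : R) f x : measurable_fun [set: R * R] f ->
  measurable_fun [set: R * R] (fun y => kp e (x - y) * f y).
Proof. by move=> mf; apply: measurable_funM => //; exact: measurable_kpl. Qed.

Lemma pot_ig2 (e M r : R) f x : 0 <= e -> e < 1 -> bsup M r f ->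
  ig2 (fun y => kp e (x - y) * f y).
Proof.
move=> e0 e1 fM; have [mf _ _] := fM.
pose X := Num.max (`|x.1| + `|x.2|) (1 - r).
have x1 : `|x.1| <= X by rewrite le_max lerDl normr_ge0.
have x2 : `|x.2| <= X by rewrite le_max lerDr normr_ge0.
have r0 : 0 < r + X.
  have : 1 - r <= X by rewrite le_max lexx orbT.
  lra.
apply: (ig2_le (measurable_pot_in e x mf) (pot_dom e fM x1 x2)).
by apply: ig2Z; exact: (kp_boxl x e0 e1 r0).1.
Qed.

Definition pot (e : R) f x : R := I2 (fun y => kp e (x - y) * f y).

Lemma pot_measurable e M r f : 0 <= e -> e < 1 -> bsup M r f ->
  measurable_fun [set: R * R] (pot e f).
Proof.
move=> e0 e1 fM; have [mf _ _] := fM.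
pose F : (R * R) * (R * R) -> \bar R := fun p => (kp e (p.1 - p.2) * f p.2)%:E.
have mF : measurable_fun [set: (R * R) * (R * R)] F.
  apply/measurable_EFinP; apply: measurable_funM; first exact: measurable_kp2.
  exact: measurableT_comp.
have mp (h : R * R -> R) : measurable_fun [set: R * R] h -> (forall x, 0 <= h x) -> bsup M r h ->
    measurable_fun [set: R * R] (pot e h).
  move=> mh h0 hM.
  apply: (measurableT_comp (@fine_measurable R setT measurableT)).
  apply: (@measurable_fun_fubini_tonelli_F _ _ _ _ R (@lam2 R)
     (fun p : (R * R) * (R * R) => (kp e (p.1 - p.2) * h p.2)%:E)).
    apply/measurable_EFinP; apply: measurable_funM; first exact: measurable_kp2.
    exact: measurableT_comp.
  by move=> p; rewrite lee_fin mulr_ge0 ?kp_ge0.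
have [fM1 fr] : (forall x, `|f x| <= M) /\
   (forall x, f x != 0 -> `|x.1| <= r /\ `|x.2| <= r) by case: fM.
have bp : bsup M r (fun x => Num.max (f x) 0).
  split; first exact: measurable_maxr.
  - move=> x; rewrite (le_trans _ (fM1 x))// /Num.max.
    by case: ifP => //; rewrite normr0.
  - by move=> x; rewrite /Num.max; case: ifP => [_|_]; rewrite ?eqxx// => /fr.
have bn : bsup M r (fun x => Num.max (- f x) 0).
  split; first by apply: measurable_maxr => //; exact: measurableT_comp.
  - move=> x; rewrite (le_trans _ (fM1 x))// /Num.max.
    by case: ifP => //; rewrite ?normr0// normrN.
  - by move=> x; rewrite /Num.max; case: ifP => [_|_]; rewrite ?eqxx// oppr_eq0 => /fr.
have -> : pot e f = (fun x => pot e (fun x => Num.max (f x) 0) x -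
     pot e (fun x => Num.max (- f x) 0) x).
  apply/funext => x; rewrite /pot -I2B; [|exact: pot_ig2 bp|exact: pot_ig2 bn].
  apply: eq_I2 => y; rewrite -mulrBr; congr (_ * _).
  by rewrite /Num.max; case: ltP => ?; case: ltP => ?; lra.
apply: measurable_funB; apply: mp => //; first by case: bp.
- by move=> x; rewrite le_max lexx orbT.
- by case: bn.
- by move=> x; rewrite le_max lexx orbT.
Qed.

(** With [t = a1 / a2] the claim is [1 - t^p <= 2 (1 - t)^b], which follows from
    [1 - t^p <= 1 - t^2 <= 2 (1 - t)]. Any fraction [b] of a derivative can thus be taken, at the
    price of [b] more orders of singularity. *)
Lemma powR_diff_le (p b a1 a2 : R) : 0 <= p <= 2 -> 0 <= b <= 1 -> 0 < a1 -> a1 <= a2 ->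
  a1 `^ (- p) - a2 `^ (- p) <= 2 * (a2 - a1) `^ b * (a1 `^ (- p) * a2 `^ (- b)).
Proof.
move=> /andP[p0 p2] /andP[b0 b1] a10 a12; have a20 := lt_le_trans a10 a12.
have [->|ne] := eqVneq a1 a2; first by rewrite subrr !mulr_ge0 ?powR_ge0.
have lt12 : a1 < a2 by rewrite lt_neqAle ne.
pose t := a1 / a2.
have t0 : 0 < t by rewrite divr_gt0.
have t1 : t < 1 by rewrite ltr_pdivrMr// mul1r.
have e1 : a2 `^ (- p) = a1 `^ (- p) * t `^ p.
  rewrite /t powRM ?(ltW a10)//; last by rewrite invr_ge0 ltW.
  rewrite mulrA -powRD; last by rewrite (gt_eqF a10) implybT.
  by rewrite addNr powRr0 mul1r -(powR_inv1 (ltW a20)) -powRrM mulN1r.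
have e2 : (a2 - a1) `^ b * a2 `^ (- b) = (1 - t) `^ b.
  have -> : a2 - a1 = (1 - t) * a2 by rewrite /t; field; rewrite gt_eqF.
  rewrite powRM ?(ltW a20)//; last by rewrite subr_ge0 ltW.
  rewrite -mulrA -powRD; last by rewrite (gt_eqF a20) implybT.
  by rewrite subrr powRr0 mulr1.
rewrite [X in _ <= X](_ : _ = a1 `^ (- p) * (2 * (1 - t) `^ b)); last first.
  by rewrite -e2; ring.
rewrite e1 -{1}[a1 `^ _]mulr1 -mulrBr ler_pM2l ?powR_gt0//.
have h1 : t `^ 2 <= t `^ p by apply: ger_powR => //; rewrite t0 (ltW t1).
have h2 : 1 - t <= (1 - t) `^ b.
  apply: ger1_powR => //; rewrite subr_gt0 t1 gerBl (ltW t0)//.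
move: h1; rewrite (powR_mulrn 2 (ltW t0)) expr2 => h1.
move: ((1 - t) `^ b) (t `^ p) h1 h2 => u v h1 h2; nra.
Qed.

End Kernel.

Section Potential.
Context (R : realType).
Implicit Types (x y z : R * R) (f g : R * R -> R).

Lemma bsup_ge0 (M r : R) f : bsup M r f -> 0 <= M.
Proof. by case=> _ /(_ 0) h _; exact: le_trans h. Qed.

Lemma bsupD (M r M' : R) f g : bsup M r f -> bsup M' r g ->
  bsup (M + M') r (fun x => f x + g x).
Proof.
move=> [mf fM fr] [mg gM gr]; split; first exact: measurable_funD.
  by move=> x; rewrite (le_trans (ler_normD _ _))// lerD.
move=> x; have [fx0|/fr//] := eqVneq (f x) 0.
by rewrite fx0 add0r => /gr.
Qed.

Lemma bsupN (M r : R) f : bsup M r f -> bsup M r (fun x => - f x).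
Proof.
move=> [mf fM fr]; split; first exact: measurableT_comp.
  by move=> x; rewrite normrN.
by move=> x; rewrite oppr_eq0 => /fr.
Qed.

Lemma bsupB (M r M' : R) f g : bsup M r f -> bsup M' r g ->
  bsup (M + M') r (fun x => f x - g x).
Proof. by move=> hf /bsupN hg; exact: bsupD. Qed.

Lemma bsupM (M r M' : R) f g : bsup M r f -> measurable_fun [set: R * R] g ->
  (forall x, `|x.1| <= r -> `|x.2| <= r -> `|g x| <= M') -> 0 <= M' ->
  bsup (M * M') r (fun x => f x * g x).
Proof.
move=> fb mg gM M'0; have M0 := bsup_ge0 fb; case: fb => mf fM fr.
split; first exact: measurable_funM.
  move=> x; have [->|/fr[h1 h2]] := eqVneq (f x) 0.
    by rewrite mul0r normr0 mulr_ge0.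
  by rewrite normrM ler_pM// gM.
by move=> x; rewrite mulf_eq0 negb_or => /andP[/fr].
Qed.

Lemma kbox_ge0 (e r : R) : 0 <= kbox e r. Proof. exact: sqr_ge0. Qed.

Lemma pairP x y : x.1 = y.1 -> x.2 = y.2 -> x = y.
Proof. by case: x y => ? ? [? ?] /= -> ->. Qed.

Lemma norm_via (u m v X rho : R) : `|u| <= X -> `|m| <= X -> `|m - v| <= rho ->
  `|u - v| <= rho + (X + X).
Proof.
by rewrite !ler_norml => /andP[? ?] /andP[? ?] /andP[? ?]; apply/andP; split; lra.
Qed.

Lemma eqN_eq0 (u : R) : - u = u -> u = 0. Proof. lra. Qed.

Lemma half_le (a b c : R) : 2 * a <= b + c -> b <= c -> a <= c. Proof. lra. Qed.

Lemma half_le' (a b c : R) : 2 * a <= b + c -> c <= b -> a <= b. Proof. lra. Qed.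

Context (e : R) (e0 : 0 <= e) (e1 : e < 1).

Lemma pot_bound (M r X : R) f x : bsup M r f -> 0 < r + X ->
  `|x.1| <= X -> `|x.2| <= X -> `|pot e f x| <= M * kbox e (r + X).
Proof.
move=> fM rX x1 x2; have [mf _ _] := fM; have M0 := bsup_ge0 fM.
have [Ib Ik] := kp_boxl x e0 e1 rX.
rewrite (le_trans (I2_abs_le (measurable_pot_in e x mf) (ig2Z M Ib) (pot_dom e fM x1 x2)))//.
by rewrite I2Z// ler_wpM2l.
Qed.

Lemma potD (M r M' : R) f g x : bsup M r f -> bsup M' r g ->
  pot e (fun x => f x + g x) x = pot e f x + pot e g x.
Proof.
move=> hf hg; rewrite /pot -I2D; [|exact: pot_ig2 hf|exact: pot_ig2 hg].
by apply: eq_I2 => y; rewrite mulrDr.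
Qed.

Lemma potB (M r M' : R) f g x : bsup M r f -> bsup M' r g ->
  pot e (fun x => f x - g x) x = pot e f x - pot e g x.
Proof.
move=> hf hg; rewrite /pot -I2B; [|exact: pot_ig2 hf|exact: pot_ig2 hg].
by apply: eq_I2 => y; rewrite mulrBr.
Qed.

Lemma pot_ge0 f x : (forall x, 0 <= f x) -> 0 <= pot e f x.
Proof. by move=> f0; apply: I2_ge0 => y; rewrite mulr_ge0 ?kp_ge0. Qed.

Lemma pot_ae f g (N : set (R * R)) x : (@lam2 R).-negligible N ->
  measurable_fun [set: R * R] f -> measurable_fun [set: R * R] g ->
  (forall y, ~ N y -> f y = g y) -> pot e f x = pot e g x.
Proof.
move=> N0 mf mg fg; apply: (I2_eq_ae N0); [exact: measurable_pot_in..|].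
by move=> y /fg->.
Qed.

(** The kernel is split at distance [rho]: the near part is controlled by the supremum of the
    density, the far part by its mass. The radius is left free and chosen at each use. *)
Lemma pot_sup (M r rho : R) f x : bsup M r f -> (forall x, 0 <= f x) -> 0 < rho ->
  pot e f x <= M * kbox e rho + rho `^ (- (2 * e)) * I2 f.
Proof.
move=> fM f0 r0; have [mf fb _] := fM; have M0 := bsup_ge0 fM.
have [Ib Ik] := kp_boxl x e0 e1 r0; have If := bsup_ig2 fM.
apply: (@le_trans _ _ (I2 (fun y => M * (kp e (x - y) * ibox rho (x - y)) +
    rho `^ (- (2 * e)) * f y))).
  apply: le_I2; first exact: pot_ig2 fM.
    by apply: ig2D; exact: ig2Z.
  move=> y; rewrite /ibox; case: ifP => [_|/negbT].
    rewrite mulr1 -[leLHS]addr0 lerD ?mulr_ge0 ?powR_ge0//.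
    by rewrite mulrC ler_wpM2r ?kp_ge0// (le_trans (ler_norm _)).
  rewrite !mulr0 add0r => h; rewrite ler_wpM2r// kpE.
  apply: powRN_le => //; first by rewrite mulr_ge0.
  move: h; rewrite negb_and -!ltNge => /orP[] /ltW /le_trans; apply.
    exact: enorm_ge1.
  exact: enorm_ge2.
by rewrite I2D ?I2Z ?lerD2r ?ler_wpM2l//; exact: ig2Z.
Qed.

(** The gain [|u - v|^b] comes from [powR_diff_le], and the weight [|y - m|^g] is absorbed by the
    larger distance [|v - y|]. A kernel of order [2 e + b - g] remains, integrable as long as this
    is below [2]. *)
Lemma kp_diff_le (H g b : R) u v y m : 0 <= H -> 0 <= g -> g <= b -> b <= 1 ->
  0 < enorm (u - y) -> enorm (u - y) <= enorm (v - y) ->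
  enorm (y - m) <= enorm (v - y) ->
  (kp e (u - y) - kp e (v - y)) * (H * enorm (y - m) `^ g) <=
  2 * H * enorm (u - v) `^ b * kp ((2 * e + b - g) / 2) (u - y).
Proof.
move=> H0 g0 gb b1.
have b0 : 0 <= b by exact: le_trans gb.
set E := (2 * e + b - g) / 2.
move=> uy uv ym; have vy := lt_le_trans uy uv.
rewrite !kpE.
have p2 : 0 <= 2 * e <= 2.
  by rewrite mulr_ge0//= -[leRHS]mulr1 ler_wpM2l// ltW.
have bb : 0 <= b <= 1 by rewrite b0.
have L1 := powR_diff_le p2 bb uy uv.
have L2 : enorm (v - y) - enorm (u - y) <= enorm (u - v).
  rewrite (le_trans (ler_norm _))// (le_trans (enorm_dist _ _))//.
  by rewrite opprB addrA subrK enorm_distC.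
have L3 : (enorm (v - y) - enorm (u - y)) `^ b <= enorm (u - v) `^ b.
  by apply: ge0_ler_powR => //; rewrite nnegrE ?subr_ge0 ?enorm_ge0.
have L4 : enorm (y - m) `^ g <= enorm (v - y) `^ g.
  by apply: ge0_ler_powR => //; rewrite nnegrE ?enorm_ge0.
have L5 : enorm (v - y) `^ (- b) * enorm (v - y) `^ g <= enorm (u - y) `^ (- (b - g)).
  rewrite -powRD; last by rewrite (gt_eqF vy) implybT.
  rewrite (_ : - b + g = - (b - g)); last by ring.
  by apply: powRN_le => //; rewrite subr_ge0.
have L6 : enorm (u - y) `^ (- (2 * E)) = enorm (u - y) `^ (- (2 * e)) * enorm (u - y) `^ (- (b - g)).
  rewrite -powRD; last by rewrite (gt_eqF uy) implybT.
  by congr (_ `^ _); rewrite /E; field.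
apply: (@le_trans _ _ (2 * enorm (u - v) `^ b * (enorm (u - y) `^ (- (2 * e)) *
    enorm (v - y) `^ (- b)) * (H * enorm (v - y) `^ g))).
  apply: ler_pM.
  - by rewrite subr_ge0; apply: powRN_le => //; rewrite mulr_ge0.
  - by rewrite mulr_ge0 ?powR_ge0.
  - rewrite (le_trans L1)// ler_wpM2r ?mulr_ge0 ?powR_ge0//.
    by rewrite ler_wpM2l.
  - by rewrite ler_wpM2l.
have reorder (A P Q V : R) : 2 * A * (P * Q) * (H * V) = 2 * H * A * (P * (Q * V)) by ring.
rewrite L6 reorder.
by rewrite ler_wpM2l ?mulr_ge0 ?powR_ge0// ler_wpM2l ?powR_ge0.
Qed.

(* The integrand is antisymmetric about the midpoint of [x] and [x'], which
   allows the value of [f] there to be subtracted. *)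
Lemma pot_hoelder (r H g b X : R) : 0 <= H -> 0 <= g -> g <= b ->
  b <= 1 -> 2 * e + b - g < 2 -> 0 < r -> 0 < X ->
  exists2 C, 0 <= C & forall (M : R) f, bsup M r f ->
    (forall y z, `|f y - f z| <= H * enorm (y - z) `^ g) -> forall x x',
    `|x.1| <= X -> `|x.2| <= X -> `|x'.1| <= X -> `|x'.2| <= X ->
    `|pot e f x - pot e f x'| <= C * enorm (x - x') `^ b.
Proof.
move=> H0 g0 gb b1 eE r0 X0.
pose E := (2 * e + b - g) / 2.
have E0 : 0 <= E.
  by rewrite divr_ge0// -addrA addr_ge0 ?subr_ge0// mulr_ge0.
have E1 : E < 1 by rewrite /E ltr_pdivrMr// mul1r.
have b0 : 0 <= b by exact: le_trans gb.
pose rho := r + X; have rho0 : 0 < rho by rewrite addr_gt0.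
pose T := rho + (X + X); have T0 : 0 < T by rewrite !addr_gt0.
exists (2 * H * (kbox E T + kbox E T)).
  by rewrite !mulr_ge0// addr_ge0 ?kbox_ge0.
move=> M f fM fH x x' x1 x2 x1' x2'; have [mf fb fr] := fM.
pose m : R * R := ((x.1 + x'.1) / 2, (x.2 + x'.2) / 2).
have hv (u v : R) : `|u| <= X -> `|v| <= X -> `|(u + v) / 2| <= X.
  by rewrite !ler_norml => /andP[? ?] /andP[? ?]; apply/andP; split; lra.
have m1 : `|m.1| <= X by exact: hv.
have m2 : `|m.2| <= X by exact: hv.
pose D y := kp e (x - y) - kp e (x' - y).
have mD : measurable_fun [set: R * R] D by apply: measurable_funB; exact: measurable_kpl.
have mib : measurable_fun [set: R * R] (fun y => ibox rho (m - y)).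
  exact: (measurableT_comp (measurable_ibox rho) (measurable_subl m)).
have boxT z y : `|z.1| <= X -> `|z.2| <= X -> ibox rho (m - y) = 1 -> ibox T (z - y) = 1.
  rewrite /ibox => z1 z2; case: ifP => [/andP[/= h1 h2] _|_ /esym/eqP]; last first.
    by rewrite oner_eq0.
  by rewrite ifT//; apply/andP; split; [exact: norm_via h1|exact: norm_via h2].
have Dib : ig2 (fun y => D y * ibox rho (m - y)).
  have [I1 _] := kp_boxl x e0 e1 T0; have [I2' _] := kp_boxl x' e0 e1 T0.
  apply: (ig2_le _ _ (ig2D I1 I2')); first exact: measurable_funM.
  move=> y; rewrite normrM; have [h|->] := iboxP rho (m - y); last first.
    by rewrite normr0 mulr0 addr_ge0// mulr_ge0 ?kp_ge0 ?ibox_ge0.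
  rewrite h (boxT x y)// (boxT x' y)// normr1 !mulr1 /D.
  by rewrite (le_trans (ler_normB _ _))// !ger0_norm ?kp_ge0.
have I0 : I2 (fun y => D y * ibox rho (m - y)) = 0.
  have [_] := I2_refl (m + m) Dib.
  rewrite (_ : I2 (fun y => D (m + m - y) * ibox rho (m - (m + m - y))) =
    - I2 (fun y => D y * ibox rho (m - y))); last first.
    rewrite -I2N//; apply: eq_I2 => y; rewrite -mulNr; congr (_ * _).
      have mm : m + m = x + x' by apply: pairP => /=; field.
      rewrite /D mm (_ : x - (x + x' - y) = - (x' - y)); last by apply: pairP => /=; ring.
      rewrite (_ : x' - (x + x' - y) = - (x - y)); last by apply: pairP => /=; ring.
      by rewrite !kpN opprB.
    rewrite (_ : m - (m + m - y) = - (m - y)); last by apply: pairP => /=; ring.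
    by rewrite /ibox /= !normrN.
  exact: eqN_eq0.
have Epot : pot e f x - pot e f x' = I2 (fun y => D y * (f y - f m) * ibox rho (m - y)).
  rewrite /pot -I2B; [|exact: pot_ig2 fM|exact: pot_ig2 fM].
  have If : ig2 (fun y => D y * f y).
    have := ig2B (pot_ig2 x e0 e1 fM) (pot_ig2 x' e0 e1 fM).
    by apply: eq_ig2 => y; rewrite mulrBl.
  transitivity (I2 (fun y => D y * f y) - f m * I2 (fun y => D y * ibox rho (m - y))).
    by rewrite I0 mulr0 subr0; apply: eq_I2 => y; rewrite mulrBl.
  rewrite -I2Z// -I2B//; last exact: ig2Z.
  apply: eq_I2 => y; have [->|/fr[h1 h2]] := eqVneq (f y) 0; first by ring.
  have -> : ibox rho (m - y) = 1.
    by apply: ibox1 => /=; rewrite (le_trans (ler_normB _ _))// addrC lerD.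
  by ring.
rewrite Epot.
pose c := 2 * H * enorm (x - x') `^ b.
have c0 : 0 <= c by rewrite !mulr_ge0 ?powR_ge0.
have [I1 B1] := kp_boxl x E0 E1 T0; have [I1' B1'] := kp_boxl x' E0 E1 T0.
have N0 : (@lam2 R).-negligible ([set y : R * R | y.1 = x.1] `|` [set y : R * R | y.1 = x'.1]).
  exact: negligibleU (null_vline _) (null_vline _).
have Ig := ig2Z c (ig2D I1 I1').
have [] := @I2_abs_le_ae R (fun y => D y * (f y - f m) * ibox rho (m - y)) _ _ N0 _ Ig.
- apply: measurable_funM => //; apply: measurable_funM => //.
  by apply: measurable_funB => //; exact: measurable_cst.
- move=> y /= /not_orP[yx yx'].
  have xy0 : 0 < enorm (x - y).
    by apply: enorm_gt0; rewrite subr_eq0; apply: contra_notN yx => /eqP->.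
  have xy0' : 0 < enorm (x' - y).
    by apply: enorm_gt0; rewrite subr_eq0; apply: contra_notN yx' => /eqP->.
  rewrite normrM; have [h|->] := iboxP rho (m - y); last first.
    by rewrite normr0 mulr0 mulr_ge0// addr_ge0// mulr_ge0 ?kp_ge0 ?ibox_ge0.
  rewrite h (boxT x y)// (boxT x' y)// normr1 !mulr1 normrM.
  have key u v := @kp_diff_le H g b u v y m H0 g0 gb b1.
  (* The midpoint is no farther from [y] than the farther of [x] and [x']; the nearer one takes the
     role of [u] in [kp_diff_le]. *)
  have mid : 2 * enorm (y - m) <= enorm (x - y) + enorm (x' - y).
    rewrite -(enormN (x - y)) -(enormN (x' - y)).
    apply: le_trans (enormD _ _).
    rewrite (_ : - (x - y) - (x' - y) = 2 *: (y - m)); last first.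
      by rewrite scaler_nat mulr2n; apply: pairP => /=; field.
    by rewrite enormZ ger0_norm.
  rewrite (le_trans (ler_wpM2l (normr_ge0 _) (fH y m)))//.
  have kpos u : 0 <= kp E (u - y) by exact: kp_ge0.
  have [le|/ltW le] := leP (enorm (x - y)) (enorm (x' - y)).
    have ym : enorm (y - m) <= enorm (x' - y) by exact: half_le mid le.
    rewrite ger0_norm; last first.
      by rewrite subr_ge0 !kpE; apply: powRN_le => //; rewrite mulr_ge0.
    by rewrite (le_trans (key _ _ xy0 le ym))// /c mulrDr lerDl mulr_ge0.
  have ym : enorm (y - m) <= enorm (x - y) by exact: half_le' mid le.
  rewrite distrC ger0_norm; last first.
    by rewrite subr_ge0 !kpE; apply: powRN_le => //; rewrite mulr_ge0.
  have := key _ _ xy0' le ym; rewrite (enorm_distC x' x) -/c => L.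
  by rewrite (le_trans L)// mulrDr lerDr mulr_ge0.
move=> _ L; rewrite (le_trans L)// I2Z; last exact: ig2D.
by rewrite I2D// /c [leRHS]mulrAC ler_wpM2l// lerD.
Qed.

Definition en f g : R := I2 (fun x => f x * pot e g x).

Lemma en_bsup (M M' r : R) f g : 0 < r -> bsup M r f -> bsup M' r g ->
  bsup (M * (M' * kbox e (r + r))) r (fun x => f x * pot e g x).
Proof.
move=> r0 hf hg; apply: bsupM => //.
- exact: pot_measurable hg.
- by move=> x x1 x2; apply: pot_bound => //; rewrite addr_gt0.
- by rewrite mulr_ge0 ?kbox_ge0// (bsup_ge0 hg).
Qed.

Lemma enC (M M' r : R) f g : 0 < r -> bsup M r f -> bsup M' r g -> en f g = en g f.
Proof.
move=> r0 hf hg; have [mf _ _] := hf; have [mg _ _] := hg.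
pose h x y := f x * (kp e (x - y) * g y).
have Ih x : ig2 (h x) by apply: ig2Z; exact: pot_ig2 hg.
have [] := @I2_swap R h (fun x => `|f x| * pot e (fun y => `|g y|) x).
- apply: measurable_funM; first exact: measurableT_comp.
  apply: measurable_funM; first exact: measurable_kp2.
  exact: measurableT_comp.
- have ba (k : R * R -> R) L : bsup L r k -> bsup L r (fun y => `|k y|).
    move=> [mk kL kr]; split; first exact: measurableT_comp.
      by move=> y; rewrite normr_id.
    by move=> y; rewrite normr_eq0 => /kr.
  exact: bsup_ig2 (en_bsup r0 (ba _ _ hf) (ba _ _ hg)).
- exact: Ih.
- move=> x; rewrite le_eqVlt; apply/orP; left; apply/eqP.
  rewrite /pot -I2Z; last first.
    have := ig2_abs (pot_ig2 x e0 e1 hg); apply: eq_ig2 => y.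
    by rewrite normrM ger0_norm ?kp_ge0.
  by apply: eq_I2 => y; rewrite /h !normrM (ger0_norm (kp_ge0 _ _)).
move=> _ _ E _; rewrite /en.
transitivity (I2 (fun x => I2 (h x))).
  apply: eq_I2 => x; rewrite /pot -I2Z//; exact: pot_ig2 hg.
rewrite E; apply: eq_I2 => y; rewrite /pot -I2Z; last exact: pot_ig2 hf.
by apply: eq_I2 => x; rewrite /h (kpC _ y x); ring.
Qed.

End Potential.

(** * Positive definiteness of the interaction energy *)

Section GammaPositive.
Context (R : realType).
Local Notation leb := (@lebesgue_measure R).
Local Notation mR := (measurableTypeR R).

Lemma ge0_integral_scale (a : R) (f : R -> \bar R) : a != 0 ->
  measurable_fun [set: mR] f -> (forall t, (0 <= f t)%E) ->
  (`|a|%:E * \int[leb]_t f (a * t)%R = \int[leb]_t f t)%E.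
Proof.
move=> a0 mf f0; have mm := measurable_affine a 0.
have := @ge0_integral_pushforward _ _ _ _ R _ mm leb setT f measurableT mf
  (fun y _ => f0 y).
rewrite preimage_setT => E.
rewrite (_ : (\int[leb]_t f (a * t)%R = \int[leb]_t (f \o (fun t : mR => (a * t + 0)%R)) t)%E);
  last by apply: eq_integral => t _ /=; rewrite addr0.
rewrite -E -[X in (X%:E * _)%E]/((NngNum (normr_ge0 a))%:num).
rewrite -(@ge0_integral_mscale _ _ R (pushforward_measure leb mm) setT measurableT
  (NngNum (normr_ge0 a)) f mf (fun y _ => f0 y)).
apply: eq_measure_integral => A mA _ /=.
exact: lebesgue_measure_affine.
Qed.

Definition wgam (z t : R) : R := if 0 < t then t `^ (z - 1) * expR (- t) else 0.

Lemma wgam_ge0 z t : 0 <= wgam z t.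
Proof. by rewrite /wgam; case: ifP => // _; rewrite mulr_ge0 ?powR_ge0 ?expR_ge0. Qed.

Lemma measurable_wgam z : measurable_fun [set: R] (wgam z).
Proof.
apply: measurable_fun_ifT.
- exact: measurable_fun_ltr.
- apply: measurable_funM; first exact: measurable_powR.
  by apply: measurableT_comp => //; exact: measurable_expR.
- exact: measurable_cst.
Qed.

(** The power is integrable near [0], and for [t >= 1] and [z <= 1] the integrand is at most the
    exponential density. *)
Lemma wgam_lt_pinfty z : 0 < z <= 1 -> (\int[leb]_t (wgam z t)%:E < +oo)%E.
Proof.
move=> /andP[z0 z1].
apply: (@le_lt_trans _ _ (\int[leb]_t ((wpow z 1 t)%:E + (exponential_pdf 1 t)%:E))%E).
  apply: ge0_le_integral => //.
  - by move=> t _; rewrite lee_fin wgam_ge0.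
  - by apply/measurable_EFinP; exact: measurable_wgam.
  - apply: emeasurable_funD; apply/measurable_EFinP; first exact: measurable_wpow.
    exact: measurable_exponential_pdf.
  move=> t _; rewrite -EFinD lee_fin /wgam /wpow; case: ifPn => [t0|t0]; last first.
    by rewrite addr_ge0 ?exponential_pdf_ge0//; case: ifP; rewrite ?powR_ge0.
  rewrite gtr0_norm// exponential_pdfE ?(ltW t0)// mul1r mulN1r.
  case: (leP t 1) => t1.
    rewrite -[leLHS]addr0 lerD ?expR_ge0//.
    by rewrite ler_piMr ?powR_ge0// -expR0 ler_expR lerNl oppr0 ltW.
  rewrite add0r ler_piMl ?expR_ge0//.
  rewrite -[leRHS](powRr0 t); apply: ler_powR; [exact: ltW|lra].
rewrite ge0_integralD//.
- rewrite integral_exponential_pdf//.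
  rewrite lte_add_pinfty ?ltry//.
  exact: le_lt_trans (wpow_integral z0 ltr01) (ltry _).
- by move=> t _; rewrite lee_fin wpow_ge0.
- by apply/measurable_EFinP; exact: measurable_wpow.
- by move=> t _; rewrite lee_fin exponential_pdf_ge0.
- by apply/measurable_EFinP; exact: measurable_exponential_pdf.
Qed.

Lemma wgam_gt0 z : z <= 1 -> (0 < \int[leb]_t (wgam z t)%:E)%E.
Proof.
move=> z1.
have c0 : 0 < 2 `^ (z - 1) * expR (- 2) :> R by rewrite mulr_gt0 ?powR_gt0 ?expR_gt0.
apply: (@lt_le_trans _ _ (\int[leb]_(t in `[1%R, 2%R]%classic) (2 `^ (z - 1) * expR (- 2))%:E)%E).
  rewrite integral_cst//= lebesgue_measure_itv/= lte_fin ifT; last lra.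
  by rewrite -EFinB -EFinM lte_fin mulr_gt0// subr_gt0; lra.
rewrite integral_mkcond; apply: ge0_le_integral => //.
- by move=> t _; rewrite patchE; case: ifP => // _; rewrite lee_fin ltW.
- by apply/(measurable_restrictT _ _).1 => //; exact: measurable_cst.
- by apply/measurable_EFinP; exact: measurable_wgam.
move=> t _; rewrite patchE mem_setE in_itv/=; case: ifPn => [/andP[t1 t2]|_]; last first.
  by rewrite lee_fin wgam_ge0.
have t0 : 0 < t by lra.
rewrite lee_fin /wgam t0 ler_pM ?powR_ge0 ?expR_ge0//.
  by have := @powRN_le R (1 - z) t 2; rewrite opprB; apply => //; rewrite subr_ge0.
by rewrite ler_expR lerN2.
Qed.

Lemma Gamma_gt0 (z : R) : 0 < z <= 1 -> 0 < Gamma z.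
Proof.
move=> z01; have fin := wgam_lt_pinfty z01.
have [_ z1] := andP z01; have pos := wgam_gt0 z1.
rewrite /Gamma /Rintegral.
rewrite (_ : (\int[leb]_(t in `]0%R, +oo[) _ = \int[leb]_t (wgam z t)%:E)%E).
  by rewrite fine_gt0// pos.
rewrite integral_mkcond; apply: eq_integral => t _.
by rewrite patchE mem_setE in_itv/= andbT /wgam; case: ifP.
Qed.

Lemma c_gt0 (s : R) : 0 < s < 1 -> 0 < c_ s.
Proof.
move=> /andP[s0 s1]; rewrite divr_gt0//.
  by apply: Gamma_gt0; apply/andP; split; lra.
rewrite !mulr_gt0 ?powR_gt0 ?pi_gt0//.
by apply: Gamma_gt0; rewrite s0 ltW.
Qed.

(** The Gamma integral in the variable [t A]. With [A = nrm2 z] the right-hand side contains the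
    kernel [kp e z], the left-hand side Gaussians in [z]. *)
Lemma wgam_scale (e A : R) : 0 < A ->
  (\int[leb]_t ((if 0 < t then t `^ (e - 1) else 0) * expR (- (t * A)))%:E =
   (A `^ (- e))%:E * \int[leb]_t (wgam e t)%:E)%E.
Proof.
move=> A0; have An : A != 0 by rewrite gt_eqF.
rewrite -(@ge0_integral_scale A (EFin \o wgam e))//; last 2 first.
- by apply/measurable_EFinP; exact: measurable_wgam.
- by move=> t; rewrite lee_fin wgam_ge0.
rewrite muleA -EFinM gtr0_norm// -ge0_integralZl//; first last.
- by rewrite lee_fin mulr_ge0 ?powR_ge0// ltW.
- by move=> t _; rewrite lee_fin wgam_ge0.
- apply/measurable_EFinP; apply: (measurableT_comp (measurable_wgam e)).
  exact: measurable_funM.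
apply: eq_integral => t _ /=; rewrite -EFinM; congr EFin.
rewrite /wgam pmulr_rgt0//; case: ifPn => t0; last by rewrite mul0r mulr0.
rewrite powRM ?(ltW A0) ?(ltW t0)// (mulrC t A) mulrA; congr (_ * _).
rewrite mulrA mulrAC -mulrA mulrCA -[LHS]mulr1; congr (_ * _).
rewrite -{2}(powRr1 (ltW A0)) -!powRD ?(gt_eqF A0) ?implybT//.
have -> : - e + 1 + (e - 1) = 0 by ring.
by rewrite powRr0.
Qed.

End GammaPositive.

Section PositiveDefinite.
Context (R : realType).
Local Notation leb := (@lebesgue_measure R).
Local Notation mR := (measurableTypeR R).
Local Notation l2 := (@lam2 R).
Implicit Types (x y z : R * R) (a b : R * R -> R).

Definition gauss2 (c : R) z : R := expR (- (c * nrm2 z)).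

Lemma gauss2_ge0 c z : 0 <= gauss2 c z. Proof. exact: expR_ge0. Qed.

Lemma gauss2_le1 c z : 0 <= c -> gauss2 c z <= 1.
Proof. by move=> c0; rewrite -expR0 ler_expR oppr_le0 mulr_ge0 ?nrm2_ge0. Qed.

Lemma measurable_gauss2 c : measurable_fun [set: R * R] (gauss2 c).
Proof.
apply: measurableT_comp; first exact: measurable_expR.
apply: measurableT_comp => //; apply: measurable_funM => //; exact: measurable_nrm2.
Qed.

(** Comparison with a two-sided exponential density through [c t^2 >= 2 |t| - 1]; for positivity,
    the exponent on the unit square is at most [4 * 2]. The parameters needed are the [2] and [4] of
    [gauss2_conv]. *)
Lemma gauss2_ig c : 1 <= c <= 4 -> ig2 (gauss2 c) /\ 0 < I2 (gauss2 c).
Proof.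
move=> /andP[c1 c4].
pose q (t : R) : R := expR 1 * (exponential_pdf 1 t + exponential_pdf 1 (- t)).
have mq : measurable_fun [set: R] q.
  apply: measurable_funM => //; apply: measurable_funD.
    exact: measurable_exponential_pdf.
  by apply: measurableT_comp => //; exact: measurable_exponential_pdf.
have q0 t : 0 <= q t by rewrite mulr_ge0 ?expR_ge0 ?addr_ge0 ?exponential_pdf_ge0.
have qle t : expR (- (c * t ^+ 2)) <= q t.
  apply: (@le_trans _ _ (expR (1 - `|t|))).
    rewrite ler_expR; have := sqr_ge0 (`|t| - 1); rewrite sqrrB1 real_normK ?num_real//.
    by have := normr_ge0 t; have := sqr_ge0 t; rewrite mulr2n; nra.
  rewrite expRD /q ler_wpM2l ?expR_ge0//.
  have [t0|t0] := leP 0 t.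
    by rewrite ger0_norm// exponential_pdfE// mul1r mulN1r lerDl exponential_pdf_ge0.
  rewrite ltr0_norm// [exponential_pdf 1 (- t)]exponential_pdfE ?oppr_ge0 ?(ltW t0)//.
  by rewrite mul1r mulN1r lerDr exponential_pdf_ge0.
have qint : (\int[leb]_t (q t)%:E <= (expR 1 * 2)%:E)%E.
  rewrite /q; under eq_integral do rewrite EFinM.
  have me : measurable_fun [set: mR] (fun t : mR => (exponential_pdf (1:R) t)%:E).
    by apply/measurable_EFinP; exact: measurable_exponential_pdf.
  have mN : measurable_fun [set: mR] (fun t : mR => (exponential_pdf (1:R) (- t))%:E).
    apply/measurable_EFinP; apply: measurableT_comp => //; exact: measurable_exponential_pdf.
  rewrite ge0_integralZl//; last 2 first.
  - apply/measurable_EFinP; apply: measurable_funD; first exact: measurable_exponential_pdf.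
    by apply: measurableT_comp => //; exact: measurable_exponential_pdf.
  - by move=> t _; rewrite lee_fin addr_ge0 ?exponential_pdf_ge0.
  rewrite EFinM lee_wpmul2l ?lee_fin ?expR_ge0//.
  under eq_integral do rewrite EFinD.
  rewrite ge0_integralD//; first last.
  - by move=> t _; rewrite lee_fin exponential_pdf_ge0.
  - by move=> t _; rewrite lee_fin exponential_pdf_ge0.
  have E := @ge0_integral_scale R (-1) (fun t => (exponential_pdf 1 t)%:E) _ me.
  rewrite (_ : (\int[leb]_t (exponential_pdf 1 (- t))%:E = \int[leb]_t (exponential_pdf 1 t)%:E)%E).
    by rewrite integral_exponential_pdf// -EFinD lee_fin; lra.
  rewrite -E ?oppr_eq0 ?oner_eq0//; last by move=> t; rewrite lee_fin exponential_pdf_ge0.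
  rewrite normrN1 mul1e; apply: eq_integral => t _; by rewrite mulN1r.
have [Iq _] := @ig2_prod R q q mq mq q0 q0 _ _ qint qint.
have ig : ig2 (gauss2 c).
  apply: (ig2_le (measurable_gauss2 c) _ Iq) => z.
  rewrite ger0_norm ?gauss2_ge0// /gauss2 /nrm2 mulrDr opprD expRD.
  by rewrite ler_pM ?expR_ge0.
split=> //.
have h : 0 < expR (- 8) :> R by exact: expR_gt0.
apply: (@lt_le_trans _ _ (I2 (fun z => expR (- 8) * ibox 1 z))); last first.
  apply: le_I2 => //; first by apply: ig2Z; exact: ig2_ibox.
  move=> z; rewrite /ibox; case: ifP => [/andP[z1 z2]|_]; last by rewrite mulr0 gauss2_ge0.
  rewrite mulr1 ler_expR lerN2.
  have : nrm2 z <= 2; last by have := nrm2_ge0 z; nra.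
  rewrite /nrm2 -(real_normK (num_real z.1)) -(real_normK (num_real z.2)).
  by rewrite (_ : 2 = 1 + 1)// lerD// expr_le1.
rewrite I2Z; last exact: ig2_ibox.
rewrite mulr_gt0//; rewrite -lte_fin I2E; last exact: ig2_ibox.
apply: (@lt_le_trans _ _ (l2 (`[0%R, 1%R] `*` `[0%R, 1%R]))).
  rewrite lam2_prod// lebesgue_measure_itv/= lte_fin ltr01.
  by rewrite -EFinB -EFinM lte_fin subr0 mulr1.
rewrite -[leLHS]mul1e -(@integral_cst _ _ _ l2 _ _ 1%E); last exact: measurableX.
rewrite integral_mkcond; apply: ge0_le_integral => //.
- by move=> t _; rewrite patchE; case: ifP => // _; rewrite lee_fin.
- apply/(measurable_restrictT _ _).1; first exact: measurableX.
  exact: measurable_cst.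
- by apply/measurable_EFinP; exact: measurable_ibox.
move=> z _; rewrite patchE; case: ifPn => [|_]; last by rewrite lee_fin ibox_ge0.
rewrite inE/= !in_itv/= => -[/andP[? ?] /andP[? ?]].
by rewrite lee_fin ibox1// ger0_norm.
Qed.

(** Completing the square about the midpoint. It exhibits the Gaussian kernel as [h h^T] with [h]
    again Gaussian, the source of positivity. *)
Lemma gauss2_conv (u v : R * R) :
  ig2 (fun z => gauss2 2 (u - z) * gauss2 2 (v - z)) /\
  I2 (fun z => gauss2 2 (u - z) * gauss2 2 (v - z)) = gauss2 1 (u - v) * I2 (gauss2 4).
Proof.
pose m : R * R := ((u.1 + v.1) / 2, (u.2 + v.2) / 2).
have E z : gauss2 2 (u - z) * gauss2 2 (v - z) = gauss2 1 (u - v) * gauss2 4 (m - z).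
  by rewrite /gauss2 -!expRD; congr expR; rewrite /nrm2 /m /=; field.
have [ig _] : ig2 (gauss2 4) /\ 0 < I2 (gauss2 4).
  by apply: gauss2_ig; apply/andP; split; lra.
have [ig' E'] := I2_refl m ig.
have EE : (fun z => gauss2 2 (u - z) * gauss2 2 (v - z)) =
    (fun z => gauss2 1 (u - v) * gauss2 4 (m - z)) by exact/funext.
rewrite EE; split; first exact: (ig2Z _ ig').
by rewrite (I2Z _ ig') E'.
Qed.

Lemma mulr2_le (u v : R) : 2 * (u * v) <= u * u + v * v.
Proof. by have := sqr_ge0 (u - v); rewrite sqrrB !expr2 mulr2n; lra. Qed.

Lemma ig2_mul_le1 a (g : R * R -> R) : ig2 a -> measurable_fun [set: R * R] g ->
  (forall x, 0 <= g x <= 1) -> ig2 (fun x => a x * g x).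
Proof.
move=> Ia mg g01; apply: (ig2_le _ _ (ig2_abs Ia)).
  by apply: measurable_funM => //; exact: ig2_meas Ia.
by move=> x; have /andP[g0 g1] := g01 x; rewrite normrM (ger0_norm g0) ler_piMr.
Qed.

Definition kconv (h : R * R -> R * R -> R) a z : R := I2 (fun x => a x * h x z).

Lemma scaled_le (C u v w u' v' w' : R) : 0 < C -> C * u = u' -> C * v = v' -> C * w = w' ->
  2 * u' <= v' + w' -> 2 * u <= v + w.
Proof. by move=> C0 <- <- <-; rewrite mulrCA -mulrDr ler_pM2l. Qed.

Lemma scaled_lee (C u v w : R) (u' v' w' : \bar R) : 0 < C -> (C%:E * u%:E = u')%E ->
  (C%:E * v%:E = v')%E -> (C%:E * w%:E = w')%E -> (2%:E * u' <= v' + w')%E -> 2 * u <= v + w.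
Proof.
move=> C0 <- <- <-; rewrite -!EFinM -EFinD lee_fin.
exact: scaled_le C0 erefl erefl erefl.
Qed.

(** If the kernel [C g] is [h h^T], the bilinear form is the [L^2] product of [kconv h a] and
    [kconv h b]. The integrals are exchanged against [b] for fixed [x], then against [a]. *)
Lemma factor_pair (h g : R * R -> R * R -> R) (C C1 : R) a b :
  measurable_fun [set: (R * R) * (R * R)] (fun p => h p.1 p.2) ->
  (forall x z, 0 <= h x z <= 1) -> (forall x, ig2 (h x)) -> (forall x, I2 (h x) = C1) ->
  0 < C -> (forall x y, ig2 (fun z => h x z * h y z)) ->
  (forall x y, I2 (fun z => h x z * h y z) = C * g x y) ->
  (forall x, measurable_fun [set: R * R] (g x)) -> (forall x y, 0 <= g x y <= 1) ->
  ig2 a -> ig2 b ->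
  ig2 (fun z => kconv h a z * kconv h b z) /\
  C * I2 (fun x => a x * I2 (fun y => b y * g x y)) =
  I2 (fun z => kconv h a z * kconv h b z).
Proof.
move=> mh h01 Ihx Ihxe C0 Igg Egg mg g01 Ia Ib.
have ma := ig2_meas Ia; have mb := ig2_meas Ib.
have h0 x z : 0 <= h x z by have /andP[] := h01 x z.
have mhx x : measurable_fun [set: R * R] (h x) by exact: ig2_meas (Ihx x).
have mhz z : measurable_fun [set: R * R] (fun x => h x z).
  exact: (measurableT_comp mh (pair2_measurable z)).
have C10 : 0 <= C1 by rewrite -(Ihxe 0); exact: I2_ge0.
have Iahz c z : ig2 c -> ig2 (fun y => c y * h y z) by move=> Ic; exact: ig2_mul_le1.
have step1 x : I2 (fun y => b y * (C * g x y)) = I2 (fun z => h x z * kconv h b z).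
  have [] := @I2_swap R (fun y z => b y * (h x z * h y z)) (fun y => C * `|b y|).
  - apply: measurable_funM; first exact: measurableT_comp.
    apply: measurable_funM => //.
    by apply: (measurableT_comp (mhx x)); exact: measurable_snd.
  - exact/ig2Z/ig2_abs.
  - by move=> y; apply: ig2Z; exact: Igg.
  - move=> y; rewrite (_ : I2 _ = `|b y| * I2 (fun z => h x z * h y z)); last first.
      rewrite -I2Z; last exact: Igg.
      by apply: eq_I2 => z; rewrite !normrM !(ger0_norm (h0 _ _)).
    have /andP[_ g1] := g01 x y.
    by rewrite Egg mulrCA ler_pM2l// ler_piMr.
  move=> _ _ E _.
  rewrite (_ : I2 _ = I2 (fun y => I2 (fun z => b y * (h x z * h y z)))); last first.
    by apply: eq_I2 => y; rewrite -Egg -(I2Z _ (Igg x y)).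
  rewrite E; apply: eq_I2 => z; rewrite /kconv -(I2Z _ (Iahz b z Ib)).
  by apply: eq_I2 => y; rewrite mulrCA.
pose B := I2 (fun y => `|b y|).
have gb z : `|kconv h b z| <= B.
  rewrite /kconv (le_trans (I2_abs (Iahz b z Ib)))//.
  apply: le_I2; [exact: ig2_abs (Iahz b z Ib)|exact: ig2_abs|] => y.
  by have /andP[_ h1] := h01 y z; rewrite normrM (ger0_norm (h0 _ _)) ler_piMr.
have B0 : 0 <= B by apply: I2_ge0.
have mgb : measurable_fun [set: R * R] (kconv h b).
  have [] := @I2_swap R (fun y z => b y * h y z) (fun y => C1 * `|b y|).
  - by apply: measurable_funM => //; exact: measurableT_comp.
  - exact/ig2Z/ig2_abs.
  - by move=> y; exact: ig2Z.
  - move=> y; rewrite mulrC -(Ihxe y) -(I2Z _ (Ihx y)).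
    apply: le_I2; [exact/ig2_abs/ig2Z|exact: ig2Z|] => z.
    by rewrite normrM (ger0_norm (h0 _ _)).
  by move=> _ /ig2_meas.
have Ihb x : ig2 (fun z => h x z * kconv h b z).
  apply: (ig2_le _ _ (ig2Z B (Ihx x))); first exact: measurable_funM.
  by move=> z; rewrite normrM mulrC (ger0_norm (h0 _ _)) ler_wpM2r.
have [] := @I2_swap R (fun x z => a x * (h x z * kconv h b z)) (fun x => (B * C1) * `|a x|).
- apply: measurable_funM; first exact: measurableT_comp.
  apply: measurable_funM => //; exact: measurableT_comp.
- exact/ig2Z/ig2_abs.
- by move=> x; exact: ig2Z.
- move=> x; rewrite mulrC -(Ihxe x) -(I2Z B (Ihx x)) -(I2Z `|a x| (ig2Z B (Ihx x))).
  apply: le_I2; [exact/ig2_abs/ig2Z|exact/ig2Z/ig2Z|] => z.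
  by rewrite !normrM (ger0_norm (h0 _ _)) ler_wpM2l// mulrC ler_wpM2r.
move=> I1s I2s E _.
have Igz z : I2 (fun x => a x * (h x z * kconv h b z)) = kconv h a z * kconv h b z.
  rewrite {2}/kconv -(I2Zr _ (Iahz a z Ia)); apply: eq_I2 => x; exact: mulrA.
split; first by apply: eq_ig2 I2s.
rewrite -(eq_I2 Igz) -E.
pose q x := a x * I2 (fun y => b y * g x y).
have Ex x : I2 (fun z => a x * (h x z * kconv h b z)) = C * q x.
  rewrite (I2Z _ (Ihb x)) -step1 /q mulrCA; congr (_ * _).
  rewrite -(I2Z C (ig2_mul_le1 Ib (mg x) (g01 x))).
  by apply: eq_I2 => y; rewrite mulrCA.
have Iq : ig2 q.
  have := ig2Z C^-1 I1s; apply: eq_ig2 => x.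
  exact: (canLR (mulKf (lt0r_neq0 C0)) (Ex x)).
by rewrite (eq_I2 Ex) (I2Z _ Iq).
Qed.

Lemma factor_pd (h g : R * R -> R * R -> R) (C C1 : R) a b :
  measurable_fun [set: (R * R) * (R * R)] (fun p => h p.1 p.2) ->
  (forall x z, 0 <= h x z <= 1) -> (forall x, ig2 (h x)) -> (forall x, I2 (h x) = C1) ->
  0 < C -> (forall x y, ig2 (fun z => h x z * h y z)) ->
  (forall x y, I2 (fun z => h x z * h y z) = C * g x y) ->
  (forall x, measurable_fun [set: R * R] (g x)) -> (forall x y, 0 <= g x y <= 1) ->
  ig2 a -> ig2 b ->
  2 * I2 (fun x => a x * I2 (fun y => b y * g x y)) <=
  I2 (fun x => a x * I2 (fun y => a y * g x y)) + I2 (fun x => b x * I2 (fun y => b y * g x y)).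
Proof.
move=> h1 h2 h3 h4 C0 h6 h7 h8 h9 Ia Ib.
have [Iab Eab] := factor_pair h1 h2 h3 h4 C0 h6 h7 h8 h9 Ia Ib.
have [Iaa Eaa] := factor_pair h1 h2 h3 h4 C0 h6 h7 h8 h9 Ia Ia.
have [Ibb Ebb] := factor_pair h1 h2 h3 h4 C0 h6 h7 h8 h9 Ib Ib.
apply: (scaled_le C0 Eab Eaa Ebb); rewrite -(I2Z _ Iab) -(I2D Iaa Ibb).
by apply: le_I2; [exact: ig2Z|exact: ig2D|] => z; exact: mulr2_le.
Qed.

Lemma gauss2_scale (k : R) x y : gauss2 1 (k *: x - k *: y) = gauss2 (k ^+ 2) (x - y).
Proof. by rewrite -scalerBr /gauss2 /nrm2 /= !exprMn -mulrDr mul1r. Qed.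

Lemma measurable_gauss2_pair (c k : R) :
  measurable_fun [set: (R * R) * (R * R)] (fun p => gauss2 c (k *: p.1 - p.2)).
Proof.
have m11 : measurable_fun [set: (R * R) * (R * R)] (fun p => p.1.1 : R).
  by apply: (measurableT_comp measurable_fst); exact: measurable_fst.
have m12 : measurable_fun [set: (R * R) * (R * R)] (fun p => p.1.2 : R).
  by apply: (measurableT_comp measurable_snd); exact: measurable_fst.
have m21 : measurable_fun [set: (R * R) * (R * R)] (fun p => p.2.1 : R).
  by apply: (measurableT_comp measurable_fst); exact: measurable_snd.
have m22 : measurable_fun [set: (R * R) * (R * R)] (fun p => p.2.2 : R).
  by apply: (measurableT_comp measurable_snd); exact: measurable_snd.
have m : measurable_fun [set: (R * R) * (R * R)] (fun p => k *: p.1 - p.2 : R * R).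
  by apply: measurable_fun_pair => /=; apply: measurable_funB => //; exact: measurable_funM.
exact: (measurableT_comp (measurable_gauss2 c) m).
Qed.

(** The absolute value keeps the Gaussian bounded for every real [t]; the weight [wpos] later
    selects [t > 0]. *)
Definition gpair (t : R) a b : R :=
  I2 (fun x => a x * I2 (fun y => b y * gauss2 `|t| (x - y))).

(** Scaling the points by the square root of [|t|], and not the auxiliary variable, reduces every
    [t], including [0], to one fixed Gaussian. *)
Lemma gpair_pd (t : R) a b : ig2 a -> ig2 b ->
  2 * gpair t a b <= gpair t a a + gpair t b b.
Proof.
move=> Ia Ib; pose k := Num.sqrt `|t|.
have k2 : k ^+ 2 = `|t| by rewrite sqr_sqrtr.
have [I4 C0] : ig2 (gauss2 4) /\ 0 < I2 (gauss2 4) by apply: gauss2_ig; apply/andP; split; lra.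
have [Ih _] : ig2 (gauss2 2) /\ 0 < I2 (gauss2 2) by apply: gauss2_ig; apply/andP; split; lra.
rewrite /gpair -k2.
apply: (@factor_pd (fun x z => gauss2 2 (k *: x - z)) (fun x y => gauss2 (k ^+ 2) (x - y))
  (I2 (gauss2 4)) (I2 (gauss2 2))) => //.
- exact: measurable_gauss2_pair.
- by move=> x z; rewrite gauss2_ge0 gauss2_le1.
- by move=> x; have [] := I2_refl (k *: x) Ih.
- by move=> x; have [] := I2_refl (k *: x) Ih.
- by move=> x y; have [] := gauss2_conv (k *: x) (k *: y).
- by move=> x y; have [_ ->] := gauss2_conv (k *: x) (k *: y); rewrite gauss2_scale mulrC.
- move=> x; exact: (measurableT_comp (measurable_gauss2 _) (measurable_subl x)).
- by move=> x y; rewrite gauss2_ge0 gauss2_le1// sqr_ge0.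
Qed.

Definition wpos (e t : R) : R := if 0 < t then t `^ (e - 1) else 0.

Lemma wpos_ge0 e t : 0 <= wpos e t.
Proof. by rewrite /wpos; case: ifP => // _; rewrite powR_ge0. Qed.

Lemma measurable_wpos e : measurable_fun [set: R] (wpos e).
Proof.
apply: measurable_fun_ifT; [exact: measurable_fun_ltr|exact: measurable_powR|].
exact: measurable_cst.
Qed.

Lemma measurable_gauss_family :
  measurable_fun [set: (mR * (mR * mR)) * (mR * mR)] (fun p => gauss2 `|p.1.1| (p.1.2 - p.2)).
Proof.
have mt : measurable_fun [set: (mR * (mR * mR)) * (mR * mR)] (fun p => p.1.1 : R).
  by apply: (measurableT_comp measurable_fst); exact: measurable_fst.
have mx : measurable_fun [set: (mR * (mR * mR)) * (mR * mR)] (fun p => p.1.2 : mR * mR).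
  by apply: (measurableT_comp measurable_snd); exact: measurable_fst.
have mp : measurable_fun [set: (mR * (mR * mR)) * (mR * mR)] (fun p => (p.1.2, p.2)).
  by apply: measurable_fun_pair => //; exact: measurable_snd.
have ms := measurableT_comp (@measurable_sub2 R) mp.
have mn := measurableT_comp (@measurable_nrm2 R) ms.
apply: measurableT_comp; first exact: measurable_expR.
apply: measurableT_comp => //; apply: measurable_funM; last exact: mn.
exact: measurableT_comp.
Qed.

(* Off the diagonal, [kp e] is a mixture of Gaussians with the weight [wgam e]. *)
Lemma en_gpair (e M r : R) a b : 0 <= e -> e < 1 -> 0 < r ->
  bsup M r a -> bsup M r b -> (forall x, 0 <= a x) -> (forall x, 0 <= b x) ->
  measurable_fun [set: R] (fun t => gpair t a b) /\
  ((\int[leb]_t (wgam e t)%:E) * (en e a b)%:E =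
   \int[leb]_t (wpos e t * gpair t a b)%:E)%E.
Proof.
move=> e0 e1 r0 ha hb a0 b0; have [ma _ _] := ha; have [mb _ _] := hb.
have Ia := bsup_ig2 ha; have Ib := bsup_ig2 hb.
have : exists2 G : R -> R * R -> R * R -> R, (forall t x y, G t x y = gauss2 `|t| (x - y)) &
  measurable_fun [set: (mR * (mR * mR)) * (mR * mR)] (fun p => G p.1.1 p.1.2 p.2).
  by exists (fun t x y => gauss2 `|t| (x - y)) => //; exact: measurable_gauss_family.
move=> [G GE mG].
have G01 t x y : 0 <= G t x y <= 1 by rewrite GE gauss2_ge0 gauss2_le1.
have G0 t x y : 0 <= G t x y by have /andP[] := G01 t x y.
have mGy t x : measurable_fun [set: R * R] (G t x).
  exact: (measurableT_comp mG (pair1_measurable (t, x))).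
pose q (t : R) x := I2 (fun y => b y * G t x y).
have Igy t x : ig2 (fun y => b y * G t x y) by exact: ig2_mul_le1.
have q0 t x : 0 <= q t x by apply: I2_ge0 => y; rewrite mulr_ge0.
have mq : measurable_fun [set: mR * (mR * mR)] (fun p => q p.1 p.2).
  apply: (measurableT_comp (@fine_measurable R setT measurableT)).
  apply: (@measurable_fun_fubini_tonelli_F _ _ _ _ R l2
     (fun p : (mR * (mR * mR)) * (mR * mR) => (b p.2 * G p.1.1 p.1.2 p.2)%:E)).
    apply/measurable_EFinP; apply: measurable_funM => //.
    by apply: (measurableT_comp mb); exact: measurable_snd.
  by move=> p; rewrite lee_fin mulr_ge0.
have mqt t : measurable_fun [set: R * R] (q t).
  exact: (measurableT_comp mq (pair1_measurable t)).
have Igx t : ig2 (fun x => a x * q t x).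
  apply: (ig2_le _ _ (ig2Z (I2 (fun y => `|b y|)) (ig2_abs Ia))).
    exact: measurable_funM.
  move=> x; rewrite normrM mulrC ler_wpM2r// /q (le_trans (I2_abs (Igy t x)))//.
  apply: le_I2; [exact/ig2_abs/Igy|exact: ig2_abs|] => y.
  by have /andP[_ g1] := G01 t x y; rewrite normrM (ger0_norm (G0 _ _ _)) ler_piMr.
have gpE t : gpair t a b = I2 (fun x => a x * q t x).
  by apply: eq_I2 => x; congr (_ * _); apply: eq_I2 => y; rewrite GE.
split.
  rewrite (_ : (fun t => gpair t a b) = (fun t => I2 (fun x => a x * q t x))); last exact/funext.
  apply: (measurableT_comp (@fine_measurable R setT measurableT)).
  apply: (@measurable_fun_fubini_tonelli_F _ _ _ _ R l2
     (fun p : mR * (mR * mR) => (a p.2 * q p.1 p.2)%:E)).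
    apply/measurable_EFinP; apply: measurable_funM => //.
    by apply: (measurableT_comp ma); exact: measurable_snd.
  by move=> p; rewrite lee_fin mulr_ge0.
pose Gam := (\int[leb]_t (wgam e t)%:E)%E.
have mWG x : measurable_fun [set: mR * (mR * mR)]
    (fun p => (wpos e p.1 * (b p.2 * G p.1 x p.2))%:E).
  apply/measurable_EFinP; apply: measurable_funM.
    by apply: (measurableT_comp (measurable_wpos e)); exact: measurable_fst.
  apply: measurable_funM; first by apply: (measurableT_comp mb); exact: measurable_snd.
  have mp : measurable_fun [set: mR * (mR * mR)] (fun p => ((p.1, x : mR * mR), p.2)).
    apply: measurable_fun_pair; last exact: measurable_snd.
    by apply: measurable_fun_pair; [exact: measurable_fst|exact: measurable_cst].
  exact: (measurableT_comp mG mp).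
have inner x y : y.1 <> x.1 -> (\int[leb]_t (wpos e t * (b y * G t x y))%:E =
    Gam * (kp e (x - y) * b y)%:E)%E.
  move=> yx; have A0 : 0 < nrm2 (x - y).
    by apply: nrm2_gt0; rewrite subr_eq0; apply: contra_notN yx => /eqP->.
  transitivity (\int[leb]_t ((b y)%:E * (wpos e t * expR (- (t * nrm2 (x - y))))%:E))%E.
    apply: eq_integral => t _; rewrite -EFinM; congr EFin.
    rewrite GE /wpos /gauss2; case: ifPn => [t0|_]; last by rewrite !mul0r mulr0.
    by rewrite gtr0_norm// mulrCA.
  rewrite ge0_integralZl//; last 3 first.
  - apply/measurable_EFinP; apply: measurable_funM; first exact: measurable_wpos.
    apply: measurableT_comp; first exact: measurable_expR.
    by apply: measurableT_comp => //; exact: measurable_funM.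
  - by move=> t _; rewrite lee_fin mulr_ge0 ?wpos_ge0 ?expR_ge0.
  - by rewrite lee_fin.
  rewrite (wgam_scale e A0) -/Gam muleA -EFinM -/(kp e (x - y)) muleC.
  by rewrite (mulrC (b y)).
have mid x : (\int[leb]_t (wpos e t * q t x)%:E = Gam * (pot e b x)%:E)%E.
  transitivity (\int[leb]_t \int[l2]_y (wpos e t * (b y * G t x y))%:E)%E.
    apply: eq_integral => t _; rewrite EFinM /q (I2E (Igy t x)) -ge0_integralZl//.
    + apply/measurable_EFinP; exact: ig2_meas (Igy t x).
    + by move=> y _; rewrite lee_fin mulr_ge0.
    + by rewrite lee_fin wpos_ge0.
  rewrite (@fubini_tonelli _ _ _ _ R leb l2
    (fun p : mR * (mR * mR) => (wpos e p.1 * (b p.2 * G p.1 x p.2))%:E)) => //; last first.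
    by move=> p; rewrite lee_fin mulr_ge0 ?wpos_ge0// mulr_ge0.
  have Ipot : ig2 (fun y => kp e (x - y) * b y) by exact: pot_ig2 hb.
  have mpot := ig2_meas Ipot.
  rewrite /pot (I2E Ipot) -ge0_integralZl//; last 3 first.
  - exact/measurable_EFinP.
  - by move=> y _; rewrite lee_fin mulr_ge0 ?kp_ge0.
  - by apply: integral_ge0 => t _; rewrite lee_fin wgam_ge0.
  apply: ae_eq_integral => //.
  - apply: (@measurable_fun_fubini_tonelli_G _ _ _ _ R leb
      (fun p : mR * (mR * mR) => (wpos e p.1 * (b p.2 * G p.1 x p.2))%:E)) => //.
    by move=> p; rewrite lee_fin mulr_ge0 ?wpos_ge0// mulr_ge0.
  - apply: emeasurable_funM => //; exact/measurable_EFinP.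
  have [N [mN N0 sN]] := @null_vline R x.1.
  exists N; split=> // y /= hy; apply: sN => /=; apply: contrapT => yx.
  by apply: hy => _; rewrite inner.
have mpb := pot_measurable e0 e1 hb.
have Ien : ig2 (fun x => a x * pot e b x) by exact: bsup_ig2 (en_bsup e0 e1 r0 ha hb).
rewrite /en (I2E Ien) -/Gam -ge0_integralZl//; last 3 first.
- by apply/measurable_EFinP; exact: measurable_funM.
- by move=> x _; rewrite lee_fin mulr_ge0// pot_ge0.
- by apply: integral_ge0 => t _; rewrite lee_fin wgam_ge0.
transitivity (\int[l2]_x \int[leb]_t (wpos e t * (a x * q t x))%:E)%E.
  apply: eq_integral => x _; rewrite EFinM muleCA -mid -ge0_integralZl//.
  - by apply: eq_integral => t _; rewrite -EFinM mulrCA.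
  - apply/measurable_EFinP; apply: measurable_funM; first exact: measurable_wpos.
    exact: (measurableT_comp mq (pair2_measurable x)).
  - by move=> t _; rewrite lee_fin mulr_ge0 ?wpos_ge0.
  - by rewrite lee_fin.
rewrite -(@fubini_tonelli _ _ _ _ R leb l2
    (fun p : mR * (mR * mR) => (wpos e p.1 * (a p.2 * q p.1 p.2))%:E)).
- apply: eq_integral => t _; rewrite EFinM gpE.
  rewrite (I2E (Igx t)) -ge0_integralZl//.
  + apply/measurable_EFinP; exact: ig2_meas (Igx t).
  + by move=> x _; rewrite lee_fin mulr_ge0.
  + by rewrite lee_fin wpos_ge0.
- apply/measurable_EFinP; apply: measurable_funM.
    by apply: (measurableT_comp (measurable_wpos e)); exact: measurable_fst.
  apply: measurable_funM => //; by apply: (measurableT_comp ma); exact: measurable_snd.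
- by move=> p; rewrite lee_fin mulr_ge0 ?wpos_ge0// mulr_ge0.
Qed.

(** Polarized form for two nonnegative densities, in place of positivity on the signed [a - b]: all
    integrals over [t] are then of nonnegative functions. The integral of [wgam e] is finite and
    positive and cancels. *)
Lemma en_pd (e M r : R) a b : 0 < e -> e < 1 -> 0 < r ->
  bsup M r a -> bsup M r b -> (forall x, 0 <= a x) -> (forall x, 0 <= b x) ->
  2 * en e a b <= en e a a + en e b b.
Proof.
move=> e0 e1 r0 ha hb a0 b0; have e0' := ltW e0.
have [mab Eab] := en_gpair e0' e1 r0 ha hb a0 b0.
have [maa Eaa] := en_gpair e0' e1 r0 ha ha a0 a0.
have [mbb Ebb] := en_gpair e0' e1 r0 hb hb b0 b0.
have fin : (\int[leb]_t (wgam e t)%:E < +oo)%E.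
  by apply: wgam_lt_pinfty; rewrite e0 ltW.
have pos : (0 < \int[leb]_t (wgam e t)%:E)%E by apply: wgam_gt0; exact: ltW.
move: fin pos Eab Eaa Ebb; case: (\int[leb]_t (wgam e t)%:E)%E => [G| |]//= _.
rewrite lte_fin => G0 Eab Eaa Ebb.
have gp0 c d : (forall x, 0 <= c x) -> (forall x, 0 <= d x) -> forall t, 0 <= wpos e t * gpair t c d.
  move=> c0 d0 t; rewrite mulr_ge0 ?wpos_ge0// /gpair I2_ge0// => x.
  by rewrite mulr_ge0// I2_ge0// => y; rewrite mulr_ge0// gauss2_ge0.
have mW c d : measurable_fun [set: R] (fun t => gpair t c d) ->
    measurable_fun [set: mR] (fun t => (wpos e t * gpair t c d)%:E).
  by move=> m; apply/measurable_EFinP; apply: measurable_funM => //; exact: measurable_wpos.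
apply: (scaled_lee G0 Eab Eaa Ebb).
rewrite -ge0_integralD//; first last.
- exact: mW.
- by move=> t _; rewrite lee_fin gp0.
- exact: mW.
- by move=> t _; rewrite lee_fin gp0.
rewrite -ge0_integralZl//; first last.
- by move=> t _; rewrite lee_fin gp0.
- exact: mW.
apply: ge0_le_integral => //.
- by move=> t _; rewrite -EFinM lee_fin mulr_ge0// gp0.
- by apply: measurable_funeM; exact: mW.
- by apply: emeasurable_funD; exact: mW.
move=> t _; rewrite -EFinM -EFinD lee_fin mulrCA -mulrDr ler_wpM2l ?wpos_ge0//.
by apply: gpair_pd; [exact: bsup_ig2 ha|exact: bsup_ig2 hb].
Qed.

End PositiveDefinite.

(** * The half-plane potential *)

Section HalfPlane.
Context (R : realType).
Implicit Types (x y z : R * R) (f g : R * R -> R).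

Lemma is_derive_powR_shift (A p t : R) : 0 < A + t ->
  is_derive t 1 (fun u : R => (A + u) `^ p) (p * (A + t) `^ (p - 1)).
Proof.
move=> At.
have d1 : is_derive t 1 (fun u : R => A + u) (1 : R).
  have := @is_deriveD R R R (cst A) id t 1 0 1 (is_derive_cst A t 1) (is_derive_id t 1).
  by rewrite add0r.
have := @is_derive1_comp R (fun u : R => u `^ p) (fun u : R => A + u) t _ _
  (@is_derive1_powR R p (A + t) At) d1.
by rewrite mulr1.
Qed.

Lemma powRN_mvt (q a b : R) : 0 < a -> a <= b ->
  exists2 c, a <= c <= b & a `^ (- q) - b `^ (- q) = q * c `^ (- q - 1) * (b - a).
Proof.
move=> a0 ab.
have d (u : R) : 0 < u -> is_derive u 1 (fun v : R => v `^ (- q)) (- q * u `^ (- q - 1)).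
  by move=> u0; exact: is_derive1_powR.
have [] := @MVT_segment R (fun u => u `^ (- q)) (fun u => - q * u `^ (- q - 1)) a b ab.
- by move=> u; rewrite in_itv/= => /andP[au _]; apply: d; exact: lt_trans au.
- apply: continuous_in_subspaceT => u /set_mem/=; rewrite in_itv/= => /andP[au _].
  apply: differentiable_continuous; apply/derivable1_diffP.
  by have [] := d u (lt_le_trans a0 au).
move=> c; rewrite in_itv/= => cab E; exists c => //.
by rewrite -opprB E; ring.
Qed.

Lemma powRN_diff_le (q a b : R) : 0 <= q -> 0 < a -> a <= b ->
  a `^ (- q) - b `^ (- q) <= q * a `^ (- (q + 1)) * (b - a).
Proof.
move=> q0 a0 ab; have [c /andP[ac cb] ->] := powRN_mvt q a0 ab.
rewrite ler_wpM2r ?subr_ge0// ler_wpM2l// (_ : - q - 1 = - (q + 1)); last by ring.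
by apply: powRN_le => //; rewrite addr_ge0.
Qed.

Lemma powRN_diff_ge (q a b : R) : 0 <= q -> 0 < a -> a <= b ->
  q * b `^ (- (q + 1)) * (b - a) <= a `^ (- q) - b `^ (- q).
Proof.
move=> q0 a0 ab; have [c /andP[ac cb] ->] := powRN_mvt q a0 ab.
rewrite ler_wpM2r ?subr_ge0// ler_wpM2l// (_ : - q - 1 = - (q + 1)); last by ring.
by apply: powRN_le; [rewrite addr_ge0|exact: lt_le_trans ac|].
Qed.

(** A mixed second difference of the convex function [t^(-q)]: the mean value theorem in [u], then
    the first-order lower bound in [v]. *)
Lemma powRN_diff2_ge (q A B u v : R) : 0 <= q -> 0 < A -> 0 <= u -> 0 <= v ->
  A + u + v <= B ->
  q * (q + 1) * B `^ (- (q + 2)) * (u * v) <=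
  (A `^ (- q) - (A + v) `^ (- q)) - ((A + u) `^ (- q) - (A + u + v) `^ (- q)).
Proof.
move=> q0 A0 u0 v0 AB.
pose F t : R := (A + t) `^ (- q) - ((A + v) + t) `^ (- q).
pose dF t : R := - q * (A + t) `^ (- q - 1) - (- q) * ((A + v) + t) `^ (- q - 1).
have d (t : R) : 0 <= t -> is_derive t 1 F (dF t).
  move=> t0; apply: is_deriveB; apply: is_derive_powR_shift; lra.
have [] := @MVT_segment R F dF 0 u u0.
- by move=> t; rewrite in_itv/= => /andP[/ltW t0 _]; exact: d.
- apply: continuous_in_subspaceT => t /set_mem/=; rewrite in_itv/= => /andP[t0 _].
  apply: differentiable_continuous; apply/derivable1_diffP.
  by have [] := d t t0.
move=> t; rewrite in_itv/= => /andP[t0 tu] E.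
have -> : (A `^ (- q) - (A + v) `^ (- q)) - ((A + u) `^ (- q) - (A + u + v) `^ (- q)) = - (F u - F 0).
  by rewrite /F !addr0 (addrAC A v); ring.
rewrite E subr0.
have At : 0 < A + t by lra.
have Atv : A + t <= A + v + t by lra.
have q10 : 0 <= q + 1 by lra.
have := powRN_diff_ge q10 At Atv.
rewrite (_ : A + v + t - (A + t) = v); last by ring.
rewrite (_ : q + 1 + 1 = q + 2); last by ring.
have B0 : 0 < A + v + t by lra.
have q20 : 0 <= q + 2 by lra.
have BB : B `^ (- (q + 2)) <= (A + v + t) `^ (- (q + 2)).
  by apply: powRN_le => //; lra.
rewrite /dF (_ : - q - 1 = - (q + 1)); last by ring.
move: ((A + v + t) `^ (- (q + 2))) ((A + t) `^ (- (q + 1))) ((A + v + t) `^ (- (q + 1))) BB => X Y Z BB H.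
have h1 : (q + 1) * B `^ (- (q + 2)) * v <= Y - Z.
  by apply: le_trans H; rewrite ler_wpM2r// ler_wpM2l.
have -> : - ((- q * Y - - q * Z) * u) = (q * u) * (Y - Z) by ring.
have -> : q * (q + 1) * B `^ (- (q + 2)) * (u * v) = (q * u) * ((q + 1) * B `^ (- (q + 2)) * v) by ring.
by rewrite ler_wpM2l// mulr_ge0.
Qed.

Definition bar x : R * R := (- x.1, x.2).

Lemma barK x : bar (bar x) = x.
Proof. by case: x => a b; rewrite /bar /= opprK. Qed.

Lemma I2_bar f : ig2 f -> ig2 (fun x => f (bar x)) /\ I2 (fun x => f (bar x)) = I2 f.
Proof.
move=> If; have N : (-1 : R) != 0 by rewrite oppr_eq0 oner_neq0.
have [] := @I2_aff R (-1) 0 1 0 f N (oner_neq0 _) If.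
rewrite mulr1 normrN1 mul1r.
have -> // : (fun x => f (aff2 (-1) 0 1 0 x)) = (fun x => f (bar x)).
by apply/funext => x; rewrite /aff2 !addr0 mulN1r mul1r.
Qed.

Lemma measurable_bar : measurable_fun [set: R * R] bar.
Proof. by apply: measurable_fun_pair => /=; first exact: measurableT_comp. Qed.

Lemma bsup_bar (M r : R) f : bsup M r f -> bsup M r (fun x => f (bar x)).
Proof.
move=> [mf fM fr]; split; first exact: (measurableT_comp mf measurable_bar).
  by move=> x; exact: fM.
by move=> x /fr; rewrite /bar /= normrN.
Qed.

Lemma kp_bar e x y : kp e (bar x - bar y) = kp e (x - y).
Proof. by rewrite /kp /nrm2 /bar /= -opprD sqrrN. Qed.

Context (e : R) (e0 : 0 <= e) (e1 : e < 1).

Lemma pot_bar (M r : R) f x : bsup M r f -> pot e (fun y => f (bar y)) x = pot e f (bar x).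
Proof.
move=> fM; rewrite /pot -(I2_bar (pot_ig2 (bar x) e0 e1 fM)).2.
by apply: eq_I2 => y; rewrite -(barK y) kp_bar barK.
Qed.

(* Potential of the odd extension of a density carried by the half-plane. *)
Definition hpot f x : R := pot e f x - pot e f (bar x).

Lemma measurable_hpot (M r : R) f : bsup M r f -> measurable_fun [set: R * R] (hpot f).
Proof.
move=> fM; have mp := pot_measurable e0 e1 fM.
have mb := measurableT_comp mp measurable_bar; exact: (measurable_funB mp mb).
Qed.

Lemma hpot_ae f g (N : set (R * R)) x : (@lam2 R).-negligible N ->
  measurable_fun [set: R * R] f -> measurable_fun [set: R * R] g ->
  (forall y, ~ N y -> f y = g y) -> hpot f x = hpot g x.
Proof. by move=> N0 mf mg fg; rewrite /hpot !(pot_ae _ _ N0 mf mg fg). Qed.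

Lemma hpotE (M r : R) f x : bsup M r f ->
  ig2 (fun y => (kp e (x - y) - kp e (bar x - y)) * f y) /\
  hpot f x = I2 (fun y => (kp e (x - y) - kp e (bar x - y)) * f y).
Proof.
move=> fM; have I1 := pot_ig2 x e0 e1 fM; have I1' := pot_ig2 (bar x) e0 e1 fM.
split; first by have := ig2B I1 I1'; apply: eq_ig2 => y; rewrite mulrBl.
by rewrite /hpot /pot -I2B//; apply: eq_I2 => y; rewrite mulrBl.
Qed.

Lemma hpot_le (M r : R) f x : bsup M r f -> (forall y, 0 <= f y) -> hpot f x <= pot e f x.
Proof. by move=> fM f0; rewrite /hpot gerBl pot_ge0. Qed.

Definition hen f g : R := I2 (fun x => f x * hpot g x).

Lemma en_bar (M r : R) f g : 0 < r -> bsup M r f -> bsup M r g ->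
  en e (fun x => f (bar x)) (fun x => g (bar x)) = en e f g.
Proof.
move=> r0 hf hg; rewrite /en.
have Ien : ig2 (fun x => f x * pot e g x) by exact: bsup_ig2 (en_bsup e0 e1 r0 hf hg).
rewrite -(I2_bar Ien).2; apply: eq_I2 => x; by rewrite (pot_bar _ hg).
Qed.

Lemma henE (M r : R) f g : 0 < r -> bsup M r f -> bsup M r g ->
  hen f g = en e f g - en e f (fun x => g (bar x)).
Proof.
move=> r0 hf hg; rewrite /hen /en -I2B.
- by apply: eq_I2 => x; rewrite (pot_bar _ hg) mulrBr.
- exact: bsup_ig2 (en_bsup e0 e1 r0 hf hg).
- exact: bsup_ig2 (en_bsup e0 e1 r0 hf (bsup_bar hg)).
Qed.

Lemma en_barC (M r : R) f g : 0 < r -> bsup M r f -> bsup M r g ->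
  en e f (fun x => g (bar x)) = en e g (fun x => f (bar x)).
Proof.
move=> r0 hf hg; rewrite (enC e0 e1 r0 hf (bsup_bar hg)).
rewrite -(en_bar r0 (bsup_bar hg) hf).
by congr (en e _ _); apply/funext => x; rewrite barK.
Qed.

Lemma enDl (M M' r : R) f g h : 0 < r -> bsup M r f -> bsup M' r g -> forall M'', bsup M'' r h ->
  en e (fun x => f x + g x) h = en e f h + en e g h.
Proof.
move=> r0 hf hg M'' hh; rewrite /en -I2D.
- by apply: eq_I2 => x; rewrite mulrDl.
- exact: bsup_ig2 (en_bsup e0 e1 r0 hf hh).
- exact: bsup_ig2 (en_bsup e0 e1 r0 hg hh).
Qed.

Lemma enDr (M M' r : R) f g h : 0 < r -> bsup M r f -> bsup M' r g -> forall M'', bsup M'' r h ->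
  en e h (fun x => f x + g x) = en e h f + en e h g.
Proof.
move=> r0 hf hg M'' hh.
rewrite (enC e0 e1 r0 hh (bsupD hf hg)) (enDl r0 hf hg hh).
by rewrite (enC e0 e1 r0 hf hh) (enC e0 e1 r0 hg hh).
Qed.

Lemma hen_arith (p q u v w s : R) : 2 * (p + u + (v + p)) <= (q + w + (w + s)) + (s + w + (w + q)) ->
  2 * (p - w) <= q - u + (s - v).
Proof. lra. Qed.

(** [f + g o bar] and [g + f o bar] are nonnegative and their difference is the odd extension of
    [f - g]; positivity in the whole plane applies to them and gives twice the claim. *)
Lemma hen_pd (M r : R) f g : 0 < e -> 0 < r -> bsup M r f -> bsup M r g ->
  (forall x, 0 <= f x) -> (forall x, 0 <= g x) ->
  2 * hen f g <= hen f f + hen g g.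
Proof.
move=> e00 r0 hf hg f0 g0.
pose fb x := f (bar x); pose gb x := g (bar x).
have hfb : bsup M r fb by exact: bsup_bar.
have hgb : bsup M r gb by exact: bsup_bar.
have := @en_pd R e _ _ (fun x => f x + gb x) (fun x => g x + fb x) e00 e1 r0
  (bsupD hf hgb) (bsupD hg hfb) (fun x => addr_ge0 (f0 x) (g0 _)) (fun x => addr_ge0 (g0 x) (f0 _)).
rewrite (enDl r0 hf hgb (bsupD hg hfb)) !(enDr r0 hg hfb hf) !(enDr r0 hg hfb hgb).
rewrite (enDl r0 hf hgb (bsupD hf hgb)) !(enDr r0 hf hgb hf) !(enDr r0 hf hgb hgb).
rewrite (enDl r0 hg hfb (bsupD hg hfb)) !(enDr r0 hg hfb hg) !(enDr r0 hg hfb hfb).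
rewrite (henE r0 hf hg) (henE r0 hf hf) (henE r0 hg hg) -/fb -/gb.
have -> : en e gb fb = en e f g by rewrite (en_bar r0 hg hf) (enC e0 e1 r0 hg hf).
have -> : en e gb gb = en e g g by exact: (en_bar r0 hg hg).
have -> : en e fb fb = en e f f by exact: (en_bar r0 hf hf).
have -> : en e gb g = en e g gb by exact: (enC e0 e1 r0 hgb hg).
have -> : en e gb f = en e f gb by exact: (enC e0 e1 r0 hgb hf).
have -> : en e fb g = en e f gb.
  by rewrite (enC e0 e1 r0 hfb hg) /fb /gb (en_barC r0 hg hf).
have -> : en e g fb = en e f gb by rewrite /fb /gb (en_barC r0 hg hf).
exact: hen_arith.
Qed.

Definition sdec f := forall (a b c : R), `|b| <= `|c| -> f (a, c) <= f (a, b).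

Lemma sdec_even f (a b : R) : sdec f -> f (a, - b) = f (a, b).
Proof. by move=> sf; apply/le_anti; rewrite !sf ?normrN. Qed.

Lemma I2_hrefl (m : R) f : ig2 f -> ig2 (fun y => f (y.1, 2 * m - y.2)) /\
  I2 (fun y => f (y.1, 2 * m - y.2)) = I2 f.
Proof.
move=> If; have N : (-1 : R) != 0 by rewrite oppr_eq0 oner_neq0.
have [] := @I2_aff R 1 0 (-1) (2 * m) f (oner_neq0 _) N If.
rewrite mul1r normrN1 mul1r.
have -> // : (fun x => f (aff2 1 0 (-1) (2 * m) x)) = (fun y => f (y.1, 2 * m - y.2)).
by apply/funext => y; rewrite /aff2 addr0 mul1r mulN1r addrC.
Qed.

Lemma hker_refl (x1 a b : R) y : kp e ((x1, a) - (y.1, (a + b) - y.2)) = kp e ((x1, b) - y).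
Proof. rewrite /kp; congr (_ `^ _); rewrite /nrm2 /=; ring. Qed.

Lemma sqr_abs_le (x y : R) : `|x| <= y -> x ^+ 2 <= y ^+ 2.
Proof.
move=> xy; rewrite -(@real_normK _ x) ?num_real// ler_pXn2r ?nnegrE//.
exact: le_trans xy.
Qed.

Lemma slope_arith (l X r x1 a b z1 z2 : R) : 0 <= l -> l <= x1 -> x1 <= X -> 0 <= a -> a <= b ->
  b <= X -> l <= z1 -> z1 <= r -> - (r + 2 * X) <= z2 -> z2 <= r + 2 * X -> 0 <= r -> 0 <= X ->
  ((x1 - z1) ^+ 2 + (a - z2) ^+ 2) + 2 * (b - a) * ((a + b) / 2 - z2) + 4 * x1 * z1 <=
  (X + r) ^+ 2 + (3 * X + r) ^+ 2 + 4 * X * r + (X + X) * (3 * X + r) * 2 + 1.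
Proof.
move=> l0 lx xX a0 ab bX lz zr z21 z22 r0 X0.
have h1 : (x1 - z1) ^+ 2 <= (X + r) ^+ 2.
  by apply: sqr_abs_le; rewrite ler_norml; apply/andP; split; lra.
have h2 : (a - z2) ^+ 2 <= (3 * X + r) ^+ 2.
  by apply: sqr_abs_le; rewrite ler_norml; apply/andP; split; lra.
have h3 : (b - a) * ((a + b) / 2 - z2) <= (X + X) * (3 * X + r).
  have [h|h] := leP ((a + b) / 2 - z2) 0.
    apply: (@le_trans _ _ 0); first by rewrite mulr_ge0_le0// subr_ge0.
    by rewrite mulr_ge0//; lra.
  by rewrite ler_pM// ?subr_ge0// ?(ltW h)//; lra.
have h4 : x1 * z1 <= X * r by rewrite ler_pM//; lra.
lra.
Qed.

Lemma abs_refl_le (a b t r X : R) : 0 <= a -> a <= b -> b <= X ->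
  `|a + b - t| <= r -> `|t| <= r + 2 * X.
Proof. by move=> a0 ab bX; rewrite !ler_norml => /andP[? ?]; apply/andP; split; lra. Qed.

Lemma abs_refl_le2 (a b t r X : R) : 0 <= a -> a <= b -> b <= X -> 0 <= r ->
  (a + b) / 2 <= t -> `|t| <= r + 2 * X -> `|a + b - t| <= r + 2 * X.
Proof. by move=> a0 ab bX r0 h; rewrite !ler_norml => /andP[? ?]; apply/andP; split; lra. Qed.

Lemma refl_norm_ge (m t : R) : 0 <= m -> t <= m -> `|t| <= `|2 * m - t|.
Proof.
by move=> m0 tm; rewrite (@ger0_norm _ (2 * m - t)) ?ler_norml; [apply/andP; split; lra|lra].
Qed.

Lemma refl_norm_le (m t : R) : 0 <= m -> m < t -> `|2 * m - t| <= `|t|.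
Proof.
by move=> m0 tm; rewrite (@ger0_norm _ t) ?ler_norml; [apply/andP; split; lra|lra].
Qed.

Lemma refl_le (m t : R) : m < t -> 2 * m - t <= m.
Proof. lra. Qed.

(* Quantitative strict monotonicity in [|x.2|]: reflect about the line
   [y.2 = (a + b) / 2], where both factors of the integrand have the same sign. *)
Lemma hpot_slope (r l X : R) : 0 < e -> 0 < l -> 0 < r -> 0 < X ->
  exists2 c, 0 < c & forall (M : R) f, bsup M r f -> (forall y, 0 <= f y) -> sdec f ->
    (forall y, f y != 0 -> l <= y.1) -> forall (x1 a b : R), l <= x1 <= X -> 0 <= a -> a <= b -> b <= X ->
    c * (b ^+ 2 - a ^+ 2) * I2 f <= hpot f (x1, a) - hpot f (x1, b).
Proof.
move=> e00 l0 r0 X0.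
(* An upper bound for the largest of the four squared distances compared below. *)
pose B := (X + r) ^+ 2 + (3 * X + r) ^+ 2 + 4 * X * r + (X + X) * (3 * X + r) * 2 + 1.
have B0 : 0 < B by rewrite /B; nra.
pose c0 := e * (e + 1) * B `^ (- (e + 2)) * (2 * (4 * l ^+ 2)).
have c00 : 0 < c0.
  rewrite /c0 !mulr_gt0 ?powR_gt0 ?exprn_gt0//; lra.
exists (c0 / 2); first by rewrite divr_gt0.
move=> M f fM f0 sf fl x1 a b /andP[lx xX] a0 ab bX.
have [mf fb fr] := fM; have If := bsup_ig2 fM.
pose m := (a + b) / 2.
have m2 : 2 * m = a + b by rewrite /m; field.
pose K (t : R) y := kp e ((x1, t) - y) - kp e (bar (x1, t) - y).
have [Ia Ea] := hpotE (x1, a) fM; have [Ib Eb] := hpotE (x1, b) fM.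
pose D y := K a y - K b y.
have ID : ig2 (fun y => D y * f y).
  by have := ig2B Ia Ib; apply: eq_ig2 => y; rewrite -mulrBl.
have ED : hpot f (x1, a) - hpot f (x1, b) = I2 (fun y => D y * f y).
  by rewrite Ea Eb -I2B//; apply: eq_I2 => y; rewrite -mulrBl.
pose s y : R * R := (y.1, 2 * m - y.2).
have ms : measurable_fun [set: R * R] s.
  by apply: measurable_fun_pair => //=; apply: measurable_funB => //; exact: measurable_cst.
have Ka y : K a (s y) = K b y.
  by rewrite /K /s m2 hker_refl /bar /= hker_refl.
have Kb y : K b (s y) = K a y.
  by rewrite /K /s m2 (addrC a b) hker_refl /bar /= hker_refl.
have Ds y : D (s y) = - D y by rewrite /D (Ka y) (Kb y) -opprB.
have [IDs EDs] := I2_hrefl m ID.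
(* [D] is odd under the reflection [s], so only the odd part of [f] contributes; the same holds for
   the linear weight [p], with which [D] will be compared. *)
pose g y := f y - f (s y).
have Dg : ig2 (fun y => D y * g y) /\ I2 (fun y => D y * g y) = 2 * I2 (fun y => D y * f y).
  have E y : D y * g y = D y * f y + D (s y) * f (s y) by rewrite Ds /g; ring.
  split; first by have := ig2D ID IDs; apply: eq_ig2 => y; rewrite E.
  by rewrite (eq_I2 E) I2D// EDs; ring.
pose p y : R := m - y.2.
have Ipf : ig2 (fun y => p y * f y).
  apply: (ig2_le _ _ (ig2Z (`|m| + r) (ig2_abs If))).
    apply: measurable_funM => //; apply: measurable_funB => //; exact: measurable_cst.
  move=> y; rewrite normrM; have [->|/fr[_ y2]] := eqVneq (f y) 0; first by rewrite normr0 !mulr0.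
  by rewrite ler_wpM2r// (le_trans (ler_normB _ _))// lerD2l.
have [Ips Eps] := I2_hrefl m Ipf.
have pg : ig2 (fun y => p y * g y) /\ I2 (fun y => p y * g y) = 2 * I2 (fun y => p y * f y).
  have E y : p y * g y = p y * f y + p (s y) * f (s y).
    by rewrite /p /g /s /=; ring.
  split; first by have := ig2D Ipf Ips; apply: eq_ig2 => y; rewrite E.
  by rewrite (eq_I2 E) I2D// Eps; ring.
(* By evenness the first moment of [f] in [y.2] vanishes, which makes the lower bound explicit. *)
have Ipfm : I2 (fun y => p y * f y) = m * I2 f.
  have I2f : ig2 (fun y => y.2 * f y).
    have := ig2B (ig2Z m If) Ipf; apply: eq_ig2 => y; rewrite /p; ring.
  have z0 : I2 (fun y => y.2 * f y) = 0.
    have [I' E'] := I2_hrefl 0 I2f.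
    apply: eqN_eq0; rewrite -{2}E' -(I2N I2f); apply: eq_I2 => y /=.
    by rewrite mulr0 sub0r (sdec_even _ _ sf) mulNr; case: y.
  transitivity (m * I2 f - I2 (fun y => y.2 * f y)); last by rewrite z0 subr0.
  by rewrite -(I2Z _ If) -I2B//; [apply: eq_I2 => y; rewrite mulrBl|exact: ig2Z].
have key y : y.1 != x1 -> c0 * (b - a) * (p y * g y) <= D y * g y.
  move=> yx.
  have low z : z.1 != x1 -> z.2 <= m -> l <= z.1 <= r -> `|z.2| <= r + 2 * X ->
      c0 * (b - a) * p z <= D z.
    move=> zx zm /andP[lz zr]; rewrite ler_norml => /andP[z21 z22].
    (* [A] is the squared distance between [(x1, a)] and [z]; [u] is its increase when [a] becomes
       [b], and [v] its increase when [x1] changes sign. So [D z] is a mixed second difference. *)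
    pose A := (x1 - z.1) ^+ 2 + (a - z.2) ^+ 2.
    have A0 : 0 < A.
      by rewrite ltr_wpDr ?sqr_ge0// lt_neqAle sqr_ge0 andbT eq_sym sqrf_eq0 subr_eq0 eq_sym.
    pose u := 2 * (b - a) * p z; pose v := 4 * x1 * z.1.
    have pz : 0 <= p z by rewrite /p subr_ge0.
    have u0 : 0 <= u by rewrite /u mulr_ge0// mulr_ge0// subr_ge0.
    have v0 : 4 * l ^+ 2 <= v.
      by rewrite /v -mulrA ler_pM2l// expr2 ler_pM// ltW.
    have v00 : 0 <= v by apply: le_trans v0; rewrite mulr_ge0 ?sqr_ge0.
    have AB : A + u + v <= B.
      exact: (slope_arith (ltW l0) lx xX a0 ab bX lz zr z21 z22 (ltW r0) (ltW X0)).
    have := powRN_diff2_ge e0 A0 u0 v00 AB.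
    have -> : D z = (A `^ (- e) - (A + v) `^ (- e)) - ((A + u) `^ (- e) - (A + u + v) `^ (- e)).
      rewrite /D /K /kp /nrm2 /bar /=.
      by congr ((_ `^ _ - _ `^ _) - (_ `^ _ - _ `^ _)); rewrite /A /u /v /p /m; field.
    apply: le_trans; rewrite /c0 /u -!mulrA ler_pM2l// ler_pM2l ?ltr_wpDl// ler_pM2l ?powR_gt0//.
    rewrite [leLHS](_ : _ = (2 * ((b - a) * p z)) * (4 * (l ^+ 2))); last by ring.
    have -> : 2 * ((b - a) * (p z * v)) = (2 * ((b - a) * p z)) * v by ring.
    by rewrite ler_wpM2l// mulr_ge0// mulr_ge0// subr_ge0.
  have gsupp : g y != 0 -> (l <= y.1 <= r) /\ `|y.2| <= r + 2 * X.
    rewrite /g => gy; have [fy|fy] := eqVneq (f y) 0.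
      have fsy : f (s y) != 0 by move: gy; rewrite fy sub0r oppr_eq0.
      have [h1 h2] := fr _ fsy; have h3 := fl _ fsy; move: h1 h2 h3; rewrite /s /= => h1 h2 h3.
      rewrite h3 (le_trans (ler_norm _) h1); split => //.
      by move: h2; rewrite m2; exact: abs_refl_le a0 ab bX.
    have [h1 h2] := fr _ fy; rewrite (fl _ fy) (le_trans (ler_norm _) h1); split => //.
    by rewrite (le_trans h2)// lerDl mulr_ge0// ltW.
  have [->|/gsupp[y1 y2]] := eqVneq (g y) 0; first by rewrite !mulr0.
  have m0 : 0 <= m by rewrite /m divr_ge0// addr_ge0// (le_trans a0 ab).
  have [ym|ym] := leP y.2 m.
    have gy : 0 <= g y.
      rewrite /g /s subr_ge0; case: (y) ym => y' y'' /= ym; apply: sf.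
      exact: refl_norm_ge.
    by rewrite mulrA ler_wpM2r// low.
  have gy : g y <= 0.
    rewrite /g /s subr_le0; case: (y) ym => y' y'' /= ym; apply: sf.
    exact: refl_norm_le.
  rewrite mulrA ler_wnM2r//.
  (* Above the reflection line both factors change sign, and the bound is used at the mirror
     point. *)
  have := low (s y); rewrite /s /=.
  rewrite -/(s y) Ds => /(_ yx) H.
  have := H _ _ _; rewrite {1}/p /=.
  have -> : m - (2 * m - y.2) = - p y by rewrite /p; ring.
  rewrite mulrN lerN2; apply => //; first exact: refl_le.
  by rewrite m2; apply: (abs_refl_le2 a0 ab bX (ltW r0) _ y2); rewrite -/m ltW.
have [IDg EDg] := Dg; have [Ipg Epg] := pg.
have mono : c0 * (b - a) * I2 (fun y => p y * g y) <= I2 (fun y => D y * g y).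
  rewrite -(I2Z _ Ipg) -subr_ge0 -I2B//; last exact: ig2Z.
  rewrite (@I2_eq_ae R _ (fun y => `|D y * g y - c0 * (b - a) * (p y * g y)|) _ (null_vline x1)).
  - by apply: I2_ge0 => y.
  - exact: ig2_meas (ig2B IDg (ig2Z _ Ipg)).
  - exact: ig2_meas (ig2_abs (ig2B IDg (ig2Z _ Ipg))).
  - by move=> y /= /eqP yx; rewrite ger0_norm// subr_ge0 key.
move: mono; rewrite Epg EDg Ipfm ED => mono.
have -> : c0 / 2 * (b ^+ 2 - a ^+ 2) * I2 f = (c0 * (b - a) * (2 * (m * I2 f))) / 2.
  by rewrite /m; field.
by rewrite ler_pdivrMr// [leRHS]mulrC.
Qed.

End HalfPlane.

(** * Young duality for the vorticity function *)

Section Young.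
Context (R : realType) (f : R -> R) (T : R).
Context (fm : forall t u : R, t <= u -> f t <= f u) (fz : forall t : R, t <= 0 -> f t = 0).
Context (T0 : 0 <= T).
Local Notation leb := (@lebesgue_measure R).

Lemma nondecr_ge0 t : 0 <= f t.
Proof. by have [t0|/ltW t0] := leP t 0; [rewrite fz|rewrite -(fz (lexx 0)) fm]. Qed.

Lemma nondecr_meas : measurable_fun [set: R] f.
Proof. by apply: nondecreasing_measurable => // t u; exact: fm. Qed.

Definition prim (t : R) : R := \int[leb]_(u in `[0, t]) f u.

Lemma nondecr_ig (a b : R) : leb.-integrable `[a, b] (EFin \o f).
Proof.
apply: measurable_bounded_integrable => //.
- by rewrite (_ : (_ < _)%E = (leb `[a, b]%classic < +oo)%E)// lebesgue_measure_itv /=; case: ifP => // _; rewrite -EFinB ltry.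
- exact: measurable_funS nondecr_meas.
- exists (f b); split; first exact: num_real.
  move=> M Mb t; rewrite /= in_itv/= => /andP[_ tb].
  by rewrite ger0_norm ?nondecr_ge0// (le_trans (fm tb))// ltW.
Qed.

Lemma prim_itv (a b : R) : 0 <= a -> a <= b ->
  f a * (b - a) <= prim b - prim a <= f b * (b - a).
Proof.
move=> a0 ab.
have iab : leb.-integrable `]a, b] (EFin \o f).
  by apply: integrableS (nondecr_ig a b) => //; exact: subset_itv_oc_cc.
have ic (k : R) : leb.-integrable `]a, b] (EFin \o cst k).
  apply: measurable_bounded_integrable => //.
    by rewrite (_ : (_ < _)%E = (leb `]a, b]%classic < +oo)%E)// lebesgue_measure_itv /=; case: ifP => // _; rewrite -EFinB ltry.
  exists `|k|; split; first exact: num_real.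
  by move=> M Mk t _ /=; exact: ltW.
have E : prim b - prim a = \int[leb]_(u in `]a, b]) f u.
  by apply: Rintegral_itvB; rewrite ?bnd_simp//; exact: nondecr_ig.
have Ec (k : R) : \int[leb]_(u in `]a, b]) cst k u = k * (b - a).
  rewrite Rintegral_cst//= lebesgue_measure_itv/= lte_fin.
  have [ba|ba] := ltP a b; first by rewrite -EFinB.
  by rewrite (le_anti (introT andP (conj ab ba))) subrr mulr0.
rewrite E -!Ec; apply/andP; split; apply: le_Rintegral => //.
- by move=> t; rewrite /= in_itv/= => /andP[/ltW/fm].
- by move=> t; rewrite /= in_itv/= => /andP[_ /fm].
Qed.

Lemma prim_neg t : t <= 0 -> prim t = 0.
Proof.
rewrite le_eqVlt => /predU1P[->|t0]; first by rewrite /prim set_itv1 Rintegral_set1.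
by rewrite /prim set_itv_ge ?bnd_simp -?ltNge// Rintegral_set0.
Qed.

(** [f a] is a subgradient at [a] of the convex function [prim], on the whole line because both
    vanish for negative arguments. *)
Lemma prim_ge (a b : R) : f a * (b - a) <= prim b - prim a.
Proof.
have [a0|a0] := leP 0 a.
  have [ab|/ltW ba] := leP a b; first by have /andP[] := prim_itv a0 ab.
  have [b0|/ltW b0] := leP 0 b.
    have /andP[_] := prim_itv b0 ba.
    by rewrite -(opprB a b) mulrN -(opprB (prim a)) lerN2.
  rewrite (prim_neg b0) sub0r -(opprB a b) mulrN lerN2.
  have /andP[_] := prim_itv (lexx 0) a0; rewrite (prim_neg (lexx 0)) !subr0 => h.
  by rewrite (le_trans h)// ler_wpM2l ?nondecr_ge0// lerDl oppr_ge0.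
rewrite (fz (ltW a0)) mul0r (prim_neg (ltW a0)) subr0.
have [b0|/ltW/prim_neg->//] := leP 0 b.
have /andP[+ _] := prim_itv (lexx 0) b0.
by rewrite (fz (lexx 0)) mul0r (prim_neg (lexx 0)) subr0.
Qed.

Lemma prim_ge0 t : 0 <= prim t.
Proof. by have := prim_ge 0 t; rewrite (fz (lexx 0)) mul0r (prim_neg (lexx 0)) subr0. Qed.

(* Legendre transform of [prim], with slopes truncated at [T]. *)
Definition conj_f (h : R) : R := sup [set t * h - prim t | t in `[0, T]%classic].

Lemma conj_has (h : R) : has_ubound [set t * h - prim t | t in `[0, T]%classic].
Proof.
exists (T * `|h|) => y [t ht <-]; move: ht; rewrite /= in_itv/= => /andP[t0 tT].
rewrite lerBlDr (le_trans (ler_norm _))// normrM (ger0_norm t0) (le_trans (ler_wpM2r _ tT))//.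
by rewrite lerDl prim_ge0.
Qed.

Lemma conj_ub (h t : R) : 0 <= t -> t <= T -> t * h - prim t <= conj_f h.
Proof.
by move=> t0 tT; apply: (ub_le_sup (conj_has h)); exists t; rewrite //= in_itv/= t0.
Qed.

Lemma conj_le (h c : R) : (forall t, 0 <= t -> t <= T -> t * h - prim t <= c) -> conj_f h <= c.
Proof.
move=> H; apply: ge_sup.
  by exists (0 * h - prim 0); exists 0; rewrite //= in_itv/= lexx.
by move=> y [t ht <-]; move: ht; rewrite /= in_itv/= => /andP[t0 tT]; exact: H.
Qed.

Lemma conj_ge0 (h : R) : 0 <= conj_f h.
Proof. by have := conj_ub h (lexx 0) T0; rewrite mul0r (prim_neg (lexx 0)) subr0. Qed.

Lemma conj0 : conj_f 0 = 0.
Proof.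
apply/le_anti; rewrite conj_ge0 andbT; apply: conj_le => t _ _.
by rewrite mulr0 sub0r oppr_le0 prim_ge0.
Qed.

(** Slopes beyond [t] bring no more, because there [prim] grows at least at the rate [h]. *)
Lemma conj_le_lin (h t : R) : 0 <= t -> h <= f t -> 0 <= h -> conj_f h <= t * h.
Proof.
move=> t0 hf h0; apply: conj_le => u u0 uT.
have [ut|/ltW tu] := leP u t.
  by rewrite lerBlDr (le_trans (ler_wpM2r h0 ut))// lerDl prim_ge0.
have h1 := prim_ge t u; have h2 := prim_ge0 t.
have h3 : h * (u - t) <= f t * (u - t) by rewrite ler_wpM2r// subr_ge0.
lra.
Qed.

Lemma conj_mono (h k : R) : h <= k -> conj_f h <= conj_f k.
Proof.
move=> hk; apply: conj_le => t t0 tT; apply: le_trans (conj_ub k t0 tT).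
by rewrite lerD2r ler_wpM2l.
Qed.

Lemma conj_leT (h : R) : 0 <= h -> conj_f h <= T * h.
Proof.
move=> h0; apply: conj_le => t t0 tT.
by rewrite lerBlDr (le_trans (ler_wpM2r h0 tT))// lerDl prim_ge0.
Qed.

Lemma conj_meas : measurable_fun [set: R] conj_f.
Proof. by apply: nondecreasing_measurable => // h k; exact: conj_mono. Qed.

(** By duality [h t - conj_f h] is maximal at [h = f t]; the truncation of the slopes is harmless
    for [t <= T]. *)
Lemma young (h t : R) : 0 <= h -> t <= T ->
  h * t - conj_f h <= f t * t - conj_f (f t).
Proof.
move=> h0 tT; have [t0|/ltW t0] := leP t 0.
  rewrite (fz t0) mul0r conj0 subr0 lerBlDr add0r (le_trans _ (conj_ge0 h))//.
  by rewrite mulr_ge0_le0.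
have h1 : conj_f (f t) <= t * f t - prim t.
  by apply: conj_le => u u0 uT; have := prim_ge t u; lra.
by have := conj_ub h t0 tT; lra.
Qed.

(* Equality in Young's inequality forces [h] into the subdifferential of [prim]. *)
Lemma young_eq (h t d : R) : 0 <= h -> 0 <= d -> 0 < d -> t + d <= T ->
  f t * t - conj_f (f t) <= h * t - conj_f h -> f (t - d) <= h <= f (t + d).
Proof.
move=> h0 d0 dp tdT H.
have tT : t <= T by apply: le_trans tdT; rewrite lerDl.
have [t0|t0] := leP 0 t; last first.
  have : 0 <= h * t.
    by move: H; rewrite (fz (ltW t0)) mul0r conj0 subr0 subr_ge0 => /(le_trans (conj_ge0 h)).
  move=> ht; have h00 : h = 0.
    apply/le_anti; rewrite h0 andbT leNgt; apply/negP => hp.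
    by move: ht; rewrite leNgt pmulr_rlt0// t0.
  rewrite h00 nondecr_ge0 andbT fz// subr_le0 (le_trans (ltW t0))//.
have h1 : conj_f (f t) <= t * f t - prim t.
  by apply: conj_le => u u0 uT; have := prim_ge t u; lra.
have h2 u : 0 <= u -> u <= T -> h * (u - t) <= f u * (u - t).
  by move=> u0 uT; have := conj_ub h u0 uT; have := prim_ge u t; lra.
apply/andP; split; last first.
  by have := h2 (t + d) (addr_ge0 t0 d0) tdT; rewrite addrAC subrr add0r ler_pM2r.
have [td|/ltW td] := leP 0 (t - d); last by rewrite (fz td).
have tdT' : t - d <= T by apply: le_trans tT; rewrite gerBl.
have := h2 (t - d) td tdT'; rewrite addrAC subrr sub0r !mulrN lerN2.
by rewrite ler_pM2r.
Qed.

End Young.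

(** * Vertical shifts of symmetric decreasing functions *)

Section Shift.
Context (R : realType).
Implicit Types (x y z : R * R) (f g : R * R -> R).

Definition rect (a b c d : R) x : R :=
  if ((a <= x.1) && (x.1 <= b)) && ((c <= x.2) && (x.2 <= d)) then 1 else 0.

Lemma rect_indic (a b c d : R) : rect a b c d = \1_(`[a, b]%classic `*` `[c, d]%classic).
Proof.
apply/funext => x; rewrite /rect indicE.
case: ifP => h; first by rewrite mem_set//=; move: h; rewrite !in_itv/= => /andP[].
rewrite memNset// => -[/=]; rewrite !in_itv/= => h1 h2.
by rewrite h1 h2 in h.
Qed.

Lemma rect_ge0 (a b c d : R) x : 0 <= rect a b c d x.
Proof. by rewrite /rect; case: ifP. Qed.

Lemma measurable_rect (a b c d : R) : measurable_fun [set: R * R] (rect a b c d).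
Proof. by rewrite rect_indic; apply: measurable_indic; apply: measurableX. Qed.

Lemma lam2_rect (a b c d : R) : a <= b -> c <= d ->
  @lam2 R (`[a, b]%classic `*` `[c, d]%classic) = ((b - a) * (d - c))%:E.
Proof.
move=> ab cd; apply: (eq_trans (lam2_prod _ _)) => //.
have h (u v : R) : u <= v -> @lebesgue_measure R `[u, v]%classic = (v - u)%:E.
  rewrite lebesgue_measure_itv/= lte_fin => uv; have [_|vu] := ltP u v; first by rewrite -EFinB.
  by rewrite (le_anti (introT andP (conj uv vu))) subrr.
by rewrite !h.
Qed.

Lemma ig2_rect (a b c d : R) : a <= b -> c <= d -> ig2 (rect a b c d).
Proof.
move=> ab cd; apply: ig2P; first exact: measurable_rect.
rewrite (_ : (fun x => _) = (fun x => (rect a b c d x)%:E)); last first.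
  by apply/funext => x; rewrite ger0_norm ?rect_ge0.
rewrite rect_indic integral_indic//; last exact: measurableX.
by rewrite setIT -/(lam2 _) [X in (X < _)%E](lam2_rect ab cd) ltry.
Qed.

Lemma I2_rect (a b c d : R) : a <= b -> c <= d -> I2 (rect a b c d) = (b - a) * (d - c).
Proof.
move=> ab cd; rewrite /I2 /Rintegral rect_indic integral_indic//; last exact: measurableX.
by rewrite setIT [X in fine X](lam2_rect ab cd).
Qed.

Definition pos2 x : R := if 0 < x.2 then 1 else 0.

Lemma measurable_pos2 : measurable_fun [set: R * R] pos2.
Proof.
apply: measurable_fun_ifT; [|exact: measurable_cst|exact: measurable_cst].
by apply: measurable_fun_ltr => //; exact: measurable_cst.
Qed.

Lemma ig2_mul_bd (k : R) f g : ig2 f -> measurable_fun [set: R * R] g ->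
  (forall x, `|g x| <= k) -> ig2 (fun x => f x * g x).
Proof.
move=> If mg gk; apply: (ig2_le _ _ (ig2Z k (ig2_abs If))).
  exact: measurable_funM (ig2_meas If) mg.
by move=> x; rewrite normrM mulrC ler_wpM2r.
Qed.

Lemma pos2_le1 x : `|pos2 x| <= 1.
Proof. by rewrite /pos2; case: ifP => _; rewrite ?normr1 ?normr0. Qed.

Lemma I2_even f : ig2 f -> (forall x, f (x.1, - x.2) = f x) ->
  I2 f = 2 * I2 (fun x => f x * pos2 x).
Proof.
move=> If fe.
have Ip := ig2_mul_bd If measurable_pos2 pos2_le1.
have [Iq Eq] := I2_hrefl 0 Ip.
rewrite mulr_natl mulr2n -{2}Eq -I2D//.
apply: (I2_eq_ae (null_hline 0)); [exact: ig2_meas|exact: ig2_meas (ig2D Ip Iq)|].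
move=> x /= /eqP x0; rewrite mulr0 sub0r fe /pos2 /= oppr_gt0.
by case: ltgtP x0 => // _ _; rewrite mulr0 mulr1 ?addr0 ?add0r.
Qed.

(* Pushing a symmetric decreasing function away from the axis by [t] costs the
   mass of a strip of width [t]. *)
Lemma sdec_shift (M r t : R) f : bsup M r f -> (forall x, 0 <= f x) -> sdec f ->
  0 <= r -> 0 <= t ->
  ig2 (fun x => f (x.1, `|x.2| + t)) /\
  I2 (fun x => f x - f (x.1, `|x.2| + t)) <= 4 * r * t * M.
Proof.
move=> fM f0 sf r0 t0; have If := bsup_ig2 fM; have [mf fb fr] := fM.
have M0 := bsup_ge0 fM.
have Ig : ig2 (fun x => f (x.1, `|x.2| + t)).
  apply: (ig2_le _ _ If).
    apply: (measurableT_comp mf); apply: measurable_fun_pair => //=.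
    have m2 : measurable_fun [set: R * R] (fun x => `|x.2|) by exact: measurableT_comp.
    have mc : measurable_fun [set: R * R] (fun x => t) by exact: measurable_cst.
    exact: measurable_funD m2 mc.
  move=> x; rewrite ger0_norm//; case: x => a b /=; apply: sf.
  by rewrite (@ger0_norm _ (_ + t)) ?addr_ge0// lerDl.
split => //.
pose h x := f x - f (x.1, `|x.2| + t).
have Ih : ig2 h by exact: ig2B.
have he x : h (x.1, - x.2) = h x.
  by rewrite /h /= normrN (sdec_even _ _ sf); case: x.
rewrite -/h (I2_even Ih he).
have [It Et] := I2_translate (0, t) (ig2_mul_bd If measurable_pos2 pos2_le1).
have Is : ig2 (fun x => M * rect (- r) r 0 t x).
  by apply: ig2Z; apply: ig2_rect; rewrite // ge0_cp.
have Ip := ig2_mul_bd If measurable_pos2 pos2_le1.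
have Ihp := ig2_mul_bd Ih measurable_pos2 pos2_le1.
(* In the upper half-plane the shifted function has lost exactly the part of [f] with
   [0 < x.2 <= t], which lives in a rectangle of area [2 r t]. Evenness doubles it. *)
have [Iu Eu] : ig2 (fun x => f (x.1, x.2 + t) * pos2 x) /\
    I2 (fun x => f x * pos2 x) - M * (r - - r) * (t - 0) <= I2 (fun x => f (x.1, x.2 + t) * pos2 x).
  have [Iv Ev] := I2_translate (0, t) If.
  have E1 : (fun x => f (x + (0, t))) = (fun x => f (x.1, x.2 + t)).
    by apply/funext => x; congr f; apply: pairP => /=; rewrite ?addr0.
  rewrite E1 in Iv.
  have Iu := ig2_mul_bd Iv measurable_pos2 pos2_le1; split => //.
  pose w x := f x * (if t < x.2 then 1 else 0).
  have mt : measurable_fun [set: R * R] (fun x => if t < x.2 then 1 else 0 : R).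
    apply: measurable_fun_ifT; [|exact: measurable_cst|exact: measurable_cst].
    by apply: measurable_fun_ltr => //; exact: measurable_cst.
  have t1 x : `|if t < x.2 then 1 else 0 : R| <= 1.
    by case: ifP => _; rewrite ?normr1 ?normr0.
  have Iw : ig2 w := ig2_mul_bd If mt t1.
  have [_ Ew] := I2_translate (0, t) Iw.
  have -> : I2 (fun x => f (x.1, x.2 + t) * pos2 x) = I2 w.
    rewrite -Ew; apply: eq_I2 => x; rewrite /w /pos2 /= ltrDr.
    by congr (f _ * _); apply: pairP => /=; rewrite ?addr0.
  rewrite lerBlDr -mulrA -I2_rect ?ge0_cp// -(I2Z M); last by apply: ig2_rect; rewrite ?ge0_cp.
  rewrite -I2D//; apply: le_I2 => //; first exact: ig2D.
  move=> x; rewrite /w /pos2 /rect.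
  have [fx0|/fr[x1 x2]] := eqVneq (f x) 0.
    by rewrite fx0 !mul0r add0r mulr_ge0//; case: ifP.
  have [xt|xt] := ltP t x.2; first by rewrite (le_lt_trans t0 xt) mulr1 lerDl mulr_ge0//; case: ifP.
  rewrite mulr0 add0r; case: ltP => x20; last by rewrite mulr0 mulr_ge0//; case: ifP.
  move: x1; rewrite ler_norml => ->; rewrite (ltW x20)/= !mulr1.
  by rewrite (le_trans (ler_norm _)).
have -> : I2 (fun x => h x * pos2 x) = I2 (fun x => f x * pos2 x) - I2 (fun x => f (x.1, x.2 + t) * pos2 x).
  rewrite -I2B//; apply: eq_I2 => x; rewrite /h /pos2 mulrBl; case: ltP => x2.
    by rewrite gtr0_norm.
  by rewrite !mulr0.
rewrite subr0 in Eu; lra.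
Qed.

End Shift.

(** * Compactness of equicontinuous sequences *)

Section Compactness.
Context (R : realType).
Implicit Types (x y z : R * R).

(** Limits along one ultrafilter exist for all bounded sequences at once, which replaces diagonal
    extraction: the values at all points and the coordinates of chosen points converge together. *)
Lemma ultra_lim (U : set_system nat) (a : nat -> R) (A : R) : UltraFilter U ->
  (forall n, `|a n| <= A) ->
  exists2 l, `|l| <= A & forall eps : R, 0 < eps -> U [set n | `|a n - l| < eps].
Proof.
move=> UU aA; have FP : ProperFilter (a @ U) by exact: fmap_proper_filter.
have UA : (a @ U) `[- A, A]%classic.
  suff : U (a @^-1` `[- A, A]%classic) by [].
  by apply: filterE => n /=; rewrite in_itv/= -ler_norml aA.
have [l [lA lc]] := @segment_compact R (- A) A (a @ U) FP UA.
exists l; first by move: lA; rewrite /= in_itv/= -ler_norml.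
move=> eps e0; have [//|UC] := in_ultra_setVsetC [set n | `|a n - l| < eps] UU.
have := lc [set u | ~ (`|u - l| < eps)] (ball l eps) UC (nbhsx_ballx l eps e0).
move=> [u /= [nu]]; rewrite /ball/= distrC => ul.
by exfalso; apply: nu.
Qed.

Definition inbox (X : R) x : Prop := `|x.1| <= X /\ `|x.2| <= X.

Lemma hoelder_small (C b eps : R) : 0 <= C -> 0 < b -> 0 < eps ->
  exists2 d, 0 < d & forall t, 0 <= t -> t <= d -> C * t `^ b <= eps.
Proof.
move=> C0 b0 e0; have C1 : 0 < C + 1 by rewrite ltr_wpDl.
exists ((eps / (C + 1)) `^ b^-1); first by apply: powR_gt0; rewrite divr_gt0.
move=> t t0 td.
have : t `^ b <= eps / (C + 1).
  have := @ge0_ler_powR _ b (ltW b0) t _ _ _ td.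
  rewrite -powRrM mulVf ?gt_eqF// powRr1 ?divr_ge0// ?(ltW e0) ?(ltW C1)//.
  by apply; rewrite nnegrE ?powR_ge0.
rewrite ler_pdivlMr// => h; apply: le_trans h; rewrite mulrC ler_wpM2l ?powR_ge0//.
by rewrite lerDl.
Qed.

Lemma abs3 (a b c d eps : R) : `|a - b| <= eps -> `|b - c| <= eps -> `|c - d| <= eps ->
  `|a - d| <= 3 * eps.
Proof. by rewrite !ler_norml => /andP[? ?] /andP[? ?] /andP[? ?]; apply/andP; split; lra. Qed.

(* Arzela-Ascoli along an ultrafilter. *)
Lemma hoelder_subseq_limit (X C b M : R) (p : nat -> R * R -> R) : 0 <= C -> 0 < b ->
  (forall n x, inbox X x -> `|p n x| <= M) ->
  (forall n x x', inbox X x -> inbox X x' -> `|p n x - p n x'| <= C * enorm (x - x') `^ b) ->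
  exists P : R * R -> R, forall eps : R, 0 < eps -> forall N : nat, exists n : nat,
    (N <= n)%N /\ forall x, inbox X x -> `|p n x - P x| <= eps.
Proof.
move=> C0 b0 pM pC.
have [U [UU subU]] := ultraFilterLemma (@eventually_filter : ProperFilter \oo).
have ptl x : exists l : R, inbox X x -> forall eps : R, 0 < eps -> U [set n | `|p n x - l| < eps].
  have [xX|nxX] := pselect (inbox X x); last by exists 0.
  by have [l _ lU] := ultra_lim UU (fun n => pM n x xX); exists l.
have [P PU] := choice ptl; exists P => eps eps0 N.
have PC x x' : inbox X x -> inbox X x' -> `|P x - P x'| <= C * enorm (x - x') `^ b.
  move=> xX x'X; apply/ler_addgt0Pr => t t0.
  have t2 : 0 < t / 2 by rewrite divr_gt0.
  have [n [/= h1 h2]] := filter_ex (filterI (PU x xX _ t2) (PU x' x'X _ t2)).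
  have := pC n x x' xX x'X.
  move: h1 h2; move: (C * _) (p n x) (p n x') (P x) (P x') => u a a' A A'.
  rewrite !ltr_norml !ler_norml => /andP[? ?] /andP[? ?] /andP[? ?]; apply/andP; split; lra.
pose good := [set n | forall x, inbox X x -> `|p n x - P x| <= eps].
suff Ug : U good.
  have UN : U [set n | (N <= n)%N] by apply: subU; exact: nbhs_infty_ge.
  by have [n [/= h1 h2]] := filter_ex (filterI UN Ug); exists n.
have [//|Ub] := in_ultra_setVsetC good UU.
(* Otherwise the bad indices belong to [U]. A point of failure is chosen for each, and these points
   converge along [U] to some [xl] of the box, where equicontinuity gives a contradiction. *)
have bad n : exists x, ~ good n -> inbox X x /\ eps < `|p n x - P x|.
  have [gn|gn] := pselect (good n); first by exists (0, 0).
  have [x nx] := (existsNP _).2 gn.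
  have [xX np] := (not_implyP _ _).1 nx.
  by exists x => _; split => //; rewrite ltNge; apply/negP.
have [xs hxs] := choice bad.
pose u1 n : R := if pselect (good n) then 0 else (xs n).1.
pose u2 n : R := if pselect (good n) then 0 else (xs n).2.
have [[m Xm]|X0] := pselect (exists m, ~ good m); last first.
  by have [n /= nn] := filter_ex Ub; exfalso; apply: X0; exists n.
have X0 : 0 <= X by have [[h _] _] := hxs m Xm; exact: le_trans h.
have u1X n : `|u1 n| <= X.
  by rewrite /u1; case: pselect => h; [rewrite normr0|have [[]] := hxs n h].
have u2X n : `|u2 n| <= X.
  by rewrite /u2; case: pselect => h; [rewrite normr0|have [[]] := hxs n h].
have [l1 l1X l1U] := ultra_lim UU u1X; have [l2 l2X l2U] := ultra_lim UU u2X.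
(* Three errors of a quarter of [eps] leave a strict inequality. *)
have eps4 : 0 < eps / 4 by rewrite divr_gt0.
have [d d0 dC] := hoelder_small C0 b0 eps4.
have d2 : 0 < d / 2 by rewrite divr_gt0.
pose xl : R * R := (l1, l2); have xlX : inbox X xl by split.
have [n [[/= gn h1] [/= h2 h3]]] :=
  filter_ex (filterI (filterI Ub (l1U _ d2)) (filterI (l2U _ d2) (PU xl xlX _ eps4))).
have [xnX xnP] := hxs n gn.
have E1 : u1 n = (xs n).1 by rewrite /u1; case: pselect.
have E2 : u2 n = (xs n).2 by rewrite /u2; case: pselect.
have close : enorm (xs n - xl) <= d.
  apply: (le_trans (enorm_le_sum _)) => /=; rewrite -E1 -E2.
  by rewrite [leRHS](splitr d) lerD// ltW.
have close' : enorm (xl - xs n) <= d by rewrite enorm_distC.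
have k1 := le_trans (pC n _ _ xnX xlX) (dC _ (enorm_ge0 _) close).
have k2 := le_trans (PC _ _ xlX xnX) (dC _ (enorm_ge0 _) close').
have := abs3 k1 (ltW h3) k2.
rewrite leNgt (le_lt_trans _ xnP)//.
have -> : 3 * (eps / 4) = eps - eps / 4 by field.
by rewrite gerBl ltW.
Qed.

Lemma I2_eq0_ae (f : R * R -> R) : ig2 f -> (forall x, 0 <= f x) -> I2 f <= 0 ->
  exists2 N : set (R * R), (@lam2 R).-negligible N & forall x, ~ N x -> f x = 0.
Proof.
move=> If f0 I0; have mf := ig2_meas If.
have E0 : (\int[@lam2 R]_x `|(f x)%:E| = 0)%E.
  rewrite (_ : (fun x => `|(f x)%:E|%E) = EFin \o f); last first.
    by apply/funext => x; rewrite gee0_abs// lee_fin.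
  by rewrite -I2E// (le_anti (introT andP (conj I0 (I2_ge0 f0)))).
have mE : measurable_fun [set: R * R] (EFin \o f) by exact/measurable_EFinP.
have [h _] := ae_eq_integral_abs (@lam2 R) measurableT mE.
have [N [mN N0 sN]] := h E0.
exists N; first by exists N; split.
move=> x nN; apply/eqP/negPn/negP => /eqP fx; apply: nN; apply: sN => /= H.
by have [/fx] := H I.
Qed.

End Compactness.

Section HPot.
Context (R : realType) (e : R) (e0 : 0 <= e) (e1 : e < 1).
Implicit Types (x y z : R * R) (f g : R * R -> R).

Lemma hpot_bound (M r X : R) f x : bsup M r f -> 0 < r + X -> inbox X x ->
  `|hpot e f x| <= 2 * (M * kbox e (r + X)).
Proof.
move=> fM rX [x1 x2]; rewrite /hpot (le_trans (ler_normB _ _))// mulr_natl mulr2n lerD//.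
  exact: pot_bound.
by apply: pot_bound => //; rewrite /bar /= ?normrN.
Qed.

Lemma abs_sub4 (a a' b b' C t : R) : `|a - a'| <= C * t -> `|b - b'| <= C * t ->
  `|(a - b) - (a' - b')| <= 2 * C * t.
Proof. by rewrite -mulrA !ler_norml => /andP[? ?] /andP[? ?]; apply/andP; split; lra. Qed.

(** A bounded density satisfies the hypothesis of [pot_hoelder] with exponent [0]; the constant then
    depends on the bound alone, as equicontinuity requires. *)
Lemma hpot_hoelder (r M b X : R) : 0 <= M -> 0 <= b -> b <= 1 -> 2 * e + b < 2 ->
  0 < r -> 0 < X -> exists2 C, 0 <= C & forall f, bsup M r f -> forall x x',
    inbox X x -> inbox X x' -> `|hpot e f x - hpot e f x'| <= C * enorm (x - x') `^ b.
Proof.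
move=> M0 b0 b1 eb r0 X0.
have M2 : 0 <= 2 * M by rewrite mulr_ge0.
have eb' : 2 * e + b - 0 < 2 by rewrite subr0.
have [C C0 HC] := pot_hoelder e0 e1 M2 (lexx 0) b0 b1 eb' r0 X0.
exists (2 * C); first by rewrite mulr_ge0.
move=> f fM x x' [x1 x2] [x1' x2']; have [mf fb fr] := fM.
have Hf y z : `|f y - f z| <= 2 * M * enorm (y - z) `^ 0.
  by rewrite powRr0 mulr1 (le_trans (ler_normB _ _))// mulr_natl mulr2n lerD.
have h1 := HC M f fM Hf x x' x1 x2 x1' x2'.
have h2 : `|pot e f (bar x) - pot e f (bar x')| <= C * enorm (x - x') `^ b.
  have -> : enorm (x - x') = enorm (bar x - bar x').
    by rewrite /enorm /bar /= -opprD sqrrN.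
  by apply: (HC M f fM Hf); rewrite /bar /= ?normrN.
exact: abs_sub4 h1 h2.
Qed.

Lemma pot_sdec_even f (a b : R) (M r : R) : bsup M r f -> sdec f ->
  pot e f (a, - b) = pot e f (a, b).
Proof.
move=> fM sf; have [_] := I2_hrefl 0 (pot_ig2 (a, b) e0 e1 fM).
rewrite /pot => <-; apply: eq_I2 => y /=.
rewrite mulr0 sub0r (sdec_even _ _ sf); congr (_ * _); last by case: y.
by rewrite /kp /nrm2 /=; congr (_ `^ _); ring.
Qed.

Lemma hpot_even f (a b : R) (M r : R) : bsup M r f -> sdec f ->
  hpot e f (a, - b) = hpot e f (a, b).
Proof. by move=> fM sf; rewrite /hpot /bar /= !(pot_sdec_even _ _ fM sf). Qed.

End HPot.

(** * Existence of maximizers *)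

Section Core.
Context (R : realType) (e c kappa : R) (f : R -> R) (T Lam : R).
Context (e0 : 0 < e) (e1 : e < 1) (c0 : 0 < c) (k0 : 0 < kappa) (T0 : 0 < T).
Context (fm : forall t u : R, t <= u -> f t <= f u) (fz : forall t : R, t <= 0 -> f t = 0).
Context (fT : f T <= Lam).
Context (potT : forall (r : R) (h : R * R -> R) x, bsup Lam r h -> (forall y, 0 <= h y) ->
  I2 h = kappa -> c * pot e h x <= T / 2).
Implicit Types (x y z : R * R) (g h : R * R -> R) (L mu : R).

Local Notation J := (conj_f f T).

Definition dom L : R * R -> R := rect (L / 2) (3 * L / 2) (- (L / 2)) (L / 2).

Lemma domP L x : reflect (dom L x = 1) ((L / 2 <= x.1 <= 3 * L / 2) && (`|x.2| <= L / 2)).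
Proof.
rewrite ler_norml /dom /rect; apply: (iffP idP) => [->//|]; case: ifP => // _ /esym/eqP.
by rewrite oner_eq0.
Qed.

Lemma dom01 L x : dom L x = 1 \/ dom L x = 0.
Proof. by rewrite /dom /rect; case: ifP; [left|right]. Qed.

Lemma dom_ge0 L x : 0 <= dom L x.
Proof. exact: rect_ge0. Qed.

Lemma dom_inbox L x : 0 <= L -> dom L x = 1 -> inbox (2 * L) x.
Proof.
move=> L0 /domP/andP[/andP[x1 x1'] x2]; split; last lra.
by rewrite ler_norml; apply/andP; split; lra.
Qed.

Definition adm L h := [/\ bsup Lam (2 * L) h, forall x, 0 <= h x,
  forall x, h x != 0 -> dom L x = 1, I2 h = kappa & sdec h].

(** Horizontal derivative at [(L, 0)] of the contribution of a mirror vortex of mass [- kappa] at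
    [(- L, 0)]: the translation velocity of a point vortex pair. *)
Definition speed L : R := kappa * c * (2 * e) * (2 * L) `^ (- (2 * e + 1)).

Lemma speed_ge0 L : 0 <= speed L.
Proof. by rewrite /speed !mulr_ge0 ?powR_ge0// ltW. Qed.

Definition psi L h x : R := c * hpot e h x - speed L * x.1.

Definition mom h : R := I2 (fun x => x.1 * h x).

Definition En L h : R := c / 2 * hen e h h - speed L * mom h - I2 (fun x => J (h x)).

Lemma f_ge0 t : 0 <= f t. Proof. exact: (nondecr_ge0 fm fz). Qed.

Lemma f_meas : measurable_fun [set: R] f. Proof. exact: (nondecr_meas fm). Qed.

Lemma adm_ig L h : adm L h -> ig2 h. Proof. by case=> /bsup_ig2. Qed.

Lemma adm_x1 L h x : 0 < L -> adm L h -> h x != 0 -> 0 < x.1.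
Proof.
move=> L0 [_ _ hd _ _] /hd/domP/andP[/andP[h1 _] _].
by apply: lt_le_trans h1; rewrite divr_gt0.
Qed.

Lemma Lam_ge0 : 0 <= Lam. Proof. exact: le_trans (f_ge0 T) fT. Qed.

Lemma measurable_psi L h (M r : R) : bsup M r h -> measurable_fun [set: R * R] (psi L h).
Proof.
move=> hM; have mh := measurable_hpot (ltW e0) e1 hM.
have m1 : measurable_fun [set: R * R] (fun x => c * hpot e h x).
  exact: measurable_funM (@measurable_cst _ _ _ _ setT c) mh.
have m2 : measurable_fun [set: R * R] (fun x => speed L * x.1).
  exact: measurable_funM (@measurable_cst _ _ _ _ setT (speed L)) measurable_fst.
exact: measurable_funB m1 m2.
Qed.

Lemma psi_le L h x : 0 < L -> adm L h -> 0 <= x.1 -> psi L h x <= T / 2.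
Proof.
move=> L0 [hb h0 hd hk sh] x1; rewrite /psi lerBlDr.
apply: (@le_trans _ _ (c * pot e h x)); first by rewrite ler_pM2l// (hpot_le _ _ hb h0).
by apply: (le_trans (potT x hb h0 hk)); rewrite lerDl mulr_ge0// speed_ge0.
Qed.

Lemma ig_mul_hpot L g h : 0 < L -> adm L g -> adm L h -> ig2 (fun x => g x * hpot e h x).
Proof.
move=> L0 [gb _ _ _ _] [hb _ _ _ _].
have L2 : 0 < 2 * L + 2 * L by rewrite addr_gt0// mulr_gt0.
apply: bsup_ig2 (bsupM gb (measurable_hpot (ltW e0) e1 hb) (M' := 2 * (Lam * kbox e (2 * L + 2 * L))) _ _).
  by move=> x x1 x2; exact: (hpot_bound (ltW e0) e1 hb L2 (conj x1 x2)).
by rewrite mulr_ge0// mulr_ge0 ?kbox_ge0// Lam_ge0.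
Qed.

Lemma ig_mom L h : 0 < L -> adm L h -> ig2 (fun x => x.1 * h x).
Proof.
move=> L0 [hb _ _ _ _]; have L2 : 0 <= 2 * L by rewrite mulr_ge0// ltW.
have m1 : measurable_fun [set: R * R] (@fst R R) by exact: measurable_fst.
have := bsup_ig2 (bsupM hb m1 (fun z p1 _ => p1) L2).
by apply: eq_ig2 => x; exact: mulrC.
Qed.

Lemma ig_conj L h : adm L h -> ig2 (fun x => J (h x)).
Proof.
move=> [hb h0 hd hk sh]; have [mh _ _] := hb.
apply: (ig2_le _ _ (ig2Z T (bsup_ig2 hb))).
  exact: (measurableT_comp (conj_meas fm fz (ltW T0)) mh).
by move=> x; rewrite ger0_norm; [apply: conj_leT|exact: (conj_ge0 fm fz (ltW T0))] => //; exact: ltW.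
Qed.

Lemma ig_psi L g h : 0 < L -> adm L g -> adm L h -> ig2 (fun x => g x * psi L h x) /\
  I2 (fun x => g x * psi L h x) = c * hen e g h - speed L * mom g.
Proof.
move=> L0 ag ah; have I1 := ig2Z c (ig_mul_hpot L0 ag ah).
have I2' := ig2Z (speed L) (ig_mom L0 ag).
have E x : g x * psi L h x = c * (g x * hpot e h x) - speed L * (x.1 * g x).
  by rewrite /psi; ring.
split; first by have := ig2B I1 I2'; apply: eq_ig2 => x; rewrite E.
rewrite (eq_I2 E) (I2B I1 I2') (I2Z _ (ig_mul_hpot L0 ag ah)) (I2Z _ (ig_mom L0 ag)).
by [].
Qed.

Lemma En_arith (c' a b d w p q j i : R) : 0 <= c' -> 2 * a <= b + d ->
  (c' * a - w * p - j) - (c' * d - w * q - i) <=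
  (c' / 2 * b - w * p - j) - (c' / 2 * d - w * q - i).
Proof. by move=> c'0 h; have := ler_wpM2l c'0 h; lra. Qed.

(* The interaction form is positive definite, so the energy lies above its
   linearization in the interaction term. *)
Lemma En_chain L g h : 0 < L -> adm L g -> adm L h ->
  (I2 (fun x => g x * psi L h x) - I2 (fun x => J (g x))) -
  (I2 (fun x => h x * psi L h x) - I2 (fun x => J (h x))) <= En L g - En L h.
Proof.
move=> L0 ag ah; have [gb g0 _ _ _] := ag; have [hb h0 _ _ _] := ah.
rewrite (ig_psi L0 ag ah).2 (ig_psi L0 ah ah).2.
have L2 : 0 < 2 * L by rewrite mulr_gt0.
exact: En_arith (ltW c0) (hen_pd (ltW e0) e1 e0 L2 gb hb g0 h0).
Qed.

Lemma En_le L h : 0 < L -> adm L h -> En L h <= T / 4 * kappa.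
Proof.
move=> L0 ah; have [hb h0 _ hk _] := ah.
have L2 : 0 < 2 * L by rewrite mulr_gt0.
have j0 : 0 <= I2 (fun x => J (h x)) by apply: I2_ge0 => x; exact: (conj_ge0 fm fz (ltW T0)).
have m0 : 0 <= speed L * mom h.
  rewrite mulr_ge0 ?speed_ge0//; apply: I2_ge0 => x.
  have [->|hx] := eqVneq (h x) 0; first by rewrite mulr0.
  by rewrite mulr_ge0// ltW// (adm_x1 L0 ah).
have hh : c * hen e h h <= T / 2 * kappa.
  rewrite -hk -(I2Z _ (adm_ig ah)) /hen -(I2Z _ (ig_mul_hpot L0 ah ah)).
  apply: le_I2; [exact/ig2Z/(ig_mul_hpot L0 ah ah)|exact/ig2Z/(adm_ig ah)|].
  move=> x; rewrite mulrCA mulrC ler_wpM2r//.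
  apply: le_trans (potT x hb h0 hk).
  by rewrite ler_pM2l// (hpot_le _ _ hb h0).
rewrite /En; move: hh j0 m0; move: (hen _ _ _) (I2 _) (speed L * _) => A B D; lra.
Qed.

Definition bath L (p : R * R -> R) mu x : R := dom L x * f (p x - mu).

(** The properties of [psi L h] that survive a uniform limit. The limit of the potentials of a
    maximizing sequence is not known to be the potential of an admissible density, so the bathtub
    lemmas are stated for any such [p]. *)
Definition goodpot L (p : R * R -> R) (sg : R) :=
  [/\ measurable_fun [set: R * R] p, forall x, dom L x = 1 -> p x <= T / 2,
      forall a b : R, p (a, - b) = p (a, b), 0 < sg &
      forall a b b' : R, L / 2 <= a <= 3 * L / 2 -> 0 <= b -> b <= b' -> b' <= L / 2 ->
        sg * (b' ^+ 2 - b ^+ 2) <= p (a, b) - p (a, b')].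

Lemma measurable_bath L p mu : measurable_fun [set: R * R] p ->
  measurable_fun [set: R * R] (bath L p mu).
Proof.
move=> mp; have mc : measurable_fun [set: R * R] (fun x => mu) by exact: measurable_cst.
have m1 := measurableT_comp f_meas (measurable_funB mp mc).
exact: measurable_funM (measurable_rect _ _ _ _) m1.
Qed.

Lemma bath_bsup L p sg mu : 0 < L -> goodpot L p sg -> 0 <= mu -> bsup Lam (2 * L) (bath L p mu).
Proof.
move=> L0 [mp pT _ _ _] mu0; split; first exact: measurable_bath.
  move=> x; rewrite /bath; have [d1|->] := dom01 L x; last by rewrite mul0r normr0 Lam_ge0.
  rewrite d1 mul1r ger0_norm ?f_ge0// (le_trans _ fT)//; apply: fm.
  by have := pT x d1; have := T0; lra.
move=> x; rewrite /bath; have [d1 _|->] := dom01 L x; first exact: (dom_inbox (ltW L0) d1).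
by rewrite mul0r eqxx.
Qed.

Lemma bath_ge0 L p mu x : 0 <= bath L p mu x.
Proof. by rewrite mulr_ge0 ?f_ge0 ?dom_ge0. Qed.

Lemma goodpot_abs L p sg (a b : R) : goodpot L p sg -> p (a, `|b|) = p (a, b).
Proof. by move=> [_ _ pe _ _]; case: (ger0P b) => // _; rewrite pe. Qed.

Lemma bath_sdec L p sg mu : goodpot L p sg -> sdec (bath L p mu).
Proof.
move=> gp a b b' bb'; have [_ _ pe sg0 ps] := gp; rewrite /bath.
have [d1|->] := dom01 L (a, b'); last by rewrite mul0r mulr_ge0 ?f_ge0 ?dom_ge0.
have /andP[h1 h2] := introT (domP _ _) d1.
have d2 : dom L (a, b) = 1 by apply/domP/andP; split => //=; exact: le_trans h2.
rewrite d1 d2 !mul1r; apply: fm; rewrite lerD2r.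
rewrite -(goodpot_abs _ b gp) -(goodpot_abs _ b' gp).
rewrite -subr_ge0 (le_trans _ (ps a `|b| `|b'| h1 (normr_ge0 _) bb' h2))//.
by rewrite mulr_ge0 ?(ltW sg0)// subr_ge0 ler_pXn2r ?nnegrE.
Qed.

Lemma shift_arith (sg b t P Q : R) : 0 <= sg -> 0 <= t -> 0 <= b ->
  sg * ((b + t) ^+ 2 - b ^+ 2) <= P - Q -> Q <= P - sg * t ^+ 2.
Proof.
move=> sg0 t0 b0; have h : 0 <= sg * (b * t) by rewrite !mulr_ge0.
have -> : sg * ((b + t) ^+ 2 - b ^+ 2) = sg * t ^+ 2 + 2 * (sg * (b * t)) by ring.
lra.
Qed.

(** Raising the level by [d] is outdone by a vertical shift of size [sqrt (d / sg)], over which the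
    slope lowers the potential by at least [d]. The mass is therefore continuous in the level even
    where [f] jumps. *)
Lemma bath_osc L p sg mu (d : R) : 0 < L -> goodpot L p sg -> 0 <= mu -> 0 <= d ->
  I2 (bath L p mu) - I2 (bath L p (mu + d)) <= 4 * (2 * L) * Num.sqrt (d / sg) * Lam.
Proof.
move=> L0 gp mu0 d0; have [mp pT pe sg0 ps] := gp.
have L2 : 0 <= 2 * L by rewrite mulr_ge0// ltW.
have hb := bath_bsup L0 gp mu0.
have hb' := bath_bsup L0 gp (addr_ge0 mu0 d0).
have [Is hs] := sdec_shift hb (bath_ge0 L p mu) (@bath_sdec _ _ _ mu gp) L2 (sqrtr_ge0 (d / sg)).
apply: le_trans hs; rewrite -I2B; [|exact: bsup_ig2 hb|exact: bsup_ig2 hb'].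
apply: le_I2; [exact: ig2B (bsup_ig2 hb) (bsup_ig2 hb')|exact: ig2B (bsup_ig2 hb) Is|].
move=> x; rewrite lerD2l lerN2 /bath.
set t := Num.sqrt _; have t0 : 0 <= t by exact: sqrtr_ge0.
have [d1|->] := dom01 L (x.1, `|x.2| + t); last by rewrite mul0r mulr_ge0 ?f_ge0 ?dom_ge0.
have /andP[/= h1 h2] := introT (domP _ _) d1.
rewrite ger0_norm ?addr_ge0// in h2.
have d2 : dom L x = 1.
  by apply/domP/andP; split => //; apply: le_trans h2; rewrite lerDl.
rewrite d1 d2 !mul1r; apply: fm; rewrite opprD addrA [leRHS]addrAC lerD2r.
have -> : p x = p (x.1, `|x.2|) by rewrite (goodpot_abs _ _ gp); case: (x).
have := ps x.1 `|x.2| (`|x.2| + t) h1 (normr_ge0 _) _ h2; rewrite lerDl => /(_ t0).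
move=> /(shift_arith (ltW sg0) t0 (normr_ge0 _)).
by rewrite sqr_sqrtr ?divr_ge0 ?(ltW sg0)// mulrCA mulfV ?gt_eqF// mulr1.
Qed.

(** Intermediate value theorem for the mass as a function of the level; it vanishes once the level
    reaches [T], because [p <= T / 2]. *)
Lemma bath_mass L p sg (mu0 : R) : 0 < L -> goodpot L p sg -> 0 <= mu0 ->
  kappa <= I2 (bath L p mu0) -> exists2 mu, mu0 <= mu & adm L (bath L p mu).
Proof.
move=> L0 gp m0 mk; have [mp pT pe sg0 ps] := gp.
(* The maximum with [0] extends the mass continuously to negative levels, for which the profile
   might exceed [Lam]. *)
pose m (u : R) := I2 (bath L p (Num.max u 0)).
have mono (u v : R) : u <= v -> 0 <= m u - m v.
  move=> uv; rewrite /m subr_ge0; apply: le_I2.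
  - by apply: bsup_ig2 (bath_bsup L0 gp _); rewrite le_max lexx orbT.
  - by apply: bsup_ig2 (bath_bsup L0 gp _); rewrite le_max lexx orbT.
  move=> x; rewrite /bath ler_wpM2l ?dom_ge0//; apply: fm; rewrite lerB//.
  by rewrite ge_max !le_max lexx uv orbT.
pose C := 4 * (2 * L) * Lam / Num.sqrt sg.
have C0 : 0 <= C.
  by rewrite /C divr_ge0 ?sqrtr_ge0// mulr_ge0 ?Lam_ge0// mulr_ge0// mulr_ge0// ltW.
have osc (u v : R) : u <= v -> m u - m v <= C * (v - u) `^ 2^-1.
  move=> uv; have u0 : 0 <= Num.max u 0 by rewrite le_max lexx orbT.
  have d0 : 0 <= Num.max v 0 - Num.max u 0.
    by rewrite subr_ge0 ge_max !le_max lexx uv orbT.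
  have := bath_osc L0 gp u0 d0; rewrite subrKC => h; apply: (le_trans h).
  rewrite /C -powR12_sqrt ?divr_ge0 ?(ltW sg0)//.
  have -> : ((Num.max v 0 - Num.max u 0) / sg) `^ 2^-1 = (Num.max v 0 - Num.max u 0) `^ 2^-1 * (sg^-1) `^ 2^-1.
    by rewrite powRM// invr_ge0 ltW.
  have -> : (sg^-1) `^ 2^-1 = (Num.sqrt sg)^-1.
    by rewrite powR12_sqrt ?invr_ge0 ?(ltW sg0)// sqrtrV// ltW.
  have -> : 4 * (2 * L) * Lam / Num.sqrt sg * (v - u) `^ 2^-1 =
    4 * (2 * L) * ((v - u) `^ 2^-1 / Num.sqrt sg) * Lam by ring.
  rewrite ler_wpM2r ?Lam_ge0// ler_wpM2l ?mulr_ge0 ?(ltW L0)//.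
  rewrite ler_wpM2r ?invr_ge0 ?sqrtr_ge0// ge0_ler_powR ?invr_ge0// ?nnegrE ?subr_ge0//.
  by rewrite /Num.max; case: ltP => h1; case: ltP => h2; lra.
have abs_osc (u v : R) : `|m u - m v| <= C * `|u - v| `^ 2^-1.
  have [uv|/ltW uv] := leP u v.
    by rewrite (ger0_norm (mono _ _ uv)) (distrC u) (@ger0_norm _ (v - u)) ?subr_ge0// osc.
  by rewrite distrC (ger0_norm (mono _ _ uv)) (@ger0_norm _ (u - v)) ?subr_ge0// osc.
have cm : continuous m.
  move=> u; apply/cvgrPdist_le => eps eps0.
  have h2 : (0 : R) < 2^-1 by rewrite invr_gt0.
  have [d d0 dC] := hoelder_small C0 h2 eps0.
  apply/nbhs_ballP; exists d => // v; rewrite /ball/= => /ltW uv.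
  exact: (le_trans (abs_osc u v) (dC _ (normr_ge0 _) uv)).
have mmu0 : kappa <= m mu0 by rewrite /m max_l.
have mT : m (Num.max mu0 T) = 0.
  rewrite /m (_ : bath L p _ = fun=> 0) ?I2_0//; apply/funext => x; rewrite /bath.
  have [d1|->] := dom01 L x; last by rewrite mul0r.
  rewrite fz ?mulr0// subr_le0 (le_trans (pT x d1))// le_max; apply/orP; left.
  by rewrite le_max; apply/orP; right; have := T0; lra.
have mle : mu0 <= Num.max mu0 T by rewrite le_max lexx.
have [] := @IVT R m mu0 (Num.max mu0 T) kappa mle.
- by apply: continuous_subspaceT.
- by rewrite mT ge_min le_max (ltW k0) mmu0 orbT.
move=> mu; rewrite in_itv/= => /andP[h1 h2] E; exists mu => //.
have mu00 : 0 <= mu by exact: le_trans h1.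
split; [exact: bath_bsup gp _|exact: bath_ge0| | |exact: bath_sdec gp].
- move=> x; rewrite /bath; have [//|->] := dom01 L x; by rewrite mul0r eqxx.
- by rewrite -E /m max_l.
Qed.

(* Pointwise Young inequality on the domain: a bathtub profile beats every
   admissible density in the linearized problem, up to the error in the potential. *)
Lemma bath_improve L p mu (d : R) h : 0 < L -> 0 <= mu -> adm L (bath L p mu) -> adm L h ->
  (forall x, dom L x = 1 -> p x <= T / 2) -> 0 <= d ->
  (forall x, dom L x = 1 -> `|p x - psi L h x| <= d) ->
  En L h - 2 * d * kappa <= En L (bath L p mu).
Proof.
move=> L0 mu0 ab ah pT d0 pd; set g := bath L p mu.
have [I1 _] := ig_psi L0 ab ah; have [I3 _] := ig_psi L0 ah ah.
have key x : h x * psi L h x - J (h x) - (mu + d) * h x <=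
             g x * psi L h x - J (g x) - (mu + d) * g x + 2 * d * g x.
  have [_ h0 hd _ _] := ah; have [_ g0 gd _ _] := ab.
  have [d1|nd] := dom01 L x; last first.
    have hx : h x = 0 by apply/eqP/negPn/negP => /hd/eqP; rewrite nd eq_sym oner_eq0.
    have gx : g x = 0 by apply/eqP/negPn/negP => /gd/eqP; rewrite nd eq_sym oner_eq0.
    by rewrite hx gx !mul0r !mulr0 subr0 addr0.
  have tT : p x - mu <= T by have := pT x d1; have := T0; lra.
  have := young fm fz (ltW T0) (h0 x) tT.
  have -> : f (p x - mu) = g x by rewrite /g /bath d1 mul1r.
  have := pd x d1; rewrite ler_norml => /andP[p1 p2].
  have := ler_wpM2l (h0 x) p1; have := ler_wpM2l (g0 x) p2.
  move: (J _) (J _) (g0 x) (h0 x); rewrite -/g; move: (h x) (g x) (p x) (psi L h x) => a b q s A B.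
  lra.
have Ih := adm_ig ah; have Ig := adm_ig ab; have Jh := ig_conj ah; have Jg := ig_conj ab.
have Il := ig2B (ig2B I3 Jh) (ig2Z (mu + d) Ih).
have Ir0 := ig2B (ig2B I1 Jg) (ig2Z (mu + d) Ig).
have Ir := ig2D Ir0 (ig2Z (2 * d) Ig).
have := le_I2 Il Ir key.
rewrite (I2D Ir0 (ig2Z (2 * d) Ig)) (I2B (ig2B I3 Jh) (ig2Z (mu + d) Ih)) (I2B I3 Jh).
rewrite (I2B (ig2B I1 Jg) (ig2Z (mu + d) Ig)) (I2B I1 Jg) !(I2Z _ Ih) !(I2Z _ Ig).
have [_ _ _ -> _] := ah; have [_ _ _ -> _] := ab.
have := En_chain L0 ab ah; rewrite -/g.
move: (I2 _) (I2 _) (I2 _) (I2 _) (En _ _) (En _ _) => A B D F G H; lra.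
Qed.

Lemma limit_arith (S A B c' k eps : R) : S - eps <= A -> A - 2 * (c' * eps) * k <= B ->
  S - (1 + 2 * c' * k) * eps <= B.
Proof. lra. Qed.

Lemma psi_slope_arith (c' s k q u v w : R) : 0 <= c' -> s * q * k <= u - v ->
  c' * s * k * q <= (c' * u - w) - (c' * v - w).
Proof.
move=> c'0 h; have := ler_wpM2l c'0 h.
by rewrite mulrBr !mulrA [leLHS]mulrAC => ?; lra.
Qed.

Lemma psi_diff_arith (c' u v w d : R) : 0 <= c' -> `|v - u| <= d ->
  `|(c' * u - w) - (c' * v - w)| <= c' * d.
Proof.
move=> c'0 h; rewrite (_ : _ - _ - _ = c' * (u - v)); last by ring.
by rewrite normrM (ger0_norm c'0) ler_wpM2l// distrC.
Qed.

Lemma psi_good L : 0 < L -> exists2 sg, 0 < sg & forall h, adm L h -> goodpot L (psi L h) sg.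
Proof.
move=> L0; have L2 : 0 < L / 2 by rewrite divr_gt0.
have L2' : 0 < 2 * L by rewrite mulr_gt0.
have [s s0 H] := hpot_slope (ltW e0) e1 e0 L2 L2' L2'.
exists (c * s * kappa); first by rewrite !mulr_gt0.
move=> h ah; have [hb h0 hd hk sh] := ah; split.
- exact: measurable_psi hb.
- move=> x /domP/andP[/andP[x1 _] _]; apply: psi_le => //.
  by apply: le_trans x1; exact: ltW.
- by move=> a b; rewrite /psi (hpot_even (ltW e0) e1 _ _ hb sh).
- by rewrite !mulr_gt0.
- move=> a b b' /andP[a1 a2] b0 bb' b'L.
  have hl y : h y != 0 -> L / 2 <= y.1 by move=> /hd/domP/andP[/andP[]].
  have aX : L / 2 <= a <= 2 * L by rewrite a1/=; lra.
  have bX : b' <= 2 * L by lra.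
  have := H _ h hb h0 sh hl a b b' aX b0 bb' bX; rewrite hk => hh.
  exact: psi_slope_arith (ltW c0) hh.
Qed.

Lemma natSinv_small (eps : R) : 0 < eps ->
  exists N : nat, forall n, (N <= n)%N -> n.+1%:R^-1 <= eps.
Proof.
move=> ep; exists (Num.bound eps^-1) => n Nn; rewrite -[leRHS]invrK lef_pV2 ?posrE ?invr_gt0//.
have h : 0 <= eps^-1 by rewrite invr_ge0 ltW.
by rewrite (le_trans (ltW (archi_boundP h)))// ler_nat (leq_trans Nn).
Qed.

Lemma maximizing_limit L (S : R) : 0 < L ->
  (forall eps : R, 0 < eps -> exists2 h, adm L h & S - eps <= En L h) ->
  exists P : R * R -> R, forall eps : R, 0 < eps -> exists h,
    [/\ adm L h, S - eps <= En L h & forall x, inbox (2 * L) x -> `|hpot e h x - P x| <= eps].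
Proof.
move=> L0 HS; have L2 : 0 < 2 * L by rewrite mulr_gt0.
have sn n : exists h, adm L h /\ S - n.+1%:R^-1 <= En L h.
  have n0 : 0 < n.+1%:R^-1 :> R by rewrite invr_gt0.
  by have [h h1 h2] := HS _ n0; exists h.
have [hn hnP] := choice sn.
(* The exponent [1 - e] is admissible for bounded densities, since [2 e + (1 - e) < 2]. *)
have b0 : 0 < 1 - e by rewrite subr_gt0.
have b1 : 1 - e <= 1 by rewrite gerBl ltW.
have eb : 2 * e + (1 - e) < 2 by have := e1; lra.
have [C C0 HC] := hpot_hoelder (ltW e0) e1 Lam_ge0 (ltW b0) b1 eb L2 L2.
have L4 : 0 < 2 * L + 2 * L by rewrite addr_gt0.
have bd n x : inbox (2 * L) x -> `|hpot e (hn n) x| <= 2 * (Lam * kbox e (2 * L + 2 * L)).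
  by move=> xX; have [[hb _ _ _ _] _] := hnP n; exact: (hpot_bound (ltW e0) e1 hb L4 xX).
have hc n x x' : inbox (2 * L) x -> inbox (2 * L) x' ->
    `|hpot e (hn n) x - hpot e (hn n) x'| <= C * enorm (x - x') `^ (1 - e).
  by move=> xX x'X; have [[hb _ _ _ _] _] := hnP n; exact: HC.
have [P HP] := hoelder_subseq_limit C0 b0 bd hc.
exists P => eps eps0.
have [N HN] := natSinv_small eps0.
have [n [Nn Pn]] := HP eps eps0 N; have [an En'] := hnP n.
exists (hn n); split => //; by apply: le_trans En'; rewrite lerD2l lerN2 HN.
Qed.

(** A second bathtub pass turns an almost everywhere identity into an everywhere one: [z0], the
    profile of the limit potential, and [zt], the profile of [psi L z0], are both maximizers and
    agree off a null set; so they have the same potential, and [zt] is its own profile at each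
    point. The last hypothesis keeps both levels above [mu0]. *)
Theorem maximizer_exists L (e00 mu0 : R) : 0 < L -> 0 < e00 -> 0 < mu0 ->
  (exists2 h, adm L h & e00 <= En L h) ->
  (forall h, adm L h -> e00 / 2 <= En L h -> kappa < I2 (bath L (psi L h) (2 * mu0))) ->
  exists zt mu, [/\ adm L zt, mu0 <= mu, e00 <= En L zt,
    forall h, adm L h -> En L h <= En L zt & zt =1 bath L (psi L zt) mu].
Proof.
move=> L0 e000 mu00 [h1 ah1 Eh1] Hm.
pose V := [set En L h | h in adm L].
have Vub : has_ubound V by exists (T / 4 * kappa) => y [h ah <-]; exact: En_le.
have Vne : V !=set0 by exists (En L h1); exists h1.
pose S := sup V.
have ES h : adm L h -> En L h <= S by move=> ah; apply: (ub_le_sup Vub); exists h.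
have eS : e00 <= S by exact: le_trans (ES _ ah1).
have apx (eps : R) : 0 < eps -> exists2 h, adm L h & S - eps <= En L h.
  move=> ep; have [y [h ah <-] /ltW hy] := sup_adherent ep (conj Vne Vub).
  by exists h.
have [P HP] := maximizing_limit L0 apx.
have [sg sg0 Hsg] := psi_good L0.
(* [P] is under control in a box only; with the factor [dom] the first term is a pointwise limit
   everywhere, hence measurable. *)
pose p x := dom L x * (c * P x) - speed L * x.1.
have clos (eps : R) : 0 < eps -> exists h, [/\ adm L h, S - eps <= En L h &
    forall x, dom L x = 1 -> `|p x - psi L h x| <= c * eps].
  move=> ep; have [h [ah Eh hP]] := HP _ ep; exists h; split => // x d1.
  have := hP x (dom_inbox (ltW L0) d1); rewrite /p /psi d1 mul1r.
  exact: psi_diff_arith (ltW c0).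
have approx (A B D : R) : 0 <= D -> (forall eps, 0 < eps -> A - D * eps <= B) -> A <= B.
  move=> D0 H; apply/ler_addgt0Pr => t t0.
  have t1 : 0 < t / (D + 1) by rewrite divr_gt0// ltr_wpDl.
  have := H _ t1; rewrite lerBlDr => /le_trans; apply; rewrite lerD2l.
  by rewrite mulrCA ger_pMr// ler_pdivrMr ?ltr_wpDl// mul1r lerDl.
have gp : goodpot L p (sg).
  have even (a b : R) : dom L (a, b) = dom L (a, - b).
    by rewrite /dom /rect /= lerN2 lerNl; congr (if _ && _ then _ else _); rewrite andbC.
  split => //.
  - have sn n : exists h, adm L h /\ forall x, inbox (2 * L) x -> `|hpot e h x - P x| <= n.+1%:R^-1.
      have n0 : 0 < n.+1%:R^-1 :> R by rewrite invr_gt0.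
      by have [h [? _ ?]] := HP _ n0; exists h.
    have [hn hnP] := choice sn.
    have m1 : measurable_fun [set: R * R] (fun x => dom L x * (c * P x)).
      apply: (@measurable_fun_cvg _ _ _ setT (fun n x => dom L x * (c * hpot e (hn n) x))).
        move=> n; have [[hb _ _ _ _] _] := hnP n.
        have m1 := measurable_funM (@measurable_cst _ _ (R * R)%type _ setT c) (measurable_hpot (ltW e0) e1 hb).
        exact: measurable_funM (measurable_rect _ _ _ _) m1.
      move=> x _; have [d1|->] := dom01 L x; last first.
        rewrite mul0r (_ : (fun n => _) = fun=> 0); first exact: cvg_cst.
        by apply/funext => n; rewrite mul0r.
      rewrite d1 mul1r (_ : (fun n => _) = fun n => c * hpot e (hn n) x); last first.
        by apply/funext => n; rewrite mul1r.
      apply: cvgMr; apply/cvgrPdist_le => eps ep.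
      near=> n; have [_ h] := hnP n; rewrite distrC (le_trans (h x (dom_inbox (ltW L0) d1)))//.
      by near: n; have [N hN] := natSinv_small ep; exists N.
    have m2 := measurable_funM (@measurable_cst _ _ (R * R)%type _ setT (speed L)) (@measurable_fst _ _ R R).
    exact: measurable_funB m1 m2.
  - move=> x d1; apply: (approx _ _ c (ltW c0)) => eps ep.
    have [h [ah _ hp]] := clos _ ep; have [_ hT _ _ _] := Hsg h ah.
    have := hp x d1; have := hT x d1; rewrite ler_norml => ? /andP[? ?]; lra.
  - move=> a b; rewrite /p -even /=; have [d1|->] := dom01 L (a, b); last by rewrite !mul0r.
    have d2 : dom L (a, - b) = 1 by rewrite -even.
    have X1 := dom_inbox (ltW L0) d1; have X2 := dom_inbox (ltW L0) d2.
    rewrite d1 !mul1r; congr (c * _ - _); apply/eqP; rewrite -subr_eq0 -normr_le0.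
    apply: (approx _ _ 2) => // eps ep; have [h [[hb _ _ _ sh] _ hP]] := HP _ ep.
    have := hP _ X1; have := hP _ X2; rewrite (hpot_even (ltW e0) e1 _ _ hb sh).
    move: (hpot _ _ _) (P _) (P _) => u v w; rewrite !ler_norml => /andP[? ?] /andP[? ?].
    rewrite lerBlDr add0r ler_norml; apply/andP; split; lra.
  - move=> a b b' aL b0 bb' b'L.
    have d1 : dom L (a, b) = 1.
      by apply/domP/andP; split => //=; rewrite ger0_norm// (le_trans bb').
    have d2 : dom L (a, b') = 1.
      by apply/domP/andP; split => //=; rewrite ger0_norm// (le_trans b0).
    have c20 : 0 <= 2 * c by rewrite mulr_ge0// ltW.
    apply: (approx _ _ (2 * c) c20) => eps ep.
    have [h [ah _ hp]] := clos _ ep; have [_ _ _ _ hs] := Hsg h ah.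
    have := hs a b b' aL b0 bb' b'L; have := hp _ d1; have := hp _ d2.
    move: (psi _ _ _) (psi _ _ _) (p _) (p _) (sg * _) => u v w z s.
    rewrite !ler_norml => /andP[? ?] /andP[? ?] ?; lra.
have [_ pT _ _ _] := gp.
have mass0 : kappa <= I2 (bath L p mu0).
  (* Half of the energy may be given away, and the error [c ep <= mu0] in the potential fits into
     the gap between the levels [2 mu0] and [mu0]. *)
  pose ep := Num.min (e00 / 2) (mu0 / c).
  have ep0 : 0 < ep by rewrite lt_min !divr_gt0.
  have [h [ah Eh hp]] := clos _ ep0.
  have Eh' : e00 / 2 <= En L h.
    have epl : ep <= e00 / 2 by rewrite ge_min lexx.
    by apply: le_trans Eh; rewrite lerBrDr; apply: le_trans eS; rewrite [leRHS](splitr e00) lerD2l.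
  apply/ltW/(lt_le_trans (Hm h ah Eh')); apply: le_I2.
  - by apply: bsup_ig2 (bath_bsup L0 (Hsg h ah) _); rewrite mulr_ge0// ltW.
  - by apply: bsup_ig2 (bath_bsup L0 gp _); rewrite ltW.
  move=> x; rewrite /bath; have [d1|->] := dom01 L x; last by rewrite !mul0r.
  rewrite d1 !mul1r; apply: fm.
  have : c * ep <= mu0 by rewrite -ler_pdivlMl// mulrC ge_min lexx orbT.
  by have := hp x d1; rewrite ler_norml => /andP[? ?]; lra.
have [mu1 mu1ge az0] := bath_mass L0 gp (ltW mu00) mass0.
set z0 := bath L p mu1 in az0.
have mu10 : 0 <= mu1 by exact: le_trans (ltW mu00) mu1ge.
have Ez0 : S <= En L z0.
  have D0 : 0 <= 1 + 2 * c * kappa by rewrite addr_ge0// !mulr_ge0// ltW.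
  apply: (approx _ _ _ D0) => eps ep.
  have [h [ah Eh hp]] := clos _ ep.
  have cep : 0 <= c * eps by rewrite mulr_ge0// ltW.
  exact: limit_arith Eh (bath_improve L0 mu10 az0 ah pT cep hp).
have gz0 := Hsg z0 az0.
have mz0 : kappa <= I2 (bath L (psi L z0) mu0).
  have hE : e00 / 2 <= En L z0 by apply: le_trans Ez0; lra.
  apply/ltW/(lt_le_trans (Hm z0 az0 hE)); apply: le_I2.
  - by apply: bsup_ig2 (bath_bsup L0 gz0 _); rewrite mulr_ge0// ltW.
  - by apply: bsup_ig2 (bath_bsup L0 gz0 _); rewrite ltW.
  by move=> x; rewrite /bath ler_wpM2l ?dom_ge0//; apply: fm; lra.
have [mu mumu0 az] := bath_mass L0 gz0 (ltW mu00) mz0.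
set zt := bath L (psi L z0) mu in az.
have mup : 0 < mu by exact: lt_le_trans mumu0.
have psT : forall x, dom L x = 1 -> psi L z0 x <= T / 2 by case: gz0.
have Ezt : En L z0 <= En L zt.
  have := bath_improve L0 (ltW mup) az az0 psT (lexx 0) _.
  rewrite mulr0 mul0r subr0; apply => x _.
  by rewrite subrr normr0.
(* The deficit of [z0] in Young's inequality: nonnegative at each point, while maximality of [z0]
   makes its integral nonpositive. *)
pose G x := (zt x * (psi L z0 x) - J (zt x) - mu * zt x) - (z0 x * (psi L z0 x) - J (z0 x) - mu * z0 x).
have [Ia _] := ig_psi L0 az az0; have [Ib _] := ig_psi L0 az0 az0.
have Iz := adm_ig az; have Iz0 := adm_ig az0; have Jz := ig_conj az; have Jz0 := ig_conj az0.
have IG1 := ig2B (ig2B Ia Jz) (ig2Z mu Iz); have IG2 := ig2B (ig2B Ib Jz0) (ig2Z mu Iz0).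
have IG : ig2 G by exact: ig2B IG1 IG2.
have tauT x : dom L x = 1 -> psi L z0 x - mu <= T / 2 by move=> /psT; lra.
have ztE x : dom L x = 1 -> f (psi L z0 x - mu) = zt x by move=> d1; rewrite /zt /bath d1 mul1r.
have offd x : dom L x = 0 -> zt x = 0 /\ z0 x = 0.
  by move=> d1; rewrite /zt /z0 /bath d1 !mul0r.
have z00 x : 0 <= z0 x by exact: bath_ge0.
have G0 x : 0 <= G x.
  have [d1|/offd[h2 h3]] := dom01 L x; last by rewrite /G h2 h3 !mul0r !mulr0 subrr.
  have tT : psi L z0 x - mu <= T by have := tauT x d1; have := T0; lra.
  have := young fm fz (ltW T0) (z00 x) tT; rewrite (ztE x d1) /G.
  by move: (J _) (J _) => A B; lra.
have GI : I2 G <= 0.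
  rewrite (I2B IG1 IG2) (I2B (ig2B Ia Jz) (ig2Z mu Iz)) (I2B (ig2B Ib Jz0) (ig2Z mu Iz0)).
  rewrite (I2B Ia Jz) (I2B Ib Jz0) (I2Z _ Iz) (I2Z _ Iz0).
  have [_ _ _ -> _] := az; have [_ _ _ -> _] := az0.
  have := En_chain L0 az az0; have := ES _ az; move: Ez0.
  move: (I2 _) (I2 _) (I2 _) (I2 _) (En _ _) (En _ _) => A B D F U W; lra.
have [N N0 NG] := I2_eq0_ae IG G0 GI.
have Idz := ig2_abs (ig2B Iz0 Iz).
(* Off the null set both [z0] and [zt] lie between the profiles of levels [mu + d] and [mu - d], so
   their distance is at most the oscillation of the mass over [2 d]. *)
have dle (d : R) : 0 < d -> d <= mu -> d <= T / 2 ->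
    I2 (fun x => `|z0 x - zt x|) <= 4 * (2 * L) * Num.sqrt ((2 * d) / sg) * Lam.
  move=> d0 dmu dT.
  have md : 0 <= mu - d by rewrite subr_ge0.
  have d20 : 0 <= 2 * d by rewrite mulr_ge0// ltW.
  apply: le_trans (bath_osc L0 gz0 md d20).
  have i1 := bsup_ig2 (bath_bsup L0 gz0 md); have i2 := bsup_ig2 (bath_bsup L0 gz0 (addr_ge0 md d20)).
  rewrite -(I2B i1 i2).
  apply: (le_trans (ler_norm _)).
  apply: (I2_abs_le_ae N0 (ig2_meas Idz) (ig2B i1 i2) _).2.
  move=> x /NG; rewrite normr_id /bath; have [d1|/[dup]/offd[h2 h3] ->] := dom01 L x; last first.
    by rewrite h2 h3 subrr normr0 !mul0r subrr.
  have [/= tx] : psi L z0 x - mu + d <= T by have := tauT x d1; lra.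
  rewrite d1 !mul1r => Gx.
  have yeq : f (psi L z0 x - mu) * (psi L z0 x - mu) - J (f (psi L z0 x - mu)) <=
             z0 x * (psi L z0 x - mu) - J (z0 x).
    by rewrite (ztE x d1); move: Gx; rewrite /G; move: (J _) (J _) => A B; lra.
  have /andP[] := young_eq fm fz (ltW T0) (z00 x) (ltW d0) d0 tx yeq.
  have -> : psi L z0 x - (mu - d) = psi L z0 x - mu + d by ring.
  have -> : psi L z0 x - (mu - d + 2 * d) = psi L z0 x - mu - d by ring.
  have dd : psi L z0 x - mu - d <= psi L z0 x - mu by rewrite gerBl ltW.
  have du : psi L z0 x - mu <= psi L z0 x - mu + d by rewrite lerDl ltW.
  have := fm dd; have := fm du; rewrite (ztE x d1).
  move: (f _) (f _) => A B *; rewrite ler_norml; apply/andP; split; lra.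
have d00 : I2 (fun x => `|z0 x - zt x|) <= 0.
  have K0 : 0 <= 4 * (2 * L) * Lam.
    by rewrite mulr_ge0 ?Lam_ge0// mulr_ge0// mulr_ge0// ltW.
  apply/ler_addgt0Pr => t t0; rewrite add0r.
  pose q := t / (4 * (2 * L) * Lam + 1).
  have q0 : 0 < q by rewrite divr_gt0// ltr_wpDl.
  pose d := Num.min (Num.min mu (T / 2)) (q ^+ 2 * sg / 2).
  have q2 : 0 < q ^+ 2 * sg / 2 by rewrite divr_gt0// mulr_gt0// exprn_gt0.
  have T2 : 0 < T / 2 by rewrite divr_gt0.
  have d0 : 0 < d by rewrite !lt_min mup T2 q2.
  have dm : d <= mu by rewrite !ge_min lexx.
  have dT : d <= T / 2 by rewrite !ge_min lexx !orbT.
  have dq : 2 * d / sg <= q ^+ 2.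
    by rewrite ler_pdivrMr// mulrC -ler_pdivlMr// ge_min lexx orbT.
  apply: (le_trans (dle d d0 dm dT)).
  have sq : Num.sqrt (2 * d / sg) <= q.
    by rewrite -[leRHS](ger0_norm (ltW q0)) -sqrtr_sqr ler_wsqrtr.
  rewrite mulrAC (le_trans (ler_wpM2l K0 sq))//.
  rewrite /q mulrCA ger_pMr// ler_pdivrMr ?ltr_wpDl// mul1r lerDl//.
have [N' N'0 HN'] := I2_eq0_ae Idz (fun x => normr_ge0 _) d00.
have psiE x : psi L z0 x = psi L zt x.
  rewrite /psi (hpot_ae e x N'0 (ig2_meas Iz0) (ig2_meas Iz))//.
  by move=> y /HN'/eqP; rewrite normr_eq0 subr_eq0 => /eqP.
exists zt, mu; split => //.
- by apply: le_trans Ezt; exact: le_trans Ez0.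
- by move=> h /ES/le_trans; apply; exact: le_trans Ez0 Ezt.
- by move=> x; rewrite {1}/zt /bath psiE.
Unshelve. all: by end_near. Qed.

End Core.

(** * Concentration and localization of the vortex *)

Section PotBounds.
Context (R : realType).
Implicit Types (x y z : R * R) (f g h : R * R -> R).

Lemma le_I2_ae f g (N : set (R * R)) : (@lam2 R).-negligible N -> ig2 f -> ig2 g ->
  (forall x, ~ N x -> f x <= g x) -> I2 f <= I2 g.
Proof.
move=> N0 If Ig fg; rewrite -subr_ge0 -(I2B Ig If).
rewrite (I2_eq_ae N0 (ig2_meas (ig2B Ig If)) (ig2_meas (ig2_abs (ig2B Ig If)))).
  by apply: I2_ge0 => x.
by move=> x nx; rewrite ger0_norm// subr_ge0 fg.
Qed.

Lemma powN_small (p K eta : R) : 0 < p -> 0 <= K -> 0 < eta ->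
  exists2 L0 : R, 0 < L0 & forall L, L0 <= L -> K * L `^ (- p) <= eta.
Proof.
move=> p0 K0 h0; have k1 : 0 < K / eta + 1 by rewrite ltr_wpDl// divr_ge0// ltW.
exists ((K / eta + 1) `^ p^-1); first exact: powR_gt0.
move=> L hL; have L0 : 0 < L by apply: lt_le_trans hL; exact: powR_gt0.
have : K / eta + 1 <= L `^ p.
  have := @ge0_ler_powR _ p (ltW p0) _ _ _ _ hL.
  rewrite -powRrM mulVf ?gt_eqF// powRr1 ?(ltW k1)//.
  by apply; rewrite nnegrE ?powR_ge0// ltW.
rewrite powRN => h; rewrite ler_pdivrMr ?powR_gt0//.
have : K / eta <= L `^ p by apply: le_trans h; rewrite lerDl.
by rewrite ler_pdivrMr// mulrC.
Qed.

Lemma kp_far (e a : R) x : 0 <= e -> 0 < a -> a ^+ 2 <= nrm2 x -> kp e x <= a `^ (- (2 * e)).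
Proof.
move=> e0 a0 h; rewrite -mulrN powRrM (powR_mulrn 2 (ltW a0)) /kp.
by apply: powRN_le => //; exact: exprn_gt0.
Qed.

Context (e : R) (e0 : 0 < e) (e1 : e < 1).

Lemma pot_le_far (M r K : R) h x : bsup M r h -> (forall y, 0 <= h y) ->
  (forall y, h y != 0 -> kp e (x - y) <= K) -> pot e h x <= K * I2 h.
Proof.
move=> hb h0 hK; rewrite -(I2Z _ (bsup_ig2 hb)); apply: le_I2.
- exact: pot_ig2 (ltW e0) e1 hb.
- exact/ig2Z/(bsup_ig2 hb).
- move=> y; have [->|/hK hy] := eqVneq (h y) 0; first by rewrite !mulr0.
  by rewrite ler_wpM2r.
Qed.

Lemma measurable_ibox_shift (r : R) x : measurable_fun [set: R * R] (fun y => ibox r (y - x)).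
Proof.
have ms : measurable_fun [set: R * R] (fun y : R * R => y - x).
  have := measurable_aff2 (1 : R) (- x.1) 1 (- x.2); congr measurable_fun.
  by apply/funext => y; rewrite /aff2 !mul1r; apply: pairP.
exact: measurableT_comp (measurable_ibox r) ms.
Qed.

Lemma ibox_le1 (r : R) x : `|ibox r x| <= 1.
Proof. by rewrite /ibox; case: ifP => _; rewrite ?normr1 ?normr0. Qed.

Lemma ig2_mul_ibox (M r r' : R) h x : bsup M r h -> ig2 (fun y => h y * ibox r' (y - x)).
Proof.
move=> hb; apply: (ig2_mul_bd (k := 1) (bsup_ig2 hb) (measurable_ibox_shift r' x)).
by move=> y; exact: ibox_le1.
Qed.

Lemma pot_ge_box (M r r' : R) h x : bsup M r h -> (forall y, 0 <= h y) -> 0 < r' ->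
  (2 * r' ^+ 2) `^ (- e) * I2 (fun y => h y * ibox r' (y - x)) <= pot e h x.
Proof.
move=> hb h0 r0; have Ib := ig2_mul_ibox r' x hb.
rewrite -(I2Z _ Ib); apply: (le_I2_ae (null_vline x.1)).
- exact: ig2Z.
- exact: pot_ig2 (ltW e0) e1 hb.
move=> y /= yx; have xy : x - y != 0.
  by rewrite subr_eq0; apply/eqP => xy; apply: yx; rewrite xy.
rewrite /ibox; case: ifP => [/andP[/= h1 h2]|_]; last first.
  by rewrite !mulr0 mulr_ge0 ?kp_ge0.
rewrite mulr1 ler_wpM2r// /kp powRN_le ?(ltW e0) ?nrm2_gt0//.
have sq (u v : R) : `|u - v| <= r' -> (v - u) ^+ 2 <= r' ^+ 2.
  by rewrite distrC; exact: sqr_abs_le.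
by rewrite /nrm2 mulr_natl mulr2n lerD//= sq.
Qed.

Lemma kboxE (r : R) : 0 <= r -> kbox e r = (2 / (1 - e)) ^+ 2 * r `^ (2 * (1 - e)).
Proof.
move=> r0; rewrite /kbox mulrC [2 * (1 - e)]mulrC powRrM (powR_mulrn 2) ?powR_ge0//.
by rewrite -exprMn; congr (_ ^+ 2); ring.
Qed.

(** By the choice of [R0] the mass outside the box accounts for at most [A / 3], and by the choice
    of [rho] the singularity for another third; the last third is at most [rho^(-2 e)] times the
    mass in the box. The radius [r] of the support does not enter the constants. *)
Lemma concentration (A M k : R) : 0 < A -> 0 <= M -> 0 <= k ->
  exists R0 m0 : R, [/\ 0 < R0, 0 < m0 & forall (r : R) h x, bsup M r h ->
    (forall y, 0 <= h y) -> I2 h = k -> A <= pot e h x ->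
    m0 <= I2 (fun y => h y * ibox R0 (y - x))].
Proof.
move=> A0 M0 k00; have A3 : 0 < A / 3 by rewrite divr_gt0.
have e2 : 0 < 2 * e by rewrite mulr_gt0.
have e12 : 0 < 2 * (1 - e) by rewrite mulr_gt0// subr_gt0.
have [R0 R00 HR] := powN_small e2 k00 A3.
have C0 : 0 <= M * (2 / (1 - e)) ^+ 2 by rewrite mulr_ge0// sqr_ge0.
have [rho rho0 Hr] := hoelder_small C0 e12 A3.
exists R0, (A / 3 * rho `^ (2 * e)); split => //; first by rewrite mulr_gt0// powR_gt0.
move=> r h x hb h0 hk hA; have [mh hM hr] := hb.
pose h1 y := h y * ibox R0 (y - x); pose h2 y := h y - h1 y.
have h1le y : 0 <= h1 y <= h y.
  by rewrite /h1; have [->|->] := iboxP R0 (y - x); rewrite ?mulr1 ?mulr0 ?h0 ?lexx.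
have b1 : bsup M r h1.
  split.
  - exact: measurable_funM mh (measurable_ibox_shift R0 x).
  - move=> y; have /andP[p1 p2] := h1le y; rewrite ger0_norm// (le_trans p2)//.
    exact: le_trans (ler_norm _) (hM y).
  - by move=> y; rewrite /h1 mulf_eq0 negb_or => /andP[/hr].
have b2 : bsup M r h2.
  split.
  - exact: measurable_funB mh (let: And3 m _ _ := b1 in m).
  - move=> y; have /andP[p1 p2] := h1le y; rewrite ger0_norm ?subr_ge0//.
    rewrite lerBlDr (le_trans (ler_norm _))// (le_trans (hM y))// lerDl//.
  - move=> y hy; apply: hr; apply: contra_neq hy => hy.
    by rewrite /h2 /h1 hy mul0r subrr.
have Eh : pot e h x = pot e h1 x + pot e h2 x.
  by rewrite -(potD (ltW e0) e1 x b1 b2); congr (pot e _ x); apply/funext => y; rewrite addrC subrK.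
have far : pot e h2 x <= A / 3.
  apply: (@le_trans _ _ (R0 `^ (- (2 * e)) * I2 h2)).
    apply: pot_le_far b2 _ _ => [y|y]; first by have /andP[_] := h1le y; rewrite subr_ge0.
    rewrite /h2 /h1 /ibox; case: ifPn => [_|]; first by rewrite mulr1 subrr eqxx.
    rewrite negb_and -!ltNge => out _; apply: (kp_far (ltW e0) R00).
    rewrite -enorm_sqr; apply: sqr_abs_le; rewrite (ger0_norm (ltW R00)) enorm_distC.
    by case/orP: out => /ltW/le_trans; apply; [exact: enorm_ge1|exact: enorm_ge2].
  apply: le_trans (HR R0 (lexx _)); rewrite mulrC ler_wpM2r ?powR_ge0// -hk.
  apply: le_I2 (bsup_ig2 b2) (bsup_ig2 hb) _ => y; rewrite /h2 gerBl.
  by have /andP[] := h1le y.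
have near : pot e h1 x <= A / 3 + rho `^ (- (2 * e)) * I2 h1.
  apply: le_trans (pot_sup (ltW e0) e1 x b1 (fun y => proj1 (andP (h1le y))) rho0) _.
  by rewrite lerD2r kboxE ?(ltW rho0)// mulrA Hr// ltW.
have : A / 3 <= rho `^ (- (2 * e)) * I2 h1.
  by move: hA near far; rewrite Eh; move: (_ * I2 _) (pot _ _ _) (pot _ _ _) => u v w; lra.
by move=> h3; rewrite -ler_pdivlMr ?powR_gt0//; move: h3; rewrite powRN [leRHS]mulrC.
Qed.

End PotBounds.

(** * Energy of a trial density *)

Section Trial.
Context (R : realType) (e c kappa : R) (f : R -> R) (T Lam : R).
Context (e0 : 0 < e) (e1 : e < 1) (c0 : 0 < c) (k0 : 0 < kappa) (T0 : 0 < T).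
Context (fm : forall t u : R, t <= u -> f t <= f u) (fz : forall t : R, t <= 0 -> f t = 0).
Context (fT : f T <= Lam).
Context (potT : forall (r : R) (h : R * R -> R) x, bsup Lam r h -> (forall y, 0 <= h y) ->
  I2 h = kappa -> c * pot e h x <= T / 2).
Context (f0 : forall B : R, 0 < B -> exists2 t0 : R, 0 < t0 &
  forall t, 0 < t -> t < t0 -> B * t `^ e^-1 <= f t).
Implicit Types (x y z : R * R) (g h : R * R -> R) (L mu : R).
Local Notation J := (conj_f f T).
Local Notation adm := (adm kappa Lam).
Local Notation En := (En e c kappa f T).
Local Notation psi := (psi e c kappa).
Local Notation bath := (bath f).
Local Notation speed := (speed e c kappa).

Lemma speed_x L (t : R) : 0 < L -> 0 <= t -> t <= 2 * L ->
  speed L * t <= kappa * c * (2 * e) * L `^ (- (2 * e)).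
Proof.
move=> L0 t0 tL; have L2 : 0 < 2 * L by rewrite mulr_gt0.
have K0 : 0 <= kappa * c * (2 * e) by rewrite !mulr_ge0// ltW.
have e2 : 0 <= 2 * e by rewrite mulr_ge0// ltW.
rewrite /speed -[leLHS]mulrA ler_wpM2l//.
apply: (@le_trans _ _ ((2 * L) `^ (- (2 * e)))).
  rewrite opprD powRD ?(gt_eqF L2) ?implybT// powR_inv1 ?(ltW L2)//.
  by rewrite -mulrA ler_piMr ?powR_ge0// mulrC ler_pdivrMr// mul1r.
by apply: powRN_le => //; rewrite ler_peMl ?(ltW L0)// ler1n.
Qed.

(** The image of [x] and the points of the support are at horizontal distance at least [L]. *)
Lemma img_le L h x : 0 < L -> adm L h -> L / 2 <= x.1 ->
  pot e h (bar x) <= L `^ (- (2 * e)) * kappa.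
Proof.
move=> L0 [hb h0 hd <- _] x1; apply: (pot_le_far e0 e1 hb h0) => y /hd/domP/andP[/andP[y1 _] _].
apply: (kp_far (ltW e0) L0); rewrite /nrm2 /bar /=.
rewrite -[leLHS]addr0 lerD ?sqr_ge0//.
have h1 : L <= x.1 + y.1 by move: x1 y1; lra.
by rewrite -opprD sqrrN; apply: sqr_abs_le; rewrite (ger0_norm (ltW L0)).
Qed.

Lemma psi_ge L h x : 0 < L -> adm L h -> L / 2 <= x.1 -> x.1 <= 2 * L ->
  c * pot e h x - (c * kappa + kappa * c * (2 * e)) * L `^ (- (2 * e)) <= psi L h x.
Proof.
move=> L0 ah x1 x2; have x0 : 0 <= x.1 by apply: le_trans x1; rewrite divr_ge0// ltW.
have := speed_x L0 x0 x2; have := ler_wpM2l (ltW c0) (img_le L0 ah x1).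
rewrite /psi /hpot; move: (speed L * _) (L `^ _) (pot _ _ _) (pot _ _ _) => u v w s.
rewrite mulrBr; move: (c * w) (c * s) => w' s' h1 h2.
have -> : (c * kappa + kappa * c * (2 * e)) * v = c * (v * kappa) + kappa * c * (2 * e) * v by ring.
lra.
Qed.

Lemma En_ge_arith (P k c' A S D F H : R) : P * k <= c' * A -> S <= F -> D <= H ->
  P / 2 * k - F - H <= c' / 2 * A - S - D.
Proof. lra. Qed.

Lemma En_ge L h (P J1 : R) : 0 < L -> adm L h ->
  (forall x, h x != 0 -> P <= psi L h x + c * pot e h (bar x) * 0) ->
  (forall x, J (h x) <= J1 * h x) -> 0 <= P ->
  P / 2 * kappa - kappa * c * (2 * e) * L `^ (- (2 * e)) * kappa - J1 * kappa <= En L h.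
Proof.
move=> L0 ah hP hJ P0; have [hb h0 hd hk sh] := ah.
have ih := adm_ig ah; have ip := ig_psi c e0 e1 fm fz fT L0 ah ah.
have hJ' : I2 (fun x => J (h x)) <= J1 * kappa.
  rewrite -hk -(I2Z _ ih); apply: le_I2 => //; [exact: (ig_conj T0 fm fz ah)|exact: ig2Z].
have hm : speed L * mom h <= kappa * c * (2 * e) * L `^ (- (2 * e)) * kappa.
  have im := ig_mom L0 ah.
  rewrite /mom -(I2Z _ im) -[X in _ <= _ * X]hk -(I2Z _ ih); apply: le_I2; try exact: ig2Z.
  move=> x; have [->|hx] := eqVneq (h x) 0; first by rewrite !mulr0.
  rewrite mulrA ler_wpM2r//; apply: speed_x => //; first by rewrite ltW// (adm_x1 L0 ah).
  have /domP/andP[/andP[_ h1] _] := hd x hx; by move: h1; have := L0; lra.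
have hm0 : 0 <= speed L * mom h.
  rewrite mulr_ge0 ?(speed_ge0 e0 c0 k0)//; apply: I2_ge0 => x.
  have [->|hx] := eqVneq (h x) 0; first by rewrite mulr0.
  by rewrite mulr_ge0// ltW// (adm_x1 L0 ah).
have hh : P * kappa <= c * hen e h h.
  have : P * kappa <= I2 (fun x => h x * psi L h x).
    rewrite -[X in P * X]hk -(I2Z _ ih); apply: le_I2; [exact: ig2Z|exact: ip.1|].
    move=> x; have [->|hx] := eqVneq (h x) 0; first by rewrite mulr0 mul0r.
    by rewrite mulrC ler_wpM2l//; have := hP x hx; rewrite mulr0 addr0.
  rewrite ip.2; move: (speed L * _) hm0 (c * hen _ _ _) => A B D; lra.
exact: En_ge_arith hh hm hJ'.
Qed.

Definition trial L (l tau : R) x : R := tau * rect (L - l) (L + l) (- l) l x.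

Lemma rect_sdec (a b l : R) : sdec (rect a b (- l) l).
Proof.
move=> u v w vw; rewrite /rect /= -!ler_norml; case: ifP => [/andP[-> /= h]|_].
  by rewrite (le_trans vw h).
by case: ifP.
Qed.

Lemma trial_adm L (l tau : R) : 0 < l -> l <= L / 2 -> 0 <= tau -> tau <= Lam ->
  tau * (4 * l ^+ 2) = kappa -> adm L (trial L l tau).
Proof.
move=> l0 lL t0 tL tk.
have r1 x : rect (L - l) (L + l) (- l) l x != 0 -> dom L x = 1.
  rewrite /rect; case: ifP => [/andP[/andP[h1 h2] /andP[h3 h4]] _|_]; last by rewrite eqxx.
  by apply/domP; rewrite ler_norml; apply/andP; split; apply/andP; split; lra.
have r2 x : trial L l tau x != 0 -> dom L x = 1.
  by rewrite /trial mulf_eq0 negb_or => /andP[_ /r1].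
have ll : L - l <= L + l by lra.
have ll' : - l <= l by lra.
split.
- split.
  + exact: measurable_funM (@measurable_cst _ _ _ _ setT tau) (measurable_rect _ _ _ _).
  + move=> x; rewrite /trial /rect; case: ifP => _; rewrite ?mulr1 ?mulr0 ?normr0.
      by rewrite ger0_norm.
    exact: le_trans tL.
  + by move=> x /r2; apply: dom_inbox; lra.
- by move=> x; rewrite mulr_ge0 ?rect_ge0.
- exact: r2.
- rewrite (I2Z _ (ig2_rect ll ll')) (I2_rect ll ll') -tk; ring.
- by move=> a b b' bb'; rewrite ler_wpM2l// rect_sdec.
Qed.

Lemma sqrt_quarter (k t : R) : 0 < k -> 0 < t -> t * (4 * (Num.sqrt (k / t) / 2) ^+ 2) = k.
Proof.
move=> kp tp; rewrite expr_div_n sqr_sqrtr ?divr_ge0 ?ltW//; field.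
by rewrite gt_eqF.
Qed.

Lemma inv_from (a b K : R) : 0 < K -> a * (b * K) = K -> a^-1 = b.
Proof.
move=> K0 h; have Kn : K != 0 by rewrite gt_eqF.
have ab : a * b = 1 by apply: (mulIf Kn); rewrite -mulrA h mul1r.
have an : a != 0 by apply: contra_eq_neq ab => ->; rewrite mul0r eq_sym oner_eq0.
by rewrite -[LHS]mulr1 -ab mulKf.
Qed.

(** The patch has height [tau <= f t1], hence [J (h) <= t1 h], and is so small that its own
    potential is at least [8 t1 / c]. The interaction gains about [4 t1 kappa], the dual term costs
    at most [t1 kappa], and image and drift fade as [L] grows. *)
Lemma trial_energy : exists e00 L0 : R, [/\ 0 < e00, 0 < L0 &
  forall L, L0 <= L -> exists2 h, adm L h & e00 <= En L h].
Proof.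
(* Chosen to make [(2 (2 l)^2)^(-e) kappa = 8 t1 / c] when [tau = B t1^(1/e)] and
   [4 l^2 tau = kappa]. *)
pose B := (8 / (c * kappa) * (2 * kappa) `^ e) `^ e^-1.
have Bp : 0 < 8 / (c * kappa) * (2 * kappa) `^ e.
  by apply: mulr_gt0; [rewrite divr_gt0// mulr_gt0|apply: powR_gt0; rewrite mulr_gt0].
have B0 : 0 < B by exact: powR_gt0.
have [t0 t00 Ht] := f0 B0.
pose t1 := Num.min (t0 / 2) T.
have t10 : 0 < t1 by rewrite lt_min T0 divr_gt0.
have t1t : t1 < t0.
  by apply: (@le_lt_trans _ _ (t0 / 2)); [rewrite ge_min lexx|move: t00; lra].
have t1T : t1 <= T by rewrite ge_min lexx orbT.
pose tau := B * t1 `^ e^-1.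
have tau0 : 0 < tau by rewrite mulr_gt0// powR_gt0.
have tauf : tau <= f t1 by exact: Ht.
have tauL : tau <= Lam by apply: (le_trans tauf); exact: le_trans (fm t1T) fT.
pose l := Num.sqrt (kappa / tau) / 2.
have l0 : 0 < l by rewrite divr_gt0// sqrtr_gt0 divr_gt0.
have lE : tau * (4 * l ^+ 2) = kappa by exact: sqrt_quarter.
have K0 : 0 <= 2 * (c * kappa + kappa * c * (2 * e)) + kappa * c * (2 * e).
  by rewrite !(addr_ge0, mulr_ge0)// ltW.
have e2 : 0 < 2 * e by rewrite mulr_gt0.
have t12 : 0 < t1 / 2 by rewrite divr_gt0.
have [L1 L10 HL] := powN_small e2 K0 t12.
exists (t1 * kappa / 2), (Num.max L1 (2 * l)); split.
- by rewrite divr_gt0// mulr_gt0.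
- by rewrite lt_max L10.
move=> L; rewrite ge_max => /andP[LL1 Ll].
have L0 : 0 < L by exact: lt_le_trans LL1.
have lL : l <= L / 2 by move: Ll; lra.
have ah := trial_adm l0 lL (ltW tau0) tauL lE.
exists (trial L l tau) => //; set h := trial L l tau in ah *.
have [hb h0 hd hk sh] := ah.
have inb x y : h x != 0 -> h y != 0 -> ibox (2 * l) (y - x) = 1.
  have hh z : h z != 0 -> (L - l <= z.1 <= L + l) && (- l <= z.2 <= l).
    by rewrite /h /trial /rect; case: ifP => // _; rewrite mulr0 eqxx.
  move=> /hh/andP[/andP[? ?] /andP[? ?]] /hh/andP[/andP[? ?] /andP[? ?]].
  by apply: ibox1; rewrite /= ler_norml; apply/andP; split; lra.
have l2 : 0 < 2 * l by rewrite mulr_gt0.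
have pe : (2 * (2 * l) ^+ 2) `^ (- e) = 8 / (c * kappa) * t1.
  have te : tau `^ e = 8 / (c * kappa) * t1 * (2 * kappa) `^ e.
    rewrite /tau powRM ?(ltW B0) ?powR_ge0// /B -!powRrM mulVf ?gt_eqF//.
    by rewrite !powRr1 ?(ltW t10) ?(ltW Bp)// mulrAC.
  rewrite powRN; apply: (@inv_from _ _ ((2 * kappa) `^ e)).
    by apply: powR_gt0; rewrite mulr_gt0.
  have X0 : 0 <= 2 * (2 * l) ^+ 2 by rewrite mulr_ge0// sqr_ge0.
  rewrite -te -(powRM _ X0 (ltW tau0)) (_ : 2 * (2 * l) ^+ 2 * tau = 2 * kappa)//.
  by rewrite -[in RHS]lE; ring.
have ploc x : h x != 0 -> 8 / c * t1 <= pot e h x.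
  move=> hx; apply: le_trans (pot_ge_box e0 e1 x hb h0 l2).
  rewrite pe (_ : I2 _ = kappa); last first.
    rewrite -hk; apply: eq_I2 => y.
    by have [->|hy] := eqVneq (h y) 0; [rewrite mul0r|rewrite inb// mulr1].
  rewrite le_eqVlt; apply/orP; left; apply/eqP; field.
  by rewrite !gt_eqF.
have := HL L LL1; set v := L `^ _ => hv.
pose P := 8 * t1 - (c * kappa + kappa * c * (2 * e)) * v.
have v0 : 0 <= v by exact: powR_ge0.
have q0 : 0 <= kappa * c * (2 * e) * v by rewrite !mulr_ge0// ltW.
have q1 : 0 <= (c * kappa + kappa * c * (2 * e)) * v.
  by rewrite mulr_ge0// addr_ge0// !mulr_ge0// ltW.
have P4 : 7 * t1 <= P.
  rewrite /P; move: hv q0 q1; rewrite mulrDl -mulrA.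
  move: ((c * kappa + _) * v) (kappa * c * _ * v) => A1 A2; move: t10; lra.
have hP x : h x != 0 -> P <= psi L h x + c * pot e h (bar x) * 0.
  move=> hx; rewrite mulr0 addr0.
  have /domP/andP[/andP[x1 x2] _] := hd x hx.
  have x2' : x.1 <= 2 * L by move: x2 L0; lra.
  apply: le_trans (psi_ge L0 ah x1 x2'); rewrite /P lerD2r.
  have := ler_wpM2l (ltW c0) (ploc x hx); rewrite (_ : c * (8 / c * t1) = 8 * t1)//.
  by field; rewrite gt_eqF.
have hJ x : J (h x) <= t1 * h x.
  apply: (conj_le_lin fm fz (ltW T0) (ltW t10) _ (h0 x)).
  rewrite /h /trial /rect; case: ifP => _; rewrite ?mulr1 ?mulr0//.
  exact: (nondecr_ge0 fm fz).
have P0 : 0 <= P by apply: le_trans P4; rewrite mulr_ge0// ltW.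
apply: le_trans (En_ge L0 ah hP hJ P0); rewrite -/v.
have q2 : kappa * c * (2 * e) * v <= t1 / 2.
  by move: hv q1; rewrite mulrDl -mulrA; move: (_ * v) (_ * v) => A1 A2; lra.
have h1 := ler_wpM2r (ltW k0) q2; have h2 := ler_wpM2r (ltW k0) P4.
move: h1 h2; move: (kappa * c * _ * v * kappa) => A1.
have := mulr_gt0 t10 k0; rewrite -(mulrA 7) (mulrAC t1) (mulrAC P).
move: (t1 * kappa) (P * kappa) => A2 A3; lra.
Qed.

End Trial.

(** * Lower bound for the level *)

Section Mass.
Context (R : realType) (e c kappa : R) (f : R -> R) (T Lam : R).
Context (e0 : 0 < e) (e1 : e < 1) (c0 : 0 < c) (k0 : 0 < kappa) (T0 : 0 < T).
Context (fm : forall t u : R, t <= u -> f t <= f u) (fz : forall t : R, t <= 0 -> f t = 0).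
Context (fT : f T <= Lam).
Context (potT : forall (r : R) (h : R * R -> R) x, bsup Lam r h -> (forall y, 0 <= h y) ->
  I2 h = kappa -> c * pot e h x <= T / 2).
Context (f0 : forall B : R, 0 < B -> exists2 t0 : R, 0 < t0 &
  forall t, 0 < t -> t < t0 -> B * t `^ e^-1 <= f t).
Implicit Types (x y z : R * R) (g h : R * R -> R) (L mu : R).
Local Notation J := (conj_f f T).
Local Notation adm := (adm kappa Lam).
Local Notation En := (En e c kappa f T).
Local Notation psi := (psi e c kappa).
Local Notation bath := (bath f).
Local Notation speed := (speed e c kappa).

(** If the potential stayed below [E0 / (c kappa)] on the support, the interaction energy would be
    at most [E0 / 2], and the other two terms only lower the energy. *)
Lemma energy_pot L h (E0 : R) : 0 < L -> adm L h -> 0 < E0 -> E0 <= En L h ->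
  exists2 x, h x != 0 & E0 / (c * kappa) <= pot e h x.
Proof.
move=> L0 ah E00 hE; have [hb h0 hd hk sh] := ah.
apply: contrapT => no.
have lt x : h x != 0 -> pot e h x <= E0 / (c * kappa).
  move=> hx; rewrite leNgt; apply/negP => /ltW lt; apply: no; by exists x.
have ck : 0 < c * kappa by rewrite mulr_gt0.
have ih := adm_ig ah.
have ihh := ig_mul_hpot e0 e1 fm fz fT L0 ah ah.
have hh : hen e h h <= E0 / (c * kappa) * kappa.
  rewrite -[X in _ * X]hk -(I2Z _ ih); apply: le_I2 => //; first exact: ig2Z.
  move=> x; have [->|hx] := eqVneq (h x) 0; first by rewrite mul0r mulr0.
  by rewrite mulrC ler_wpM2r// (le_trans (hpot_le _ _ hb h0))// lt.
have m0 : 0 <= speed L * mom h.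
  rewrite mulr_ge0 ?(speed_ge0 e0 c0 k0)//; apply: I2_ge0 => x.
  have [->|hx] := eqVneq (h x) 0; first by rewrite mulr0.
  by rewrite mulr_ge0// ltW// (adm_x1 L0 ah).
have j0 : 0 <= I2 (fun x => J (h x)) by apply: I2_ge0 => x; exact: (conj_ge0 fm fz (ltW T0)).
have := ler_wpM2l (divr_ge0 (ltW c0) (ler0n _ 2)) hh.
have -> : c / 2 * (E0 / (c * kappa) * kappa) = E0 / 2 by field; rewrite !gt_eqF.
by move: hE m0 j0; rewrite /En; move: (speed L * _) (I2 _) (_ / 2 * hen _ _ _) => A B D; lra.
Qed.

Lemma powR_m2e (r : R) : 0 < r -> (2 * (2 * r) ^+ 2) `^ (- e) = 8 `^ (- e) * r `^ (- (2 * e)).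
Proof.
move=> r0; have -> : 2 * (2 * r) ^+ 2 = 8 * r ^+ 2 by ring.
rewrite powRM ?sqr_ge0// -(powR_mulrn 2 (ltW r0)) -powRrM; congr (_ * _ `^ _); ring.
Qed.

(** Of the four squares of side [r] with corner [x0], the one pointing to the centre of the box
    stays inside it. *)
Lemma quarter_box L (r : R) x0 : 0 < r -> 2 * r <= L -> dom L x0 = 1 ->
  exists2 ab : R * R, (forall x, rect ab.1 (ab.1 + r) ab.2 (ab.2 + r) x = 1 ->
     dom L x = 1 /\ (`|x.1 - x0.1| <= r /\ `|x.2 - x0.2| <= r)) & True.
Proof.
move=> r0 rL /domP; rewrite ler_norml => /andP[/andP[a1 a2] /andP[b1 b2]].
pose a := if x0.1 <= L then x0.1 else x0.1 - r.
pose b := if x0.2 <= 0 then x0.2 else x0.2 - r.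
have ha : L / 2 <= a /\ a + r <= 3 * L / 2 by rewrite /a; case: (leP x0.1 L) => h; split; lra.
have hb : - (L / 2) <= b /\ b + r <= L / 2 by rewrite /b; case: (leP x0.2 0) => h; split; lra.
have ha' : a <= x0.1 <= a + r by rewrite /a; case: (leP x0.1 L) => h; apply/andP; split; lra.
have hb' : b <= x0.2 <= b + r by rewrite /b; case: (leP x0.2 0) => h; apply/andP; split; lra.
exists (a, b) => // x; rewrite /rect /=; case: ifP => [|_ /esym/eqP]; last by rewrite oner_eq0.
move=> /andP[/andP[h1 h2] /andP[h3 h4]] _; move: ha ha' hb hb' => [? ?] /andP[? ?] [? ?] /andP[? ?].
by split; [apply/domP|split]; rewrite ler_norml; apply/andP; split; try (apply/andP; split); lra.
Qed.

Lemma norm_box2 (u v w r r' : R) : `|u - v| <= r -> `|w - v| <= r' -> r' <= r -> `|w - u| <= 2 * r.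
Proof. by rewrite !ler_norml => /andP[? ?] /andP[? ?] ?; apply/andP; split; lra. Qed.

Lemma mu_arith (u v w t : R) : v - w <= u -> w <= t / 4 -> t <= v -> t / 2 <= u - 2 * (t / 8).
Proof. lra. Qed.

Lemma mass_arith (c' m p q I P : R) : 0 <= c' -> 0 <= p -> 0 <= q -> m <= I ->
  p * q * I <= P -> c' * m * p * q <= c' * P.
Proof.
move=> c'0 p0 q0 mI hP; rewrite -!mulrA ler_wpM2l//; apply: le_trans hP.
by rewrite mulrC ler_wpM2l// mulr_ge0.
Qed.

(** The mass found by [concentration] makes [c pot] at least [ar] on a square of side [r]; image,
    drift and level consume at most half of that. At [t = ar / 2] the growth of [f] gives
    [f t >= 2 kappa r^(-2)]: as [t] is proportional to [r^(-2 e)], the power [t^(1/e)] scales like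
    the inverse area, so the profile carries at least [2 kappa] on the square. *)
Lemma mass_lemma (E0 : R) : 0 < E0 -> exists mu0 L1 : R, [/\ 0 < mu0, 0 < L1 &
  forall L h, L1 <= L -> adm L h -> E0 <= En L h ->
    kappa < I2 (bath L (psi L h) (2 * mu0))].
Proof.
move=> E00; have A0 : 0 < E0 / (c * kappa) by rewrite divr_gt0// mulr_gt0.
have [R0 [m0 [R00 m00 Hc]]] := concentration e0 e1 A0 (Lam_ge0 fm fz fT) (ltW k0).
pose a := c * m0 * 8 `^ (- e).
have a0 : 0 < a by rewrite !mulr_gt0// powR_gt0.
have a2 : 0 < a / 2 by rewrite divr_gt0.
(* Normalized by [B (a / 2)^(1/e) = 2 kappa]. *)
pose B := 2 * kappa / (a / 2) `^ e^-1.
have B0 : 0 < B by rewrite divr_gt0 ?powR_gt0// mulr_gt0.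
have [t0 t00 Ht] := f0 B0.
have e2 : 0 < 2 * e by rewrite mulr_gt0.
have t02 : 0 < t0 / 2 by rewrite divr_gt0.
have [r1 r10 Hr1] := powN_small e2 (ltW a2) t02.
pose r := Num.max r1 R0.
have r0 : 0 < r by rewrite lt_max r10.
have rp : 0 < r `^ (- (2 * e)) by exact: powR_gt0.
pose ar := a * r `^ (- (2 * e)).
have ar0 : 0 < ar by rewrite mulr_gt0.
have ar4 : 0 < ar / 4 by rewrite divr_gt0.
have K0 : 0 <= c * kappa + kappa * c * (2 * e) by rewrite addr_ge0// !mulr_ge0// ltW.
have [L1 L10 HL] := powN_small e2 K0 ar4.
exists (ar / 8), (Num.max L1 (2 * r)); split; [by rewrite divr_gt0|by rewrite lt_max L10|].
move=> L h; rewrite ge_max => /andP[LL1 rL] ah hE.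
have L0 : 0 < L by exact: lt_le_trans LL1.
have [hb h0 hd hk sh] := ah.
have [x0 hx0 px0] := energy_pot L0 ah E00 hE.
have mx0 := Hc _ h x0 hb h0 hk px0.
have [[p q] hpq _] := quarter_box r0 rL (hd _ hx0).
have R0r : R0 <= r by rewrite le_max lexx orbT.
have r2 : 0 < 2 * r by rewrite mulr_gt0.
pose t := ar / 2.
have tE : t = a / 2 * r `^ (- (2 * e)) by rewrite /t /ar; ring.
have ft : 2 * kappa * r ^- 2 <= f t.
  have tlt : t < t0.
    apply: (@le_lt_trans _ _ (t0 / 2)); last by move: t00; lra.
    by rewrite tE Hr1// le_max lexx.
  have tp : 0 < t by rewrite divr_gt0.
  apply: le_trans (Ht t tp tlt); rewrite tE powRM ?(ltW a2) ?(ltW rp)// -powRrM.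
  have -> : - (2 * e) * e^-1 = - 2 by rewrite mulNr -mulrA mulfV ?gt_eqF// mulr1.
  rewrite powRN (powR_mulrn 2 (ltW r0)) /B mulrA ler_wpM2r ?invr_ge0 ?sqr_ge0//.
  by rewrite -mulrA mulVf ?mulr1// gt_eqF// powR_gt0.
have bge x : f t * rect p (p + r) q (q + r) x <= bath L (psi L h) (2 * (ar / 8)) x.
  have [rx|rx] : rect p (p + r) q (q + r) x = 1 \/ rect p (p + r) q (q + r) x = 0.
    by rewrite /rect; case: ifP; [left|right].
  2: by rewrite rx mulr0; apply: bath_ge0.
  have [d1 [h1 h2]] := hpq x rx; rewrite rx mulr1 /bath d1 mul1r; apply: fm.
  have /domP/andP[/andP[x1 x2] _] := d1.
  have x2' : x.1 <= 2 * L by move: x2 L0; lra.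
  have := psi_ge e0 e1 c0 k0 L0 ah x1 x2'; have := HL L LL1.
  have hm : m0 <= I2 (fun y => h y * ibox (2 * r) (y - x)).
    apply: (le_trans mx0); apply: le_I2; try exact: (ig2_mul_ibox _ _ hb).
    move=> y; rewrite ler_wpM2l// {1}/ibox; case: ifP => [/andP[/= h3 h4]|_]; last exact: ibox_ge0.
    by rewrite ibox1//=; [exact: norm_box2 h1 h3 R0r|exact: norm_box2 h2 h4 R0r].
  have := pot_ge_box e0 e1 x hb h0 r2; rewrite (powR_m2e r0) => hp.
  have : ar <= c * pot e h x.
    exact: mass_arith (ltW c0) (powR_ge0 _ _) (powR_ge0 _ _) hm hp.
  move=> k1 k2 k3; exact: mu_arith k3 k2 k1.
have pr : p <= p + r by rewrite lerDl ltW.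
have qr : q <= q + r by rewrite lerDl ltW.
have [sg sg0 Hg] := psi_good e0 e1 c0 k0 potT L0.
have m20 : 0 <= 2 * (ar / 8) by rewrite mulr_ge0// ltW// divr_gt0.
have ib := bsup_ig2 (bath_bsup T0 fm fz fT L0 (Hg h ah) m20).
apply: (@lt_le_trans _ _ (2 * kappa)); first by rewrite ltr_pMl// ltr1n.
have := le_I2 (ig2Z (f t) (ig2_rect pr qr)) ib bge.
rewrite (I2Z _ (ig2_rect pr qr)) (I2_rect pr qr) => hI; apply: le_trans hI.
have := ler_wpM2r (sqr_ge0 r) ft; rewrite mulfVK ?gt_eqF ?exprn_gt0// => hf.
by apply: (le_trans hf); rewrite le_eqVlt; apply/orP; left; apply/eqP; ring.
Qed.

(** The mass lemma is used at half of the trial energy, because [maximizer_exists] applies it to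
    nearly maximal densities as well. *)
Theorem core_existence : exists mu0 L1 : R, [/\ 0 < mu0, 0 < L1 &
  forall L, L1 <= L -> exists zt mu, [/\ adm L zt, mu0 <= mu,
    forall h, adm L h -> En L h <= En L zt & zt =1 bath L (psi L zt) mu]].
Proof.
have [E0 [L0 [E00 L00 HT]]] := trial_energy e0 e1 c0 k0 T0 fm fz fT f0.
have E02 : 0 < E0 / 2 by rewrite divr_gt0.
have [mu0 [L1 [mu00 L10 HM]]] := mass_lemma E02.
exists mu0, (Num.max L0 L1); split; [by []|by rewrite lt_max L00|].
move=> L; rewrite ge_max => /andP[LL0 LL1].
have Lp : 0 < L by exact: lt_le_trans LL0.
have [zt [mu [h1 h2 h3 h4 h5]]] := maximizer_exists e0 e1 c0 k0 T0 fm fz fT potT Lp E00 mu00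
  (HT L LL0) (fun h ah hE => HM L h LL1 ah hE).
by exists zt, mu; split.
Qed.

End Mass.

(** * Extent of the support *)

Section Vertical.
Context (R : realType).
Implicit Types (x y z : R * R) (g h : R * R -> R).

Definition below2 (t : R) x : R := if x.2 <= t then 1 else 0.
Definition below1 (t : R) x : R := if x.1 <= t then 1 else 0.

Lemma measurable_below1 t : measurable_fun [set: R * R] (below1 t).
Proof.
apply: measurable_fun_ifT; [|exact: measurable_cst|exact: measurable_cst].
by apply: measurable_fun_ler => //; exact: measurable_cst.
Qed.

Lemma measurable_below2 t : measurable_fun [set: R * R] (below2 t).
Proof.
apply: measurable_fun_ifT; [|exact: measurable_cst|exact: measurable_cst].
by apply: measurable_fun_ler => //; exact: measurable_cst.
Qed.

Lemma below1_le1 t x : `|below1 t x| <= 1.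
Proof. by rewrite /below1; case: ifP => _; rewrite ?normr1 ?normr0. Qed.

Lemma below2_le1 t x : `|below2 t x| <= 1.
Proof. by rewrite /below2; case: ifP => _; rewrite ?normr1 ?normr0. Qed.

(* Disjoint boxes around points of the support carry mass [m0] each, so there are at most [n]
   of them; by symmetry and monotonicity in [|x.2|] they fill the whole vertical extent. *)
Lemma vertical_extent (M r R0 m0 k : R) (n : nat) h : bsup M r h -> (forall x, 0 <= h x) ->
  sdec h -> 0 < R0 -> I2 h = k -> k < n.+1%:R * m0 ->
  (forall x, h x != 0 -> m0 <= I2 (fun y => h y * ibox R0 (y - x))) ->
  forall x, h x != 0 -> `|x.2| < n%:R * (3 * R0).
Proof.
move=> hb h0 sh R00 hk kn Hm x hx; rewrite ltNge; apply/negP => xn.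
have ih := bsup_ig2 hb.
have iu t : ig2 (fun y => h y * below2 t y).
  exact: ig2_mul_bd ih (measurable_below2 t) (below2_le1 t).
(* The centres are [3 R0] apart, more than the side [2 R0], and lie in the support because [h]
   decreases in [|x.2|]; the lowest is on the axis. *)
have claim j : (j <= n)%N -> j.+1%:R * m0 <= I2 (fun y => h y * below2 (j%:R * (3 * R0) + R0) y).
  elim: j => [|j IH] jn.
    have h00 : h (x.1, 0) != 0.
      rewrite gt_eqF//; apply: (@lt_le_trans _ _ (h x)); first by rewrite lt_neqAle eq_sym hx h0.
      by case: (x) => a b /=; apply: sh; rewrite normr0.
    rewrite mul1r mul0r add0r; apply: (le_trans (Hm _ h00)); apply: le_I2.
    - exact: ig2_mul_ibox hb.
    - exact: iu.
    - move=> y; rewrite ler_wpM2l// /ibox /below2; case: ifP => [/andP[_ /=]|_]; last by case: ifP.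
      by rewrite subr0 => /ler_normlW ->.
  have jx : h (x.1, j.+1%:R * (3 * R0)) != 0.
    rewrite gt_eqF//; apply: (@lt_le_trans _ _ (h x)); first by rewrite lt_neqAle eq_sym hx h0.
    case: (x) xn => a b /= xn; apply: sh; apply: le_trans xn.
    rewrite ger0_norm ?mulr_ge0// ?(ltW R00)// ler_wpM2r ?mulr_ge0 ?(ltW R00)//.
    by rewrite ler_nat.
  have IHj := IH (ltnW jn); have Mj := Hm _ jx.
  have -> : j.+2%:R * m0 = j.+1%:R * m0 + m0 by rewrite -[in LHS]addn1 natrD mulrDl mul1r.
  apply: (le_trans (lerD IHj Mj)); rewrite -(I2D (iu _) (ig2_mul_ibox _ _ hb)).
  apply: le_I2; [exact: ig2D (iu _) (ig2_mul_ibox _ _ hb)|exact: iu|].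
  move=> y; rewrite -mulrDr ler_wpM2l// /below2 /ibox /=.
  have -> : j.+1%:R * (3 * R0) = j%:R * (3 * R0) + 3 * R0 by rewrite -addn1 natrD mulrDl mul1r.
  move: (j%:R * (3 * R0)) => s.
  case: (leP y.2 (s + R0)) => y1; case: (leP y.2 (s + 3 * R0 + R0)) => y2;
    case: ifP => [/andP[_]|_]; rewrite ?ler_norml ?addr0 ?add0r//; try lra;
    move=> /andP[? ?]; lra.
have := claim n (leqnn n); apply/negP; rewrite -ltNge; apply: le_lt_trans kn; rewrite -hk.
apply: le_I2 (iu _) ih _ => y; rewrite -[leRHS]mulr1 ler_wpM2l//.
exact: le_trans (ler_norm _) (below2_le1 _ _).
Qed.

(* The same count in [x.1], where the absence of large gaps is assumed instead. *)
Lemma horizontal_extent (M r R0 m0 k G : R) (n : nat) h : bsup M r h -> (forall x, 0 <= h x) ->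
  0 < R0 -> 0 < G -> I2 h = k -> k < n.+1%:R * m0 ->
  (forall x, h x != 0 -> m0 <= I2 (fun y => h y * ibox R0 (y - x))) ->
  (forall t x y, h x != 0 -> x.1 <= t -> h y != 0 -> t < y.1 ->
    exists2 z, h z != 0 & t < z.1 <= t + G) ->
  forall x y, h x != 0 -> h y != 0 -> y.1 - x.1 < n%:R * (2 * R0 + G).
Proof.
move=> hb h0 R00 G0 hk kn Hm Hg x y hx hy; rewrite ltNge; apply/negP => xn.
have ih := bsup_ig2 hb.
have iu t : ig2 (fun y => h y * below1 t y).
  exact: ig2_mul_bd ih (measurable_below1 t) (below1_le1 t).
(* The next point is taken beyond [z.1 + 2 R0], at most [G] farther by the gap hypothesis, so its
   box is disjoint from the mass counted so far. *)
have claim j : (j <= n)%N -> exists z, [/\ h z != 0, z.1 <= x.1 + j%:R * (2 * R0 + G) &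
    j.+1%:R * m0 <= I2 (fun y => h y * below1 (z.1 + R0) y)].
  elim: j => [|j IH] jn.
    exists x; split=> //; first by rewrite mul0r addr0.
    rewrite mul1r; apply: (le_trans (Hm _ hx)); apply: le_I2.
    - exact: ig2_mul_ibox hb.
    - exact: iu.
    - move=> z; rewrite ler_wpM2l// /ibox /below1; case: ifP => [/andP[/= + _]|_]; last by case: ifP.
      by move=> /ler_normlW; rewrite lerBlDl => ->.
  have [z [hz zx mz]] := IH (ltnW jn).
  have jE : j.+1%:R * (2 * R0 + G) = j%:R * (2 * R0 + G) + (2 * R0 + G).
    by rewrite -addn1 natrD mulrDl mul1r.
  have jnS : j.+1%:R * (2 * R0 + G) <= n%:R * (2 * R0 + G).
    by rewrite ler_wpM2r ?ler_nat// addr_ge0 ?mulr_ge0// ltW.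
  have zt : z.1 <= z.1 + 2 * R0 by rewrite lerDl mulr_ge0// ltW.
  have ty : z.1 + 2 * R0 < y.1.
    by move: zx xn jnS G0; rewrite jE; move: (j%:R * _) (n%:R * _) => u v; lra.
  have [z' hz' /andP[z'1 z'2]] := Hg _ z y hz zt hy ty.
  exists z'; split => //.
    by move: z'2 zx; rewrite jE; move: (j%:R * _) => u; lra.
  have Mz := Hm _ hz'.
  have -> : j.+2%:R * m0 = j.+1%:R * m0 + m0 by rewrite -[in LHS]addn1 natrD mulrDl mul1r.
  apply: (le_trans (lerD mz Mz)); rewrite -(I2D (iu _) (ig2_mul_ibox _ _ hb)).
  apply: le_I2; [exact: ig2D (iu _) (ig2_mul_ibox _ _ hb)|exact: iu|].
  move=> w; rewrite -mulrDr ler_wpM2l// /below1 /ibox /=.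
  case: (leP w.1 (z.1 + R0)) => w1; case: (leP w.1 (z'.1 + R0)) => w2;
    case: ifP => [/andP[+ _]|_]; rewrite ?ler_norml ?addr0 ?add0r//; try (by []);
    try (by move: z'1 R00 w1 w2; lra);
    by move=> /andP[? ?]; move: z'1 R00 w1 w2; lra.
have [z [_ _]] := claim n (leqnn n); apply/negP; rewrite -ltNge; apply: le_lt_trans kn; rewrite -hk.
apply: le_I2 (iu _) ih _ => w; rewrite -[leRHS]mulr1 ler_wpM2l//.
exact: le_trans (ler_norm _) (below1_le1 _ _).
Qed.

End Vertical.

(** * Horizontal translations *)

Section Translation.
Context (R : realType).
Implicit Types (x y z : R * R) (g h : R * R -> R).

Definition tr (a : R) h x : R := h (x.1 + a, x.2).

Lemma trE a h : tr a h = fun x => h (x + (a, 0)).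
Proof. by apply/funext => x; rewrite /tr; congr h; apply: pairP => /=; rewrite ?addr0. Qed.

Lemma I2_tr a h : ig2 h -> ig2 (tr a h) /\ I2 (tr a h) = I2 h.
Proof. by rewrite trE; exact: I2_translate. Qed.

Lemma measurable_tr a h : measurable_fun [set: R * R] h -> measurable_fun [set: R * R] (tr a h).
Proof.
move=> mh; apply: (measurableT_comp mh); apply: measurable_fun_pair => //=.
by apply: measurable_funD => //; exact: measurable_cst.
Qed.

Lemma sdec_tr a h : sdec h -> sdec (tr a h).
Proof. by move=> sh u v w vw; exact: sh. Qed.

Lemma pot_tr (e M r a : R) h x : 0 <= e -> e < 1 -> bsup M r h ->
  pot e (tr a h) x = pot e h (x.1 + a, x.2).
Proof.
move=> e0 e1 hb; have [_ E] := I2_tr a (pot_ig2 (x.1 + a, x.2) e0 e1 hb).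
rewrite /pot -E; apply: eq_I2 => y; rewrite /tr; congr (_ * _); congr (kp e _).
by apply: pairP => /=; ring.
Qed.

Lemma en_tr (e M r a : R) g h : 0 <= e -> e < 1 -> 0 < r -> bsup M r g -> bsup M r h ->
  en e (tr a g) (tr a h) = en e g h.
Proof.
move=> e0 e1 r0 gb hb.
have [_ E] := I2_tr a (bsup_ig2 (en_bsup e0 e1 r0 gb hb)).
by rewrite /en -E; apply: eq_I2 => x; rewrite (pot_tr _ _ e0 e1 hb).
Qed.

Lemma mom_tr (a : R) h : ig2 h -> ig2 (fun x => x.1 * h x) ->
  mom (tr a h) = mom h - a * I2 h.
Proof.
move=> ih im; have ia := ig2Z a ih.
rewrite -(I2Z _ ih) /mom -(I2B im ia).
have [_ <-] := I2_tr a (ig2B im ia); apply: eq_I2 => x; rewrite /tr /=; ring.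
Qed.

(** A set such as [zt != 0] need not be closed, so a rightmost point is replaced by one within [1]
    of the supremum. *)
Lemma near_max (P : R * R -> Prop) (C : R) x : P x -> (forall y, P y -> y.1 <= C) ->
  exists2 x0, P x0 & forall y, P y -> y.1 <= x0.1 + 1.
Proof.
move=> Px PC; pose V := [set y.1 | y in [set y | P y]].
have Vub : has_ubound V by exists C => v [y Py <-]; exact: PC.
have Vne : V !=set0 by exists x.1; exists x.
have [v [y Py <-] hv] := sup_adherent ltr01 (conj Vne Vub).
exists y => // z Pz; have : z.1 <= sup V by apply: (ub_le_sup Vub); exists z.
by move: hv; lra.
Qed.

Lemma near_min (P : R * R -> Prop) (C : R) x : P x -> (forall y, P y -> C <= y.1) ->
  exists2 x0, P x0 & forall y, P y -> x0.1 - 1 <= y.1.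
Proof.
move=> Px PC; have Pb : P (bar (bar x)) by rewrite barK.
have [|x0 Px0 H] := @near_max (fun y => P (bar y)) (- C) (bar x) Pb.
  by move=> y /PC; rewrite /bar /= lerNr.
by exists (bar x0) => // y Py; have := H (bar y); rewrite barK => /(_ Py); rewrite /bar /=; lra.
Qed.

End Translation.

Section Gap.
Context (R : realType) (e c kappa : R) (f : R -> R) (T Lam : R).
Context (e0 : 0 < e) (e1 : e < 1) (c0 : 0 < c) (k0 : 0 < kappa) (T0 : 0 < T).
Context (fm : forall t u : R, t <= u -> f t <= f u) (fz : forall t : R, t <= 0 -> f t = 0).
Context (fT : f T <= Lam).
Implicit Types (x y z : R * R) (g h : R * R -> R) (L mu : R).
Local Notation J := (conj_f f T).
Local Notation adm := (adm kappa Lam).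
Local Notation En := (En e c kappa f T).
Local Notation speed := (speed e c kappa).

(** The mirror interaction is at most [L^(-2 e) kappa^2], so the gap argument may work with the
    translation invariant [en]. *)
Lemma hen_lower L h : 0 < L -> adm L h -> en e h h - L `^ (- (2 * e)) * kappa * kappa <= hen e h h.
Proof.
move=> L0 ah; have [hb h0 hd hk sh] := ah; have L2 : 0 < 2 * L by rewrite mulr_gt0.
rewrite (henE (ltW e0) e1 L2 hb hb) lerD2l lerN2.
have ih := bsup_ig2 hb.
rewrite -[X in _ * X]hk -(I2Z _ ih) /en; apply: le_I2.
- exact: bsup_ig2 (en_bsup (ltW e0) e1 L2 hb (bsup_bar hb)).
- exact: ig2Z.
move=> x; have [->|hx] := eqVneq (h x) 0; first by rewrite mulr0 mul0r.
rewrite mulrC ler_wpM2r// (pot_bar (ltW e0) e1 _ hb).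
by have /domP/andP[/andP[x1 _] _] := hd x hx; exact: (img_le e0 e1 L0 ah x1).
Qed.

Lemma hen_upper L h : 0 < L -> adm L h -> hen e h h <= en e h h.
Proof.
move=> L0 ah; have [hb h0 hd hk sh] := ah; have L2 : 0 < 2 * L by rewrite mulr_gt0.
rewrite (henE (ltW e0) e1 L2 hb hb) gerBl; apply: I2_ge0 => x.
by rewrite mulr_ge0// pot_ge0.
Qed.

Lemma sqr_abs_le' (x y : R) : `|x| <= `|y| -> x ^+ 2 <= y ^+ 2.
Proof. by move=> xy; rewrite -(real_normK (num_real y)); exact: sqr_abs_le. Qed.

Lemma gap_norm1 (z1 w1 x1 y1 R0 R1 : R) : `|z1 - x1| <= R0 -> `|w1 - y1| <= R0 ->
  y1 = x1 + 3 -> 0 <= R0 -> 0 <= R1 -> `|w1 - z1| <= 3 + 2 * R0 + 2 * R1.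
Proof. by rewrite !ler_norml => /andP[? ?] /andP[? ?] ? ? ?; apply/andP; split; lra. Qed.

Lemma gap_norm2 (z2 w2 x2 y2 R0 R1 : R) : `|z2 - x2| <= R0 -> `|w2 - y2| <= R0 ->
  `|x2| <= R1 -> `|y2| <= R1 -> 0 <= R0 -> 0 <= R1 -> `|w2 - z2| <= 3 + 2 * R0 + 2 * R1.
Proof. by rewrite !ler_norml => /andP[? ?] /andP[? ?] /andP[? ?] /andP[? ?] ? ?; apply/andP; split; lra. Qed.

Lemma far_arith (a b t G : R) : 0 < G -> a <= t -> t + G < b -> `|G| <= `|a - b|.
Proof.
move=> G0 h1 h2; rewrite (ger0_norm (ltW G0)) distrC ger0_norm; lra.
Qed.

Lemma sep_arith1 (z x t G R0 : R) : `|z - x| <= R0 -> t + G < z -> x <= t -> R0 + 3 <= G ->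
  0 < R0 -> False.
Proof. by rewrite ler_norml => /andP[_ ?] ? ? ? ?; lra. Qed.

Lemma sep_arith2 (z y t G R0 : R) : `|z - y| <= R0 -> z <= t -> t + G < y -> R0 + 3 <= G ->
  0 < R0 -> False.
Proof. by rewrite ler_norml => /andP[? _] ? ? ? ?; lra. Qed.

Lemma en_arith (A B u v g K : R) : u <= K -> g <= v ->
  A + B + 2 * u + 2 * (g - K) <= A + B + 2 * v.
Proof. lra. Qed.

Lemma gap_arith (c' S m m' j A A' B C g K k : R) : 0 < c' -> 0 <= S -> m' <= m ->
  A' - K <= B -> C <= A -> 0 < g -> A + 2 * (g - k) <= A' -> K <= g / 4 -> k <= g / 4 ->
  c' / 2 * B - S * m' - j <= c' / 2 * C - S * m - j -> False.
Proof.
move=> c'0 S0 mm h1 h2 g0 h3 h4 h5 h6.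
have h7 : S * m' <= S * m by rewrite ler_wpM2l.
have h8 : c' / 2 * B <= c' / 2 * C by lra.
have : B <= C by rewrite -(ler_pM2l (_ : 0 < c' / 2))// divr_gt0.
lra.
Qed.

(** If the strip were empty, moving the part on its right to the left, up to a distance of order
    one, would raise the interaction of the two parts from at most [g / 4] to at least [g]. The
    mirror interaction costs at most [g / 4], the drift term improves, and the dual term is
    unchanged because the supports stay disjoint. *)
Lemma no_gap (R0 R1 m0 G L : R) zt : 0 < L -> adm L zt ->
  (forall h, adm L h -> En L h <= En L zt) -> 0 < R0 -> 0 <= R1 -> 0 < m0 ->
  (forall x, zt x != 0 -> m0 <= I2 (fun y => zt y * ibox R0 (y - x))) ->
  (forall x, zt x != 0 -> `|x.2| <= R1) ->
  let g := (2 * (3 + 2 * R0 + 2 * R1) ^+ 2) `^ (- e) * m0 * m0 in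
  R0 + 3 <= G -> G `^ (- (2 * e)) * kappa * kappa <= g / 4 ->
  L `^ (- (2 * e)) * kappa * kappa <= g / 4 ->
  forall (t : R) x y, zt x != 0 -> x.1 <= t -> zt y != 0 -> t < y.1 ->
    exists2 z, zt z != 0 & t < z.1 <= t + G.
Proof.
move=> L0 az zmax R00 R10 m00 Hm HR1 g RG Gg Lg t x y zx xt zy ty.
apply: contrapT => no.
have G0 : 0 < G by move: RG R00; lra.
pose rho := 3 + 2 * R0 + 2 * R1.
have rho0 : 0 < rho by rewrite /rho; move: R00 R10; lra.
have alt z : zt z != 0 -> z.1 <= t \/ t + G < z.1.
  move=> zz; have [h|h] := leP z.1 t; [by left|right].
  by rewrite ltNge; apply/negP => h'; apply: no; exists z; rewrite ?h ?h'.
have [zb z0 zd zk sz] := az.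
have L2 : 0 < 2 * L by rewrite mulr_gt0.
have zdom z : zt z != 0 -> L / 2 <= z.1 <= 3 * L / 2 by move=> /zd/domP/andP[].
have [x0 [zx0 x0t] Hx0] : exists2 x0, (zt x0 != 0 /\ x0.1 <= t) &
    forall z, (zt z != 0 /\ z.1 <= t) -> z.1 <= x0.1 + 1.
  apply: (@near_max R (fun z => zt z != 0 /\ z.1 <= t) (3 * L / 2) x) => // z [/zdom/andP[]//].
have [y0 [zy0 y0t] Hy0] : exists2 y0, (zt y0 != 0 /\ t < y0.1) &
    forall z, (zt z != 0 /\ t < z.1) -> y0.1 - 1 <= z.1.
  apply: (@near_min R (fun z => zt z != 0 /\ t < z.1) (L / 2) y) => // z [/zdom/andP[]//].
have y0G : t + G < y0.1 by have [|//] := alt _ zy0; rewrite leNgt y0t.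
(* One unit for each of the two inexact extremal points, and one to keep the parts disjoint after
   the shift. *)
pose b := y0.1 - x0.1 - 3.
have b0 : 0 <= b by rewrite /b; move: x0t y0G RG R00; lra.
pose l z := zt z * below1 t z; pose r z := zt z - l z.
have lP z : l z = zt z /\ r z = 0 /\ (zt z != 0 -> z.1 <= t) \/
            l z = 0 /\ r z = zt z /\ (zt z != 0 -> t + G < z.1 /\ y0.1 - 1 <= z.1).
  rewrite /r /l /below1; case: (leP z.1 t) => h; [left|right]; rewrite ?mulr1 ?mulr0 ?subrr ?subr0.
    by split.
  split=> //; split=> // zz; split; last exact: Hy0.
  by have [|//] := alt _ zz; rewrite leNgt h.
have [mz zM zr] := zb.
have lb : bsup Lam (2 * L) l.
  split.
  - exact: measurable_funM mz (measurable_below1 t).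
  - by move=> z; have [[-> _]|[-> _]] := lP z; rewrite ?normr0// (le_trans _ (zM z)).
  - by move=> z; rewrite /l mulf_eq0 negb_or => /andP[/zr].
have rb : bsup Lam (2 * L) r.
  split.
  - exact: measurable_funB mz (let: And3 m _ _ := lb in m).
  - by move=> z; have [[_ [-> _]]|[_ [-> _]]] := lP z; rewrite ?normr0// (le_trans _ (zM z)).
  - by move=> z; have [[_ [-> _]]|[_ [-> _]]] := lP z; [rewrite eqxx|exact: zr].
have l0 z : 0 <= l z by have [[-> _]|[-> _]] := lP z.
have r0 z : 0 <= r z by have [[_ [-> _]]|[_ [-> _]]] := lP z.
have rpos z : tr b r z != 0 -> dom L z = 1 /\ x0.1 + 2 <= z.1.
  rewrite /tr; have [[_ [-> _]]|[_ [-> H]]] := lP (z.1 + b, z.2); first by rewrite eqxx.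
  move=> zz; have [/= H1 H2] := H zz.
  have /domP/andP[/andP[/= d1 d2] d3] := zd _ zz.
  have /andP[e3 e4] := zdom _ zx0.
  split; last by move: H2; rewrite /b; lra.
  by apply/domP; rewrite d3 andbT; apply/andP; split; move: H2; rewrite /b; lra.
have lpos z : l z != 0 -> dom L z = 1 /\ z.1 <= x0.1 + 1.
  have [[-> [_ H]]|[-> _]] := lP z; last by rewrite eqxx.
  by move=> zz; split; [exact: zd|apply: Hx0; split => //; exact: H].
have trb : bsup Lam (2 * L) (tr b r).
  split.
  - exact: measurable_tr (let: And3 m _ _ := rb in m).
  - by move=> z; have [_ h3 _] := rb; exact: h3.
  - by move=> z /rpos[/(dom_inbox (ltW L0))].
pose h z := l z + tr b r z.
have excl z : l z = 0 \/ tr b r z = 0.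
  have [|hl] := eqVneq (l z) 0; [by left|right].
  apply/eqP/negPn/negP => /rpos[_ h2]; have [_ h1] := lpos z hl.
  by move: h1 h2; lra.
have il := bsup_ig2 lb; have ir := bsup_ig2 rb; have itr := bsup_ig2 trb.
have Eh z : l z + r z = zt z by rewrite /r addrC subrK.
have mass : I2 l + I2 r = kappa by rewrite -(I2D il ir) (eq_I2 Eh).
have ah : adm L h.
  split.
  - have [mh _ hr] := bsupD lb trb; split => //.
    by move=> z; rewrite /h; have [->|->] := excl z; rewrite ?add0r ?addr0; [case: trb|case: lb].
  - by move=> z; rewrite addr_ge0// /tr.
  - move=> z; rewrite /h; have [->|->] := excl z; rewrite ?add0r ?addr0; first by move=> /rpos[].
    by move=> /lpos[].
  - by rewrite /h (I2D il itr) (I2_tr b ir).2.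
  - move=> u v w vw; rewrite /h lerD//.
      by rewrite /l /below1 /= ler_wpM2r//; [case: ifP|exact: sz].
    rewrite /tr /=; have [[_ [-> _]]|[_ [-> H]]] := lP (u + b, w); first exact: r0.
    have [[h1 [h2 h3]]|[_ [-> _]]] := lP (u + b, v); last exact: sz.
    rewrite h2; have [->//|zw] := eqVneq (zt (u + b, w)) 0.
    have [/= H1 _] := H zw.
    have zv : zt (u + b, v) != 0.
      rewrite gt_eqF//; apply: (@lt_le_trans _ _ (zt (u + b, w))); last exact: sz.
      by rewrite lt_neqAle eq_sym zw z0.
    have /= h4 := h3 zv; exfalso; move: H1 h4 RG R00; lra.
have J00 : J 0 = 0 by exact: (conj0 fm fz (ltW T0)).
have Jm := conj_meas fm fz (ltW T0).
have iJ g' : bsup Lam (2 * L) g' -> (forall z, 0 <= g' z) -> ig2 (fun z => J (g' z)).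
  move=> gb g0; apply: (ig2_le _ _ (ig2Z T (bsup_ig2 gb))).
    by apply: (measurableT_comp Jm); case: gb.
  move=> z; rewrite ger0_norm; first by apply: conj_leT => //; exact: ltW.
  exact: (conj_ge0 fm fz (ltW T0)).
have JE : I2 (fun z => J (h z)) = I2 (fun z => J (zt z)).
  have -> : I2 (fun z => J (h z)) = I2 (fun z => J (l z)) + I2 (tr b (fun z => J (r z))).
    rewrite -(I2D (iJ _ lb l0) (I2_tr b (iJ _ rb r0)).1); apply: eq_I2 => z.
    rewrite /h; have := excl z; rewrite /tr => -[->|->].
      by rewrite add0r J00 add0r.
    by rewrite addr0 J00 addr0.
  rewrite (I2_tr b (iJ _ rb r0)).2 -(I2D (iJ _ lb l0) (iJ _ rb r0)).
  by apply: eq_I2 => z; have [[-> [-> _]]|[-> [-> _]]] := lP z; rewrite J00 ?addr0 ?add0r.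
have ix g' : bsup Lam (2 * L) g' -> ig2 (fun z => z.1 * g' z).
  move=> gb; have m1 : measurable_fun [set: R * R] (@fst R R) by exact: measurable_fst.
  have := bsup_ig2 (bsupM gb m1 (fun z p1 _ => p1) (ltW L2)).
  by apply: eq_ig2 => z; exact: mulrC.
have momle : mom h <= mom zt.
  have -> : mom h = mom l + mom (tr b r).
    rewrite /mom -(I2D (ix _ lb) (ix _ trb)); apply: eq_I2 => z; by rewrite /h mulrDr.
  have -> : mom zt = mom l + mom r.
    rewrite /mom -(I2D (ix _ lb) (ix _ rb)); apply: eq_I2 => z; by rewrite -Eh mulrDr.
  by rewrite lerD2l (mom_tr _ ir (ix _ rb)) gerBl mulr_ge0// I2_ge0.
have enh : en e h h = en e l l + en e r r + 2 * en e l (tr b r).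
  rewrite (enDl (ltW e0) e1 L2 lb trb (bsupD lb trb)).
  rewrite !(enDr (ltW e0) e1 L2 lb trb lb) (enDr (ltW e0) e1 L2 lb trb trb).
  rewrite (en_tr _ (ltW e0) e1 L2 rb rb) (enC (ltW e0) e1 L2 trb lb).
  by move: (en e l l) (en e l _) (en e r r) => A B C; ring.
have enz : en e zt zt = en e l l + en e r r + 2 * en e l r.
  have -> : zt = (fun z => l z + r z) by apply/funext => z; rewrite Eh.
  rewrite (enDl (ltW e0) e1 L2 lb rb (bsupD lb rb)).
  rewrite !(enDr (ltW e0) e1 L2 lb rb lb) (enDr (ltW e0) e1 L2 lb rb rb).
  rewrite (enC (ltW e0) e1 L2 rb lb).
  by move: (en e l l) (en e l _) (en e r r) => A B C; ring.
have Il : I2 l <= kappa by rewrite -mass lerDl I2_ge0.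
have Ir : I2 r <= kappa by rewrite -mass lerDr I2_ge0.
have Gp : 0 <= G `^ (- (2 * e)) by exact: powR_ge0.
have enlr : en e l r <= G `^ (- (2 * e)) * kappa * kappa.
  apply: (@le_trans _ _ (G `^ (- (2 * e)) * kappa * I2 l)); last first.
    by rewrite ler_wpM2l// mulr_ge0// ltW.
  rewrite -(I2Z _ il) /en; apply: le_I2.
  - exact: bsup_ig2 (en_bsup (ltW e0) e1 L2 lb rb).
  - exact: ig2Z.
  move=> z; have [->|lz] := eqVneq (l z) 0; first by rewrite mul0r mulr0.
  rewrite mulrC ler_wpM2r//; apply: (@le_trans _ _ (G `^ (- (2 * e)) * I2 r)); last first.
    by rewrite ler_wpM2l.
  apply: (pot_le_far e0 e1 rb r0) => w rw; apply: (kp_far (ltW e0) G0).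
  have zt1 : z.1 <= t.
    by move: lz; have [[-> [_ H]] //|[-> _]] := lP z; rewrite eqxx.
  have wt : t + G < w.1.
    by move: rw; have [[_ [-> _]]|[_ [-> H]]] := lP w; [rewrite eqxx|move=> /H[]].
  rewrite /nrm2 -[leLHS]addr0 lerD ?sqr_ge0//; apply: sqr_abs_le' => //=.
  exact: far_arith G0 zt1 wt.
(* After the shift the two boxes of half-side [R0] have centres at horizontal distance [3] and at
   heights of modulus at most [R1], so their points differ by at most [rho] in each coordinate. *)
pose q := (2 * rho ^+ 2) `^ (- e).
have q0 : 0 <= q by exact: powR_ge0.
have massl : m0 <= I2 (fun z => l z * ibox R0 (z - x0)).
  apply: (le_trans (Hm _ zx0)); apply: le_I2; [exact: ig2_mul_ibox zb|exact: ig2_mul_ibox lb|].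
  move=> z; rewrite /ibox; case: ifP => [/andP[/= h1 _]|_]; last by rewrite !mulr0.
  rewrite !mulr1; have [[-> _]//|[_ [_ H]]] := lP z.
  have [->//|zz] := eqVneq (zt z) 0; have [h2 _] := H zz.
  by have := sep_arith1 h1 h2 x0t RG R00.
have massr : m0 <= I2 (fun z => tr b r z * ibox R0 (z - (y0.1 - b, y0.2))).
  have [_ E] := I2_tr b (ig2_mul_ibox R0 y0 rb).
  have -> : I2 (fun z => tr b r z * ibox R0 (z - (y0.1 - b, y0.2))) = I2 (fun z => r z * ibox R0 (z - y0)).
    rewrite -E; apply: eq_I2 => z; rewrite /tr; congr (_ * ibox R0 _).
    by apply: pairP => /=; ring.
  apply: (le_trans (Hm _ zy0)); apply: le_I2; [exact: ig2_mul_ibox zb|exact: ig2_mul_ibox rb|].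
  move=> z; rewrite /ibox; case: ifP => [/andP[/= h1 _]|_]; last by rewrite !mulr0.
  rewrite !mulr1; have [[_ [_ H]]|[_ [-> _]]//] := lP z.
  have [->//|zz] := eqVneq (zt z) 0; have h2 := H zz.
  by have := sep_arith2 h1 h2 y0G RG R00.
have enlr' : g <= en e l (tr b r).
  apply: (@le_trans _ _ (q * m0 * I2 (fun z => l z * ibox R0 (z - x0)))).
    by rewrite /g -/rho -/q ler_wpM2l// mulr_ge0// ltW.
  have ilx := ig2_mul_ibox R0 x0 lb.
  rewrite -(I2Z _ ilx) /en; apply: le_I2; first exact: ig2Z.
    exact: bsup_ig2 (en_bsup (ltW e0) e1 L2 lb trb).
  move=> z; rewrite mulrCA ler_wpM2l//.
  rewrite {1}/ibox; case: ifP => [/andP[/= h1 h2]|_]; last by rewrite mulr0; apply: pot_ge0 => w; exact: r0.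
  rewrite mulr1; apply: le_trans (pot_ge_box e0 e1 z trb _ rho0); last by move=> w; exact: r0.
  rewrite -/q ler_wpM2l//; apply: (le_trans massr); apply: le_I2; try exact: ig2_mul_ibox trb.
  move=> w; rewrite ler_wpM2l//; first exact: r0.
  rewrite {1}/ibox; case: ifP => [/andP[/= h3 h4]|_]; last exact: ibox_ge0.
  have X2 := HR1 _ zx0; have Y2 := HR1 _ zy0.
  rewrite ibox1//=; last exact: gap_norm2 h2 h4 X2 Y2 (ltW R00) R10.
  by apply: gap_norm1 h1 h3 _ (ltW R00) R10; rewrite /b; ring.
have g0 : 0 < g.
  by rewrite /g -/rho !mulr_gt0// powR_gt0// mulr_gt0// exprn_gt0.
have h1 : en e zt zt + 2 * (g - G `^ (- (2 * e)) * kappa * kappa) <= en e h h.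
  by rewrite enh enz; exact: en_arith enlr enlr'.
have h2 := zmax h ah; rewrite /En JE in h2.
exact: (gap_arith c0 (speed_ge0 e0 c0 k0 L) momle (hen_lower L0 ah) (hen_upper L0 az) g0 h1 Lg Gg h2).
Qed.

End Gap.

(** * Position of the support *)

Section Location.
Context (R : realType) (e c kappa : R) (f : R -> R) (T Lam : R).
Context (e0 : 0 < e) (e1 : e < 1) (c0 : 0 < c) (k0 : 0 < kappa) (T0 : 0 < T).
Context (fm : forall t u : R, t <= u -> f t <= f u) (fz : forall t : R, t <= 0 -> f t = 0).
Context (fT : f T <= Lam).
Implicit Types (x y z : R * R) (g h : R * R -> R) (L mu : R).
Local Notation J := (conj_f f T).
Local Notation adm := (adm kappa Lam).
Local Notation En := (En e c kappa f T).
Local Notation speed := (speed e c kappa).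
Local Notation psi := (psi e c kappa).
Local Notation bath := (bath f).

Lemma pot_diff_le (M r Q : R) h u v : bsup M r h -> (forall y, 0 <= h y) ->
  (forall y, h y != 0 -> kp e (u - y) - kp e (v - y) <= Q) ->
  pot e h u - pot e h v <= Q * I2 h.
Proof.
move=> hb h0 hQ; have Iu := pot_ig2 u (ltW e0) e1 hb; have Iv := pot_ig2 v (ltW e0) e1 hb.
rewrite /pot -(I2B Iu Iv) -(I2Z _ (bsup_ig2 hb)); apply: le_I2 => //.
- exact: ig2B.
- exact/ig2Z/(bsup_ig2 hb).
- move=> y; rewrite -mulrBl; have [->|/hQ hy] := eqVneq (h y) 0; first by rewrite !mulr0.
  by rewrite ler_wpM2r.
Qed.

(** The self-interaction is translation invariant; only the mirror term changes, and by [2 a], since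
    the image is displaced in the opposite direction. *)
Lemma hen_tr (L a : R) h : 0 < L -> adm L h -> adm L (tr a h) ->
  ig2 (fun x => h x * pot e h (2 * a - x.1, x.2)) /\
  hen e (tr a h) (tr a h) = en e h h - I2 (fun x => h x * pot e h (2 * a - x.1, x.2)).
Proof.
move=> L0 [hb _ _ _ _] [tb _ _ _ _]; have L2 : 0 < 2 * L by rewrite mulr_gt0.
have Ie := bsup_ig2 (en_bsup (ltW e0) e1 L2 tb (bsup_bar tb)).
have [It Et] := I2_tr (- a) Ie.
have E : tr (- a) (fun x => tr a h x * pot e (fun y => tr a h (bar y)) x) =
    (fun x => h x * pot e h (2 * a - x.1, x.2)).
  apply/funext => x; rewrite [LHS]/tr (pot_bar (ltW e0) e1 _ tb) (pot_tr _ _ (ltW e0) e1 hb).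
  rewrite /tr /bar /= subrK; congr (_ * pot e h (_, _)); last by ring.
  by case: x.
rewrite E in It Et; split => //.
by rewrite (henE (ltW e0) e1 L2 tb tb) (en_tr _ (ltW e0) e1 L2 hb hb) Et.
Qed.

Lemma tr0 h : tr 0 h = h.
Proof. by apply/funext => x; rewrite /tr addr0; case: x. Qed.

Lemma shift_arith2 (c' k Q S a A I0 I1 m j : R) : 0 < c' -> I1 - I0 <= Q * k * k ->
  c' / 2 * (A - I1) - S * (m - a * k) - j <= c' / 2 * (A - I0) - S * m - j ->
  S * a * k <= c' / 2 * Q * k * k.
Proof.
move=> c'0 h1 h2; have c2 : 0 <= c' / 2 by rewrite divr_ge0// ltW.
have := ler_wpM2l c2 h1.
have -> : c' / 2 * Q * k * k = c' / 2 * (Q * k * k) by ring.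
have -> : S * a * k = S * (a * k) by ring.
by move: h2; rewrite !mulrBr; lra.
Qed.

(* First-order optimality with respect to horizontal translations: the drift gain
   cannot exceed the loss in the interaction with the mirror image. *)
Lemma shift_optimal (L a Q : R) zt : 0 < L -> adm L zt -> (forall h, adm L h -> En L h <= En L zt) ->
  (forall x, zt x != 0 -> dom L (x.1 - a, x.2) = 1) ->
  (forall x y, zt x != 0 -> zt y != 0 ->
    kp e ((2 * a - x.1, x.2) - y) - kp e ((- x.1, x.2) - y) <= Q) ->
  speed L * a * kappa <= c / 2 * Q * kappa * kappa.
Proof.
move=> L0 az zmax hdom hQ; have [zb z0 zd zk sz] := az.
have L2 : 0 < 2 * L by rewrite mulr_gt0.
have td x : tr a zt x != 0 -> dom L x = 1.
  by rewrite /tr => /hdom; rewrite /= addrK; case: x.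
have iz := bsup_ig2 zb.
have at_ : adm L (tr a zt).
  split; [|by move=> x; exact: z0|by []|by rewrite (I2_tr a iz).2|exact: sdec_tr].
  split; [by apply: measurable_tr; case: zb|by move=> x; have [_ h _] := zb; exact: h|].
  by move=> x /td; apply: dom_inbox; exact: ltW.
have az0 : adm L (tr 0 zt) by rewrite tr0.
have [Ia Ea] := hen_tr L0 az at_; have [I0 E0] := hen_tr L0 az az0; rewrite tr0 in E0.
have diff : I2 (fun x => zt x * pot e zt (2 * a - x.1, x.2)) -
    I2 (fun x => zt x * pot e zt (2 * 0 - x.1, x.2)) <= Q * kappa * kappa.
  rewrite -(I2B Ia I0) -[X in _ <= _ * X]zk -(I2Z _ iz); apply: le_I2; [exact: ig2B|exact: ig2Z|].
  move=> x; rewrite -mulrBr; have [->|zx] := eqVneq (zt x) 0; first by rewrite mul0r mulr0.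
  rewrite mulrC ler_wpM2r// -[in leRHS]zk; apply: (pot_diff_le zb z0) => y zy.
  by rewrite mulr0 sub0r; exact: hQ.
have iJ := ig_conj T0 fm fz az.
have JE : I2 (fun x => J (tr a zt x)) = I2 (fun x => J (zt x)) by have [_] := I2_tr a iJ.
have := zmax _ at_; rewrite /En JE Ea E0 (mom_tr _ iz (ig_mom L0 az)) zk.
exact: shift_arith2 c0 diff.
Qed.

Lemma kp_pair (a b : R) y : kp e ((a, b) - y) = ((a - y.1) ^+ 2 + (b - y.2) ^+ 2) `^ (- e).
Proof. by []. Qed.

(** Keeping one factor [M / u] preserves the relative gain of order [1 / L] that decides
    [left_kernel]. *)
Lemma powN_ratio (p u M : R) : 1 <= p -> 0 < M -> M <= u -> u `^ (- p) <= M `^ (- p) * (M / u).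
Proof.
move=> p1 M0 Mu; have u0 : 0 < u by exact: lt_le_trans Mu.
have r1 : 1 <= u / M by rewrite ler_pdivlMr// mul1r.
have rp : u / M <= (u / M) `^ p.
  by rewrite -[leLHS]powRr1 ?(le_trans ler01 r1)// ler_powR.
have -> : u = M * (u / M) by rewrite mulrC divfK// gt_eqF.
have r0 : 0 < u / M by exact: lt_le_trans r1.
rewrite powRM ?(ltW M0) ?(ltW r0)// ler_wpM2l ?powR_ge0//.
rewrite (_ : M / (M * (u / M)) = (u / M)^-1); last by field; rewrite !gt_eqF.
by rewrite powRN lef_pV2// ?posrE ?powR_gt0.
Qed.

Lemma sq_powN (u p : R) : 0 <= u -> (u ^+ 2) `^ (- p) = u `^ (- (2 * p)).
Proof. by move=> u0; rewrite -(powR_mulrn 2 u0) -powRrM mulrN. Qed.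

(** [S] is the horizontal distance of a point to an image, and the shift lowers it by [1]. As [S]
    exceeds [2 L] by [2], the kernel grows less than for the point vortex pair, by the factor
    [1 - (6 L)^-1]; since [speed] is calibrated at distance [2 L], any strict gain contradicts
    optimality. *)
Lemma left_kernel (L S d : R) : 1 <= L -> 2 * L + 2 <= S -> S <= 3 * L ->
  ((1 - S) ^+ 2 + d ^+ 2) `^ (- e) - ((- S) ^+ 2 + d ^+ 2) `^ (- e) <=
  2 * e * (2 * L) `^ (- (2 * e + 1)) * (1 - (6 * L)^-1).
Proof.
move=> L1 S1 S2; pose u := S - 1; have u0 : 0 < u by rewrite /u; lra.
have L0 : 0 < L by lra.
have M0 : 0 < 2 * L by rewrite mulr_gt0.
have A0 : 0 < u ^+ 2 + d ^+ 2 by rewrite ltr_wpDr ?sqr_ge0// exprn_gt0.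
have AB : u ^+ 2 + d ^+ 2 <= S ^+ 2 + d ^+ 2 by rewrite lerD2r ler_pXn2r ?nnegrE//; rewrite /u; lra.
have := powRN_diff_le (ltW e0) A0 AB.
rewrite sqrrN (_ : (1 - S) ^+ 2 = u ^+ 2); last by rewrite /u; ring.
move=> h; apply: (le_trans h).
have e10 : 0 <= e + 1 by rewrite addr_ge0// ltW.
have h2 : (u ^+ 2 + d ^+ 2) `^ (- (e + 1)) <= u `^ (- (2 * e + 1)) / u.
  apply: (@le_trans _ _ ((u ^+ 2) `^ (- (e + 1)))).
    by apply: powRN_le => //; [exact: exprn_gt0|rewrite lerDl sqr_ge0].
  rewrite (sq_powN _ (ltW u0)) (_ : - (2 * (e + 1)) = - (2 * e + 1) + (- 1)); last by ring.
  by rewrite powRD ?(gt_eqF u0) ?implybT// powR_inv1 ?(ltW u0).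
have p1 : 1 <= 2 * e + 1 by rewrite lerDr mulr_ge0// ltW.
have Mu : 2 * L <= u by rewrite /u; lra.
have h3 := powN_ratio p1 M0 Mu.
have -> : S ^+ 2 + d ^+ 2 - (u ^+ 2 + d ^+ 2) = 2 * u + 1 by rewrite /u; ring.
move: h2 h3; move: ((_ + d ^+ 2) `^ _) (u `^ _) ((2 * L) `^ _) (powR_ge0 (2 * L) (- (2 * e + 1))).
move=> X Y Z Z0 h2 h3.
have h4 : X <= Z * (2 * L / u) / u.
  by apply: (le_trans h2); rewrite ler_wpM2r// invr_ge0 ltW.
have u1 : 0 <= 2 * u + 1 by rewrite addr_ge0// mulr_ge0// ltW.
have h5 : e * X * (2 * u + 1) <= e * (Z * (2 * L / u) / u) * (2 * u + 1).
  by rewrite ler_wpM2r// ler_wpM2l// ltW.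
apply: (le_trans h5).
have -> : e * (Z * (2 * L / u) / u) * (2 * u + 1) = 2 * e * Z * (2 * L * (2 * u + 1) / (2 * u ^+ 2)).
  by field; rewrite gt_eqF.
have eZ : 0 <= 2 * e * Z by rewrite mulr_ge0// mulr_ge0// ltW.
rewrite ler_wpM2l// ler_pdivrMr; last by rewrite mulr_gt0// exprn_gt0.
have uL : u <= 3 * L by rewrite /u; lra.
have h6 : (6 * L)^-1 * (2 * u ^+ 2) <= u.
  rewrite mulrC ler_pdivrMr ?mulr_gt0// expr2 mulrA mulrC.
  rewrite [leRHS](_ : _ = u * (6 * L)); last by ring.
  rewrite ler_wpM2l ?(ltW u0)//; lra.
have Lu1 : 2 * L <= u - 1 by rewrite /u; lra.
have h7 : 2 * L * (2 * u + 1) <= (u - 1) * (2 * u + 1) by rewrite ler_wpM2r.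
rewrite mulrBl mul1r; move: h6; move: ((6 * L)^-1 * _) => W h6.
apply: (le_trans h7); rewrite [leLHS](_ : _ = 2 * u ^+ 2 - u - 1); last by ring.
lra.
Qed.

(** Counterpart of [left_kernel] for a shift away from the axis: the kernel must now drop by more
    than for the pair. A vertical offset weakens the drop, hence the bound on [d] and the larger
    margin [4]. *)
Lemma right_kernel (L S d D : R) : 8 <= L -> D <= L -> L <= S -> S <= 2 * L - 4 -> d ^+ 2 <= D ->
  ((- 1 - S) ^+ 2 + d ^+ 2) `^ (- e) - ((- S) ^+ 2 + d ^+ 2) `^ (- e) <=
  - (2 * e * (2 * L) `^ (- (2 * e + 1)) * (1 + (4 * L ^+ 2)^-1)).
Proof.
move=> L8 DL LS S2 dD; pose v := S + 1; have v0 : 0 < v by rewrite /v; lra.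
have L0 : 0 < L by lra. have S0 : 0 < S by lra.
have M0 : 0 < 2 * L by rewrite mulr_gt0.
have A0 : 0 < S ^+ 2 + d ^+ 2 by rewrite ltr_wpDr ?sqr_ge0// exprn_gt0.
have AB : S ^+ 2 + d ^+ 2 <= v ^+ 2 + d ^+ 2 by rewrite lerD2r ler_pXn2r ?nnegrE//; rewrite /v; lra.
have := powRN_diff_ge (ltW e0) A0 AB.
rewrite sqrrN (_ : (-1 - S) ^+ 2 = v ^+ 2); last by rewrite /v; ring.
rewrite -[X in _ -> X <= _]opprB lerN2 => h; apply: le_trans h.
have e10 : 0 <= e + 1 by rewrite addr_ge0// ltW.
have v10 : 0 < v + 1 by rewrite addr_gt0.
(* As [d^2 <= L <= 2 v + 1], the vertical offset counts as at most one more unit of horizontal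
   distance. *)
have h2 : (v + 1) `^ (- (2 * e + 1)) / (v + 1) <= (v ^+ 2 + d ^+ 2) `^ (- (e + 1)).
  apply: (@le_trans _ _ (((v + 1) ^+ 2) `^ (- (e + 1)))); last first.
    apply: powRN_le => //; first by rewrite ltr_wpDr ?sqr_ge0// exprn_gt0.
    rewrite (_ : (v + 1) ^+ 2 = v ^+ 2 + (2 * v + 1)); last by ring.
    by rewrite lerD2l; apply: (le_trans dD); rewrite /v; lra.
  rewrite (sq_powN _ (ltW v10)) (_ : - (2 * (e + 1)) = - (2 * e + 1) + (- 1)); last by ring.
  by rewrite powRD ?(gt_eqF v10) ?implybT// powR_inv1 ?(ltW v10).
have h3 : (2 * L) `^ (- (2 * e + 1)) * (2 * L / (v + 1)) <= (v + 1) `^ (- (2 * e + 1)).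
  have vM : v + 1 <= 2 * L by rewrite /v; lra.
  have p1 : 1 <= 2 * e + 1 by rewrite lerDr mulr_ge0// ltW.
  have r1 : 1 <= 2 * L / (v + 1) by rewrite ler_pdivlMr// mul1r.
  have r0 : 0 < 2 * L / (v + 1) by exact: lt_le_trans r1.
  have rp : 2 * L / (v + 1) <= (2 * L / (v + 1)) `^ (2 * e + 1).
    by rewrite -[leLHS]powRr1 ?(ltW r0)// ler_powR.
  have E : 2 * L = (v + 1) * (2 * L / (v + 1)) by rewrite mulrCA mulfV ?mulr1// gt_eqF.
  rewrite {1}E powRM ?(ltW v10) ?(ltW r0)// -mulrA ler_piMr ?powR_ge0//.
  by rewrite powRN ler_pdivrMl ?powR_gt0// mulr1.
have -> : v ^+ 2 + d ^+ 2 - (S ^+ 2 + d ^+ 2) = 2 * v - 1 by rewrite /v; ring.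
move: h2 h3; move: ((v ^+ 2 + d ^+ 2) `^ _) ((v + 1) `^ _) ((2 * L) `^ _) (powR_ge0 (2 * L) (- (2 * e + 1))).
move=> X Y Z Z0 h2 h3.
have h4 : Z * (2 * L / (v + 1)) / (v + 1) <= X.
  by apply: le_trans h2; rewrite ler_wpM2r// invr_ge0 ltW.
have u1 : 0 <= 2 * v - 1 by rewrite /v; lra.
have h5 : e * (Z * (2 * L / (v + 1)) / (v + 1)) * (2 * v - 1) <= e * X * (2 * v - 1).
  by rewrite ler_wpM2r// ler_wpM2l// ltW.
apply: le_trans h5.
have -> : e * (Z * (2 * L / (v + 1)) / (v + 1)) * (2 * v - 1) =
    2 * e * Z * (2 * L * (v - 1 / 2) / (v + 1) ^+ 2).
  by field; rewrite gt_eqF.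
have eZ : 0 <= 2 * e * Z by rewrite mulr_ge0// mulr_ge0// ltW.
rewrite ler_wpM2l// ler_pdivlMr; last by rewrite exprn_gt0.
have vL : v + 1 <= 2 * L by rewrite /v; lra.
have h6 : (4 * L ^+ 2)^-1 * (v + 1) ^+ 2 <= 1.
  have L4 : 0 < 4 * L ^+ 2 by rewrite mulr_gt0// exprn_gt0.
  rewrite mulrC ler_pdivrMr// mul1r (_ : 4 * L ^+ 2 = (2 * L) ^+ 2); last by ring.
  by rewrite ler_pXn2r ?nnegrE// ltW.
have h7 : (v + 3) * (v - 1 / 2) <= 2 * L * (v - 1 / 2) by rewrite ler_wpM2r; rewrite /v; lra.
rewrite [leLHS]mulrDl [X in X + _ <= _]mul1r; move: h6; move: ((4 * L ^+ 2)^-1 * _) => W h6.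
apply: le_trans h7; rewrite [leRHS](_ : _ = (v + 1) ^+ 2 + (v / 2 - 5 / 2)); last by field.
have : 9 <= v by rewrite /v; lra.
lra.
Qed.

Lemma shift_contra (W k c' t : R) : 0 < W -> 0 < k -> 0 < c' -> 0 < t ->
  (k * c' * W) * (1 / 2) * k <= c' / 2 * (W * (1 - t)) * k * k -> False.
Proof.
move=> W0 k00 c00 t0; rewrite leNgt => /negP; apply; rewrite -subr_gt0.
rewrite (_ : _ - _ = c' / 2 * W * t * k * k); last by ring.
by rewrite !mulr_gt0.
Qed.

Lemma shift_contra2 (W k c' t : R) : 0 < W -> 0 < k -> 0 < c' -> 0 < t ->
  (k * c' * W) * (- (1 / 2)) * k <= c' / 2 * (- (W * (1 + t))) * k * k -> False.
Proof.
move=> W0 k00 c00 t0; rewrite leNgt => /negP; apply; rewrite -subr_gt0.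
rewrite (_ : _ - _ = c' / 2 * W * t * k * k); last by ring.
by rewrite !mulr_gt0.
Qed.

Lemma speedE L : speed L = kappa * c * (2 * e * (2 * L) `^ (- (2 * e + 1))).
Proof. by rewrite /speed; ring. Qed.

(** The support is moved by [1 / 2], which stays inside the box and changes distances to the image
    by [1], the step of [left_kernel]. *)
Lemma not_all_right L zt : 2 <= L -> adm L zt -> (forall h, adm L h -> En L h <= En L zt) ->
  (forall x, zt x != 0 -> L + 1 <= x.1) -> False.
Proof.
move=> L2 az zmax hr; have L0 : 0 < L by apply: lt_le_trans L2.
have L1 : 1 <= L by apply: le_trans L2; rewrite ler1n.
have [zb z0 zd zk sz] := az.
have hd x : zt x != 0 -> dom L (x.1 - 1 / 2, x.2) = 1.
  move=> zx; have /domP/andP[/andP[x1 x2] x3] := zd x zx; have := hr x zx.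
  by move=> x4; apply/domP; rewrite x3 andbT /=; apply/andP; split; lra.
have hQ x y : zt x != 0 -> zt y != 0 ->
    kp e ((2 * (1 / 2) - x.1, x.2) - y) - kp e ((- x.1, x.2) - y) <=
    2 * e * (2 * L) `^ (- (2 * e + 1)) * (1 - (6 * L)^-1).
  move=> zx zy; rewrite !kp_pair.
  have -> : 2 * (1 / 2) - x.1 - y.1 = 1 - (x.1 + y.1) by field.
  have -> : - x.1 - y.1 = - (x.1 + y.1) by ring.
  have := hr _ zx; have := hr _ zy.
  have /domP/andP[/andP[_ x2] _] := zd _ zx; have /domP/andP[/andP[_ y2] _] := zd _ zy.
  by move=> h1 h2; apply: left_kernel => //; lra.
have := shift_optimal L0 az zmax hd hQ; rewrite speedE.
apply: shift_contra => //; last by rewrite invr_gt0 mulr_gt0.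
by rewrite !mulr_gt0// powR_gt0// mulr_gt0.
Qed.

Lemma not_all_left L (R1 : R) zt : 8 <= L -> 4 * R1 ^+ 2 <= L -> adm L zt ->
  (forall h, adm L h -> En L h <= En L zt) -> (forall x, zt x != 0 -> `|x.2| <= R1) ->
  (forall x, zt x != 0 -> x.1 <= L - 2) -> False.
Proof.
move=> L8 RL az zmax hv hl; have L0 : 0 < L by apply: lt_le_trans L8.
have [zb z0 zd zk sz] := az.
have hd x : zt x != 0 -> dom L (x.1 - - (1 / 2), x.2) = 1.
  move=> zx; have /domP/andP[/andP[x1 x2] x3] := zd x zx; have := hl x zx.
  by move=> x4; apply/domP; rewrite x3 andbT /=; apply/andP; split; lra.
have hQ x y : zt x != 0 -> zt y != 0 ->
    kp e ((2 * (- (1 / 2)) - x.1, x.2) - y) - kp e ((- x.1, x.2) - y) <=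
    - (2 * e * (2 * L) `^ (- (2 * e + 1)) * (1 + (4 * L ^+ 2)^-1)).
  move=> zx zy; rewrite !kp_pair.
  have -> : 2 * (- (1 / 2)) - x.1 - y.1 = - 1 - (x.1 + y.1) by field.
  have -> : - x.1 - y.1 = - (x.1 + y.1) by ring.
  have h1 := hl _ zx; have h2 := hl _ zy.
  have /domP/andP[/andP[x1 _] _] := zd _ zx; have /domP/andP[/andP[y1 _] _] := zd _ zy.
  have h3 := hv _ zx; have h4 := hv _ zy.
  apply: right_kernel L8 RL _ _ _; [lra|lra|].
  rewrite (_ : 4 * R1 ^+ 2 = (2 * R1) ^+ 2); last by ring.
  apply: sqr_abs_le; apply: (le_trans (ler_normB _ _)); lra.
have := shift_optimal L0 az zmax hd hQ; rewrite speedE.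
apply: shift_contra2 => //; last by rewrite invr_gt0 mulr_gt0// exprn_gt0.
by rewrite !mulr_gt0// powR_gt0// mulr_gt0.
Qed.

Lemma nat_above (k m : R) : 0 < m -> exists n : nat, k < n.+1%:R * m.
Proof.
move=> m0; have [k0'|k0'] := leP 0 k; last by exists 0; rewrite mul1r (lt_trans k0').
exists (Num.bound (k / m)); rewrite -ltr_pdivrMr//.
have := archi_boundP (divr_ge0 k0' (ltW m0)); move/lt_trans; apply.
by rewrite ltr_nat.
Qed.

(** On the support the stream function exceeds [mu >= mu0], so the potential is at least [mu0 / c];
    this starts the concentration and extent lemmas with constants free of [L]. The support meets
    both [x.1 <= L + 1] and [x.1 >= L - 2], which ties its bounded extent to [L]. *)
Theorem localized (mu0 : R) : 0 < mu0 -> exists R2 L2 : R, [/\ 0 < R2, 0 < L2 &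
  forall L zt mu, L2 <= L -> adm L zt -> mu0 <= mu ->
    (forall h, adm L h -> En L h <= En L zt) -> zt =1 bath L (psi L zt) mu ->
    [/\ 4 * R2 <= L, forall x, zt x != 0 -> `|x.1 - L| <= R2 /\ `|x.2| <= R2,
        forall x, 0 <= x.1 -> dom L x != 1 -> c * pot e zt x <= mu / 2 &
        forall x, 0 <= x.1 -> zt x = f (psi L zt x - mu)]].
Proof.
move=> m00; have A0 : 0 < mu0 / c by rewrite divr_gt0.
have [R0 [m0 [R00 m0p Hc]]] := concentration e0 e1 A0 (Lam_ge0 fm fz fT) (ltW k0).
have [n hn] := nat_above kappa m0p.
pose R1 := n%:R * (3 * R0).
have R10 : 0 <= R1 by rewrite mulr_ge0// mulr_ge0// ltW.
pose g := (2 * (3 + 2 * R0 + 2 * R1) ^+ 2) `^ (- e) * m0 * m0.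
have g0 : 0 < g.
  rewrite /g !mulr_gt0// powR_gt0// mulr_gt0// exprn_gt0//.
  by move: R00 R10; lra.
have e2 : 0 < 2 * e by rewrite mulr_gt0.
have g4 : 0 < g / 4 by rewrite divr_gt0.
have kk : 0 <= kappa * kappa by rewrite mulr_ge0// ltW.
have [G1 G10 HG] := powN_small e2 kk g4.
pose G := Num.max G1 (R0 + 3).
have Gg : G `^ (- (2 * e)) * kappa * kappa <= g / 4.
  by rewrite -mulrA mulrC; apply: HG; rewrite le_max lexx.
have RG : R0 + 3 <= G by rewrite le_max lexx orbT.
have G0 : 0 < G by rewrite lt_max G10.
pose R2 := n%:R * (2 * R0 + G) + R1 + 2.
have ext0 : 0 <= n%:R * (2 * R0 + G) by rewrite mulr_ge0// addr_ge0 ?mulr_ge0// ltW.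
have R20 : 0 < R2 by rewrite ltr_wpDl// addr_ge0.
(* Points outside the box are at distance at least [L / 4] from the support, because [R2 <= L / 4];
   hence the factor [4^(2 e)]. *)
have ck : 0 <= c * kappa * 4 `^ (2 * e) by rewrite !mulr_ge0 ?powR_ge0// ltW.
have mu2 : 0 < mu0 / 2 by rewrite divr_gt0.
have [L3 L30 HL3] := powN_small e2 ck mu2.
pose L2 := Num.max (Num.max G1 L3) (Num.max (4 * R2) (Num.max 8 (4 * R1 ^+ 2))).
exists R2, L2; split => //; first by rewrite !lt_max G10.
move=> L zt mu; rewrite !ge_max => /andP[/andP[LG LL3] /andP[LR /andP[L8 LR1]]] az mumu0 zmax zE.
have L0 : 0 < L by exact: lt_le_trans L8.
have [zb z0 zd zk sz] := az.
have mup : 0 < mu by exact: lt_le_trans mumu0.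
have psile x : 0 <= x.1 -> psi L zt x <= c * pot e zt x.
  move=> x1; rewrite /psi lerBlDr (le_trans (ler_wpM2l (ltW c0) (hpot_le e x zb z0)))//.
  by rewrite lerDl mulr_ge0// (speed_ge0 e0 c0 k0).
have zmass x : zt x != 0 -> m0 <= I2 (fun y => zt y * ibox R0 (y - x)).
  move=> zx; apply: (Hc _ zt x zb z0 zk).
  have x1 : 0 <= x.1 by exact: ltW (adm_x1 L0 az zx).
  rewrite ler_pdivrMr// mulrC (le_trans mumu0)// (le_trans _ (psile x x1))// leNgt.
  apply/negP => lt; move: zx; rewrite zE /bath fz ?mulr0 ?eqxx//.
  by rewrite subr_le0 ltW.
have vert x : zt x != 0 -> `|x.2| <= R1.
  by move=> zx; apply: ltW; exact: (vertical_extent zb z0 sz R00 zk hn zmass zx).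
have Lg : L `^ (- (2 * e)) * kappa * kappa <= g / 4.
  by rewrite -mulrA mulrC; exact: HG.
have gap := no_gap e0 e1 c0 k0 T0 fm fz L0 az zmax R00 R10 m0p zmass vert RG Gg Lg.
have horiz := horizontal_extent zb z0 R00 G0 zk hn zmass gap.
have [a za al] : exists2 a, zt a != 0 & a.1 <= L + 1.
  apply: contrapT => no; have L2' : 2 <= L by apply: le_trans L8; rewrite ler_nat.
  apply: (not_all_right L2' az zmax) => x zx.
  by rewrite leNgt; apply/negP => /ltW xl; apply: no; exists x.
have [b zbb bl] : exists2 b, zt b != 0 & L - 2 <= b.1.
  apply: contrapT => no; apply: (not_all_left L8 LR1 az zmax vert) => x zx.
  by rewrite leNgt; apply/negP => /ltW xl; apply: no; exists x.
have near x : zt x != 0 -> `|x.1 - L| <= R2 /\ `|x.2| <= R2.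
  move=> zx; split; last first.
    by apply: (le_trans (vert x zx)); rewrite /R2 -addrA [leRHS]addrCA lerDl addr_ge0.
  have h1 := horiz _ _ za zx; have h2 := horiz _ _ zx zbb.
  move: h1 h2; rewrite ler_norml /R2; move: (n%:R * (2 * R0 + G)) => w h1 h2.
  by apply/andP; split; move: R10; lra.
have out x : 0 <= x.1 -> dom L x != 1 -> c * pot e zt x <= mu / 2.
  move=> x1 dx; apply: (@le_trans _ _ (mu0 / 2)); last by rewrite ler_wpM2r.
  have L4 : 0 < L / 4 by rewrite divr_gt0.
  have far y : zt y != 0 -> kp e (x - y) <= (L / 4) `^ (- (2 * e)).
    move=> zy; apply: (kp_far (ltW e0) L4); have [y1 y2] := near y zy.
    move: y1 y2; rewrite !ler_norml => /andP[y1 y1'] /andP[y2 y2'].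
    have dx' : ~~ ((L / 2 <= x.1 <= 3 * L / 2) && (`|x.2| <= L / 2)).
      by apply: contra dx => /domP ->.
    have xx : [\/ x.1 < L / 2, 3 * L / 2 < x.1, x.2 < - (L / 2) | L / 2 < x.2].
      move: dx'; rewrite !negb_and -!ltNge => /orP[/orP[h|h]|h].
      - by constructor 1.
      - by constructor 2.
      - by move: h; rewrite ltr_normr => /orP[h|h]; [constructor 4|constructor 3; rewrite ltrNr].
    rewrite /nrm2; case: xx => h.
    - rewrite -[leLHS]addr0 lerD ?sqr_ge0//; apply: sqr_abs_le'.
      by rewrite (ger0_norm (ltW L4)) distrC ger0_norm /=; lra.
    - rewrite -[leLHS]addr0 lerD ?sqr_ge0//; apply: sqr_abs_le'.
      by rewrite (ger0_norm (ltW L4)) ger0_norm /=; lra.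
    - rewrite -[leLHS]add0r lerD ?sqr_ge0//; apply: sqr_abs_le'.
      by rewrite (ger0_norm (ltW L4)) distrC ger0_norm /=; lra.
    - rewrite -[leLHS]add0r lerD ?sqr_ge0//; apply: sqr_abs_le'.
      by rewrite (ger0_norm (ltW L4)) ger0_norm /=; lra.
  have := pot_le_far e0 e1 zb z0 far; rewrite zk => h.
  apply: (le_trans (ler_wpM2l (ltW c0) h)); apply: le_trans (HL3 L LL3).
  rewrite [L / 4]mulrC powRM ?(ltW L0)// ?invr_ge0//.
  rewrite -powR_inv1// -powRrM mulN1r opprK le_eqVlt; apply/orP; left; apply/eqP; ring.
split => //.
move=> x x1; rewrite {1}zE /bath; have [d1|d1] := dom01 L x; first by rewrite d1 mul1r.
rewrite d1 mul0r fz// subr_le0 (le_trans (psile x x1))//.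
have dn : dom L x != 1 by rewrite d1 eq_sym oner_eq0.
by apply: (le_trans (out x x1 dn)); rewrite ler_pdivrMr// ler_pMr// ler1n.
Qed.

End Location.

(** * The modulus of continuity of the vorticity *)

Section Modulus.
Context (R : realType) (e c W mu M r l : R) (f : R -> R) (z : R * R -> R).
Context (e0 : 0 < e) (e1 : e < 1) (c0 : 0 < c) (r0 : 0 < r) (l0 : 0 < l).
Context (fm : forall t u : R, t <= u -> f t <= f u) (fz : forall t : R, t <= 0 -> f t = 0).
Context (zb : bsup M r z) (z0 : forall x, 0 <= z x) (sz : sdec z).
Context (zl : forall y, z y != 0 -> l <= y.1) (zm : 0 < I2 z).
Implicit Types (x y h : R * R).

Definition stream x : R := c * hpot e z x - W * x.1.

Context (zE : forall x, 0 <= x.1 -> z x = f (stream x - mu)).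

Definition hoelder_on (X a C : R) := forall x y, inbox X x -> inbox X y ->
  `|stream x - stream y| <= C * enorm (x - y) `^ a.

Lemma M_ge0 : 0 <= M. Proof. exact: bsup_ge0 zb. Qed.

Lemma powR_split (t a : R) : 0 <= t -> a <= 1 -> t = t `^ a * t `^ (1 - a).
Proof.
rewrite le_eqVlt => /predU1P[<-|t0] a1.
  have [->|an] := eqVneq a 1; first by rewrite subrr powRr0 mulr1 powRr1.
  by rewrite [X in _ * X]powR0 ?mulr0// subr_eq0 eq_sym.
by rewrite -powRD ?(gt_eqF t0) ?implybT// subrKC powRr1// ltW.
Qed.

Lemma enorm_inbox (X : R) x y : inbox X x -> inbox X y -> enorm (x - y) <= 4 * X.
Proof.
move=> [x1 x2] [y1 y2]; apply: (le_trans (enorm_le_sum _)) => /=.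
have := ler_normB x.1 y.1; have := ler_normB x.2 y.2; lra.
Qed.

(** One gain of regularity from the density to the stream function: every exponent [b] from [g] up
    to [1] with [b < g + 2 (1 - e)] is reached. *)
Lemma stream_hoelder_of (X H g b : R) : 0 < X -> 0 <= H -> 0 <= g -> g <= b -> b <= 1 ->
  2 * e + b - g < 2 -> (forall x y, `|z x - z y| <= H * enorm (x - y) `^ g) ->
  exists2 C, 0 <= C & hoelder_on X b C.
Proof.
move=> X0 H0 g0 gb b1 eb Hz.
have [C C0 HC] := pot_hoelder (ltW e0) e1 H0 g0 gb b1 eb r0 X0.
exists (c * (2 * C) + `|W| * (4 * X) `^ (1 - b)).
  by rewrite addr_ge0// mulr_ge0 ?powR_ge0 ?(ltW c0)// mulr_ge0.
move=> x y xX yX; have [x1 x2] := xX; have [y1 y2] := yX.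
have h1 := HC M z zb Hz x y x1 x2 y1 y2.
have h2 : `|pot e z (bar x) - pot e z (bar y)| <= C * enorm (x - y) `^ b.
  have -> : enorm (x - y) = enorm (bar x - bar y) by rewrite /enorm /bar /= -opprD sqrrN.
  by apply: (HC M z zb Hz); rewrite /bar /= ?normrN.
have h3 : `|hpot e z x - hpot e z y| <= 2 * C * enorm (x - y) `^ b.
  by rewrite /hpot; exact: (abs_sub4 h1 h2).
have h4 : `|W * x.1 - W * y.1| <= `|W| * (4 * X) `^ (1 - b) * enorm (x - y) `^ b.
  rewrite -mulrBr normrM -mulrA ler_wpM2l//; apply: (le_trans (enorm_ge1 (x - y))).
  rewrite {1}(powR_split (enorm_ge0 (x - y)) b1) mulrC ler_wpM2r ?powR_ge0//.
  have b10 : 0 <= 1 - b by rewrite subr_ge0.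
  apply: ge0_ler_powR => //; rewrite ?nnegrE ?enorm_ge0//; last exact: enorm_inbox.
  exact: le_trans (enorm_ge0 _) (enorm_inbox xX yX).
rewrite /stream mulrDl -[c * (2 * C) * _]mulrA.
rewrite (_ : _ - _ = c * (hpot e z x - hpot e z y) - (W * x.1 - W * y.1)); last first.
  by move: (hpot _ _ _) (hpot _ _ _) => A B; ring.
apply: (le_trans (ler_normB _ _)); rewrite lerD// normrM (gtr0_norm c0).
by rewrite ler_pM2l.
Qed.

Lemma stream_bounded (X : R) : 0 < X -> exists2 B, 0 < B & forall x, inbox X x -> `|stream x| <= B.
Proof.
move=> X0; have rX : 0 < r + X by rewrite addr_gt0.
have K0 : 0 <= c * (2 * (M * kbox e (r + X))) + `|W| * X.
  by rewrite addr_ge0// mulr_ge0 ?(ltW c0) ?(ltW X0)// mulr_ge0// mulr_ge0 ?kbox_ge0 ?M_ge0.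
exists (c * (2 * (M * kbox e (r + X))) + `|W| * X + 1); first by rewrite ltr_wpDl.
move=> x xX; have [x1 x2] := xX; rewrite /stream (le_trans (ler_normB _ _))//.
apply: (@le_trans _ _ (c * (2 * (M * kbox e (r + X))) + `|W| * X)); last by rewrite lerDl.
rewrite lerD// normrM; last by rewrite ler_wpM2l.
by rewrite (gtr0_norm c0) ler_pM2l// (hpot_bound (ltW e0) e1 zb rX).
Qed.

Lemma z_le x : z x <= M.
Proof. by have [_ zM _] := zb; exact: le_trans (ler_norm _) (zM x). Qed.

Lemma absB_le (a b k : R) : 0 <= a -> a <= k -> 0 <= b -> b <= k -> `|a - b| <= k.
Proof. by move=> *; rewrite ler_norml; apply/andP; split; lra. Qed.

Lemma near_inbox x y : inbox r x -> enorm (x - y) <= 1 -> inbox (r + 1) y.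
Proof.
move=> [x1 x2] xy; have := le_trans (enorm_ge1 (x - y)) xy.
have := le_trans (enorm_ge2 (x - y)) xy => /= h2 h1.
split; first by have := ler_normB x.1 (x.1 - y.1); rewrite opprB subrKC; lra.
by have := ler_normB x.2 (x.2 - y.2); rewrite opprB subrKC; lra.
Qed.

Lemma near_right x y : l <= x.1 -> enorm (x - y) <= l / 2 -> l / 2 <= y.1.
Proof.
move=> x1 xy; have := le_trans (enorm_ge1 (x - y)) xy => /=.
by rewrite ler_norml => /andP[_ ?]; lra.
Qed.

(** The equation [zE] multiplies the exponents of [f] and of the stream function. The threshold
    [eta] keeps a point close to the support in the right half-plane, where [zE] is available;
    points farther apart are handled by the bound [M]. *)
Lemma z_hoelder (a th B Cf C : R) : 0 <= a -> 0 <= th -> 0 <= C -> 0 <= Cf ->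
  (forall x, inbox (r + 1) x -> `|stream x - mu| <= B) ->
  (forall t u : R, `|t| <= B -> `|u| <= B -> `|f t - f u| <= Cf * `|t - u| `^ th) ->
  hoelder_on (r + 1) a C ->
  exists2 H, 0 <= H & forall x y, `|z x - z y| <= H * enorm (x - y) `^ (th * a).
Proof.
move=> a0 th0 C0 Cf0 HB Hf Hv.
pose eta := Num.min 1 (l / 2).
have eta0 : 0 < eta by rewrite lt_min ltr01 divr_gt0.
have p0 : 0 <= th * a by rewrite mulr_ge0.
have ep : 0 < eta `^ (th * a) by exact: powR_gt0.
pose H := M / eta `^ (th * a) + Cf * C `^ th.
have H1 : 0 <= M / eta `^ (th * a) by rewrite divr_ge0 ?M_ge0// ltW.
have H2 : 0 <= Cf * C `^ th by rewrite mulr_ge0 ?powR_ge0.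
exists H; first by rewrite addr_ge0.
have key x y : z x != 0 -> `|z x - z y| <= H * enorm (x - y) `^ (th * a).
  move=> zx; have nn := enorm_ge0 (x - y).
  have [big|small] := leP eta (enorm (x - y)).
    apply: (@le_trans _ _ M); first by apply: absB_le; rewrite ?z0 ?z_le.
    rewrite /H mulrDl; apply: (@le_trans _ _ (M / eta `^ (th * a) * enorm (x - y) `^ (th * a))); last first.
      by rewrite lerDl mulr_ge0// powR_ge0.
    rewrite -mulrA ler_peMr ?M_ge0// mulrC ler_pdivlMr// mul1r.
    by apply: ge0_ler_powR => //; rewrite nnegrE// ltW.
  have [_ _ zr] := zb; have xr : inbox r x by exact: zr.
  have s1 : enorm (x - y) <= 1 by apply: le_trans (ltW small) _; rewrite ge_min lexx.
  have s2 : enorm (x - y) <= l / 2 by apply: le_trans (ltW small) _; rewrite ge_min lexx orbT.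
  have yX := near_inbox xr s1.
  have xX : inbox (r + 1) x by case: xr => ? ?; split; rewrite (le_trans (y := r))// lerDl.
  have y1 : 0 <= y.1 by apply: le_trans (near_right (zl zx) s2); rewrite divr_ge0// ltW.
  have x1 : 0 <= x.1 by apply: le_trans (zl zx); exact: ltW.
  rewrite (zE x1) (zE y1); apply: (le_trans (Hf _ _ (HB _ xX) (HB _ yX))).
  rewrite /H mulrDl; apply: (@le_trans _ _ (Cf * C `^ th * enorm (x - y) `^ (th * a))); last first.
    by rewrite lerDr mulr_ge0// powR_ge0.
  rewrite -mulrA ler_wpM2l// [th * a]mulrC powRrM -powRM ?powR_ge0//.
  apply: ge0_ler_powR => //; rewrite ?nnegrE ?normr_ge0// ?mulr_ge0 ?powR_ge0//.
  rewrite (_ : _ - _ = stream x - stream y); last by ring.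
  exact: Hv.
move=> x y; have [zx|zx] := eqVneq (z x) 0; last exact: key.
have [zy|zy] := eqVneq (z y) 0; last by rewrite distrC enorm_distC key.
by rewrite zx zy subrr normr0 mulr_ge0 ?powR_ge0// addr_ge0.
Qed.

Lemma ig_shift h : ig2 (fun x => z (x - h)) /\ I2 (fun x => z (x - h)) = I2 z.
Proof. exact: (I2_translate (- h) (bsup_ig2 zb)). Qed.

Lemma ig_diff h : ig2 (fun x => `|z (x - h) - z x|).
Proof. exact: ig2_abs (ig2B (ig_shift h).1 (bsup_ig2 zb)). Qed.

Lemma far_bound (d tau rho sg x2 P0 P1 P2 : R) : 0 < sg -> 0 < rho -> rho < x2 ->
  0 <= tau -> tau <= rho -> d <= sg * (tau * rho) ->
  sg * (x2 ^+ 2 - (x2 - tau) ^+ 2) <= P1 - P0 -> sg * ((x2 + tau) ^+ 2 - x2 ^+ 2) <= P0 - P2 ->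
  P0 + d <= P1 /\ P2 <= P0 - d.
Proof.
move=> sg0 rho0 rx t0 tr hd h1 h2.
have k1 : sg * (tau * rho) <= sg * (x2 ^+ 2 - (x2 - tau) ^+ 2).
  rewrite ler_pM2l// (_ : _ - _ = tau * (2 * x2 - tau)); last by ring.
  rewrite ler_wpM2l//; lra.
have k2 : sg * (tau * rho) <= sg * ((x2 + tau) ^+ 2 - x2 ^+ 2).
  rewrite ler_pM2l// (_ : _ - _ = tau * (2 * x2 + tau)); last by ring.
  rewrite ler_wpM2l//; lra.
split; lra.
Qed.

Lemma between_abs (a b p q : R) : p <= a -> a <= q -> p <= b -> b <= q -> `|a - b| <= q - p.
Proof. by move=> *; rewrite ler_norml; apply/andP; split; lra. Qed.

(** One nonzero value is enough to place both points where the equation and the slope estimate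
    hold. *)
Lemma shift_conf h x : enorm h <= 1 -> enorm h <= l / 2 -> z (x - h) != 0 \/ z x != 0 ->
  [/\ inbox (r + 1) x, inbox (r + 1) (x - h), l / 2 <= x.1 & l / 2 <= (x - h).1].
Proof.
move=> h1 hl.
have en1 : enorm (x - (x - h)) = enorm h by rewrite opprB addrC subrK.
have en2 : enorm (x - h - x) = enorm h by rewrite addrAC subrr add0r enormN.
have [_ _ zr] := zb.
have up y : inbox r y -> inbox (r + 1) y.
  by move=> [? ?]; split; rewrite (le_trans (y := r))// lerDl.
have lp y : l <= y.1 -> l / 2 <= y.1 by have := l0; lra.
case=> zx; have xr := zr _ zx; have xl := zl zx.
  split; [|exact: up| |exact: lp].
    by apply: near_inbox xr _; rewrite en2.
  by apply: near_right xl _; rewrite en2.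
split; [exact: up| |exact: lp|].
  by apply: near_inbox xr _; rewrite en1.
by apply: near_right xl _; rewrite en1.
Qed.

Lemma sandwich (P0 P1 P2 s d : R) : P0 + d <= P1 -> P2 <= P0 - d -> `|s - P0| <= d ->
  [/\ P2 <= s, s <= P1, P2 <= P0 & P0 <= P1].
Proof. by move=> h1 h2; rewrite ler_norml => /andP[h3 h4]; split; lra. Qed.

(* Away from the axis the slope in [x.2] turns an oscillation of the stream
   function into a vertical shift by [tau]. *)
Lemma far_pointwise (X sg C a tau rho : R) h x : 0 < sg -> r + 2 <= X ->
  (forall x1 a b : R, l / 2 <= x1 <= X -> 0 <= a -> a <= b -> b <= X ->
    sg * (b ^+ 2 - a ^+ 2) <= stream (x1, a) - stream (x1, b)) ->
  hoelder_on (r + 1) a C -> enorm h <= 1 -> enorm h <= l / 2 ->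
  0 < rho -> rho < x.2 -> 0 <= tau -> tau <= rho -> tau <= 1 ->
  C * enorm h `^ a <= sg * (tau * rho) ->
  `|z (x - h) - z x| <= z (x.1, x.2 - tau) - z (x.1, x.2 + tau).
Proof.
move=> sg0 rX Hs Hv h1 hl rho0 rx tau0 tr tau1 hd.
have D0 : 0 <= z (x.1, x.2 - tau) - z (x.1, x.2 + tau).
  by rewrite subr_ge0 sz// !ger0_norm; lra.
have [/andP[/eqP zh /eqP zx]|nz] := boolP ((z (x - h) == 0) && (z x == 0)).
  by rewrite zh zx subrr normr0.
have [xX yX x1 y1] : [/\ inbox (r + 1) x, inbox (r + 1) (x - h), l / 2 <= x.1 & l / 2 <= (x - h).1].
  by apply: shift_conf => //; move: nz; rewrite negb_and => /orP.
have [a1 a2] := xX.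
have l2 : 0 <= l / 2 by rewrite divr_ge0// ltW.
have xx : l / 2 <= x.1 <= X.
  by rewrite x1/=; move: a1; rewrite ler_norml => /andP[_ ?]; lra.
have x2X : x.2 <= X - 1 by move: a2; rewrite ler_norml => /andP[_ ?]; lra.
have p1 : 0 <= x.2 - tau by lra.
have p4 : 0 <= x.2 by lra.
have p2 : x.2 - tau <= x.2 by rewrite gerBl.
have p5 : x.2 <= x.2 + tau by rewrite lerDl.
have p3 : x.2 <= X by lra.
have p6 : x.2 + tau <= X by lra.
have k1 := Hs x.1 (x.2 - tau) x.2 xx p1 p2 p3.
have k2 := Hs x.1 x.2 (x.2 + tau) xx p4 p5 p6.
have xe : (x.1, x.2) = x by case: (x).
rewrite xe in k1 k2.
have [k3 k4] := far_bound sg0 rho0 rx tau0 tr hd k1 k2.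
have en2 : enorm (x - h - x) = enorm h by rewrite addrAC subrr add0r enormN.
have hv := Hv _ _ yX xX; rewrite en2 in hv.
have [q1 q2 q3 q4] := sandwich k3 k4 hv.
have x10 : 0 <= x.1 by exact: le_trans x1.
have y10 : 0 <= (x - h).1 by exact: le_trans y1.
rewrite (zE y10) (zE x10) (@zE (x.1, x.2 - tau) x10) (@zE (x.1, x.2 + tau) x10).
exact: (between_abs (fm (lerB q1 (lexx mu))) (fm (lerB q2 (lexx mu))) (fm (lerB q3 (lexx mu))) (fm (lerB q4 (lexx mu)))).
Qed.

Lemma add3_mid (a b c' : R) : 0 <= a -> 0 <= c' -> b <= a + b + c'.
Proof. lra. Qed.

(** In the strip [|x.2| <= rho] the vertical slope degenerates: there the regularity of [f] is used,
    multiplied by the area of the strip. Outside it the differences are at most [z] at height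
    [|x.2| - tau] minus [z] at height [|x.2| + tau], whose integral is the mass of a strip of width
    [2 tau]. *)
Lemma modulus_small (X sg C a th Cf tau rho : R) h : 0 < sg -> r + 2 <= X ->
  (forall x1 a b : R, l / 2 <= x1 <= X -> 0 <= a -> a <= b -> b <= X ->
    sg * (b ^+ 2 - a ^+ 2) <= stream (x1, a) - stream (x1, b)) ->
  hoelder_on (r + 1) a C -> 0 <= C -> 0 <= th -> 0 <= Cf ->
  (forall x y, inbox (r + 1) x -> inbox (r + 1) y ->
    `|f (stream x - mu) - f (stream y - mu)| <= Cf * `|stream x - stream y| `^ th) ->
  enorm h <= 1 -> enorm h <= l / 2 ->
  0 < rho -> 0 <= tau -> tau <= rho -> tau <= 1 ->
  C * enorm h `^ a <= sg * (tau * rho) ->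
  I2 (fun x => `|z (x - h) - z x|) <=
    Cf * (C * enorm h `^ a) `^ th * (4 * (r + 1) * rho) + 16 * r * tau * M.
Proof.
move=> sg0 rX Hs Hv C0 th0 Cf0 Hf h1 hl rho0 tau0 tr tau1 hd.
set N := Cf * _.
have N0 : 0 <= N by rewrite mulr_ge0 ?powR_ge0.
have t20 : 0 <= 2 * tau by rewrite mulr_ge0.
have [Is hs] := sdec_shift zb z0 sz (ltW r0) t20.
pose D y := z y - z (y.1, `|y.2| + 2 * tau).
have ID : ig2 D by exact: ig2B (bsup_ig2 zb) Is.
have D0 y : 0 <= D y.
  rewrite subr_ge0; case: y => u v /=; apply: sz.
  by rewrite (@ger0_norm _ (_ + _)) ?addr_ge0// lerDl.
(* Two translates of [D] dominate the parts above and below the strip; each integrates to at most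
   [4 r (2 tau) M]. *)
have [I1 E1] := I2_translate (0, - tau) ID; have [I3 E3] := I2_translate (0, tau) ID.
have rr : - (r + 1) <= r + 1 by have := r0; lra.
have rh : - rho <= rho by lra.
have IR := ig2Z N (ig2_rect rr rh).
apply: (@le_trans _ _ (I2 (fun x => N * rect (- (r + 1)) (r + 1) (- rho) rho x + D (x + (0, - tau)) + D (x + (0, tau))))).
  apply: le_I2; [exact: ig_diff|exact: ig2D (ig2D IR I1) I3|].
  move=> x; have R0 : 0 <= N * rect (- (r + 1)) (r + 1) (- rho) rho x by rewrite mulr_ge0 ?rect_ge0.
  have [x2|x2] := ltP rho x.2.
    apply: le_trans (far_pointwise sg0 rX Hs Hv h1 hl rho0 x2 tau0 tr tau1 hd) _.
    apply: (@le_trans _ _ (D (x + (0, - tau)))); last exact: add3_mid.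
    rewrite /D /= addr0 (_ : `|x.2 - tau| + 2 * tau = x.2 + tau).
      by rewrite (_ : x + (0, - tau) = (x.1, x.2 - tau))//; apply: pairP; rewrite /= ?addr0.
    by rewrite ger0_norm; lra.
  have [x2'|x2'] := ltP x.2 (- rho).
    have en : enorm (h.1, - h.2) = enorm h by rewrite /enorm /= sqrrN.
    have h1' : enorm (h.1, - h.2) <= 1 by rewrite en.
    have hl' : enorm (h.1, - h.2) <= l / 2 by rewrite en.
    have hd' : C * enorm (h.1, - h.2) `^ a <= sg * (tau * rho) by rewrite en.
    have x2'' : rho < (x.1, - x.2).2 by rewrite /= ltrNr.
    have := far_pointwise sg0 rX Hs Hv h1' hl' rho0 x2'' tau0 tr tau1 hd'.
    have -> : z ((x.1, - x.2) - (h.1, - h.2)) = z (x - h).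
      rewrite (_ : _ - _ = ((x - h).1, - (x - h).2)); last by apply: pairP => //=; ring.
      by rewrite (sdec_even _ _ sz); case: (x - h).
    have -> : z (x.1, - x.2) = z x by rewrite (sdec_even _ _ sz); case: (x).
    move=> /= hh; apply: (le_trans hh).
    apply: (@le_trans _ _ (D (x + (0, tau)))); last by rewrite lerDr addr_ge0.
    rewrite /D /= addr0 (_ : `|x.2 + tau| + 2 * tau = - x.2 + tau); last by rewrite ler0_norm; lra.
    rewrite (_ : x + (0, tau) = (x.1, - (- x.2 - tau))); last by apply: pairP; rewrite /= ?addr0//; ring.
    by rewrite (sdec_even _ _ sz).
  apply: (@le_trans _ _ (N * rect (- (r + 1)) (r + 1) (- rho) rho x)); last by rewrite -addrA lerDl addr_ge0.
  have [/andP[/eqP zh /eqP zx]|nz] := boolP ((z (x - h) == 0) && (z x == 0)).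
    by rewrite zh zx subrr normr0.
  have [xX yX xl yl] : [/\ inbox (r + 1) x, inbox (r + 1) (x - h), l / 2 <= x.1 & l / 2 <= (x - h).1].
    by apply: shift_conf => //; move: nz; rewrite negb_and => /orP.
  have l2 : 0 <= l / 2 by rewrite divr_ge0// ltW.
  have -> : rect (- (r + 1)) (r + 1) (- rho) rho x = 1.
    by rewrite /rect x2 x2' -ler_norml; case: xX => -> _.
  rewrite mulr1 (zE (le_trans l2 yl)) (zE (le_trans l2 xl)); apply: (le_trans (Hf _ _ yX xX)).
  rewrite /N ler_wpM2l//; apply: ge0_ler_powR => //; rewrite ?nnegrE ?normr_ge0 ?mulr_ge0 ?powR_ge0//.
  apply: (le_trans (Hv _ _ yX xX)).
  by rewrite (_ : x - h - x = - h) ?enormN// addrAC subrr add0r.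
rewrite (I2D (ig2D IR I1) I3) (I2D IR I1) E1 E3 (I2Z _ (ig2_rect rr rh)) (I2_rect rr rh).
have -> : N * ((r + 1 - - (r + 1)) * (rho - - rho)) = N * (4 * (r + 1) * rho) by ring.
rewrite -addrA lerD2l; move: hs; rewrite -/D; move: (I2 D) => A; lra.
Qed.

Lemma powR_exp_le (n p q : R) : 0 < n -> n <= 1 -> p <= q -> n `^ q <= n `^ p.
Proof. by move=> n0 n1 pq; apply: ger_powR => //; rewrite n0. Qed.

(** With [n = |h|], [rho] of order [n^b] and [tau] of order [n^(a - b)], the strip contributes
    [n^(b + a th)] and the rest [n^(a - b)]; [2 b <= a] keeps [tau <= rho]. *)
Lemma modulus_of (X sg C a th Cf b gam : R) : 0 < sg -> r + 2 <= X ->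
  (forall x1 a b : R, l / 2 <= x1 <= X -> 0 <= a -> a <= b -> b <= X ->
    sg * (b ^+ 2 - a ^+ 2) <= stream (x1, a) - stream (x1, b)) ->
  hoelder_on (r + 1) a C -> 0 <= C -> 0 <= th -> 0 <= Cf ->
  (forall x y, inbox (r + 1) x -> inbox (r + 1) y ->
    `|f (stream x - mu) - f (stream y - mu)| <= Cf * `|stream x - stream y| `^ th) ->
  0 < b -> 2 * b <= a -> 0 <= gam -> gam <= b + a * th -> gam <= a - b ->
  exists2 K, 0 <= K & forall h, I2 (fun x => `|z (x - h) - z x|) <= K * enorm h `^ gam.
Proof.
move=> sg0 rX Hs Hv C0 th0 Cf0 Hf b0 ba g0 g1 g2.
pose K := Num.sqrt (C / sg) + 1.
have K1 : 1 <= K by rewrite lerDr sqrtr_ge0.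
have K0 : 0 < K by exact: lt_le_trans K1.
have KC : C <= sg * K ^+ 2.
  rewrite mulrC -ler_pdivrMr// -[leLHS](sqr_sqrtr (divr_ge0 C0 (ltW sg0))).
  by apply: sqr_abs_le; rewrite ger0_norm ?sqrtr_ge0// lerDl.
have [d d0 Hd] := hoelder_small (ltW K0) b0 ltr01.
pose eta := Num.min (Num.min 1 (l / 2)) d.
have eta0 : 0 < eta by rewrite !lt_min ltr01 d0 divr_gt0.
have ep : 0 < eta `^ gam by exact: powR_gt0.
pose Q1 := Cf * C `^ th * (4 * (r + 1) * K); pose Q2 := 16 * r * (C / (sg * K)) * M.
pose Q3 := 2 * I2 z / eta `^ gam.
have Q10 : 0 <= Q1.
  by rewrite /Q1 mulr_ge0 ?mulr_ge0 ?powR_ge0 ?(ltW K0)// addr_ge0// ltW.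
have Q20 : 0 <= Q2.
  rewrite /Q2 !mulr_ge0 ?M_ge0 ?invr_ge0 ?mulr_ge0 ?(ltW r0) ?(ltW sg0) ?(ltW K0)//.
have Q30 : 0 <= Q3 by rewrite /Q3 divr_ge0 ?(ltW ep)// mulr_ge0// ltW.
exists (Q1 + Q2 + Q3); first by rewrite !addr_ge0.
move=> h; have n0 := enorm_ge0 h; set n := enorm h in n0 *.
have [big|small] := leP eta n.
  apply: (@le_trans _ _ (Q3 * n `^ gam)); last by rewrite ler_wpM2r ?powR_ge0// lerDr addr_ge0.
  apply: (@le_trans _ _ (2 * I2 z)).
    have [Ih Eh] := ig_shift h.
    rewrite mulr_natl mulr2n -{1}Eh -(I2D Ih (bsup_ig2 zb)).
    apply: le_I2; [exact: ig_diff|exact: ig2D Ih (bsup_ig2 zb)|].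
    by move=> x; rewrite (le_trans (ler_normB _ _))// !ger0_norm.
  rewrite /Q3 -mulrA ler_peMr ?mulr_ge0 ?(ltW zm)// mulrC ler_pdivlMr// mul1r.
  by apply: ge0_ler_powR => //; rewrite nnegrE// ltW.
have [hn|hn] := eqVneq h 0.
  rewrite (_ : (fun x => _) = fun=> 0) ?I2_0 ?mulr_ge0 ?powR_ge0// ?addr_ge0//.
  by apply/funext => x; rewrite hn subr0 subrr normr0.
have np : 0 < n by exact: enorm_gt0.
have n1 : n <= 1 by apply: le_trans (ltW small) _; rewrite !ge_min lexx.
have nl : n <= l / 2 by apply: le_trans (ltW small) _; rewrite !ge_min lexx !orbT.
have nd : n <= d by apply: le_trans (ltW small) _; rewrite !ge_min lexx !orbT.
pose rho := K * n `^ b; have nb : 0 < n `^ b by exact: powR_gt0.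
have rho0 : 0 < rho by rewrite mulr_gt0.
have rho1 : rho <= 1 by exact: Hd.
pose tau := C * n `^ a / (sg * rho).
have sr : 0 < sg * rho by rewrite mulr_gt0.
have tau0 : 0 <= tau by rewrite divr_ge0 ?(ltW sr)// mulr_ge0 ?powR_ge0.
have tr : tau <= rho.
  rewrite ler_pdivrMr// (_ : rho * (sg * rho) = sg * K ^+ 2 * (n `^ b * n `^ b)); last by rewrite /rho; ring.
  rewrite -powRD ?(gt_eqF np) ?implybT// ler_pM ?powR_ge0//; apply: powR_exp_le => //; lra.
have tau1 : tau <= 1 by exact: le_trans rho1.
have hd : C * enorm h `^ a <= sg * (tau * rho).
  rewrite le_eqVlt; apply/orP; left; apply/eqP; rewrite /tau -/n.
  by field; rewrite !gt_eqF.
apply: (le_trans (modulus_small sg0 rX Hs Hv C0 th0 Cf0 Hf n1 nl rho0 tau0 tr tau1 hd)).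
rewrite -/n; apply: (@le_trans _ _ (Q1 * n `^ gam + Q2 * n `^ gam)); last first.
  by rewrite -mulrDl ler_wpM2r ?powR_ge0// lerDl.
apply: lerD.
  rewrite (powRM _ C0 (powR_ge0 _ _)) -powRrM.
  have -> : Cf * (C `^ th * n `^ (a * th)) * (4 * (r + 1) * rho) = Q1 * (n `^ (a * th) * n `^ b).
    by rewrite /Q1 /rho; ring.
  rewrite ler_wpM2l// -powRD ?(gt_eqF np) ?implybT// powR_exp_le//; lra.
have -> : 16 * r * tau * M = Q2 * (n `^ a / n `^ b).
  by rewrite /Q2 /tau /rho; field; rewrite !gt_eqF.
rewrite ler_wpM2l// -powRN -powRD ?(gt_eqF np) ?implybT// powR_exp_le//.
Qed.

Lemma stream_slope (X : R) : 0 < X -> exists2 sg, 0 < sg &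
  forall x1 a b : R, l / 2 <= x1 <= X -> 0 <= a -> a <= b -> b <= X ->
    sg * (b ^+ 2 - a ^+ 2) <= stream (x1, a) - stream (x1, b).
Proof.
move=> X0; have l2 : 0 < l / 2 by rewrite divr_gt0.
have [s s0 H] := hpot_slope (ltW e0) e1 e0 l2 r0 X0.
exists (c * s * I2 z); first by rewrite !mulr_gt0.
move=> x1 a b hx a0 ab bX.
have hl y : z y != 0 -> l / 2 <= y.1 by move=> /zl; have := l0; lra.
exact: psi_slope_arith (ltW c0) (H _ z zb z0 sz hl x1 a b hx a0 ab bX).
Qed.

Lemma geom_small (q eta : R) : 0 < q -> q < 1 -> 0 < eta -> exists k, q ^+ k <= eta.
Proof.
move=> q0 q1 t0; have qn : `|q| < 1 by rewrite gtr0_norm.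
have /cvgrPdist_le/(_ eta t0)[k _ hk] := cvg_expr qn.
exists k; have := hk k (leqnn k); rewrite /= sub0r normrN ger0_norm// exprn_ge0//.
exact: ltW.
Qed.

Lemma r1_gt0 : 0 < r + 1. Proof. by rewrite addr_gt0. Qed.

Lemma z_diff0 x y : `|z x - z y| <= 2 * M * enorm (x - y) `^ 0.
Proof.
rewrite powRr0 mulr1 (le_trans (ler_normB _ _))// !ger0_norm// mulr_natl mulr2n.
by rewrite lerD ?z_le.
Qed.

(** One round of density and potential estimates allows every exponent below
    [2 (1 - e) + (2 e - 1) a], a map with fixed point [1]. The exponents [1 - e^k] tend to [1], and
    each is strictly below the image of its predecessor. *)
Lemma bootstrap (Cf B : R) (k : nat) : 2^-1 < e -> 0 <= Cf ->
  (forall x, inbox (r + 1) x -> `|stream x - mu| <= B) ->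
  (forall t u : R, `|t| <= B -> `|u| <= B -> `|f t - f u| <= Cf * `|t - u| `^ (2 * e - 1)) ->
  exists2 C, 0 <= C & hoelder_on (r + 1) (1 - e ^+ k) C.
Proof.
move=> e2 Cf0 HB Hf; have th0 : 0 <= 2 * e - 1 by lra.
elim: k => [|k [C C0 HC]].
  rewrite expr0 subrr; apply: (@stream_hoelder_of _ (2 * M) 0 0 r1_gt0) => //.
  - by rewrite mulr_ge0 ?M_ge0.
  - by have := e1; lra.
  - exact: z_diff0.
have q0 : 0 < e ^+ k by exact: exprn_gt0.
have q1 : e ^+ k <= 1 by apply: exprn_ile1; exact: ltW.
have a0 : 0 <= 1 - e ^+ k by rewrite subr_ge0.
have [H H0 Hz] := z_hoelder a0 th0 C0 Cf0 HB Hf HC.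
have g0 : 0 <= (2 * e - 1) * (1 - e ^+ k) by rewrite mulr_ge0.
have E : (1 - e ^+ k.+1) = (2 * e - 1) * (1 - e ^+ k) + (1 - e) * (2 - e ^+ k).
  by rewrite exprS; ring.
have h1 : 0 <= (1 - e) * (2 - e ^+ k) by rewrite mulr_ge0 ?subr_ge0 ?(ltW e1)//; lra.
apply: (stream_hoelder_of r1_gt0 H0 g0 _ _ _ Hz).
- by rewrite E lerDl.
- by rewrite gerBl exprn_ge0// ltW.
- have h2 : 0 < (1 - e) * e ^+ k by rewrite mulr_gt0// subr_gt0.
  rewrite E (_ : 2 * e + _ - _ = 2 - (1 - e) * e ^+ k); last by ring.
  by rewrite ltrBlDr ltrDl.
Qed.

(** For [e > 1/2] a bootstrapped exponent of at least [(1 + e) / 2] together with [b = (1 - e) / 2]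
    gives [gam = e^2], and [e^2 = 2 e - 1 + (1 - e)^2]. For [e <= 1/2] any positive order suffices:
    with [th = 0] the strip counts through its area alone, and jumps of [f] are allowed. *)
Theorem modulus :
  (2^-1 < e -> forall B : R, exists2 Cf, 0 <= Cf & forall t u : R, `|t| <= B -> `|u| <= B ->
    `|f t - f u| <= Cf * `|t - u| `^ (2 * e - 1)) ->
  exists K gam : R, [/\ 0 <= K, 0 < gam, gam <= 1, 2 * e - 1 < gam &
    forall h, I2 (fun x => `|z (x - h) - z x|) <= K * enorm h `^ gam].
Proof.
move=> hH; have X0 : 0 < r + 2 by rewrite addr_gt0.
have [sg sg0 Hs] := stream_slope X0.
have [B0 B00 HB0] := stream_bounded r1_gt0.
pose B := B0 + `|mu|.
have HB x : inbox (r + 1) x -> `|stream x - mu| <= B.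
  by move=> /HB0 h; rewrite (le_trans (ler_normB _ _))// lerD2r.
have [e2|e2] := ltP 2^-1 e.
  have [Cf Cf0 Hf] := hH e2 B.
  have t0 : 0 < (1 - e) / 2 by rewrite divr_gt0// subr_gt0.
  have [k hk] := geom_small e0 e1 t0.
  have [C C0 HC] := bootstrap k e2 Cf0 HB Hf.
  have ee : e ^+ 2 <= e by rewrite expr2 ler_piMl// ltW.
  have sq : 0 < (1 - e) ^+ 2 by rewrite exprn_gt0// subr_gt0.
  have eE : e ^+ 2 = 2 * e - 1 + (1 - e) ^+ 2 by ring.
  have th0 : 0 <= 2 * e - 1 by lra.
  have q1 : (1 + e) / 2 <= 1 - e ^+ k by move: hk; move: (e ^+ k) => q; lra.
  have [||||K K0 HK] := @modulus_of (r + 2) sg C (1 - e ^+ k) (2 * e - 1) Cf ((1 - e) / 2) (e ^+ 2)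
      sg0 (lexx _) Hs HC C0 th0 Cf0 _ t0 _ (sqr_ge0 e).
  - by move=> x y xX yX; apply: le_trans (Hf _ _ (HB _ xX) (HB _ yX)) _; rewrite opprB addrA subrK.
  - by move: q1; move: (e ^+ k) => q; lra.
  - have h1 : (1 + e) / 2 * (2 * e - 1) <= (1 - e ^+ k) * (2 * e - 1) by rewrite ler_wpM2r.
    by apply: le_trans (lerD (lexx _) h1); rewrite (_ : e ^+ 2 = (1 - e) / 2 + (1 + e) / 2 * (2 * e - 1))//; field.
  - by apply: le_trans ee _; move: q1; move: (e ^+ k) => q; lra.
  exists K, (e ^+ 2); split => //.
  - exact: exprn_gt0.
  - by apply: le_trans ee _; exact: ltW.
  - by rewrite eE ltrDl.
have h2 : (0 : R) <= 2^-1 by rewrite invr_ge0.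
have M2 : 0 <= 2 * M by rewrite mulr_ge0 ?M_ge0.
have [||C C0 HC] := stream_hoelder_of r1_gt0 M2 (lexx 0) h2 _ _ z_diff0; [lra|lra|].
have fB0 : 0 <= f B by exact: (nondecr_ge0 fm fz).
have h4 : (0 : R) < 4^-1 by rewrite invr_gt0.
have [||||K K0 HK] := @modulus_of (r + 2) sg C 2^-1 0 (f B) 4^-1 4^-1
    sg0 (lexx _) Hs HC C0 (lexx 0) fB0 _ h4 _ (ltW h4).
- move=> x y xX yX; rewrite powRr0 mulr1; apply: absB_le; rewrite ?(nondecr_ge0 fm fz)//.
    by apply: fm; exact: le_trans (ler_norm _) (HB _ xX).
  by apply: fm; exact: le_trans (ler_norm _) (HB _ yX).
- lra.
- lra.
- lra.
exists K, 4^-1; split => //; lra.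
Qed.

End Modulus.

(** * The weak gradient of the potential *)

Section Dominated.
Context (R : realType).
Implicit Types (x y : R * R) (f g b : R * R -> R).

Lemma I2_dct (F : nat -> R * R -> R) g b (N : set (R * R)) : (@lam2 R).-negligible N ->
  (forall n, measurable_fun [set: R * R] (F n)) -> measurable_fun [set: R * R] g -> ig2 b ->
  (forall n x, ~ N x -> `|F n x| <= b x) ->
  (forall x, ~ N x -> F n x @[n --> \oo] --> g x) ->
  ig2 g /\ I2 (F n) @[n --> \oo] --> I2 g.
Proof.
move=> N0 mF mg Ib Fb Fg.
have mF' n : measurable_fun [set: R * R] (EFin \o F n) by exact/measurable_EFinP.
have mg' : measurable_fun [set: R * R] (EFin \o g) by exact/measurable_EFinP.
have [||||| Ig _ cI] := @dominated_convergence _ _ R (@lam2 R) setT measurableT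
  (fun n x => (F n x)%:E) (fun x => (g x)%:E) (fun x => (b x)%:E).
- exact: mF'.
- exact: mg'.
- apply: negligibleS N0 => x /= nx; apply: contrapT => xN; apply: nx => _.
  by apply: cvg_EFin; [exact: nearW|exact: Fg].
- exact: Ib.
- apply: negligibleS N0 => x /= nx; apply: contrapT => xN; apply: nx => n _.
  by rewrite lee_fin Fb.
split => //; rewrite /I2 /Rintegral.
apply: fine_cvg; rewrite fineK//; first exact: integral_fune_fin_num.
Qed.

Lemma I2_dctT (F : nat -> R * R -> R) g b :
  (forall n, measurable_fun [set: R * R] (F n)) -> ig2 b ->
  (forall n x, `|F n x| <= b x) -> (forall x, F n x @[n --> \oo] --> g x) ->
  ig2 g /\ I2 (F n) @[n --> \oo] --> I2 g.
Proof.
move=> mF Ib Fb Fg; apply: (I2_dct (null_vline 0) mF _ Ib (fun n x _ => Fb n x)) => //.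
by apply: measurable_fun_cvg mF _ => x _; exact: Fg.
Qed.

End Dominated.

(** * Partial derivatives through difference quotients *)

Section DiffQuot.
Context (R : realType).
Implicit Types (x y : R * R) (f g p q : R * R -> R) (i j : bool) (t C r : R).

Definition mv i t x : R * R := if i then (x.1 + t, x.2) else (x.1, x.2 + t).

Lemma mv_add i t x : mv i t x = x + mv i t 0.
Proof. by case: i; rewrite /mv; apply: pairP; rewrite /= ?addr0 ?add0r. Qed.

Lemma mvC i j (t u : R) x : mv i t (mv j u x) = mv j u (mv i t x).
Proof. by case: i; case: j; rewrite /mv /=; apply: pairP => //=; ring. Qed.

Lemma mv0 i x : mv i 0 x = x.
Proof. by case: i; rewrite /mv /= addr0; case: x. Qed.

Lemma I2_mv i t f : ig2 f -> ig2 (fun x => f (mv i t x)) /\ I2 (fun x => f (mv i t x)) = I2 f.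
Proof.
move=> If; have := I2_translate (mv i t 0) If.
rewrite (_ : (fun x => f (x + mv i t 0)) = (fun x => f (mv i t x)))//.
by apply/funext => x; rewrite [in RHS]mv_add.
Qed.

Lemma measurable_mv i t f : measurable_fun [set: R * R] f ->
  measurable_fun [set: R * R] (fun x => f (mv i t x)).
Proof.
move=> mf; apply: (measurableT_comp mf).
have mc : measurable_fun [set: R * R] (fun=> t) by exact: measurable_cst.
case: i; apply: measurable_fun_pair => //=; [exact: measurable_funD measurable_fst mc|].
exact: measurable_funD measurable_snd mc.
Qed.

Definition qt i (n : nat) f x : R := n.+1%:R * (f (mv i n.+1%:R^-1 x) - f x).

(* [p] is the partial derivative of the Lipschitz function [f] along the
   coordinate [i], through forward difference quotients only. *)
Definition part i C f p := [/\ measurable_fun [set: R * R] f,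
  forall x t, `|f (mv i t x) - f x| <= C * `|t| &
  forall x, qt i n f x @[n --> \oo] --> p x].

Lemma n1V_le1 (n : nat) : n.+1%:R^-1 <= 1 :> R.
Proof. by rewrite invf_le1// ler1n. Qed.

Lemma measurable_qt i n f : measurable_fun [set: R * R] f -> measurable_fun [set: R * R] (qt i n f).
Proof.
move=> mf; have m1 := measurable_funB (measurable_mv i n.+1%:R^-1 mf) mf.
exact: measurable_funM (@measurable_cst _ _ (R * R)%type _ setT (n.+1%:R : R)) m1.
Qed.

Lemma qt_bound i C f p n x : part i C f p -> `|qt i n f x| <= C.
Proof.
move=> [_ fC _]; rewrite /qt normrM gtr0_norm// mulrC -ler_pdivlMr//.
by have := fC x n.+1%:R^-1; rewrite (@gtr0_norm _ n.+1%:R^-1) ?invr_gt0.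
Qed.

Lemma part_meas i C f p : part i C f p -> measurable_fun [set: R * R] p.
Proof.
move=> [mf _ fp]; apply: (@measurable_fun_cvg _ _ _ setT (fun n => qt i n f)).
  by move=> n; exact: measurable_qt.
by move=> x _; exact: fp.
Qed.

Lemma part_bound i C f p x : part i C f p -> `|p x| <= C.
Proof.
move=> fp; have [_ _ cp] := fp.
have cn : `|qt i n f x| @[n --> \oo] --> `|p x| by apply: cvg_norm; exact: cp.
rewrite -(cvg_lim (@Rhausdorff R) cn); apply: limr_le; first by apply/cvg_ex; exists `|p x|.
by apply: nearW => n; exact: qt_bound fp.
Qed.

Definition suppb r f := forall x, f x != 0 -> inbox r x.

Lemma inbox_mv i r t x : `|t| <= 1 -> inbox r (mv i t x) -> inbox (r + 1) x.
Proof.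
move=> t1 [h1 h2]; move: t1 h1 h2; rewrite /inbox /mv; case: i => /=; rewrite !ler_norml;
  by move=> /andP[? ?] /andP[? ?] /andP[? ?]; split; apply/andP; split; lra.
Qed.

Lemma inboxW r r' x : r <= r' -> inbox r x -> inbox r' x.
Proof. by move=> rr [h1 h2]; split; exact: le_trans rr. Qed.

Lemma supp_qt i r f n : suppb r f -> suppb (r + 1) (qt i n f).
Proof.
move=> fr x; rewrite /qt => h.
have [fx|fx] := eqVneq (f x) 0; last by apply: inboxW (fr _ fx); rewrite lerDl.
have : f (mv i n.+1%:R^-1 x) != 0 by apply: contra_neq h => ->; rewrite fx subrr mulr0.
by move=> /fr; apply: inbox_mv; rewrite gtr0_norm ?invr_gt0// n1V_le1.
Qed.

Lemma supp_part i C r f p : part i C f p -> suppb r f -> suppb (r + 1) p.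
Proof.
move=> [_ _ cp] fr x px; apply: contrapT => nx; move: px.
rewrite (_ : p x = 0) ?eqxx//; have := cp x.
rewrite (_ : (fun n => qt i n f x) = fun=> 0); last first.
  apply/funext => n; apply/eqP/negPn/negP => h; exact: nx (supp_qt fr h).
by move=> /(cvg_lim (@Rhausdorff R)) <-; rewrite lim_cst.
Qed.

Lemma supp_bsup M r f : measurable_fun [set: R * R] f -> (forall x, `|f x| <= M) -> suppb r f ->
  bsup M r f.
Proof. by move=> mf fM fr; split. Qed.

Lemma ig_qt i n f : ig2 f -> ig2 (qt i n f) /\ I2 (qt i n f) = 0.
Proof.
move=> If; have [I1 E1] := I2_mv i n.+1%:R^-1 If.
split; first exact/ig2Z/ig2B.
by rewrite (I2Z _ (ig2B I1 If)) (I2B I1 If) E1 subrr mulr0.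
Qed.

Lemma part_int0 i C M r f p : part i C f p -> (forall x, `|f x| <= M) -> suppb r f ->
  ig2 p /\ I2 p = 0.
Proof.
move=> fp fM fr; have [mf _ cp] := fp.
have If : ig2 f by exact: bsup_ig2 (supp_bsup mf fM fr).
have Ib : ig2 (fun x => C * ibox (r + 1) x) by apply: ig2Z; exact: ig2_ibox.
have bd n x : `|qt i n f x| <= C * ibox (r + 1) x.
  have [->|/(supp_qt fr)[h1 h2]] := eqVneq (qt i n f x) 0.
    rewrite normr0 mulr_ge0 ?ibox_ge0//; exact: le_trans (normr_ge0 _) (qt_bound 0 x fp).
  by rewrite ibox1// mulr1; exact: qt_bound fp.
have [Ip cI] := I2_dctT (fun n => measurable_qt i n mf) Ib bd cp.
split => //; rewrite -(cvg_lim (@Rhausdorff R) cI).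
rewrite (_ : (fun n => I2 (qt i n f)) = fun=> 0) ?lim_cst//.
by apply/funext => n; exact: (ig_qt i n If).2.
Qed.

Lemma part_cont i C f p x : part i C f p -> f (mv i n.+1%:R^-1 x) @[n --> \oo] --> f x.
Proof.
move=> fp; have [_ fC _] := fp.
have C0 : 0 <= C by exact: le_trans (normr_ge0 _) (qt_bound 0 x fp).
apply/cvgrPdist_le => eps ep; have C1 : 0 < C + 1 by rewrite ltr_wpDl.
have [N hN] := natSinv_small (divr_gt0 ep C1).
exists N => // n /= Nn; rewrite distrC (le_trans (fC x _))// ger0_norm ?invr_ge0//.
apply: (@le_trans _ _ ((C + 1) * n.+1%:R^-1)); first by rewrite ler_wpM2r ?invr_ge0// lerDl.
by rewrite mulrC -ler_pdivlMr// hN.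
Qed.

Lemma part_mul i C C' M M' f g p q : part i C f p -> part i C' g q ->
  (forall x, `|f x| <= M) -> (forall x, `|g x| <= M') ->
  part i (C * M' + M * C') (fun x => f x * g x) (fun x => p x * g x + f x * q x).
Proof.
move=> fp gq fM gM; have [mf fC cp] := fp; have [mg gC cq] := gq.
split; first exact: measurable_funM.
- move=> x t; rewrite (_ : _ - _ = (f (mv i t x) - f x) * g (mv i t x) + f x * (g (mv i t x) - g x)); last by ring.
  rewrite (le_trans (ler_normD _ _))// [leRHS]mulrDl lerD// normrM.
    by rewrite mulrAC; apply: ler_pM.
  by rewrite -mulrA; apply: ler_pM.
- move=> x; rewrite (_ : (fun n => _) = fun n => qt i n f x * g (mv i n.+1%:R^-1 x) + f x * qt i n g x).
    by apply: cvgD; apply: cvgM => //; [exact: part_cont gq|exact: cvg_cst].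
  by apply/funext => n; rewrite /qt; ring.
Qed.

Lemma part_ibp i C C' M M' r f g p q : part i C f p -> part i C' g q ->
  (forall x, `|f x| <= M) -> (forall x, `|g x| <= M') -> suppb r g ->
  [/\ ig2 (fun x => p x * g x), ig2 (fun x => f x * q x) &
      I2 (fun x => p x * g x) = - I2 (fun x => f x * q x)].
Proof.
move=> fp gq fM gM gr; have [mf _ _] := fp; have [mg _ _] := gq.
have mp := part_meas fp; have mq := part_meas gq.
have I1 : ig2 (fun x => p x * g x).
  have gb := bsup_ig2 (supp_bsup mg gM gr).
  have := ig2_mul_bd gb mp (fun x => part_bound x fp).
  by apply: eq_ig2 => x; exact: mulrC.
have I3 : ig2 (fun x => f x * q x).
  have qb := bsup_ig2 (supp_bsup mq (fun x => part_bound x gq) (supp_part gq gr)).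
  by have := ig2_mul_bd qb mf fM; apply: eq_ig2 => x; exact: mulrC.
split => //.
have fg := part_mul fp gq fM gM.
have bd x : `|f x * g x| <= M * M' by rewrite normrM ler_pM.
have sp : suppb r (fun x => f x * g x) by move=> x; rewrite mulf_eq0 negb_or => /andP[_ /gr].
have [_ E] := part_int0 fg bd sp.
by apply/eqP; rewrite -subr_eq0 opprK -(I2D I1 I3) E.
Qed.

Lemma part_qt i j n C f p : part i C f p -> part i (n.+1%:R * (2 * C)) (qt j n f) (qt j n p).
Proof.
move=> fp; have [mf fC cp] := fp; split; first exact: measurable_qt.
- move=> x t; rewrite /qt -mulrBr normrM gtr0_norm// -mulrA ler_pM2l//.
  rewrite mvC (_ : _ - _ = (f (mv i t (mv j n.+1%:R^-1 x)) - f (mv j n.+1%:R^-1 x)) - (f (mv i t x) - f x)); last by ring.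
  by rewrite (le_trans (ler_normB _ _))// -mulrA mulr_natl mulr2n lerD.
- move=> x; rewrite (_ : (fun m => _) = fun m => n.+1%:R * (qt i m f (mv j n.+1%:R^-1 x) - qt i m f x)).
    by apply: cvgMr; exact: cvgB.
  by apply/funext => m; rewrite /qt mvC; ring.
Qed.

(* Mixed partial derivatives commute weakly: no second derivative is needed. *)
Lemma part_curl i j C C' D D' M M' r f fi fj g gi gj :
  part i C f fi -> part j C' f fj -> part i D g gi -> part j D' g gj ->
  (forall x, `|f x| <= M) -> (forall x, `|g x| <= M') -> suppb r f -> suppb r g ->
  (forall x, gj (mv i n.+1%:R^-1 x) @[n --> \oo] --> gj x) ->
  I2 (fun x => fj x * gi x) = I2 (fun x => fi x * gj x).
Proof.
move=> hfi hfj hgi hgj fM gM fr gr gc.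
have [mf _ ci] := hfi; have [mg _ cgi] := hgi.
have mfj := part_meas hfj; have mgj := part_meas hgj.
have C0 : 0 <= C by exact: le_trans (normr_ge0 _) (qt_bound 0 0 hfi).
have C0' : 0 <= C' by exact: le_trans (normr_ge0 _) (qt_bound 0 0 hfj).
have D0 : 0 <= D by exact: le_trans (normr_ge0 _) (qt_bound 0 0 hgi).
have D0' : 0 <= D' by exact: le_trans (normr_ge0 _) (qt_bound 0 0 hgj).
have Igj : ig2 gj.
  exact: bsup_ig2 (supp_bsup mgj (fun x => part_bound x hgj) (supp_part hgj gr)).
have If : ig2 f by exact: bsup_ig2 (supp_bsup mf fM fr).
(* Integration by parts in direction [j], summation by parts in direction [i]. The displaced
   argument of [gj] is why continuity of [gj] is assumed. *)
have step n : I2 (fun x => fj x * qt i n g x) = I2 (fun x => qt i n f x * gj (mv i n.+1%:R^-1 x)).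
  have gn := part_qt i n hgj.
  have bdq x : `|qt i n g x| <= D by exact: qt_bound hgi.
  have [J1 J2 ->] := part_ibp hfj gn fM bdq (supp_qt gr).
  have K1 : ig2 (fun x => f x * gj x).
    by have := ig2_mul_bd Igj mf fM; apply: eq_ig2 => x; exact: mulrC.
  have [K2 E2] := I2_mv i n.+1%:R^-1 K1.
  have K3 : ig2 (fun x => f x * gj (mv i n.+1%:R^-1 x)).
    have := ig2_mul_bd (I2_mv i n.+1%:R^-1 Igj).1 mf fM; by apply: eq_ig2 => x; exact: mulrC.
  have -> : I2 (fun x => f x * qt i n gj x) = n.+1%:R * (I2 (fun x => f x * gj (mv i n.+1%:R^-1 x)) - I2 (fun x => f x * gj x)).
    rewrite -(I2B K3 K1) -(I2Z _ (ig2B K3 K1)); apply: eq_I2 => x; rewrite /qt; ring.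
  rewrite -E2 -mulrN opprB -(I2B K2 K3) -(I2Z _ (ig2B K2 K3)); apply: eq_I2 => x.
  by rewrite /qt; ring.
have B1 : ig2 (fun x => C' * D * ibox (r + 1) x) by apply: ig2Z; exact: ig2_ibox.
have B2 : ig2 (fun x => C * D' * ibox (r + 1) x) by apply: ig2Z; exact: ig2_ibox.
have [_ c1] : ig2 (fun x => fj x * gi x) /\
    I2 (fun x => fj x * qt i n g x) @[n --> \oo] --> I2 (fun x => fj x * gi x).
  apply: (I2_dctT _ B1).
  - by move=> n; apply: measurable_funM => //; exact: measurable_qt.
  - move=> n x; rewrite normrM; have [->|/(supp_qt gr)[h1 h2]] := eqVneq (qt i n g x) 0.
      by rewrite normr0 mulr0 !mulr_ge0 ?ibox_ge0.
    by rewrite ibox1// mulr1 ler_pM// ?(part_bound _ hfj)// (qt_bound _ _ hgi).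
  - by move=> x; apply: cvgM => //; exact: cvg_cst.
have [_ c2] : ig2 (fun x => fi x * gj x) /\
    I2 (fun x => qt i n f x * gj (mv i n.+1%:R^-1 x)) @[n --> \oo] --> I2 (fun x => fi x * gj x).
  apply: (I2_dctT _ B2).
  - by move=> n; apply: measurable_funM; [exact: measurable_qt|exact: measurable_mv].
  - move=> n x; rewrite normrM; have [->|/(supp_qt fr)[h1 h2]] := eqVneq (qt i n f x) 0.
      by rewrite normr0 mul0r !mulr_ge0 ?ibox_ge0.
    by rewrite ibox1// mulr1 ler_pM// ?(part_bound _ hgj)// (qt_bound _ _ hfi).
  - by move=> x; apply: cvgM.
have E := funext step; rewrite E in c1.
exact: (cvg_unique (@Rhausdorff R) c1 c2).
Qed.

Lemma natSinv_cvg : (fun n => n.+1%:R^-1 : R) @ \oo --> 0^'.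
Proof.
move=> A [d /= d0 hd]; have [N hN] := natSinv_small (divr_gt0 d0 (ltr0n _ 2) : 0 < d / 2).
exists N => // n /= Nn; apply: hd; last by rewrite gt_eqF// invr_gt0.
rewrite /ball/= sub0r normrN ger0_norm ?invr_ge0//.
by apply: le_lt_trans (hN n Nn) _; rewrite ltr_pdivrMr// ltr_pMr// ltr1n.
Qed.

Lemma part_of_deriv i C f p : measurable_fun [set: R * R] f -> (forall x, `|p x| <= C) ->
  (forall x t, is_derive t 1 (fun u : R => f (mv i u x)) (p (mv i t x))) -> part i C f p.
Proof.
move=> mf pC fd; split => //.
- move=> x t.
  have lip (a b : R) : a <= b -> `|f (mv i b x) - f (mv i a x)| <= C * (b - a).
    move=> ab; have [] := @MVT_segment R (fun u => f (mv i u x)) (fun u => p (mv i u x)) a b ab.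
      apply: continuous_subspaceT => u; apply: differentiable_continuous.
      by apply/derivable1_diffP; have [] := fd x u.
    by move=> u _ ->; rewrite normrM (@ger0_norm _ (b - a)) ?subr_ge0// ler_wpM2r// subr_ge0.
  have [t0|/ltW t0] := leP 0 t.
    by have := lip 0 t t0; rewrite mv0 subr0 (ger0_norm t0).
  by have := lip t 0 t0; rewrite mv0 distrC sub0r (ler0_norm t0).
- move=> x; have := fd x 0; rewrite mv0 => -[dx Dx].
  have := dx; rewrite /derivable => /cvg_ex[v hv].
  have vE : v = p x by rewrite -Dx /derive (cvg_lim (@Rhausdorff R) hv).
  rewrite -vE; have := cvg_comp _ _ natSinv_cvg hv; apply: cvg_trans; apply: near_eq_cvg.
  apply: nearW => n /=; rewrite /qt invrK mv0; congr (_ * (f (mv i _ x) - _)).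
  by rewrite addr0 [LHS]mulr1.
Qed.

End DiffQuot.

(** * The regularized kernel and its gradient *)

Section Kernels.
Context (R : realType) (e : R) (e0 : 0 < e) (e1 : e < 1).
Implicit Types (x y z : R * R) (i : bool) (d : R).

Definition kd d z : R := (nrm2 z + d) `^ (- e).
Definition crd i z : R := if i then z.1 else z.2.
(** Partial derivative of [kd d]; for [d = 0] it is the singular kernel of the gradient, with value
    [0] at the origin. *)
Definition dk d i z : R := - (2 * e) * crd i z * (nrm2 z + d) `^ (- (e + 1)).

Lemma measurable_crd i : measurable_fun [set: R * R] (crd i).
Proof. by case: i; [exact: measurable_fst|exact: measurable_snd]. Qed.

Lemma measurable_nrm2d d : measurable_fun [set: R * R] (fun z => nrm2 z + d).
Proof. exact: measurable_funD (@measurable_nrm2 R) (@measurable_cst _ _ _ _ setT d). Qed.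

Lemma measurable_kd d : measurable_fun [set: R * R] (kd d).
Proof. by have := measurableT_comp (@measurable_powR R (- e)) (measurable_nrm2d d). Qed.

Lemma measurable_dk d i : measurable_fun [set: R * R] (dk d i).
Proof.
have m1 := measurable_funM (@measurable_cst _ _ (R * R)%type _ setT (- (2 * e))) (measurable_crd i).
have m2 := measurableT_comp (@measurable_powR R (- (e + 1))) (measurable_nrm2d d).
exact: measurable_funM m1 m2.
Qed.

Lemma kd_ge0 d z : 0 <= kd d z. Proof. exact: powR_ge0. Qed.

Lemma kd_le d z : 0 <= d -> z != 0 -> kd d z <= kp e z.
Proof. by move=> d0 zn; apply: powRN_le; rewrite ?(ltW e0) ?nrm2_gt0 ?lerDl. Qed.

Lemma kd_bound d z : 0 < d -> kd d z <= d `^ (- e).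
Proof. by move=> d0; apply: powRN_le; rewrite ?(ltW e0) ?lerDr ?nrm2_ge0. Qed.

Lemma crd_le i z : `|crd i z| <= enorm z.
Proof. by case: i; [exact: enorm_ge1|exact: enorm_ge2]. Qed.

Lemma dkN d i z : dk d i (- z) = - dk d i z.
Proof. by rewrite /dk nrm2N; case: i; rewrite /crd /=; ring. Qed.

(** Uniform in [d], with [kp (e + 2^-1) z = |z|^(-(2 e + 1))]: this majorant lets [d] tend to
    [0]. *)
Lemma dk_le d i z : 0 <= d -> `|dk d i z| <= 2 * e * kp (e + 2^-1) z.
Proof.
move=> d0; have [->|zn] := eqVneq z 0.
  rewrite /dk (_ : crd i 0 = 0); last by case: i.
  by rewrite mulr0 mul0r normr0 mulr_ge0 ?kp_ge0// mulr_ge0// ltW.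
have z0 : 0 < enorm z by exact: enorm_gt0.
rewrite /dk !normrM normrN (ger0_norm (_ : 0 <= 2 * e)) ?mulr_ge0 ?(ltW e0)//.
rewrite (ger0_norm (powR_ge0 _ _)) -mulrA ler_wpM2l ?mulr_ge0 ?(ltW e0)//.
apply: (@le_trans _ _ (enorm z * nrm2 z `^ (- (e + 1)))).
  apply: ler_pM => //; first exact: powR_ge0; first exact: crd_le.
  by apply: powRN_le; rewrite ?addr_ge0 ?(ltW e0) ?nrm2_gt0 ?lerDl.
rewrite kpE -enorm_sqr (sq_powN _ (ltW z0)) -{1}(powRr1 (ltW z0)) -powRD ?(gt_eqF z0) ?implybT//.
by rewrite le_eqVlt; apply/orP; left; apply/eqP; congr (_ `^ _); field.
Qed.

Lemma dk_bound d i z : 0 < d -> `|dk d i z| <= 2 * e * d `^ (- (e + 2^-1)).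
Proof.
move=> d0; have nd : 0 < nrm2 z + d by rewrite ltr_wpDl ?nrm2_ge0.
rewrite /dk !normrM normrN (ger0_norm (_ : 0 <= 2 * e)) ?mulr_ge0 ?(ltW e0)//.
rewrite (ger0_norm (powR_ge0 _ _)) -mulrA ler_wpM2l ?mulr_ge0 ?(ltW e0)//.
apply: (@le_trans _ _ ((nrm2 z + d) `^ 2^-1 * (nrm2 z + d) `^ (- (e + 1)))).
  rewrite ler_wpM2r ?powR_ge0// (le_trans (crd_le i z))//.
  by rewrite /enorm -/(nrm2 z) powR12_sqrt ?(ltW nd)// ler_wsqrtr// lerDl ltW.
rewrite -powRD ?(gt_eqF nd) ?implybT// (_ : 2^-1 + - (e + 1) = - (e + 2^-1)); last by field.
by apply: powRN_le; rewrite ?addr_ge0 ?invr_ge0 ?(ltW e0)// lerDr nrm2_ge0.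
Qed.

Lemma nrm2_mv i (u : R) z : nrm2 (mv i u z) = (crd i z + u) ^+ 2 + crd (~~ i) z ^+ 2.
Proof. by case: i; rewrite /nrm2 /crd /mv /=; ring. Qed.

Lemma crd_mv i (t : R) z : crd i (mv i t z) = crd i z + t.
Proof. by case: i. Qed.

Lemma is_derive_sq (a k t : R) : is_derive t 1 (fun u : R => (a + u) ^+ 2 + k) (2 * (a + t)).
Proof.
have d1 : is_derive t 1 (fun u : R => a + u) (1 : R).
  have := @is_deriveD R R R (cst a) id t 1 0 1 (is_derive_cst a t 1) (is_derive_id t 1).
  by rewrite add0r.
have d2 := @is_deriveM R R (fun u : R => a + u) (fun u : R => a + u) t 1 1 1 d1 d1.
have d3 := @is_deriveD R R R _ (cst k) t 1 _ 0 d2 (is_derive_cst k t 1).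
have := d3; rewrite addr0 (_ : _ *: 1 + _ *: 1 = 2 * (a + t)); last first.
  by rewrite /GRing.scale/=; ring.
by [].
Qed.

Lemma kd_part d i : 0 < d -> part i (2 * e * d `^ (- (e + 2^-1))) (kd d) (dk d i).
Proof.
move=> d0; apply: part_of_deriv; [exact: measurable_kd|by move=> x; exact: dk_bound|].
move=> x t; pose A (u : R) := (crd i x + u) ^+ 2 + (crd (~~ i) x ^+ 2 + d).
have A0 u : 0 < A u by rewrite /A addrA ltr_wpDl// addr_ge0// sqr_ge0.
have dA : is_derive t 1 A (2 * (crd i x + t)) by exact: is_derive_sq.
have := @is_derive1_comp R (fun u : R => u `^ (- e)) A t _ _ (@is_derive1_powR R (- e) (A t) (A0 t)) dA.
have -> : ((fun u : R => u `^ (- e)) \o A) = (fun u => kd d (mv i u x)).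
  by apply/funext => u; rewrite /kd nrm2_mv /A /= addrA.
have -> // : - e * A t `^ (- e - 1) * (2 * (crd i x + t)) = dk d i (mv i t x).
rewrite /dk nrm2_mv -addrA -/(A t) (_ : - e - 1 = - (e + 1)); last by ring.
rewrite crd_mv; ring.
Qed.

Lemma powR_cont (a p : R) : 0 < a -> (a + n.+1%:R^-1) `^ p @[n --> \oo] --> a `^ p.
Proof.
move=> a0; have cp : {for a, continuous (fun u : R => u `^ p)}.
  apply: differentiable_continuous; apply/derivable1_diffP.
  by have [] := @is_derive1_powR R p a a0.
have ca : a + n.+1%:R^-1 @[n --> \oo] --> a.
  rewrite -[X in _ --> X]addr0; apply: cvgD; first exact: cvg_cst.
  by apply: cvg_trans (@natSinv_cvg R) _; exact: cvg_within.
exact: (cvg_comp _ _ ca cp).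
Qed.

Lemma kd_cvg z : z != 0 -> kd n.+1%:R^-1 z @[n --> \oo] --> kp e z.
Proof. by move=> zn; apply: powR_cont; exact: nrm2_gt0. Qed.

Lemma dk_cvg i z : dk n.+1%:R^-1 i z @[n --> \oo] --> dk 0 i z.
Proof.
have [->|zn] := eqVneq z 0.
  have c0 : crd i (0 : R * R) = 0 by case: i.
  rewrite /dk c0 mulr0 mul0r (_ : (fun n => _) = fun=> 0); first exact: cvg_cst.
  by apply/funext => n; rewrite mul0r.
apply: cvgM; first exact: cvg_cst.
by rewrite addr0; apply: powR_cont; exact: nrm2_gt0.
Qed.

End Kernels.

(** * Principal value convolution *)

Section Conv.
Context (R : realType) (e M r K gam : R) (w : R * R -> R).
Context (e0 : 0 < e) (e1 : e < 1) (r0 : 0 < r) (wb : bsup M r w).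
Context (K0 : 0 <= K) (g0 : 0 < gam) (g1 : gam <= 1) (ge : 2 * e - 1 < gam).
Context (wK : forall h : R * R, I2 (fun x => `|w (x - h) - w x|) <= K * enorm h `^ gam).
Implicit Types (x y z : R * R) (Q : R * R -> R) (i : bool) (X C d : R).

Definition osc z x : R := w (x - z) - w x * ibox 1 z.

(* Principal value convolution; the subtraction makes it converge although the
   kernel is too singular at the origin for a merely bounded density. *)
Definition pv Q x : R := I2 (fun z => Q z * osc z x).

Definition kbound C0 Q := measurable_fun [set: R * R] Q /\ forall z, `|Q z| <= C0 * kp (e + 2^-1) z.

(** [2 E = 2 e + 1 - gam] is the singularity left when a kernel of order [2 e + 1] meets the modulus
    [|z|^gam]; it is below [2] exactly because [2 e - 1 < gam]. *)
Let E := e + 2^-1 - gam / 2.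

Definition dom_k C0 X z : R :=
  C0 * (K * (kp E z * ibox 1 z) + I2 (fun x => `|w x|) * ibox (r + X) z).

Lemma E_ge0 : 0 <= E. Proof. by rewrite /E; have := e0; have := g1; lra. Qed.

Lemma E_lt1 : E < 1. Proof. by rewrite /E; have := ge; lra. Qed.

Lemma ig_dom_k C0 X : ig2 (dom_k C0 X).
Proof.
have [I1 _] := kp_box E_ge0 E_lt1 (ltr01 : 0 < 1 :> R).
exact/ig2Z/ig2D/ig2Z/ig2_ibox/ig2Z.
Qed.

Definition osc_mass X z : R := I2 (fun x => `|osc z x| * ibox X x).

Lemma w_ig : ig2 w. Proof. exact: bsup_ig2 wb. Qed.

Lemma osc_ig z : ig2 (osc z).
Proof.
have [I1 _] := I2_translate (- z) w_ig.
apply: ig2B I1 _; have := ig2Z (ibox 1 z) w_ig.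
by apply: eq_ig2 => x; exact: mulrC.
Qed.

Lemma measurable_osc2 : measurable_fun [set: (R * R) * (R * R)] (fun p => osc p.1 p.2).
Proof.
have [mw _ _] := wb.
have ms : measurable_fun [set: (R * R) * (R * R)] (fun p => p.2 - p.1 : R * R).
  have := measurableT_comp (@measurable_sub2 R) (@measurable_swap _ _ (R * R)%type (R * R)%type).
  by [].
have m1 := measurableT_comp mw ms.
have m2 := measurableT_comp mw (@measurable_snd _ _ (R * R)%type (R * R)%type).
have m3 := measurableT_comp (measurable_ibox 1) (@measurable_fst _ _ (R * R)%type (R * R)%type).
exact: measurable_funB m1 (measurable_funM m2 m3).
Qed.

(** Inside the unit box the modulus of continuity tames the kernel. Outside it the kernel is at most
    [C0], nothing is subtracted, and only those [z] contribute that join the box to the support. *)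
Lemma osc_mass_le C0 X Q z : 0 <= X -> kbound C0 Q -> `|Q z| * osc_mass X z <= dom_k C0 X z.
Proof.
move=> X0 [mQ Qk].
have C00 : 0 <= C0.
  have := Qk (1, 0); rewrite /kp /nrm2 /= expr1n expr0n addr0 powR1 mulr1.
  exact: le_trans.
have m0 : 0 <= osc_mass X z by apply: I2_ge0 => x; rewrite mulr_ge0 ?ibox_ge0.
have Iz := ig2_abs (osc_ig z).
have Im : ig2 (fun x => `|osc z x| * ibox X x).
  exact: ig2_mul_bd Iz (measurable_ibox X) (fun x => ibox_le1 X x).
have Nw : 0 <= I2 (fun x => `|w x|) by apply: I2_ge0 => x.
apply: (le_trans (ler_wpM2r m0 (Qk z))); rewrite /dom_k -mulrA ler_wpM2l//.
have [h|h] := iboxP 1 z.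
  rewrite h mulr1; have mK : osc_mass X z <= K * enorm z `^ gam.
    apply: le_trans (wK z); apply: le_I2 => //.
      by have := Iz; apply: eq_ig2 => x; rewrite /osc h mulr1.
    by move=> x; rewrite /osc h mulr1 ler_piMr// (le_trans (ler_norm _))// ibox_le1.
  apply: (@le_trans _ _ (kp (e + 2^-1) z * (K * enorm z `^ gam))).
    by rewrite ler_wpM2l ?kp_ge0.
  apply: (@le_trans _ _ (K * kp E z)); last by rewrite lerDl mulr_ge0 ?ibox_ge0.
  rewrite mulrCA ler_wpM2l//; have [->|zn] := eqVneq z 0.
    rewrite [kp (e + 2^-1) 0](_ : _ = 0) ?mul0r ?kp_ge0//.
    rewrite /kp /nrm2 /= expr0n addr0 powR0// oppr_eq0 gt_eqF// addr_gt0//.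
  have z0 : 0 < enorm z by exact: enorm_gt0.
  rewrite !kpE -powRD ?(gt_eqF z0) ?implybT// /E le_eqVlt; apply/orP; left; apply/eqP.
  by congr (_ `^ _); field.
rewrite h mulr0 mulr0 add0r.
have kz : kp (e + 2^-1) z <= 1.
  have e2 : 0 <= e + 2^-1 by rewrite addr_ge0 ?invr_ge0 ?(ltW e0).
  have z1 : 1 ^+ 2 <= nrm2 z.
    rewrite -enorm_sqr; apply: sqr_abs_le; rewrite normr1; move: h; rewrite /ibox.
    case: ifPn => [_ /eqP|]; first by rewrite oner_eq0.
    rewrite negb_and -!ltNge => /orP[] /ltW h1 _; apply: (le_trans h1).
      exact: enorm_ge1.
    exact: enorm_ge2.
  by have := kp_far e2 ltr01 z1; rewrite powR1.
apply: (@le_trans _ _ (osc_mass X z)); first by rewrite ler_piMl.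
have [I1 E1] := I2_translate (- z) (ig2_abs w_ig).
rewrite -E1 mulrC -(I2Z _ I1); apply: le_I2 => //; first exact: ig2Z.
move=> x; rewrite /osc h mulr0 subr0.
have [->|wx] := eqVneq (w (x - z)) 0; first by rewrite normr0 mul0r mulr0.
rewrite mulrC ler_wpM2r// {1}/ibox; case: ifP => [/andP[x1 x2]|_]; last exact: ibox_ge0.
have [_ _ wr] := wb; have [y1 y2] := wr _ wx.
have tri (a b u v : R) : `|a - b| <= u -> `|a| <= v -> `|b| <= u + v.
  by rewrite !ler_norml => /andP[? ?] /andP[? ?]; apply/andP; split; lra.
by rewrite ibox1//; [exact: tri y1 x1|exact: tri y2 x2].
Qed.

(** Integrating in [x] before [z] turns oscillations into the [L^1] modulus. So [pv Q] is locally
    integrable, although its integrand is known to be integrable only for almost every [x]. *)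
Lemma pv_swap C0 X Q : 0 <= X -> kbound C0 Q ->
  [/\ ig2 (fun x => pv Q x * ibox X x),
      ig2 (fun z => `|Q z| * osc_mass X z),
      I2 (fun x => `|pv Q x| * ibox X x) <= I2 (fun z => `|Q z| * osc_mass X z) &
      exists2 N : set (R * R), (@lam2 R).-negligible N &
        forall x, ~ N x -> ibox X x = 1 -> ig2 (fun z => Q z * osc z x)].
Proof.
move=> X0 Qk; have [mQ _] := Qk.
pose h z x := Q z * osc z x * ibox X x.
have mh : measurable_fun [set: (R * R) * (R * R)] (fun p => h p.1 p.2).
  have m1 := measurableT_comp mQ (@measurable_fst _ _ (R * R)%type (R * R)%type).
  have m3 := measurableT_comp (measurable_ibox X) (@measurable_snd _ _ (R * R)%type (R * R)%type).
  exact: measurable_funM (measurable_funM m1 measurable_osc2) m3.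
have Ih z : ig2 (h z).
  have := ig2Z (Q z) (ig2_mul_bd (osc_ig z) (measurable_ibox X) (fun x => ibox_le1 X x)).
  by apply: eq_ig2 => x; rewrite /h mulrA.
have Ea z : I2 (fun x => `|h z x|) = `|Q z| * osc_mass X z.
  rewrite /osc_mass -(I2Z _ (ig2_mul_bd (ig2_abs (osc_ig z)) (measurable_ibox X) (fun x => ibox_le1 X x))).
  by apply: eq_I2 => x; rewrite /h !normrM mulrA (ger0_norm (ibox_ge0 _ _)).
have bd z : I2 (fun x => `|h z x|) <= dom_k C0 X z by rewrite Ea; exact: osc_mass_le.
have [_ I2h _ ae1] := I2_swap mh (ig_dom_k C0 X) Ih bd.
have mah : measurable_fun [set: (R * R) * (R * R)] (fun p => `|h p.1 p.2|).
  exact: measurableT_comp mh.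
have bda z : I2 (fun x => `|(`|h z x|)|) <= dom_k C0 X z.
  by rewrite (eq_I2 (fun x => normr_id _)).
have [J1 J2 J3 _] := I2_swap mah (ig_dom_k C0 X) (fun z => ig2_abs (Ih z)) bda.
have pvE x : pv Q x * ibox X x = I2 (fun z => h z x).
  rewrite /pv /h; have [->|->] := iboxP X x.
    by rewrite mulr1; apply: eq_I2 => z; rewrite mulr1.
  by rewrite mulr0 -[LHS](@I2_0 R); apply: eq_I2 => z; rewrite mulr0.
have I1 : ig2 (fun x => pv Q x * ibox X x) by apply: eq_ig2 I2h => x; rewrite pvE.
have I3 : ig2 (fun z => `|Q z| * osc_mass X z) by apply: eq_ig2 J1 => z; rewrite Ea.
have [N [mN N0 NN]] := ae1.
have Nn : (@lam2 R).-negligible N by exists N; split.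
have aeN x : ~ N x -> ig2 (fun z => h z x).
  by move=> nx; apply: contrapT => h1; apply: nx; apply: NN.
split; [exact: I1|exact: I3| |].
- rewrite -(eq_I2 Ea) J3; apply: (le_I2_ae Nn).
  + by have := ig2_abs I1; apply: eq_ig2 => x; rewrite normrM (ger0_norm (ibox_ge0 _ _)).
  + exact: J2.
  + move=> x nx; rewrite -[X in _ * X](ger0_norm (ibox_ge0 X x)) -normrM pvE.
    exact: I2_abs (aeN x nx).
- exists N; first exact: Nn.
  by move=> x nx h1; have := aeN x nx; apply: eq_ig2 => z; rewrite /h h1 mulr1.
Qed.

Lemma kboundB C0 C1 Q Q' : kbound C0 Q -> kbound C1 Q' -> kbound (C0 + C1) (fun z => Q z - Q' z).
Proof.
move=> [mQ hQ] [mQ' hQ']; split; first exact: measurable_funB.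
by move=> z; rewrite (le_trans (ler_normB _ _))// mulrDl lerD.
Qed.

(** Dominated convergence in [z] with majorant [dom_k], after the integration in [x]; no pointwise
    convergence of the principal values is involved. *)
Lemma pv_cvg_L1 C0 X (Qn : nat -> R * R -> R) Q : 0 <= X ->
  (forall n, kbound C0 (Qn n)) -> kbound C0 Q -> (forall z, Qn n z @[n --> \oo] --> Q z) ->
  I2 (fun x => `|pv (Qn n) x - pv Q x| * ibox X x) @[n --> \oo] --> 0.
Proof.
move=> X0 Qnk Qk Qc.
pose D n z := Qn n z - Q z.
have Dk n : kbound (C0 + C0) (D n) by exact: kboundB.
have md n : measurable_fun [set: R * R] (fun z => `|D n z| * osc_mass X z).
  by have [_ /ig2_meas + _ _] := pv_swap X0 (Dk n).
have bd n z : `| `|D n z| * osc_mass X z| <= dom_k (C0 + C0) X z.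
  rewrite ger0_norm; first exact: osc_mass_le.
  by rewrite mulr_ge0//; apply: I2_ge0 => x; rewrite mulr_ge0 ?ibox_ge0.
have cv z : `|D n z| * osc_mass X z @[n --> \oo] --> (0 : R).
  rewrite -[X in _ --> X](mul0r (osc_mass X z)); apply: cvgM; last exact: cvg_cst.
  rewrite -[X in _ --> X](@normr0 _ R) -(subrr (Q z)); apply: cvg_norm.
  by apply: cvgB => //; exact: cvg_cst.
have [_ cI] := I2_dctT md (ig_dom_k (C0 + C0) X) bd cv.
rewrite I2_0 in cI.
apply: (@squeeze_cvgr _ _ _ _ (fun=> 0) (fun n => I2 (fun z => `|D n z| * osc_mass X z))) => //.
  apply: nearW => n; apply/andP; split.
    by apply: I2_ge0 => x; rewrite mulr_ge0 ?ibox_ge0.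
  have [A1 _ A3 _] := pv_swap X0 (Dk n).
  have [B1 _ _ [N1 N10 B4]] := pv_swap X0 (Qnk n).
  have [C1 _ _ [N2 N20 C4]] := pv_swap X0 Qk.
  apply: le_trans A3; apply: (le_I2_ae (negligibleU N10 N20)).
  - have := ig2_abs (ig2B B1 C1); apply: eq_ig2 => x.
    by rewrite -mulrBl normrM (ger0_norm (ibox_ge0 _ _)).
  - by have := ig2_abs A1; apply: eq_ig2 => x; rewrite normrM (ger0_norm (ibox_ge0 _ _)).
  - move=> x /not_orP[n1 n2]; have [h|h] := iboxP X x; last by rewrite h !mulr0.
    rewrite h !mulr1 /pv -(I2B (B4 x n1 h) (C4 x n2 h)) le_eqVlt; apply/orP; left; apply/eqP.
    by congr (`| _ |); apply: eq_I2 => z; rewrite /D mulrBl.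
exact: cvg_cst.
Qed.

Lemma kbound_dk d i : 0 <= d -> kbound (2 * e) (dk e d i).
Proof. by move=> d0; split; [exact: measurable_dk|move=> z; exact: dk_le]. Qed.

Lemma ibox_cvg (v : R) x : v * ibox n%:R x @[n --> \oo] --> v.
Proof.
have a0 : 0 <= `|x.1| + `|x.2| by rewrite addr_ge0.
have h := ltW (archi_boundP a0).
apply/cvgrPdist_le => eps ep; exists (Num.bound (`|x.1| + `|x.2|)) => // n /= hn.
have hn' : `|x.1| + `|x.2| <= n%:R by apply: (le_trans h); rewrite ler_nat.
by rewrite ibox1 ?mulr1 ?subrr ?normr0 ?(ltW ep)// (le_trans _ hn')// ?lerDl ?lerDr.
Qed.

Lemma mv_sub i (t : R) x y : mv i t x - y = mv i t (x - y).
Proof. by case: i; rewrite /mv; apply: pairP => //=; ring. Qed.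

Definition vd d x : R := I2 (fun y => kd e d (x - y) * w y).

Lemma measurable_kdl d x : measurable_fun [set: R * R] (fun y => kd e d (x - y)).
Proof. exact: (measurableT_comp (measurable_kd e d) (measurable_subl x)). Qed.

Lemma ig_kd d x : 0 < d -> ig2 (fun y => kd e d (x - y) * w y).
Proof.
move=> d0; have := ig2_mul_bd w_ig (measurable_kdl d x) (k := d `^ (- e)) _.
move=> h; apply: (eq_ig2 _ (h _)) => [y|y]; first exact: mulrC.
by rewrite ger0_norm ?kd_ge0// kd_bound.
Qed.

Lemma measurable_vd d : 0 < d -> measurable_fun [set: R * R] (vd d).
Proof.
move=> d0; pose h y x := kd e d (x - y) * w y.
have [mw _ _] := wb.
have mh : measurable_fun [set: (R * R) * (R * R)] (fun p => h p.1 p.2).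
  have ms : measurable_fun [set: (R * R) * (R * R)] (fun p => p.2 - p.1 : R * R).
    by have := measurableT_comp (@measurable_sub2 R) (@measurable_swap _ _ (R * R)%type (R * R)%type).
  have m1 := measurableT_comp (measurable_kd e d) ms.
  exact: measurable_funM m1 (measurableT_comp mw (@measurable_fst _ _ (R * R)%type (R * R)%type)).
apply: (@measurable_fun_cvg _ _ _ setT (fun n x => vd d x * ibox n%:R x)) => [n|x _]; last first.
  exact: ibox_cvg.
have mh' : measurable_fun [set: (R * R) * (R * R)] (fun p => h p.1 p.2 * ibox n%:R p.2).
  exact: measurable_funM mh (measurableT_comp (measurable_ibox n%:R) (@measurable_snd _ _ (R * R)%type (R * R)%type)).
have Ih y : ig2 (fun x => h y x * ibox n%:R x).
  have mk : measurable_fun [set: R * R] (fun x => h y x).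
    have mc : measurable_fun [set: R * R] (fun x : R * R => x - y).
      have := measurable_aff2 (1 : R) (- y.1) 1 (- y.2); congr measurable_fun.
      by apply/funext => x; rewrite /aff2 !mul1r; apply: pairP.
    exact: measurable_funM (measurableT_comp (measurable_kd e d) mc) (@measurable_cst _ _ _ _ setT (w y)).
  have := ig2_mul_bd (ig2_ibox n%:R) mk (k := d `^ (- e) * `|w y|).
  move=> hh; apply: (eq_ig2 _ (hh _)) => x; first exact: mulrC.
  by rewrite normrM ler_wpM2r// ger0_norm ?kd_ge0// kd_bound.
pose B y := d `^ (- e) * I2 (ibox n%:R : R * R -> R) * `|w y|.
have IB : ig2 B by apply: ig2Z; exact: ig2_abs w_ig.
have bd y : I2 (fun x => `|h y x * ibox n%:R x|) <= B y.
  rewrite /B (_ : _ * _ * _ = d `^ (- e) * `|w y| * I2 (ibox n%:R : R * R -> R)); last by ring.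
  rewrite -(I2Z _ (ig2_ibox _)); apply: le_I2; [exact: ig2_abs|exact: ig2Z (ig2_ibox _)|].
  move=> x; rewrite normrM (ger0_norm (ibox_ge0 _ _)) ler_wpM2r ?ibox_ge0//.
  by rewrite /h normrM ler_wpM2r// ger0_norm ?kd_ge0// kd_bound.
have [_ I3 _ _] := I2_swap mh' IB Ih bd.
have := ig2_meas I3; congr measurable_fun; apply/funext => x.
rewrite /vd; have [->|->] := iboxP n%:R x.
  by rewrite mulr1; apply: eq_I2 => y; rewrite mulr1.
by rewrite mulr0 -[RHS](@I2_0 R); apply: eq_I2 => y; rewrite mulr0.
Qed.

Lemma vd_part d i : 0 < d ->
  part i (2 * e * d `^ (- (e + 2^-1)) * I2 (fun y => `|w y|)) (vd d) (pv (dk e d i)).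
Proof.
move=> d0; have [mk kC kc] := kd_part e0 i d0.
set C := 2 * e * _ in kC *.
have Iw := ig2_abs w_ig.
split; first exact: measurable_vd.
- move=> x t; rewrite /vd -(I2B (ig_kd _ d0) (ig_kd _ d0)).
  apply: (le_trans (I2_abs (ig2B (ig_kd _ d0) (ig_kd _ d0)))).
  rewrite mulrAC -(I2Z _ Iw); apply: le_I2; [exact: ig2_abs (ig2B (ig_kd _ d0) (ig_kd _ d0))|exact: ig2Z|].
  by move=> y; rewrite -mulrBl normrM ler_wpM2r// mv_sub kC.
- move=> x.
  have pvE : pv (dk e d i) x = I2 (fun y => dk e d i (x - y) * w y).
    have mdl : measurable_fun [set: R * R] (fun y => dk e d i (x - y)).
      exact: (measurableT_comp (measurable_dk e d i) (measurable_subl x)).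
    have Id : ig2 (fun y => dk e d i (x - y) * w y).
      have := ig2_mul_bd w_ig mdl (fun y => dk_bound e0 i (x - y) d0).
      by apply: eq_ig2 => y; exact: mulrC.
    have [J1 <-] := I2_refl x Id.
    have Ib : ig2 (fun z => dk e d i z * ibox 1 z).
      have := ig2_mul_bd (ig2_ibox 1) (measurable_dk e d i) (fun z => dk_bound e0 i z d0).
      by apply: eq_ig2 => y; exact: mulrC.
    (* [dk] is odd, so the subtracted term of [osc] integrates to zero and [pv] is the ordinary
       convolution when [d > 0]. *)
    have B0 : I2 (fun z => dk e d i z * ibox 1 z) = 0.
      have [_ Er] := I2_refl 0 Ib; apply: eqN_eq0; rewrite -[in RHS]Er -(I2N Ib).
      by apply: eq_I2 => z; rewrite sub0r dkN /ibox /= !normrN mulNr.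
    have J2 : ig2 (fun y => dk e d i (x - (x - y)) * w (x - y) - w x * (dk e d i y * ibox 1 y)).
      exact: ig2B J1 (ig2Z _ Ib).
    rewrite -[RHS]subr0 -(mulr0 (w x)) -B0 -(I2Z _ Ib) -(I2B J1 (ig2Z _ Ib)) /pv.
    apply: eq_I2 => z; rewrite /osc (_ : x - (x - z) = z); first by ring.
    by rewrite opprB addrC subrK.
  rewrite pvE.
  have Ib : ig2 (fun y => C * `|w y|) by exact: ig2Z.
  have mq n : measurable_fun [set: R * R] (fun y => qt i n (kd e d) (x - y) * w y).
    have [mw _ _] := wb; apply: measurable_funM mw.
    exact: (measurableT_comp (measurable_qt i n mk) (measurable_subl x)).
  have [_ cI] : ig2 (fun y => dk e d i (x - y) * w y) /\
      I2 (fun y => qt i n (kd e d) (x - y) * w y) @[n --> \oo] --> I2 (fun y => dk e d i (x - y) * w y).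
    apply: (I2_dctT mq Ib).
    - move=> n y; rewrite normrM ler_wpM2r//; exact: (qt_bound n (x - y) (kd_part e0 i d0)).
    - by move=> y; apply: cvgM; [exact: kc|exact: cvg_cst].
  move: cI; apply: cvg_trans; apply: near_eq_cvg; apply: nearW => n.
  rewrite /qt /vd -(I2B (ig_kd _ d0) (ig_kd _ d0)) -(I2Z _ (ig2B (ig_kd _ d0) (ig_kd _ d0))).
  by apply: eq_I2 => y; rewrite mv_sub; ring.
Qed.

Lemma vd_cvg x : vd n.+1%:R^-1 x @[n --> \oo] --> pot e w x.
Proof.
have Ia : ig2 (fun y => `|kp e (x - y) * w y|) by exact: ig2_abs (pot_ig2 x (ltW e0) e1 wb).
have [mw _ _] := wb.
have mk n : measurable_fun [set: R * R] (fun y => kd e n.+1%:R^-1 (x - y) * w y).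
  by apply: measurable_funM mw; exact: measurable_kdl.
have xy y : ~ y.1 = x.1 -> x - y != 0.
  by move=> h; rewrite subr_eq0; apply/eqP => hx; apply: h; rewrite hx.
have [] := @I2_dct R (fun n y => kd e n.+1%:R^-1 (x - y) * w y) (fun y => kp e (x - y) * w y)
  (fun y => `|kp e (x - y) * w y|) _ (null_vline x.1) mk (measurable_pot_in e x mw) Ia.
- move=> n y /xy h; rewrite !normrM ler_wpM2r// !ger0_norm ?kd_ge0 ?kp_ge0//.
  by apply: kd_le => //; rewrite invr_ge0.
- by move=> y /xy h; apply: cvgM; [exact: kd_cvg|exact: cvg_cst].
by [].
Qed.

Lemma vd_bound d X x : 0 <= d -> 0 < r + X -> inbox X x -> `|vd d x| <= M * kbox e (r + X).
Proof.
move=> d0 rX [x1 x2]; have [mw wM wr] := wb.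
have aw : bsup M r (fun y => `|w y|).
  split; [exact: measurableT_comp|by move=> y; rewrite normr_id|].
  by move=> y; rewrite normr_eq0; exact: wr.
have Ia := pot_ig2 x (ltW e0) e1 aw.
apply: (@le_trans _ _ (pot e (fun y => `|w y|) x)); last first.
  exact: le_trans (ler_norm _) (pot_bound (ltW e0) e1 aw rX x1 x2).
apply: (I2_abs_le_ae (null_vline x.1) _ Ia _).2.
  by apply: measurable_funM mw; exact: measurable_kdl.
move=> y /= h; rewrite normrM ler_wpM2r// ger0_norm ?kd_ge0//.
apply: kd_le => //; rewrite subr_eq0; apply/eqP => hx; apply: h; by rewrite hx.
Qed.

Lemma pv_measurable C0 Q : kbound C0 Q -> measurable_fun [set: R * R] (pv Q).
Proof.
move=> Qk; apply: (@measurable_fun_cvg _ _ _ setT (fun n x => pv Q x * ibox n%:R x)) => [n|x _].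
  by have [/ig2_meas + _ _ _] := pv_swap (ler0n _ n) Qk.
exact: ibox_cvg.
Qed.

(** The first factor converges in [L^1] on the box, the second boundedly and pointwise. The second
    may vary with [n] because the vorticity is mollified together with the kernel. *)
Lemma pv_pair_cvg i X C (pn : nat -> R * R -> R) (p : R * R -> R) : 0 <= X ->
  (forall n, measurable_fun [set: R * R] (pn n)) -> (forall n x, `|pn n x| <= C) ->
  (forall n, suppb X (pn n)) -> (forall x, pn n x @[n --> \oo] --> p x) ->
  [/\ ig2 (fun x => pv (dk e 0 i) x * p x), forall n, ig2 (fun x => pv (dk e n.+1%:R^-1 i) x * pn n x) &
      I2 (fun x => pv (dk e n.+1%:R^-1 i) x * pn n x) @[n --> \oo] --> I2 (fun x => pv (dk e 0 i) x * p x)].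
Proof.
move=> X0 mp pC ps pc.
have C1 : 0 <= C by exact: le_trans (normr_ge0 _) (pC 0 0).
have kn n : kbound (2 * e) (dk e n.+1%:R^-1 i) by apply: kbound_dk; rewrite invr_ge0.
have k00 : kbound (2 * e) (dk e 0 i) by exact: kbound_dk.
have [I0 _ _ _] := pv_swap X0 k00.
have In n : ig2 (fun x => pv (dk e n.+1%:R^-1 i) x * pn n x).
  have [J _ _ _] := pv_swap X0 (kn n).
  have := ig2_mul_bd J (mp n) (pC n); apply: eq_ig2 => x.
  have [->|/(ps n)[h1 h2]] := eqVneq (pn n x) 0; first by rewrite !mulr0.
  by rewrite ibox1// mulr1.
have bI : ig2 (fun x => C * `|pv (dk e 0 i) x * ibox X x|) by exact/ig2Z/ig2_abs.
have m0 := pv_measurable k00.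
have [Ip c2] : ig2 (fun x => pv (dk e 0 i) x * p x) /\
    I2 (fun x => pv (dk e 0 i) x * pn n x) @[n --> \oo] --> I2 (fun x => pv (dk e 0 i) x * p x).
  apply: (I2_dctT _ bI).
  - by move=> n; exact: measurable_funM.
  - move=> n x; have [->|/(ps n)[h1 h2]] := eqVneq (pn n x) 0; first by rewrite mulr0 normr0 mulr_ge0.
    by rewrite ibox1// mulr1 normrM mulrC ler_wpM2r.
  - by move=> x; apply: cvgM => //; exact: cvg_cst.
have J0 n : ig2 (fun x => pv (dk e 0 i) x * pn n x).
  have := ig2_mul_bd I0 (mp n) (pC n); apply: eq_ig2 => x.
  have [->|/(ps n)[h1 h2]] := eqVneq (pn n x) 0; first by rewrite !mulr0.
  by rewrite ibox1// mulr1.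
have cz z : (fun n => dk e n.+1%:R^-1 i) n z @[n --> \oo] --> dk e 0 i z by exact: dk_cvg.
have c1 : I2 (fun x => `|pv (dk e n.+1%:R^-1 i) x - pv (dk e 0 i) x| * ibox X x) @[n --> \oo] --> 0.
  exact: (pv_cvg_L1 (Qn := fun n => dk e n.+1%:R^-1 i) X0 kn k00 cz).
have c3 : I2 (fun x => pv (dk e n.+1%:R^-1 i) x * pn n x) - I2 (fun x => pv (dk e 0 i) x * pn n x) @[n --> \oo] --> 0.
  apply: norm_cvg0.
  apply: (@squeeze_cvgr _ _ _ _ (fun=> 0) (fun n => C * I2 (fun x => `|pv (dk e n.+1%:R^-1 i) x - pv (dk e 0 i) x| * ibox X x))).
  - apply: nearW => n; rewrite normr_ge0/= -(I2B (In n) (J0 n)).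
    have [Ja _ _ _] := pv_swap X0 (kn n).
    have Jd : ig2 (fun x => `|pv (dk e n.+1%:R^-1 i) x - pv (dk e 0 i) x| * ibox X x).
      have := ig2_abs (ig2B Ja I0); apply: eq_ig2 => x.
      by rewrite -mulrBl normrM (ger0_norm (ibox_ge0 _ _)).
    rewrite -(I2Z _ Jd); apply: (le_trans (I2_abs (ig2B (In n) (J0 n)))).
    apply: le_I2; [exact: ig2_abs (ig2B (In n) (J0 n))|exact: ig2Z|].
    move=> x; rewrite -mulrBl; have [->|/(ps n)[h1 h2]] := eqVneq (pn n x) 0.
      by rewrite mulr0 normr0 mulr_ge0// mulr_ge0 ?ibox_ge0.
    by rewrite ibox1// mulr1 normrM mulrC ler_wpM2r.
  - exact: cvg_cst.
  - by rewrite -[X in _ --> X](mulr0 C); apply: cvgMr.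
split; [exact: Ip|exact: In|].
rewrite (_ : (fun n => I2 (fun x => pv (dk e n.+1%:R^-1 i) x * pn n x)) =
  (fun n => I2 (fun x => pv (dk e n.+1%:R^-1 i) x * pn n x) - I2 (fun x => pv (dk e 0 i) x * pn n x) +
    I2 (fun x => pv (dk e 0 i) x * pn n x))); last by apply/funext => n; rewrite subrK.
by rewrite -[X in _ --> X]add0r; apply: cvgD; [exact: c3|exact: c2].
Qed.

(** Integration by parts holds for the mollified potential, and both sides have limits. *)
Lemma pot_weak_grad i D M' X phi p : part i D phi p -> (forall x, `|phi x| <= M') ->
  suppb X phi -> 0 <= X ->
  I2 (fun x => pot e w x * p x) = - I2 (fun x => pv (dk e 0 i) x * phi x).
Proof.
move=> hp bphi sp X0; have [mphi _ _] := hp; have mpp := part_meas hp.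
have D0 : 0 <= D by exact: le_trans (normr_ge0 _) (qt_bound 0 0 hp).
have X1 : 0 < r + (X + 1) by rewrite addrA ltr_wpDl// addr_ge0// ltW.
have [_ _ c1] := @pv_pair_cvg i X M' (fun=> phi) phi X0 (fun=> mphi) (fun=> bphi) (fun=> sp)
  (fun x => cvg_cst (phi x)).
pose B := M * kbox e (r + (X + 1)).
have B0 : 0 <= B by rewrite mulr_ge0 ?kbox_ge0// (bsup_ge0 wb).
have bI : ig2 (fun x => B * D * ibox (X + 1) x) by apply: ig2Z; exact: ig2_ibox.
have [_ c2] : ig2 (fun x => pot e w x * p x) /\
    I2 (fun x => vd n.+1%:R^-1 x * p x) @[n --> \oo] --> I2 (fun x => pot e w x * p x).
  apply: (I2_dctT _ bI).
  - by move=> n; apply: measurable_funM => //; apply: measurable_vd; rewrite invr_gt0.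
  - move=> n x; have [->|px] := eqVneq (p x) 0.
      by rewrite mulr0 normr0 mulr_ge0 ?ibox_ge0// mulr_ge0.
    have xX := supp_part hp sp px; have [h1 h2] := xX.
    rewrite ibox1// mulr1 normrM ler_pM//; last exact: part_bound hp.
    by apply: vd_bound => //; rewrite invr_ge0.
  - by move=> x; apply: cvgM; [exact: vd_cvg|exact: cvg_cst].
have c3 : - I2 (fun x => pv (dk e n.+1%:R^-1 i) x * phi x) @[n --> \oo] -->
  - I2 (fun x => pv (dk e 0 i) x * phi x) by exact: cvgN c1.
suff E' : (fun n => I2 (fun x => vd n.+1%:R^-1 x * p x)) =
    (fun n => - I2 (fun x => pv (dk e n.+1%:R^-1 i) x * phi x)).
  by rewrite E' in c2; exact: (cvg_unique (@Rhausdorff R) c2 c3).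
apply/funext => n; have d0 : 0 < n.+1%:R^-1 :> R by rewrite invr_gt0.
have pd := vd_part i d0.
have vb x : `|vd n.+1%:R^-1 x| <= n.+1%:R^-1 `^ (- e) * I2 (fun y => `|w y|).
  rewrite -(I2Z _ (ig2_abs w_ig)); apply: (le_trans (I2_abs (ig_kd x d0))).
  apply: le_I2; [exact: ig2_abs (ig_kd x d0)|exact: ig2Z (ig2_abs w_ig)|].
  by move=> y; rewrite normrM ler_wpM2r// ger0_norm ?kd_ge0// kd_bound.
have [_ _ E'] := part_ibp pd hp vb bphi sp.
by rewrite E' opprK.
Qed.

End Conv.

(** * The weak form of the equation *)

Section Averages.
Context (R : realType) (f : R -> R).
Context (fm : forall t u : R, t <= u -> f t <= f u) (fz : forall t : R, t <= 0 -> f t = 0).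
Implicit Types (t u : R).

(** Backward average of [f] over an interval of length [1 / (n + 1)]: continuous, monotone, at most
    [f], and still [0] for nonpositive arguments, which a centred average need not be. *)
Definition avg (n : nat) t : R := n.+1%:R * (prim f t - prim f (t - n.+1%:R^-1)).

Lemma prim_le t u : prim f u - prim f t <= f u * (u - t).
Proof. by have := prim_ge fm fz u t; rewrite -(opprB t u) mulrN -(opprB (prim f t)) lerN2. Qed.

Lemma avg_mono n t u : t <= u -> avg n t <= avg n u.
Proof.
move=> tu; rewrite /avg ler_wpM2l//; set h := n.+1%:R^-1.
have h0 : 0 <= h by rewrite invr_ge0.
have [ut|tu'] := leP (u - h) t; last first.
  have h1 := prim_le (t - h) t; have h2 := prim_ge fm fz (u - h) u.
  have h3 := ler_wpM2r h0 (fm (ltW tu')).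
  move: h1 h2; rewrite !opprB ![_ + (h - _)]addrC !subrK => h1 h2.
  exact: le_trans h1 (le_trans h3 h2).
have h1 := prim_ge fm fz t u; have h2 := prim_le (t - h) (u - h).
have d0 : 0 <= u - t by rewrite subr_ge0.
have h3 := ler_wpM2r d0 (fm ut).
have E : u - h - (t - h) = u - t by ring.
by rewrite E in h2; move: (prim f _) (prim f _) (prim f _) (prim f _) h1 h2 h3 => A B C D; lra.
Qed.

Lemma avg_neg n t : t <= 0 -> avg n t = 0.
Proof.
move=> t0; have t1 : t - n.+1%:R^-1 <= 0 by rewrite subr_le0 (le_trans t0)// invr_ge0.
by rewrite /avg (prim_neg f t0) (prim_neg f t1) subrr mulr0.
Qed.

Lemma avg_le n t : avg n t <= f t.
Proof.
rewrite /avg mulrC -ler_pdivlMr// (le_trans (prim_le _ _))//.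
by rewrite opprB addrC subrK.
Qed.

Lemma avg_ge n t : f (t - n.+1%:R^-1) <= avg n t.
Proof.
rewrite /avg mulrC -ler_pdivrMr// (le_trans _ (prim_ge fm fz _ _))//.
by rewrite (_ : t - (t - n.+1%:R^-1) = n.+1%:R^-1)//; ring.
Qed.

Lemma prim_lip (B t u : R) : t <= B -> u <= B -> `|prim f t - prim f u| <= f B * `|t - u|.
Proof.
move=> tB uB; wlog tu : t u tB uB / t <= u => [hw|].
  by have [/hw->//|/ltW/hw] := leP t u; rewrite distrC (distrC t); apply.
have d0 : 0 <= u - t by rewrite subr_ge0.
rewrite distrC (distrC t) (ger0_norm d0) ger0_norm.
  by apply: (le_trans (prim_le _ _)); rewrite ler_wpM2r// fm.
apply: le_trans (prim_ge fm fz _ _); by rewrite mulr_ge0// (nondecr_ge0 fm fz).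
Qed.

Lemma prim_cont : continuous (prim f).
Proof.
move=> t; apply/cvgrPdist_le => eps ep.
have K0 : 0 <= f (t + 1) by exact: (nondecr_ge0 fm fz).
have K1 : 0 < f (t + 1) + 1 by rewrite ltr_wpDl.
have d0 : 0 < Num.min 1 (eps / (f (t + 1) + 1)) by rewrite lt_min ltr01 divr_gt0.
apply/nbhs_ballP; exists (Num.min 1 (eps / (f (t + 1) + 1))) => // u.
rewrite /ball/= lt_min => /andP[u1 u2].
have uB : u <= t + 1 by move: u1; rewrite ltr_norml => /andP[? ?]; lra.
have tB : t <= t + 1 by rewrite lerDl.
apply: (le_trans (prim_lip tB uB)).
apply: (@le_trans _ _ ((f (t + 1) + 1) * `|t - u|)); first by rewrite ler_wpM2r// lerDl.
by rewrite mulrC -ler_pdivlMr// ltW.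
Qed.

Lemma avg_cont n : continuous (avg n).
Proof.
move=> t; apply: cvgMr; apply: cvgB; first exact: prim_cont.
have c1 : u - n.+1%:R^-1 @[u --> t] --> t - n.+1%:R^-1.
  by apply: cvgB; [exact: cvg_id|exact: cvg_cst].
exact: (cvg_comp _ _ c1 (@prim_cont _)).
Qed.

End Averages.

Section HalfPrim.
Context (R : realType) (f : R -> R) (U : R * R -> R) (B l r : R).
Context (fm : forall t u : R, t <= u -> f t <= f u) (fz : forall t : R, t <= 0 -> f t = 0).
Context (fc : continuous f) (l0 : 0 < l).
Context (UB : forall x : R * R, 0 <= x.1 -> U x <= B).
Context (U0 : forall x : R * R, 0 <= x.1 -> ~ (l <= x.1 /\ inbox r x) -> U x <= 0).
Implicit Types (x y : R * R).

Definition half (a : R * R -> R) x : R := if 0 <= x.1 then a x else 0.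

Lemma measurable_half a : measurable_fun [set: R * R] a -> measurable_fun [set: R * R] (half a).
Proof.
move=> ma; apply: measurable_fun_ifT; [|exact: ma|exact: measurable_cst].
by apply: measurable_fun_ler => //; exact: measurable_cst.
Qed.

Lemma half_prim_ge0 x : 0 <= half (fun y => prim f (U y)) x.
Proof. by rewrite /half; case: ifP => // _; exact: prim_ge0. Qed.

Lemma half_prim_le x : half (fun y => prim f (U y)) x <= prim f (Num.max B 0).
Proof.
have mono t u : t <= u -> prim f t <= prim f u.
  move=> tu; rewrite -subr_ge0; apply: le_trans (prim_ge fm fz t u).
  by rewrite mulr_ge0 ?subr_ge0// (nondecr_ge0 fm fz).
rewrite /half; case: ifP => [x1|_]; last exact: prim_ge0.
by apply: mono; rewrite le_max UB.
Qed.

Lemma half_prim_supp x : half (fun y => prim f (U y)) x != 0 -> l <= x.1 /\ inbox r x.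
Proof.
rewrite /half; case: ifP => [x1|_]; last by rewrite eqxx.
move=> h; apply: contrapT => no; move: h.
by rewrite (prim_neg f (U0 x1 no)) eqxx.
Qed.

(** The composite vanishes unless [l <= x.1], so its extension by [0] across the axis stays
    Lipschitz; the term with [/ l] pays for segments that leave the support and cross the axis. The
    chain rule is a squeeze between the values of [f] at the two ends of the quotient. *)
Lemma half_prim_part i (C : R) p : part i C U p ->
  part i (f (Num.max B 0) * C + prim f (Num.max B 0) / l)
    (half (fun x => prim f (U x))) (half (fun x => f (U x) * p x)).
Proof.
move=> hU; have [mU UC Uc] := hU; set B' := Num.max B 0.
have fB : 0 <= f B' by exact: (nondecr_ge0 fm fz).
have pB : 0 <= prim f B' by exact: prim_ge0.
have UB' x : 0 <= x.1 -> U x <= B' by move=> x1; rewrite le_max UB.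
split.
- apply: measurable_half; apply: (measurableT_comp _ mU).
  exact: continuous_measurable_fun (prim_cont fm fz).
- move=> x t.
  have C0 : 0 <= C * `|t| by exact: le_trans (UC x t).
  have pl : 0 <= prim f B' / l by rewrite divr_ge0// ltW.
  have cross y y' : l <= y.1 -> y'.1 < 0 -> `|y'.1 - y.1| <= `|t| -> 1 <= `|t| / l.
    move=> h1 h2 h3; rewrite ler_pdivlMr// mul1r; apply: le_trans h3.
    by have l0' := l0; rewrite distrC ger0_norm; lra.
  have dist1 : `|(mv i t x).1 - x.1| <= `|t|.
    by case: i {hU UC Uc}; rewrite /mv /= ?subrr ?normr0// addrAC subrr add0r.
  have one_side y y' : 0 <= y.1 -> (0 <= y'.1) = false -> `|y'.1 - y.1| <= `|t| ->
      half (fun x => prim f (U x)) y <= prim f B' / l * `|t|.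
    move=> y1 y1' d; have [->|/half_prim_supp[ly _]] := eqVneq (half (fun x => prim f (U x)) y) 0.
      by rewrite mulr_ge0.
    apply: (le_trans (half_prim_le y)); rewrite -/B' -mulrA ler_peMr//.
    by rewrite mulrC (cross y y')// ltNge y1'.
  rewrite mulrDl; have [h1|h1] := boolP (0 <= x.1); have [h2|h2] := boolP (0 <= (mv i t x).1).
  + rewrite {1 2}/half h1 h2 (le_trans (prim_lip fm fz (UB' _ h2) (UB' _ h1)))//.
    rewrite -[leLHS]addr0; apply: lerD; last exact: mulr_ge0.
    by rewrite -mulrA; exact: ler_wpM2l.
  + rewrite [X in `|X - _|]/half (negbTE h2) sub0r normrN (ger0_norm (half_prim_ge0 _)).
    apply: (le_trans (one_side x _ h1 (negbTE h2) dist1)).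
    by rewrite lerDr -mulrA mulr_ge0.
  + rewrite [X in `|_ - X|]/half (negbTE h1) subr0 (ger0_norm (half_prim_ge0 _)).
    rewrite distrC in dist1.
    apply: (le_trans (one_side _ x h2 (negbTE h1) dist1)).
    by rewrite lerDr -mulrA mulr_ge0.
  + by rewrite {1 2}/half (negbTE h1) (negbTE h2) subrr normr0 -mulrA; apply: addr_ge0; exact: mulr_ge0.
- move=> x; rewrite {2}/half; have [x1|x1] := boolP (0 <= x.1); last first.
    have x10 : x.1 < 0 by rewrite ltNge.
    have x11 : 0 < - x.1 / 2 by rewrite divr_gt0// oppr_gt0.
    have [N hN] := natSinv_small x11.
    apply/cvgrPdist_le => eps ep; exists N => // n /= Nn.
    rewrite /qt /half (negbTE x1) (_ : (0 <= (mv i n.+1%:R^-1 x).1) = false).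
      by rewrite subrr mulr0 subrr normr0 ltW.
    apply/negbTE; rewrite -ltNge; have := hN n Nn.
    by clear hU Uc UC; case: i => /=; move: (n.+1%:R^-1) => a ha; lra.
  have xn1 n : 0 <= (mv i n.+1%:R^-1 x).1.
    by case: (i); rewrite /mv//= addr_ge0// invr_ge0.
  have c1 : f (U x) * qt i n U x @[n --> \oo] --> f (U x) * p x.
    by apply: cvgM; [exact: cvg_cst|exact: Uc].
  have c2 : f (U (mv i n.+1%:R^-1 x)) * qt i n U x @[n --> \oo] --> f (U x) * p x.
    apply: cvgM; last exact: Uc.
    have c3 : f y @[y --> U x] --> f (U x) by exact: fc.
    have c4 := part_cont (x := x) hU.
    exact: (cvg_comp (fun n : nat => U (mv i n.+1%:R^-1 x)) f c4 c3).
  apply: (squeeze_cvgr _ c1 c2); apply: nearW => n.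
  rewrite /qt /half x1 xn1; set a := U x; set b := U _.
  have n0 : 0 <= n.+1%:R :> R by [].
  apply/andP; split.
    by rewrite mulrCA ler_wpM2l// prim_ge.
  by rewrite [leRHS]mulrCA ler_wpM2l// prim_le.
Qed.

End HalfPrim.

Section TestFunctions.
Context (R : realType).
Implicit Types (x y : R * R) (phi p : R * R -> R) (i : bool).

(** One continuous derivative along each coordinate is all that the weak form needs, and this class
    is stable under [bar]. *)
Definition c1c (X : R) (phi p1 p2 : R * R -> R) :=
  [/\ [/\ continuous phi, continuous p1 & continuous p2], suppb X phi,
      forall x (t : R), is_derive t 1 (fun u : R => phi (mv true u x)) (p1 (mv true t x)) &
      forall x (t : R), is_derive t 1 (fun u : R => phi (mv false u x)) (p2 (mv false t x))].

Lemma continuous_box (g : R * R -> R) (X : R) : continuous g ->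
  exists2 C : R, 0 <= C & forall x, inbox X x -> `|g x| <= C.
Proof.
move=> gc; pose S : set R := `[- X, X]%classic.
have cS : compact (S `*` S) by apply: compact_setX; exact: segment_compact.
have cg : {within S `*` S, continuous g} by exact: continuous_subspaceT.
have [C0 [_ hC]] := compact_bounded (continuous_compact cg cS).
exists (`|C0| + 1); first by rewrite addr_ge0.
move=> x [x1 x2]; apply: (hC (`|C0| + 1)).
  by rewrite (le_lt_trans (ler_norm _))// ltrDl.
exists x => //; split; rewrite /S /= in_itv/= -ler_norml; [exact: x1|exact: x2].
Qed.

Lemma qt_cvg_deriv i phi p x : is_derive (0 : R) 1 (fun u : R => phi (mv i u x)) (p x) ->
  qt i n phi x @[n --> \oo] --> p x.
Proof.
move=> [dx Dx]; have := dx; rewrite /derivable => /cvg_ex[v hv].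
have vE : v = p x by rewrite -Dx /derive (cvg_lim (@Rhausdorff R) hv).
rewrite -vE; have := cvg_comp _ _ (@natSinv_cvg R) hv; apply: cvg_trans; apply: near_eq_cvg.
apply: nearW => n /=; rewrite /qt invrK mv0; congr (_ * (phi (mv i _ x) - _)).
by rewrite addr0 [LHS]mulr1.
Qed.

Lemma deriv_part i (X : R) phi p : continuous phi -> continuous p -> suppb X phi ->
  (forall x (t : R), is_derive t 1 (fun u : R => phi (mv i u x)) (p (mv i t x))) ->
  exists2 C, 0 <= C & part i C phi p.
Proof.
move=> cphi cp sp dp; have [C C0 hC] := continuous_box (X + 1) cp.
exists C => //; apply: part_of_deriv; [exact: cont2_meas|move=> x].
have [/hC//|nx] := pselect (inbox (X + 1) x).
have dx : is_derive (0 : R) 1 (fun u : R => phi (mv i u x)) (p x) by have := dp x 0; rewrite mv0.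
have := qt_cvg_deriv dx; rewrite (_ : (fun n => qt i n phi x) = fun=> 0); last first.
  apply/funext => n; apply/eqP/negPn/negP => h; exact: nx (supp_qt sp h).
by move=> /(cvg_lim (@Rhausdorff R)) <-; rewrite lim_cst// normr0.
Qed.

Lemma supp_bounded (X : R) phi : continuous phi -> suppb X phi ->
  exists2 C, 0 <= C & forall x, `|phi x| <= C.
Proof.
move=> cphi sp; have [C C0 hC] := continuous_box X cphi; exists C => // x.
by have [->|/sp/hC//] := eqVneq (phi x) 0; rewrite normr0.
Qed.

Lemma c1c_bar (X : R) (phi p1 p2 : R * R -> R) : c1c X phi p1 p2 ->
  c1c X (fun x => phi (bar x)) (fun x => - p1 (bar x)) (fun x => p2 (bar x)).
Proof.
move=> [[c c1 c2] sp d1 d2].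
have cb : continuous (@bar R).
  move=> x; have c1' : - y.1 @[y --> x] --> - x.1 by apply: cvgN; exact: cvg_fst.
  have c2' : y.2 @[y --> x] --> x.2 by exact: cvg_snd.
  exact: (@cvg_pair _ _ _ _ _ _ _ _ _ _ _ c1' c2').
have cc (g : R * R -> R) : continuous g -> continuous (fun x => g (bar x)).
  by move=> cg x; apply: (cvg_comp _ _ (cb x) (cg _)).
split.
- split; [exact: cc|move=> x; apply: cvgN; exact: (cc _ c1)|exact: cc].
- by move=> x /sp[h1 h2]; split; [move: h1; rewrite /bar /= normrN|exact: h2].
- move=> x t; have dN : is_derive t 1 (fun u : R => - u) (- 1 : R) by exact: is_deriveN.
  have E u : bar (mv true u x) = mv true (- u) (bar x) by rewrite /bar /mv /= opprD.
  have := @is_derive1_comp R (fun u => phi (mv true u (bar x))) (fun u : R => - u) t _ _ (d1 (bar x) (- t)) dN.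
  by rewrite mulrN1 -E; congr is_derive; apply/funext => u /=; rewrite E.
- by move=> x t; exact: (d2 (bar x) t).
Qed.

End TestFunctions.

Lemma cvg_continuous (R : realType) (U : topologicalType) (g : U -> R) (u : nat -> U) (a : U) :
  continuous g -> u n @[n --> \oo] --> a -> g (u n) @[n --> \oo] --> g a.
Proof. by move=> cg ua; exact: (cvg_comp u g ua (cg a)). Qed.

Lemma sqr_add_ge (R : realType) (a t : R) : 0 <= a -> 0 <= t -> t ^+ 2 <= (a + t) ^+ 2 - a ^+ 2.
Proof.
move=> a0 t0; have -> : (a + t) ^+ 2 - a ^+ 2 = t ^+ 2 + 2 * a * t by ring.
by rewrite lerDl !mulr_ge0.
Qed.

Lemma le_shift2 (R : realType) (a b m t : R) : t <= a - b -> b - m <= a - m - t.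
Proof. lra. Qed.

Lemma gt_half (R : realType) (a : R) : 0 < a -> ~ a <= a / 2.
Proof. lra. Qed.

(** * The equation in the right half-plane and its reflection *)

Section Weak.
Context (R : realType) (e c W mu M r l K gam : R) (f : R -> R) (z : R * R -> R).
Context (e0 : 0 < e) (e1 : e < 1) (c0 : 0 < c) (W0 : 0 <= W) (r0 : 0 < r) (l0 : 0 < l) (mu0 : 0 < mu).
Context (fm : forall t u : R, t <= u -> f t <= f u) (fz : forall t : R, t <= 0 -> f t = 0).
Context (zb : bsup M r z) (z0 : forall x, 0 <= z x) (sz : sdec z).
Context (zl : forall y, z y != 0 -> l <= y.1) (zm : 0 < I2 z).
Context (zE : forall x, 0 <= x.1 -> z x = f (stream e c W z x - mu)).
Context (zout : forall x, 0 <= x.1 -> ~ (l <= x.1 /\ inbox r x) -> c * pot e z x <= mu).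
Context (K0 : 0 <= K) (g0 : 0 < gam) (g1 : gam <= 1) (ge : 2 * e - 1 < gam).
Context (zK : forall h : R * R, I2 (fun x => `|z (x - h) - z x|) <= K * enorm h `^ gam).
Implicit Types (x y h : R * R) (i : bool).

Definition odd_part x : R := z x - z (bar x).
Let w := odd_part.

Lemma odd_bsup : bsup (M + M) r w.
Proof. exact: bsupB zb (bsup_bar zb). Qed.

Lemma bar_sub x y : bar (x - y) = bar x - bar y.
Proof. by rewrite /bar; apply: pairP => //=; ring. Qed.

Lemma odd_bar x : w (bar x) = - w x.
Proof. by rewrite /w /odd_part barK opprB. Qed.

Lemma odd_modulus h : I2 (fun x => `|w (x - h) - w x|) <= (K + K) * enorm h `^ gam.
Proof.
have Iz := bsup_ig2 zb.
have ID k : ig2 (fun x => `|z (x - k) - z x|).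
  by apply: ig2_abs; apply: (ig2B (I2_translate (- k) Iz).1 Iz).
have [Ib Eb] := I2_bar (ID (bar h)).
apply: (@le_trans _ _ (I2 (fun x => `|z (x - h) - z x| + `|z (bar x - bar h) - z (bar x)|))).
  apply: le_I2; last 1 first.
  - move=> x; rewrite /w /odd_part bar_sub; apply: le_trans (ler_normB _ _).
    by rewrite le_eqVlt; apply/orP; left; apply/eqP; congr (`|_|); ring.
  - apply: ig2_abs; apply: ig2B; last exact: bsup_ig2 odd_bsup.
    exact: (I2_translate (- h) (bsup_ig2 odd_bsup)).1.
  - exact: ig2D (ID h) Ib.
rewrite (I2D (ID h) Ib) Eb mulrDl lerD//; apply: (le_trans (zK _)).
by rewrite /enorm /bar /= sqrrN.
Qed.

Lemma odd_pot x : pot e w x = hpot e z x.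
Proof. by rewrite /w /odd_part (potB (ltW e0) e1 x zb (bsup_bar zb)) (pot_bar (ltW e0) e1 x zb). Qed.

Lemma vd_odd_le (d : R) x : 0 < d -> vd e w d x <= pot e z x.
Proof.
move=> d0; apply: (le_I2_ae (null_vline x.1)).
- exact: (ig_kd e0 odd_bsup).
- exact: pot_ig2 x (ltW e0) e1 zb.
- move=> y h; have xy : x - y != 0.
    by rewrite subr_eq0; apply/eqP => hx; apply: h; rewrite /= hx.
  apply: (@le_trans _ _ (kd e d (x - y) * z y)).
    by rewrite ler_wpM2l ?kd_ge0// /w /odd_part gerBl.
  by rewrite ler_wpM2r// kd_le// ltW.
Qed.

Definition sdel (d : R) x : R := c * vd e w d x - W * x.1 - mu.

Definition gdel (d : R) i x : R := c * pv w (dk e d i) x - (if i then W else 0).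

Definition ub : R := c * (M * kbox e (r + r)).

(** Image and drift are nonpositive on the right and [kd d <= kp e], so the plain potential bounds
    every mollification; with [zout] the composite with [f] vanishes outside a fixed box, uniformly
    in [d]. *)
Lemma sdel_le (d : R) x : 0 < d -> 0 <= x.1 -> sdel d x <= c * pot e z x - mu.
Proof.
move=> d0 x1; have h1 := vd_odd_le x d0.
have h2 : 0 <= W * x.1 by rewrite mulr_ge0.
rewrite /sdel lerD2r; apply: (@le_trans _ _ (c * vd e w d x)); first by rewrite gerBl.
by rewrite ler_pM2l.
Qed.

Lemma sdel_out (d : R) x : 0 < d -> 0 <= x.1 -> ~ (l <= x.1 /\ inbox r x) -> sdel d x <= 0.
Proof. by move=> d0 x1 h; rewrite (le_trans (sdel_le d0 x1))// subr_le0 zout. Qed.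

Lemma sdel_ub (d : R) x : 0 < d -> 0 <= x.1 -> sdel d x <= ub.
Proof.
move=> d0 x1; have ub0 : 0 <= ub by rewrite mulr_ge0 ?(ltW c0)// mulr_ge0 ?kbox_ge0 ?(bsup_ge0 zb).
have [[xl [b1 b2]]|h] := pselect (l <= x.1 /\ inbox r x); last exact: le_trans (sdel_out d0 x1 h) ub0.
apply: (le_trans (sdel_le d0 x1)); rewrite (@le_trans _ _ (c * pot e z x))//; first by rewrite gerBl ltW.
rewrite ler_pM2l//; apply: le_trans (ler_norm _) _.
by apply: (pot_bound (ltW e0) e1 zb) => //; rewrite addr_gt0.
Qed.

Lemma sdel_part (d : R) i : 0 < d -> exists C, part i C (sdel d) (gdel d i).
Proof.
move=> d0; have [mvd vC vc] := vd_part e0 odd_bsup i d0.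
set C := _ * I2 _ in vC.
exists (c * C + W); split.
- apply: measurable_funB (@measurable_cst _ _ _ _ _ mu).
  apply: measurable_funB.
    exact: measurable_funM (@measurable_cst _ _ _ _ _ c) mvd.
  exact: measurable_funM (@measurable_cst _ _ _ _ _ W) measurable_fst.
- move=> x t; have hx := vC x t.
  have h1 : `|(mv i t x).1 - x.1| <= `|t|.
    by case: (i); rewrite /mv /= ?subrr ?normr0// addrAC subrr add0r.
  rewrite (_ : sdel d (mv i t x) - sdel d x = c * (vd e w d (mv i t x) - vd e w d x) - W * ((mv i t x).1 - x.1)).
    rewrite (le_trans (ler_normB _ _))// mulrDl !normrM (gtr0_norm c0) (ger0_norm W0) -mulrA.
    by rewrite lerD// ?ler_wpM2l// ltW.
  by rewrite /sdel; move: (mv i t x) => D; move: (vd _ _ _ _) (vd _ _ _ _) => A B; ring.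
- move=> x; rewrite (_ : (fun n => qt i n (sdel d) x) = (fun n => c * qt i n (vd e w d) x - (if i then W else 0))).
    by apply: cvgB; [exact: cvgMr (vc x)|exact: cvg_cst].
  apply/funext => n; rewrite /qt /sdel; have n0 : n.+1%:R != 0 :> R by [].
  move: (vd _ _ _ _) (vd _ _ _ _) => A B; case: (i); rewrite /mv /=; last by ring.
  by move: n0; move: (n.+1%:R) => m m0; field.
Qed.

Lemma sdel_cvg x : sdel n.+1%:R^-1 x @[n --> \oo] --> stream e c W z x - mu.
Proof.
apply: cvgB; last exact: cvg_cst; apply: cvgB; last exact: cvg_cst.
by rewrite -odd_pot; apply: cvgMr; exact: vd_cvg e0 e1 odd_bsup x.
Qed.

Lemma avg_fz n (t : R) : t <= 0 -> avg f n t = 0.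
Proof. exact: avg_neg. Qed.

(** By [avg_ge] the backward average differs from [f] by at most this; its limit is the left jump of
    [f] at the value of the stream function. *)
Definition gap n x : R :=
  half (fun x => f (stream e c W z x - mu) - f (stream e c W z x - mu - n.+1%:R^-1)) x.

Lemma gap_ge0 n x : 0 <= gap n x.
Proof. by rewrite /gap /half; case: ifP => // _; rewrite subr_ge0 fm// gerBl invr_ge0. Qed.

Lemma gap_nonincr x : nonincreasing_seq (fun n => gap n x).
Proof.
move=> n m nm; rewrite /gap /half; case: ifP => // _; rewrite lerD2l lerN2 fm// lerD2l lerN2.
by rewrite lef_pV2 ?posrE// ler_nat.
Qed.

Lemma measurable_stream : measurable_fun [set: R * R] (stream e c W z).
Proof.
apply: measurable_funB.
  exact: measurable_funM (@measurable_cst _ _ _ _ _ c) (measurable_hpot (ltW e0) e1 zb).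
exact: measurable_funM (@measurable_cst _ _ _ _ _ W) measurable_fst.
Qed.

Lemma measurable_gap n : measurable_fun [set: R * R] (gap n).
Proof.
apply: measurable_half; have mS := measurable_stream.
have mV : measurable_fun [set: R * R] (fun x => stream e c W z x - mu).
  exact: measurable_funB mS (@measurable_cst _ _ _ _ _ mu).
apply: measurable_funB; apply: (measurableT_comp (nondecr_meas fm)) => //.
exact: measurable_funB mV (@measurable_cst _ _ _ _ _ (n.+1%:R^-1 : R)).
Qed.

Lemma stream_abs (u v : R) : stream e c W z (u, `|v|) = stream e c W z (u, v).
Proof.
have [v0|v0] := leP 0 v; first by rewrite (ger0_norm v0).
rewrite (ltr0_norm v0) /stream (hpot_even (ltW e0) e1 u v zb sz) /=; reflexivity.
Qed.

(** Once [1 / (n + 1) <= sg tau^2], a vertical shift by [tau] lowers the stream function by at least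
    [1 / (n + 1)], so the gap is at most [z] minus its shift. *)
Lemma gap_int (tau : R) : 0 < tau -> tau <= 1 ->
  exists n, I2 (gap n) <= 4 * r * tau * M.
Proof.
move=> t0 t1; have X0 : 0 < r + 1 by rewrite addr_gt0.
have [sg sg0 hs] := stream_slope W e0 e1 c0 r0 l0 zb z0 sz zl zm X0.
have d0 : 0 < sg * tau ^+ 2 by rewrite mulr_gt0// exprn_gt0.
have [n hn] := natSinv_small d0; exists n; have {}hn := hn n (leqnn n).
have [Is hI] := sdec_shift zb z0 sz (ltW r0) (ltW t0).
apply: le_trans hI; have Iz := bsup_ig2 zb.
have mono x : z (x.1, `|x.2| + tau) <= z x.
  case: x => u v /=; apply: sz; rewrite (@ger0_norm _ (_ + _)) ?lerDl ?(ltW t0)//.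
  by rewrite addr_ge0// ltW.
suff le x : gap n x <= z x - z (x.1, `|x.2| + tau).
  apply: le_I2 => //; last exact: ig2B Iz Is.
  by apply: ig2_le (measurable_gap n) _ (ig2B Iz Is) => x; rewrite (ger0_norm (gap_ge0 _ _)).
rewrite /gap /half; case: ifP => [x1|_]; last by rewrite subr_ge0.
rewrite -(zE x1).
have [zx|zx] := eqVneq (z x) 0.
  have h1 := mono x; rewrite zx in h1.
  have -> : z (x.1, `|x.2| + tau) = 0 by apply/eqP; rewrite eq_le h1 z0.
  by rewrite zx lerD2l lerN2 (nondecr_ge0 fm fz).
have [_ _ /(_ x zx)[x1r x2r]] := zb; have xl := zl zx.
rewrite lerD2l lerN2 (zE (x := (x.1, _)))//; apply: fm.
have slope : sg * ((`|x.2| + tau) ^+ 2 - `|x.2| ^+ 2) <=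
    stream e c W z (x.1, `|x.2|) - stream e c W z (x.1, `|x.2| + tau).
  apply: hs => //; [|by rewrite lerDl ltW|by rewrite lerD].
  have xr := le_trans (ler_norm _) x1r; have r1 : r <= r + 1 by rewrite lerDl.
  by rewrite (le_trans xr r1) andbT (le_trans _ xl)// ler_pdivrMr// ler_peMr ?ler1n// ltW.
have ev : stream e c W z (x.1, `|x.2|) = stream e c W z x.
  by case: (x) => u v; exact: stream_abs.
rewrite ev in slope.
have sq : sg * tau ^+ 2 <= sg * ((`|x.2| + tau) ^+ 2 - `|x.2| ^+ 2).
  rewrite (ler_pM2l sg0); apply: sqr_add_ge; [exact: normr_ge0|exact: ltW].
have h := le_trans hn (le_trans sq slope).
exact: le_shift2 h.
Qed.

(* Superlevel sets of the stream function have null boundary by strict vertical monotonicity,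
   so the jumps of [f] are not seen. *)
Lemma avg_cvg_ae : exists2 N : set (R * R), (@lam2 R).-negligible N &
  forall x, ~ N x -> half (fun x => avg f n (stream e c W z x - mu)) x @[n --> \oo] --> z x.
Proof.
have cg x : gap n x @[n --> \oo] --> limn (fun n => gap n x).
  apply: nonincreasing_is_cvgn; [exact: gap_nonincr|].
  by exists 0 => _ [n _ <-]; exact: gap_ge0.
have lg0 x : 0 <= limn (fun n => gap n x).
  by apply: limr_ge; [apply/cvg_ex; eexists; exact: cg|apply: nearW => n; exact: gap_ge0].
have lgl x n : limn (fun n => gap n x) <= gap n x.
  by apply: (nonincreasing_cvgn_ge (@gap_nonincr x)); apply/cvg_ex; eexists; exact: cg.
have Iz := bsup_ig2 zb.
have zh x : ~~ (0 <= x.1) -> z x = 0.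
  by move=> h; apply/eqP; apply: contraNT h => /zl lx; exact: le_trans (ltW l0) lx.
have gz n x : gap n x <= z x.
  rewrite /gap /half; case: ifP => [x1|/negbT/zh->//].
  by rewrite (zE x1) gerBl (nondecr_ge0 fm fz).
have Ig n : ig2 (gap n).
  by apply: ig2_le (measurable_gap n) _ Iz => x; rewrite (ger0_norm (gap_ge0 _ _)).
have ml : measurable_fun [set: R * R] (fun x => limn (fun n => gap n x)).
  by apply: measurable_fun_cvg measurable_gap _ => x _; exact: cg.
have Il : ig2 (fun x => limn (fun n => gap n x)).
  by apply: ig2_le ml _ Iz => x; rewrite (ger0_norm (lg0 x)) (le_trans (lgl x 0))//.
have I0 : I2 (fun x => limn (fun n => gap n x)) <= 0.
  rewrite leNgt; apply/negP => pos.
  have M0 : 0 <= M by exact: bsup_ge0 zb.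
  have q0 : 0 < 4 * r * (M + 1) by rewrite !mulr_gt0// ltr_wpDl.
  pose J := I2 (fun x => limn (fun n => gap n x)).
  have t0 : 0 < Num.min 1 (J / (4 * r * (M + 1)) / 2).
    by rewrite lt_min ltr01 !divr_gt0.
  have t1 : Num.min 1 (J / (4 * r * (M + 1)) / 2) <= 1 by rewrite ge_min lexx.
  have t2 : Num.min 1 (J / (4 * r * (M + 1)) / 2) <= J / (4 * r * (M + 1)) / 2 by rewrite ge_min lexx orbT.
  have [n hn] := gap_int t0 t1.
  have h1 : J <= I2 (gap n) by apply: le_I2.
  have h2 : 4 * r * Num.min 1 (J / (4 * r * (M + 1)) / 2) * M <= J / 2.
    apply: (@le_trans _ _ (4 * r * (J / (4 * r * (M + 1)) / 2) * (M + 1))).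
      apply: ler_pM => //; last by rewrite lerDl.
        by rewrite !mulr_ge0// ltW.
      by rewrite ler_pM2l// mulr_gt0.
    rewrite le_eqVlt; apply/orP; left; apply/eqP; move: q0; move: (M + 1) => m q0.
    have m0 : m != 0 by apply: contraTneq q0 => ->; rewrite mulr0 ltxx.
    by field; rewrite m0 gt_eqF.
  exact: gt_half pos (le_trans h1 (le_trans hn h2)).
have [N N0 hN] := I2_eq0_ae Il lg0 I0.
exists N => // x nx; have := cg x; rewrite (hN x nx) => c0'.
have c1 : z x - gap n x @[n --> \oo] --> z x - 0 by apply: cvgB => //; exact: cvg_cst.
rewrite subr0 in c1; have c2 : z x @[n --> \oo] --> z x by exact: cvg_cst.
apply: (squeeze_cvgr _ c1 c2); apply: nearW => n.
rewrite /gap /half; case: ifP => [x1|/negbT/zh->]; last by rewrite subr0 lexx.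
by rewrite (zE x1) (avg_le fm fz) opprB addrCA subrr addr0 (avg_ge fm fz).
Qed.

Section Fixed.
Context (X : R) (phi p1 p2 : R * R -> R) (X0 : 0 <= X) (hphi : c1c X phi p1 p2).

Lemma c1c_bounds : exists2 C, 0 <= C &
  [/\ part true C phi p1, part false C phi p2, forall x, `|phi x| <= C, forall x, `|p1 x| <= C &
      forall x, `|p2 x| <= C].
Proof.
have [[cp c1 c2] sp d1 d2] := hphi.
have [C1 C10 h1] := deriv_part cp c1 sp d1; have [C2 C20 h2] := deriv_part cp c2 sp d2.
have [C3 C30 h3] := supp_bounded cp sp.
have up i C p : part i C phi p -> C <= C1 + C2 + C3 -> part i (C1 + C2 + C3) phi p.
  move=> [m1 hC hc] CC; split => // x t; apply: (le_trans (hC x t)); exact: ler_wpM2r.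
have k1 : C1 <= C1 + C2 + C3 by rewrite -addrA lerDl addr_ge0.
have k2 : C2 <= C1 + C2 + C3 by rewrite addrAC addrC lerDl addr_ge0.
exists (C1 + C2 + C3); first by rewrite !addr_ge0.
split; [exact: up h1 k1|exact: up h2 k2| | |].
- by move=> x; rewrite (le_trans (h3 x))// lerDr addr_ge0.
- by move=> x; exact: le_trans (part_bound x h1) k1.
- by move=> x; exact: le_trans (part_bound x h2) k2.
Qed.

Lemma c1c_measurable : [/\ measurable_fun [set: R * R] phi, measurable_fun [set: R * R] p1 &
  measurable_fun [set: R * R] p2].
Proof. by have [[cp c1 c2] _ _ _] := hphi; split; exact: cont2_meas. Qed.

(* The composite [prim f_n o U] of the mollified problem is a Lipschitz function with bounded
   support, so its gradient is curl free in the weak sense. *)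
Lemma curl_mollified n (d : R) : 0 < d ->
  I2 (fun x => half (fun x => avg f n (sdel d x) * gdel d false x) x * p1 x) =
  I2 (fun x => half (fun x => avg f n (sdel d x) * gdel d true x) x * p2 x).
Proof.
move=> d0; have [Cp _ [h1 h2 bp _ _]] := c1c_bounds.
have [[_ _ c2] sp _ _] := hphi.
have [Ct ht] := sdel_part true d0; have [Cf hf] := sdel_part false d0.
have am := avg_mono fm fz n; have ac := @avg_cont R f fm fz n.
have ub' x : 0 <= x.1 -> sdel d x <= ub by exact: sdel_ub.
have out' x : 0 <= x.1 -> ~ (l <= x.1 /\ inbox r x) -> sdel d x <= 0 by exact: sdel_out.
have kt := half_prim_part am (avg_fz n) ac l0 ub' out' ht.
have kf := half_prim_part am (avg_fz n) ac l0 ub' out' hf.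
set Th := half (fun x => prim (avg f n) (sdel d x)) in kt kf.
have Tb x : `|Th x| <= prim (avg f n) (Num.max ub 0).
  rewrite ger0_norm; last exact: (half_prim_ge0 _ am (avg_fz n)).
  exact: (half_prim_le am (avg_fz n) ub' x).
have Ts : suppb (Num.max r X) Th.
  by move=> x /(half_prim_supp out')[_]; apply: inboxW; rewrite le_max lexx.
have Ps : suppb (Num.max r X) phi.
  by move=> x /sp; apply: inboxW; rewrite le_max lexx orbT.
apply: (part_curl kt kf h1 h2 Tb bp Ts Ps) => x.
have ch : m.+1%:R^-1 @[m --> \oo] --> (0 : R) by exact: cvg_harmonic.
have cm1 : x.1 + m.+1%:R^-1 @[m --> \oo] --> x.1 + 0 by exact: cvgD (cvg_cst x.1) ch.
have cm2 : x.2 @[m --> \oo] --> x.2 by exact: cvg_cst.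
rewrite addr0 in cm1; have cm : mv true m.+1%:R^-1 x @[m --> \oo] --> (x.1, x.2).
  exact: (@cvg_pair _ _ _ _ _ _ _ _ _ _ _ cm1 cm2).
case: x cm {ch cm1 cm2} => u v cm.
exact: (cvg_continuous c2 cm).
Qed.

(** For fixed [n] the average of [f] is continuous, so pointwise convergence of the mollified stream
    function carries over to the vorticity, under the bound [f ub]; with [f] itself this could fail
    at a jump. *)
Lemma curl_avg n : I2 (fun x => pv w (dk e 0 false) x * (c * half (fun x => avg f n (stream e c W z x - mu)) x * p1 x)) =
  I2 (fun x => pv w (dk e 0 true) x * (c * half (fun x => avg f n (stream e c W z x - mu)) x * p2 x)) -
  I2 (fun x => W * half (fun x => avg f n (stream e c W z x - mu)) x * p2 x).
Proof.
have [Cp Cp0 [_ _ bp b1 b2]] := c1c_bounds; have [mp m1 m2] := c1c_measurable.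
have [[cp c1 c2] sp d1 d2] := hphi.
have am := avg_mono fm fz n; have ac := @avg_cont R f fm fz n.
pose a k := half (fun x => avg f n (sdel k.+1%:R^-1 x)).
pose a' := half (fun x => avg f n (stream e c W z x - mu)).
have dk0 (k : nat) : 0 < k.+1%:R^-1 :> R by rewrite invr_gt0.
have F0 : 0 <= f ub.
  by have := nondecr_ge0 fm fz ub.
have ab k x : `|a k x| <= f ub.
  rewrite /a /half; case: ifP => [x1|_]; last by rewrite normr0.
  rewrite ger0_norm; last exact: (nondecr_ge0 am (avg_fz n)).
  exact: le_trans (avg_le fm fz n _) (fm (sdel_ub (dk0 k) x1)).
have acv x : a k x @[k --> \oo] --> a' x.
  rewrite /a /a' /half; case: ifP => _; last exact: cvg_cst.
  exact: (cvg_continuous ac (@sdel_cvg x)).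
have ma k : measurable_fun [set: R * R] (a k).
  apply: measurable_half; apply: (measurableT_comp (continuous_measurable_fun ac)).
  by have [C [mS _ _]] := sdel_part true (dk0 k).
have [P1 P2] : (exists C, part true C phi p1) /\ (exists C, part false C phi p2).
  by have [C _ [h1 h2 _ _ _]] := c1c_bounds; split; exists C.
have X1 : 0 <= X + 1 by rewrite addr_ge0.
have sup1 p : suppb (X + 1) p -> forall k, suppb (X + 1) (fun x => c * a k x * p x).
  by move=> hp k x; rewrite mulf_eq0 negb_or => /andP[_ /hp].
have sp1 : suppb (X + 1) p1 by have [C h] := P1; exact: supp_part h sp.
have sp2 : suppb (X + 1) p2 by have [C h] := P2; exact: supp_part h sp.
have mm p : measurable_fun [set: R * R] p -> forall k, measurable_fun [set: R * R] (fun x => c * a k x * p x).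
  move=> hp k; apply: measurable_funM hp.
  exact: measurable_funM (@measurable_cst _ _ _ _ _ c) (ma k).
have bb p : (forall x, `|p x| <= Cp) -> forall k x, `|c * a k x * p x| <= c * f ub * Cp.
  move=> hp k x; rewrite !normrM (gtr0_norm c0) ler_pM// ?mulr_ge0 ?(ltW c0)//.
  by rewrite ler_pM2l.
have cc p x : c * a k x * p x @[k --> \oo] --> c * a' x * p x.
  by apply: cvgM; [exact: cvgMr (acv x)|exact: cvg_cst].
have odd_g : forall h, I2 (fun x => `|w (x - h) - w x|) <= (K + K) * enorm h `^ gam by exact: odd_modulus.
have KK : 0 <= K + K by rewrite addr_ge0.
have [_ I1 v1] := @pv_pair_cvg R e (M + M) r (K + K) gam w e0 odd_bsup KK g1 ge odd_g
  false (X + 1) _ _ _ X1 (mm _ m1) (bb _ b1) (sup1 _ sp1) (cc p1).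
have [_ I2' v2] := @pv_pair_cvg R e (M + M) r (K + K) gam w e0 odd_bsup KK g1 ge odd_g
  true (X + 1) _ _ _ X1 (mm _ m2) (bb _ b2) (sup1 _ sp2) (cc p2).
have Ib : ig2 (fun x => W * f ub * Cp * ibox (X + 1) x) by apply: ig2Z; exact: ig2_ibox.
have mW k : measurable_fun [set: R * R] (fun x => W * a k x * p2 x).
  apply: measurable_funM m2.
  exact: measurable_funM (@measurable_cst _ _ _ _ _ W) (ma k).
have bW k x : `|W * a k x * p2 x| <= W * f ub * Cp * ibox (X + 1) x.
  have [->|/sp2[h1 h2]] := eqVneq (p2 x) 0.
    by rewrite mulr0 normr0 !mulr_ge0 ?ibox_ge0.
  by rewrite ibox1// mulr1 !normrM (ger0_norm W0) ler_pM// ?mulr_ge0// ler_wpM2l.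
have cW x : W * a k x * p2 x @[k --> \oo] --> W * a' x * p2 x.
  by apply: cvgM; [exact: cvgMr (acv x)|exact: cvg_cst].
have [_ v3] := I2_dctT mW Ib bW cW.
have IW k : ig2 (fun x => W * a k x * p2 x) by exact: ig2_le (mW k) (bW k) Ib.
have v23 := cvgB v2 v3.
apply: (cvg_unique (@Rhausdorff R) v1); rewrite -/a'.
rewrite (_ : (fun k => _) = (fun k => I2 (fun x => pv w (dk e k.+1%:R^-1 true) x * (c * a k x * p2 x)) -
  I2 (fun x => W * a k x * p2 x))); first exact: v23.
apply/funext => k; rewrite -(I2B (I2' k) (IW k)).
have := curl_mollified n (dk0 k); rewrite /a.
set U1 := I2 _; set U2 := I2 _ => E.
have -> : I2 (fun x => pv w (dk e k.+1%:R^-1 false) x * (c * half (fun y => avg f n (sdel k.+1%:R^-1 y)) x * p1 x)) = U1.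
  apply: eq_I2 => x; rewrite /half /gdel; case: ifP => _; last by rewrite mulr0 !mul0r mulr0.
  by rewrite subr0; move: (pv _ _ _) (avg _ _ _) => A B; ring.
rewrite E; apply: eq_I2 => x; rewrite /half /gdel; case: ifP => _; last by rewrite !mulr0 !mul0r mulr0 subr0.
by move: (pv _ _ _) (avg _ _ _) => A B; ring.
Qed.

(** The principal values are now fixed and locally integrable, so almost everywhere convergence of
    the bounded averages is enough. *)
Lemma weak_right : [/\ ig2 (fun x => z x * (gdel 0 false x * p1 x)), ig2 (fun x => z x * (gdel 0 true x * p2 x)) &
  I2 (fun x => z x * (gdel 0 false x * p1 x - gdel 0 true x * p2 x)) = 0].
Proof.
have [Cp Cp0 [P1 P2 bp b1 b2]] := c1c_bounds; have [mp m1 m2] := c1c_measurable.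
have [[cp c1 c2] sp d1 d2] := hphi.
have [N N0 hN] := avg_cvg_ae; pose a n := half (fun x => avg f n (stream e c W z x - mu)).
have X1 : 0 <= X + 1 by rewrite addr_ge0.
have sp1 := supp_part P1 sp; have sp2 := supp_part P2 sp.
have M0 : 0 <= M by exact: bsup_ge0 zb.
have am n := avg_mono fm fz n.
have a0 n x : 0 <= a n x.
  by rewrite /a /half; case: ifP => // _; exact: (nondecr_ge0 (am n) (avg_fz n)).
have aM n x : a n x <= M.
  rewrite /a /half; case: ifP => // x1; apply: le_trans (avg_le fm fz n _) _.
  by rewrite -(zE x1) (z_le zb).
have ma n : measurable_fun [set: R * R] (a n).
  apply: measurable_half; apply: (measurableT_comp (nondecr_meas (am n))).
  exact: measurable_funB measurable_stream (@measurable_cst _ _ _ _ _ mu).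
have [mz _ _] := zb.
have KK : 0 <= K + K by rewrite addr_ge0.
have kb i : kbound e (2 * e) (dk e 0 i) by exact: kbound_dk.
have lim i (p : R * R -> R) : measurable_fun [set: R * R] p -> (forall x, `|p x| <= Cp) -> suppb (X + 1) p ->
  ig2 (fun x => pv w (dk e 0 i) x * (c * z x * p x)) /\
  I2 (fun x => pv w (dk e 0 i) x * (c * a n x * p x)) @[n --> \oo] --> I2 (fun x => pv w (dk e 0 i) x * (c * z x * p x)).
  move=> mp' bp' sp'.
  have [Iq _ _ _] := pv_swap e0 odd_bsup KK g1 ge odd_modulus X1 (kb i).
  have mq := pv_measurable e0 odd_bsup KK g1 ge odd_modulus (kb i).
  apply: (@I2_dct R _ _ (fun x => c * M * Cp * `|pv w (dk e 0 i) x * ibox (X + 1) x|) N N0).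
  - move=> n; apply: measurable_funM mq _; apply: measurable_funM mp'.
    exact: measurable_funM (@measurable_cst _ _ _ _ _ c) (ma n).
  - apply: measurable_funM mq _; apply: measurable_funM mp'.
    exact: measurable_funM (@measurable_cst _ _ _ _ _ c) mz.
  - exact: ig2Z (ig2_abs Iq).
  - move=> n x _; have [->|/sp'[h1 h2]] := eqVneq (p x) 0.
      by rewrite !mulr0 normr0 !mulr_ge0// ltW.
    rewrite ibox1// mulr1 normrM mulrC ler_wpM2r// !normrM (gtr0_norm c0) (ger0_norm (a0 n x)).
    by rewrite ler_pM// ?mulr_ge0 ?(ltW c0)// ler_pM2l.
  - move=> x nx; apply: cvgMr; apply: cvgM; last exact: cvg_cst.
    exact: cvgMr (hN x nx).
have [I1 v1] := lim false p1 m1 b1 sp1; have [I2' v2] := lim true p2 m2 b2 sp2.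
have Ib : ig2 (fun x => W * M * Cp * ibox (X + 1) x) by apply: ig2Z; exact: ig2_ibox.
have [IW v3] : ig2 (fun x => W * z x * p2 x) /\
    I2 (fun x => W * a n x * p2 x) @[n --> \oo] --> I2 (fun x => W * z x * p2 x).
  apply: (I2_dct N0 _ _ Ib).
  - move=> n; apply: measurable_funM m2.
    exact: measurable_funM (@measurable_cst _ _ _ _ _ W) (ma n).
  - apply: measurable_funM m2.
    exact: measurable_funM (@measurable_cst _ _ _ _ _ W) mz.
  - move=> n x _; have [->|/sp2[h1 h2]] := eqVneq (p2 x) 0.
      by rewrite mulr0 normr0 !mulr_ge0 ?ibox_ge0.
    by rewrite ibox1// mulr1 !normrM (ger0_norm W0) (ger0_norm (a0 n x)) ler_pM// ?mulr_ge0// ler_wpM2l.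
  - by move=> x nx; apply: cvgM; [exact: cvgMr (hN x nx)|exact: cvg_cst].
have E : I2 (fun x => pv w (dk e 0 false) x * (c * z x * p1 x)) =
    I2 (fun x => pv w (dk e 0 true) x * (c * z x * p2 x)) - I2 (fun x => W * z x * p2 x).
  have v23 := cvgB v2 v3.
  apply: (cvg_unique (@Rhausdorff R) v1).
  by rewrite (_ : (fun n => _) = (fun n => I2 (fun x => pv w (dk e 0 true) x * (c * a n x * p2 x)) -
    I2 (fun x => W * a n x * p2 x))); [exact: v23|apply/funext => n; exact: curl_avg].
have I23 := ig2B I2' IW.
have J1 : ig2 (fun x => z x * (gdel 0 false x * p1 x)).
  by apply: eq_ig2 I1 => x; rewrite /gdel subr0; move: (pv _ _ _) => A; ring.
have J2 : ig2 (fun x => z x * (gdel 0 true x * p2 x)).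
  by apply: eq_ig2 I23 => x; rewrite /gdel; move: (pv _ _ _) => A; ring.
split => //.
have E0 : I2 (fun x => pv w (dk e 0 false) x * (c * z x * p1 x) -
    (pv w (dk e 0 true) x * (c * z x * p2 x) - W * z x * p2 x)) = 0.
  by rewrite (I2B I1 I23) (I2B I2' IW) E subrr.
rewrite -[RHS]E0; apply: eq_I2 => x; rewrite /gdel subr0.
by move: (pv _ _ _) (pv _ _ _) => A B; ring.
Qed.

End Fixed.

(** [w] and the kernels have a parity under [bar]; the change of variables is made only where the
    principal value integral converges, hence the null set. *)
Lemma pv_bar (X : R) : 0 <= X -> exists2 N : set (R * R), (@lam2 R).-negligible N &
  forall x, ~ N x -> inbox X x ->
    pv w (dk e 0 true) (bar x) = pv w (dk e 0 true) x /\
    pv w (dk e 0 false) (bar x) = - pv w (dk e 0 false) x.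
Proof.
move=> X0; have KK : 0 <= K + K by rewrite addr_ge0.
have kb i : kbound e (2 * e) (dk e 0 i) by exact: kbound_dk.
have [_ _ _ [N1 N10 h1]] := pv_swap e0 odd_bsup KK g1 ge odd_modulus X0 (kb true).
have [_ _ _ [N2 N20 h2]] := pv_swap e0 odd_bsup KK g1 ge odd_modulus X0 (kb false).
have nb y : nrm2 (bar y) = nrm2 y by rewrite /nrm2 /= sqrrN.
have ob y x : osc w (bar y) (bar x) = - osc w y x.
  rewrite /osc -bar_sub !odd_bar (_ : ibox 1 (bar y) = ibox 1 y).
    by rewrite mulNr -opprD.
  by rewrite /ibox /= normrN.
exists (N1 `|` N2); first exact: negligibleU.
move=> x /not_orP[n1 n2] [x1 x2]; have bx := ibox1 x1 x2.
have [_ E1] := I2_bar (h1 x n1 bx); have [I2' E2] := I2_bar (h2 x n2 bx).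
split.
- rewrite /pv -[RHS]E1; apply: eq_I2 => y; rewrite -[y in osc w y _]barK ob.
  by rewrite (_ : dk e 0 true (bar y) = - dk e 0 true y) ?mulrN ?mulNr// /dk nb /= mulrN mulNr.
- rewrite /pv -[X in - X]E2 -(I2N I2'); apply: eq_I2 => y; rewrite -[y in osc w y _]barK ob.
  by rewrite /dk nb /= mulrN.
Qed.

(** The vortex on the left is the reflection of the one on the right: its contribution is
    [weak_right] for the reflected test function, with the signs supplied by [pv_bar]. *)
Lemma weak_form (X : R) (phi p1 p2 : R * R -> R) : 0 <= X -> c1c X phi p1 p2 ->
  I2 (fun x => w x * (gdel 0 false x * p1 x - gdel 0 true x * p2 x)) = 0.
Proof.
move=> X0 hphi; have [J1 J2 E1] := weak_right X0 hphi.
have [J3 J4 E2] := weak_right X0 (c1c_bar hphi).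
have [N N0 hN] := pv_bar (addr_ge0 X0 ler01).
have [C _ [h1 h2 _ _ _]] := c1c_bounds hphi.
have [mphi m1 m2] := c1c_measurable hphi.
have [_ sp _ _] := hphi; have sp1 := supp_part h1 sp; have sp2 := supp_part h2 sp.
pose k x := z x * (gdel 0 false x * - p1 (bar x) - gdel 0 true x * p2 (bar x)).
pose g x := z (bar x) * (gdel 0 false x * p1 x - gdel 0 true x * p2 x).
have Ik : ig2 k by have := ig2B J3 J4; apply: eq_ig2 => x; rewrite /k -mulrBr.
have KK : 0 <= K + K by rewrite addr_ge0.
have mg i : measurable_fun [set: R * R] (gdel 0 i).
  have kb : kbound e (2 * e) (dk e 0 i) by exact: kbound_dk.
  have mq := pv_measurable e0 odd_bsup KK g1 ge odd_modulus kb.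
  apply: measurable_funB (@measurable_cst _ _ _ _ _ _).
  exact: measurable_funM (@measurable_cst _ _ _ _ _ c) mq.
have [mz _ _] := zb.
have mgg : measurable_fun [set: R * R] g.
  apply: measurable_funM; first exact: (measurableT_comp mz (@measurable_bar R)).
  by apply: measurable_funB; apply: measurable_funM.
have gk x : ~ N x -> k x = g (bar x).
  move=> nx; rewrite /k /g barK; have [ix|ix] := pselect (inbox (X + 1) x).
    have [q1 q2] := hN x nx ix; rewrite /gdel q1 q2 !subr0.
    by move: (pv _ _ _) (pv _ _ _) => A B; ring.
  have ib : ~ inbox (X + 1) (bar x) by move=> [i1 i2]; apply: ix; split => //; rewrite /= normrN in i1.
  have -> : p1 (bar x) = 0 by apply/eqP; apply: contra_notT ib; exact: sp1.
  have -> : p2 (bar x) = 0 by apply/eqP; apply: contra_notT ib; exact: sp2.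
  by rewrite oppr0 !mulr0.
have mgb : measurable_fun [set: R * R] (fun x => g (bar x)).
  exact: (measurableT_comp mgg (@measurable_bar R)).
have Ib := ig2_eq_ae N0 (ig2_meas Ik) mgb gk Ik.
have Eb := I2_eq_ae N0 (ig2_meas Ik) mgb gk.
have [Ibb Ebb] := I2_bar Ib.
have Ig : ig2 g by apply: eq_ig2 Ibb => x; rewrite barK.
have Eg : I2 g = 0.
  by rewrite -(eq_I2 (fun x => congr1 g (barK x))) Ebb -Eb.
have J0 := ig2B J1 J2.
have J0' : ig2 (fun x => z x * (gdel 0 false x * p1 x - gdel 0 true x * p2 x)).
  by apply: eq_ig2 J0 => x; rewrite -mulrBr.
have wE x : w x * (gdel 0 false x * p1 x - gdel 0 true x * p2 x) =
    z x * (gdel 0 false x * p1 x - gdel 0 true x * p2 x) - g x by rewrite /g -mulrBl.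
by rewrite (eq_I2 wE) (I2B J0' Ig) E1 Eg subrr.
Qed.

Lemma gdel_ig i (X : R) : 0 <= X -> ig2 (fun x => gdel 0 i x * ibox X x).
Proof.
move=> X0; have KK : 0 <= K + K by rewrite addr_ge0.
have kb : kbound e (2 * e) (dk e 0 i) by exact: kbound_dk.
have [I1 _ _ _] := pv_swap e0 odd_bsup KK g1 ge odd_modulus X0 kb.
have := ig2B (ig2Z c I1) (ig2Z (if i then W else 0) (ig2_ibox X)).
by apply: eq_ig2 => x; rewrite /gdel mulrBl mulrA.
Qed.

Lemma measurable_gdel i : measurable_fun [set: R * R] (gdel 0 i).
Proof.
apply: (@measurable_fun_cvg _ _ _ setT (fun n x => gdel 0 i x * ibox n%:R x)) => [n|x _].
  exact: ig2_meas (gdel_ig i (ler0n _ n)).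
exact: ibox_cvg.
Qed.

(** The potential is covered by [pot_weak_grad]; for the drift, the derivatives of [x.1 * phi x]
    integrate to zero. *)
Lemma stream_weak_grad (X : R) (phi p1 p2 : R * R -> R) : 0 <= X -> c1c X phi p1 p2 ->
  I2 (fun x => stream e c W z x * p1 x) = - I2 (fun x => gdel 0 true x * phi x) /\
  I2 (fun x => stream e c W z x * p2 x) = - I2 (fun x => gdel 0 false x * phi x).
Proof.
move=> X0 hphi; have [C C0 [h1 h2 bp b1 b2]] := c1c_bounds hphi.
have [mphi m1 m2] := c1c_measurable hphi.
have [[cp c1 c2] sp d1 d2] := hphi.
have KK : 0 <= K + K by rewrite addr_ge0.
have G1 := pot_weak_grad e0 e1 r0 odd_bsup KK g1 ge odd_modulus h1 bp sp X0.
have G2 := pot_weak_grad e0 e1 r0 odd_bsup KK g1 ge odd_modulus h2 bp sp X0.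
have cf : continuous (fun x : R * R => x.1) by move=> x; exact: cvg_fst.
have cM (g : R * R -> R) : continuous g -> continuous (fun x => x.1 * g x).
  by move=> cg x; apply: cvgM; [exact: cf|exact: cg].
have cq1 : continuous (fun x => phi x + x.1 * p1 x).
  by move=> x; apply: cvgD; [exact: cp|exact: (cM _ c1)].
have sq : suppb X (fun x => x.1 * phi x).
  by move=> x; rewrite mulf_eq0 negb_or => /andP[_ /sp].
have dq1 x (t : R) : is_derive t 1 (fun u : R => (mv true u x).1 * phi (mv true u x))
    (phi (mv true t x) + (mv true t x).1 * p1 (mv true t x)).
  have da : is_derive t 1 (fun u : R => x.1 + u) (0 + 1) by exact: is_deriveD.
  have := is_deriveM da (d1 x t); rewrite add0r.
  by congr is_derive; rewrite /GRing.scale /= mulr1 addrC.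
have dq2 x (t : R) : is_derive t 1 (fun u : R => (mv false u x).1 * phi (mv false u x))
    ((mv false t x).1 * p2 (mv false t x)).
  have da : is_derive t 1 (fun u : R => x.1) 0 by exact: is_derive_cst.
  have := is_deriveM da (d2 x t).
  by congr is_derive; rewrite /GRing.scale /= mulr0 addr0.
have [D1 _ q1] := deriv_part (cM _ cp) cq1 sq dq1.
have [D2 _ q2] := deriv_part (cM _ cp) (cM _ c2) sq dq2.
have [B B0 hB] := supp_bounded (cM _ cp) sq.
have [Iq1 E1] := part_int0 q1 hB sq; have [Iq2 E2] := part_int0 q2 hB sq.
have Iphi : ig2 phi by exact: bsup_ig2 (supp_bsup mphi bp sp).
have Ix1 : ig2 (fun x => x.1 * p1 x).
  by have := ig2B Iq1 Iphi; apply: eq_ig2 => x; rewrite addrC addKr.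
have {}E1 : I2 (fun x => x.1 * p1 x) = - I2 phi.
  by apply/eqP; rewrite -addr_eq0 addrC -(I2D Iphi Ix1) E1.
have sp1 := supp_part h1 sp; have sp2 := supp_part h2 sp.
have X1 : 0 <= X + 1 by rewrite addr_ge0.
have Ipot (p : R * R -> R) : measurable_fun [set: R * R] p -> (forall x, `|p x| <= C) -> suppb (X + 1) p ->
    ig2 (fun x => pot e w x * p x).
  move=> mp bp' sp'.
  have mpot : measurable_fun [set: R * R] (pot e w) by exact: pot_measurable (ltW e0) e1 odd_bsup.
  have X2 : 0 < r + (X + 1) by rewrite addr_gt0// ltr_wpDl.
  apply: (@ig2_le R _ (fun x => (M + M) * kbox e (r + (X + 1)) * C * ibox (X + 1) x)).
  - exact: measurable_funM.
  - move=> x; have [->|/sp'[i1 i2]] := eqVneq (p x) 0.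
      have MM : 0 <= M + M by exact: (bsup_ge0 odd_bsup).
      by rewrite mulr0 normr0; move: (kbox_ge0 e (r + (X + 1))) (ibox_ge0 (X + 1) x) => k1 k2; exact: (mulr_ge0 (mulr_ge0 (mulr_ge0 MM k1) C0) k2).
    rewrite ibox1// mulr1 normrM ler_pM//.
    exact: (pot_bound (ltW e0) e1 odd_bsup).
  - by apply: ig2Z; exact: ig2_ibox.
have comb (p : R * R -> R) : measurable_fun [set: R * R] p -> (forall x, `|p x| <= C) -> suppb (X + 1) p ->
    ig2 (fun x => x.1 * p x) ->
    I2 (fun x => stream e c W z x * p x) = c * I2 (fun x => pot e w x * p x) - W * I2 (fun x => x.1 * p x).
  move=> mp bp' sp' Ixp; have Ip := Ipot p mp bp' sp'.
  rewrite -(I2Z _ Ip) -(I2Z _ Ixp) -(I2B (ig2Z c Ip) (ig2Z W Ixp)).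
  by apply: eq_I2 => x; rewrite /stream -odd_pot; ring.
have gi i : ig2 (fun x => pv w (dk e 0 i) x * phi x).
  have kb : kbound e (2 * e) (dk e 0 i) by exact: kbound_dk.
  have [Iv _ _ _] := pv_swap e0 odd_bsup KK g1 ge odd_modulus X0 kb.
  have := ig2_mul_bd Iv mphi bp; apply: eq_ig2 => x.
  by have [->|/sp[i1 i2]] := eqVneq (phi x) 0; rewrite ?mulr0// ibox1// mulr1.
have gE i : I2 (fun x => gdel 0 i x * phi x) = c * I2 (fun x => pv w (dk e 0 i) x * phi x) - (if i then W else 0) * I2 phi.
  rewrite -(I2Z _ (gi i)) -(I2Z _ Iphi) -(I2B (ig2Z c (gi i)) (ig2Z _ Iphi)).
  by apply: eq_I2 => x; rewrite /gdel mulrBl mulrA.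
split.
- by rewrite (comb _ m1 b1 sp1 Ix1) G1 gE E1 /=; move: (I2 _) (I2 _) => I I'; ring.
- by rewrite (comb _ m2 b2 sp2 Iq2) G2 gE E2 /=; move: (I2 _) => I; ring.
Qed.

End Weak.

(** * Passage to the definitions of the statement *)

Section Bridge.
Context (R : realType).
Implicit Types (x y : R * R) (f phi : R * R -> R).

Lemma I2_mu2 f : \int[@mu2 R]_x f x = I2 f.
Proof. by []. Qed.

Lemma bounded_Lfun (M : R) f : measurable_fun [set: R * R] f -> (forall x, `|f x| <= M) ->
  f \in Lfun (@mu2 R) +oo%E.
Proof.
move=> mf fM; rewrite inE; apply/andP; split; rewrite inE/=; first exact: mf.
rewrite /finite_norm unlock /Lnorm; case: ifPn => // _.
apply: (@le_lt_trans _ _ M%:E); last exact: ltry.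
apply/ess_sup_inf.ess_supP; apply: nearW => x /=; by rewrite lee_fin.
Qed.

Lemma compact_measurable (K : set (R * R)) : compact K -> measurable K.
Proof.
move=> cK; rewrite -(setCK K); apply: measurableC; apply: open2_measurable.
by rewrite openC; apply: compact_closed => //; exact: norm_hausdorff.
Qed.

Lemma compact_inbox (K : set (R * R)) : compact K -> exists2 X : R, 0 <= X & forall x, K x -> inbox X x.
Proof.
move=> /compact_bounded[X0 [_ hX]]; exists (`|X0| + 1); first by rewrite addr_ge0.
move=> x Kx; have := hX (`|X0| + 1) _ x Kx.
rewrite (le_lt_trans (ler_norm _)) ?ltrDl// => /(_ isT).
by rewrite /= prod_normE ge_max => /andP[].
Qed.

Lemma locally_integrable2P f : measurable_fun [set: R * R] f ->
  (forall X : R, 0 <= X -> ig2 (fun x => f x * ibox X x)) -> locally_integrable2 f.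
Proof.
move=> mf If; split => // K cK; have [X X0 hX] := compact_inbox cK.
have mK := compact_measurable cK.
have IK : (@mu2 R).-integrable K (EFin \o (fun x => f x * ibox X x)).
  by apply: integrableS (If X X0).
apply: eq_integrable IK => // x; rewrite inE => /hX[h1 h2] /=.
by rewrite ibox1// mulr1.
Qed.

Lemma riesz_pot (s M r : R) f x : 0 < s -> s < 1 -> bsup M r f ->
  riesz s f x = c_ s * pot (1 - s) f x.
Proof.
move=> s0 s1 fb; have e0 : 0 <= 1 - s by rewrite subr_ge0 ltW.
have e1 : 1 - s < 1 by rewrite gtrBl.
rewrite /pot -(I2Z _ (pot_ig2 x e0 e1 fb)); apply: eq_I2 => y.
by rewrite mulrA kpE powRN (_ : 2 * (1 - s) = 2 - 2 * s)//; ring.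
Qed.

Lemma spt_ge f x : f x != 0 -> spt f x.
Proof. by move=> h; apply: subset_closure. Qed.

Lemma test_c1c phi : test_function phi -> exists2 X : R, 0 <= X &
  c1c X phi (fun x => (grad phi x).1) (fun x => (grad phi x).2).
Proof.
move=> [hC /compact_inbox[X X0 hX]]; exists X => //.
have [cp dp c1 c2] := hC 1%N; split; [split; [exact: cp|exact: c1|exact: c2]|by move=> x /spt_ge/hX| |].
- move=> x t; have [d1 _] := dp (mv true t x).
  have E : (fun h : R => h^-1 *: (phi (mv true (h *: 1 + t) x) - phi (mv true t x))) =
      (fun h : R => h^-1 *: (phi (h *: e1 R + mv true t x) - phi (mv true t x))).
    apply/funext => h; congr (_ *: (phi _ - _)); apply: pairP => /=; rewrite ?scaler0 ?add0r//.
    by rewrite /GRing.scale /= addrCA.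
  by apply: DeriveDef; rewrite /derivable /derive E.
- move=> x t; have [_ d1] := dp (mv false t x).
  have E : (fun h : R => h^-1 *: (phi (mv false (h *: 1 + t) x) - phi (mv false t x))) =
      (fun h : R => h^-1 *: (phi (h *: e2 R + mv false t x) - phi (mv false t x))).
    apply/funext => h; congr (_ *: (phi _ - _)); apply: pairP => /=; rewrite ?scaler0 ?add0r//.
    by rewrite /GRing.scale /= addrCA.
  by apply: DeriveDef; rewrite /derivable /derive E.
Qed.

(* Uniformity on segments: the interval on which a uniform estimate holds is pushed to the
   right by gluing with the local estimate at its supremum. *)
Lemma hoelder_uniform (a : R) (g : R -> R) : 0 <= a -> locally_hoelder a g ->
  forall B : R, exists2 C, 0 <= C & forall t u, `|t| <= B -> `|u| <= B -> `|g t - g u| <= C * `|t - u| `^ a.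
Proof.
move=> a0 hg B.
pose H (p q C : R) := forall t u, p <= t -> t <= q -> p <= u -> u <= q -> `|g t - g u| <= C * `|t - u| `^ a.
suff [C [C0 hC]] : exists C, 0 <= C /\ H (- B) B C.
  by exists C => // t u; rewrite ler_norml => /andP[t1 t2]; rewrite ler_norml => /andP[u1 u2]; exact: (hC t u t1 t2 u1 u2).
have mono (d d' : R) : 0 <= d -> d <= d' -> d `^ a <= d' `^ a.
  by move=> d0 dd; apply: ge0_ler_powR => //; rewrite nnegrE// (le_trans d0).
have glue p q q' C C' : 0 <= C -> 0 <= C' -> p <= q -> H p q C -> H q q' C' -> H p q' (C + C').
  move=> C0 C0' pq h1 h2.
  have key t u : p <= t -> t <= u -> u <= q' -> `|g t - g u| <= (C + C') * `|t - u| `^ a.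
    move=> pt tu uq; have [uq'|uq'] := leP u q.
      by rewrite mulrDl (le_trans (h1 _ _ _ _ _ _)) ?lerDl ?mulr_ge0 ?powR_ge0// ?(le_trans tu)// (le_trans pt).
    have [tq|tq] := leP t q; last first.
      by rewrite mulrDl (le_trans (h2 _ _ _ _ _ _)) ?lerDr ?mulr_ge0 ?powR_ge0// ?(le_trans tu)// ltW.
    have -> : g t - g u = (g t - g q) + (g q - g u) by ring.
    rewrite (le_trans (ler_normD _ _))// mulrDl lerD//.
      apply: (le_trans (h1 _ _ _ _ _ _)) => //; rewrite ler_wpM2l// mono//.
      by rewrite !ler0_norm ?subr_le0// !opprB lerD2r ltW.
    apply: (le_trans (h2 _ _ _ _ _ _)) => //; rewrite ?(ltW uq')// ?(le_trans (ltW uq'))//.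
    rewrite ler_wpM2l// mono// !ler0_norm ?subr_le0 ?(ltW uq')// !opprB lerD2l lerN2//.
  move=> t u pt tq pu uq; have [tu|/ltW ut] := leP t u; first exact: key.
  by rewrite distrC (distrC t); exact: key.
have loc (m : R) : exists d C, [/\ 0 < d, 0 <= C & H (m - d) (m + d) C].
  have [C [[P Q] /= [/nbhs_ballP[dP /= dP0 hP] /nbhs_ballP[dQ /= dQ0 hQ]] hPQ]] := hg m.
  pose d := Num.min dP dQ / 2; have m0 : 0 < Num.min dP dQ by rewrite lt_min dP0.
  have dm : d < Num.min dP dQ by rewrite /d gtr_pMr// invf_lt1// ltr1n.
  exists d, `|C|; split; [by rewrite divr_gt0|by []|].
  move=> t u t1 t2 u1 u2; apply: (@le_trans _ _ (C * `|t - u| `^ a)); last first.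
    by rewrite ler_wpM2r ?powR_ge0// ler_norm.
  apply: (hPQ (t, u)); split => /=; [apply: hP|apply: hQ]; rewrite /ball /= distrC.
    by apply: le_lt_trans (lt_le_trans dm _); [rewrite ler_norml; lra|rewrite ge_min lexx].
  by apply: le_lt_trans (lt_le_trans dm _); [rewrite ler_norml; lra|rewrite ge_min lexx orbT].
have [B0|B0] := ltP B 0.
  exists 0; split => // t u t1 t2; have := le_trans t1 t2; lra.
pose S : set R := [set t | - B <= t <= B /\ exists C, 0 <= C /\ H (- B) t C].
have SB : S (- B).
  split; first by rewrite lexx /=; lra.
  exists 0; split => // t u t1 t2 u1 u2; have -> : t = u by lra.
  by rewrite subrr normr0 mul0r.
have hS : has_sup S by split; [exists (- B)|exists B => t [/andP[]]].
have [d [C1 [d0 C10 h1]]] := loc (sup S).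
have [t [/andP[tB tB'] [C [C0 hC]]] ht] := sup_adherent d0 hS.
have ts : t <= sup S by apply: (ub_le_sup hS.2); split; [rewrite tB|exists C].
pose q := Num.min B (sup S + d / 2).
have d2 : d / 2 < d by rewrite gtr_pMr// invf_lt1// ltr1n.
have qS : S q.
  split.
    rewrite /q le_min ge_min lexx /= andbT; apply/andP; split; first by lra.
    by have := divr_ge0 (ltW d0) (ler0n R 2); lra.
  exists (C + C1); split; first by rewrite addr_ge0.
  apply: (glue _ t) => // u v u1 u2 v1 v2.
  have q1 : q <= sup S + d / 2 by rewrite ge_min lexx orbT.
  by apply: h1; lra.
have [q1|q1] := leP B (sup S + d / 2).
  by move: qS => [_ [C' ]]; rewrite /q (min_idPl q1) => h; exists C'.
have := ub_le_sup hS.2 qS; rewrite /q (min_idPr (ltW q1)).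
by have := divr_gt0 d0 (ltr0n R 2); lra.
Qed.

End Bridge.

Section Traveling.
Context (R : realType) (s W mu M r l : R) (f : R -> R) (z : R * R -> R).
Let e := 1 - s.
Let c : R := c_ s.
Context (s0 : 0 < s) (s1 : s < 1) (W0 : 0 <= W) (r0 : 0 < r) (l0 : 0 < l) (mu0 : 0 < mu).
Context (fm : forall t u : R, t <= u -> f t <= f u) (fz : forall t : R, t <= 0 -> f t = 0).
Context (zb : bsup M r z) (z0 : forall x, 0 <= z x) (sz : sdec z).
Context (zl : forall y, z y != 0 -> l <= y.1) (zm : 0 < I2 z).
Context (zE : forall x, 0 <= x.1 -> z x = f (stream e c W z x - mu)).
Context (zout : forall x, 0 <= x.1 -> ~ (l <= x.1 /\ inbox r x) -> c * pot e z x <= mu).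

Lemma riesz_odd x : riesz s (odd_part z) x - W * x.1 = stream e c W z x.
Proof.
have e0 : 0 < 1 - s by rewrite subr_gt0.
have e1 : 1 - s < 1 by rewrite gtrBl.
by rewrite (riesz_pot x s0 s1 (odd_bsup zb)) (odd_pot e0 e1 zb).
Qed.

Lemma traveling_of_modulus (K gam : R) : 0 <= K -> 0 < gam -> gam <= 1 -> 2 * e - 1 < gam ->
  (forall h : R * R, I2 (fun x => `|z (x - h) - z x|) <= K * enorm h `^ gam) ->
  gsqg_traveling_wave s W (odd_part z).
Proof.
move=> K0 g0 g1 ge zK.
have e0 : 0 < e by rewrite subr_gt0.
have e1 : e < 1 by rewrite gtrBl.
have c0 : 0 < c by apply: c_gt0; rewrite s0.
exists (fun x => (gdel e c W z 0 true x, gdel e c W z 0 false x)).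
  have -> : (fun x => riesz s (odd_part z) x - W * x.1) = stream e c W z.
    by apply/funext => x; exact: riesz_odd.
  have lg i : locally_integrable2 (gdel e c W z 0 i).
    apply: locally_integrable2P; first exact: (measurable_gdel c W e0 zb K0 g1 ge zK).
    by move=> X X0; exact: (gdel_ig c W e0 zb K0 g1 ge zK).
  split; [|exact: lg|exact: lg|].
    have mS := measurable_stream c W e0 e1 zb.
    apply: locally_integrable2P => // X X0.
    have [B B0 hB] := stream_bounded W e0 e1 c0 r0 zb (ltr_wpDl X0 ltr01).
    have Ib : ig2 (fun x => B * ibox X x) by apply: ig2Z; exact: ig2_ibox.
    apply: ig2_le Ib; first exact: measurable_funM mS (measurable_ibox X).
    move=> x; rewrite normrM (ger0_norm (ibox_ge0 X x)) /ibox.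
    case: ifP => [/andP[x1 x2]|_]; last by rewrite !mulr0.
    by rewrite !mulr1; apply: hB; split; rewrite (le_trans x1, le_trans x2) ?lerDl.
  move=> phi /test_c1c[X X0 hphi].
  exact: (stream_weak_grad c W e0 e1 r0 zb K0 g1 ge zK X0 hphi).
move=> phi /test_c1c[X X0 hphi].
have E := weak_form e0 e1 c0 W0 r0 l0 mu0 fm fz zb z0 sz zl zm zE zout K0 g1 ge zK X0 hphi.
rewrite I2_mu2 -[RHS]E; apply: eq_I2 => x; rewrite /dot /perp /=; congr (_ * _).
by rewrite mulNr.
Qed.

Lemma traveling : (2^-1 < e -> forall B : R, exists2 Cf, 0 <= Cf &
    forall t u : R, `|t| <= B -> `|u| <= B -> `|f t - f u| <= Cf * `|t - u| `^ (2 * e - 1)) ->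
  gsqg_traveling_wave s W (odd_part z).
Proof.
have e0 : 0 < e by rewrite subr_gt0.
have e1 : e < 1 by rewrite gtrBl.
have c0 : 0 < c by apply: c_gt0; rewrite s0.
move=> hf; have [K [gam [K0 g0 g1 ge zK]]] := modulus e0 e1 c0 r0 l0 fm fz zb z0 sz zl zm zE hf.
exact: (traveling_of_modulus K0 g0 g1 ge zK).
Qed.

End Traveling.

(** * Rescaling and the limit of vanishing core *)

Section Scaling.
Context (R : realType) (s W kappa Lam D R2 mu eps : R) (f : R -> R) (zt : R * R -> R).
Let e := 1 - s.
Let c : R := c_ s.
Let L := D / eps.
Context (s0 : 0 < s) (s1 : s < 1) (W0 : 0 < W) (k0 : 0 < kappa) (D0 : 0 < D) (ep : 0 < eps) (mu0 : 0 < mu).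
Context (fm : forall t u : R, t <= u -> f t <= f u) (fz : forall t : R, t <= 0 -> f t = 0).
Context (hs : speed e c kappa L = W * eps `^ (2 * e + 1)).
Context (hadm : adm kappa Lam L zt) (hR : 4 * R2 <= L).
Context (hsup : forall x : R * R, zt x != 0 -> `|x.1 - L| <= R2 /\ `|x.2| <= R2).
Context (hout : forall x : R * R, 0 <= x.1 -> dom L x != 1 -> c * pot e zt x <= mu / 2).
Context (hE : forall x : R * R, 0 <= x.1 -> zt x = f (psi e c kappa L zt x - mu)).
Implicit Types (x y : R * R).

(** The factor preserves the mass, and the centre [(L, 0)] with [L = D / eps] moves to [(D, 0)]. *)
Definition rescale x : R := eps ^- 2 * zt (eps^-1 *: x).

Let e0 : 0 < e. Proof. by rewrite subr_gt0. Qed.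
Let e1 : e < 1. Proof. by rewrite gtrBl. Qed.
Let c0 : 0 < c. Proof. by apply: c_gt0; rewrite s0. Qed.
Let eV : 0 < eps^-1. Proof. by rewrite invr_gt0. Qed.
Let e2 : 0 < eps ^- 2. Proof. by rewrite invr_gt0 exprn_gt0. Qed.

Lemma kp_scale (t p : R) x : 0 < t -> kp p (t *: x) = t `^ (- (2 * p)) * kp p x.
Proof. by move=> t0; rewrite !kpE enormZ (gtr0_norm t0) powRM ?enorm_ge0// ltW. Qed.

Lemma rescale_abs (a b : R) : `|eps^-1 * a| <= b -> `|a| <= eps * b.
Proof. by rewrite normrM (gtr0_norm eV) mulrC ler_pdivrMr// mulrC. Qed.

Lemma rescale_neq0 x : rescale x != 0 -> zt (eps^-1 *: x) != 0.
Proof. by rewrite /rescale mulf_eq0 negb_or => /andP[]. Qed.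

Lemma rescale_supp x : rescale x != 0 -> `|x.1 - D| <= eps * R2 /\ `|x.2| <= eps * R2.
Proof.
move=> /rescale_neq0/hsup[h1 h2]; split; apply: rescale_abs; last exact: h2.
by move: h1; rewrite /= /GRing.scale /= /L mulrBr (mulrC D).
Qed.

Lemma rescale_bsup : bsup (eps ^- 2 * Lam) (2 * D) rescale.
Proof.
have [[mz zM zr] z0 _ _ _] := hadm; split.
- have mE : measurable_fun [set: R * R] (fun x : R * R => eps^-1 *: x).
    have mc : measurable_fun [set: R * R] (fun=> eps^-1) by exact: measurable_cst.
    exact: (measurable_fun_pair (measurable_funM mc measurable_fst) (measurable_funM mc measurable_snd)).
  exact: measurable_funM (@measurable_cst _ _ _ _ _ (eps ^- 2)) (measurableT_comp mz mE).
- by move=> x; rewrite /rescale normrM (gtr0_norm e2) ler_wpM2l// ltW.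
- move=> x /rescale_neq0/zr[h1 h2].
  have EL : eps * (2 * L) = 2 * D by rewrite /L; field; rewrite gt_eqF.
  by rewrite -EL; split; exact: rescale_abs.
Qed.

Lemma rescale_ge0 x : 0 <= rescale x.
Proof. by have [_ z0 _ _ _] := hadm; rewrite /rescale mulr_ge0// ltW. Qed.

Lemma rescale_sdec : sdec rescale.
Proof.
have [_ _ _ _ sz] := hadm; move=> a b b' h; rewrite /rescale ler_wpM2l ?(ltW e2)//.
by apply: sz; rewrite !normrM ler_wpM2l.
Qed.

Lemma rescale_mass : I2 rescale = kappa.
Proof.
have [zb _ _ <- _] := hadm; have [Ih Eh] := I2_scale eV (bsup_ig2 zb).
by rewrite -Eh /rescale (I2Z _ Ih) exprVn.
Qed.

Lemma rescale_pot x : pot e rescale x = eps `^ (- (2 * e)) * pot e zt (eps^-1 *: x).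
Proof.
have [zb _ _ _ _] := hadm.
pose F y := kp e (eps^-1 *: x - y) * zt y.
have IF : ig2 F by exact: pot_ig2 (ltW e0) e1 zb.
have [Ih Eh] := I2_scale eV IF.
rewrite /pot -/F -Eh -(I2Z _ Ih) -(I2Z _ (ig2Z _ Ih)); apply: eq_I2 => y.
rewrite /F -scalerBr (kp_scale _ _ eV) /rescale exprVn.
have E1 : eps `^ (- (2 * e)) * eps^-1 `^ (- (2 * e)) = 1.
  by rewrite -powRM ?(ltW ep) ?(ltW eV)// divff ?gt_eqF// powR1.
rewrite -[LHS](mul1r (_ * _)) -[X in X * _ = _]E1.
by move: (eps `^ _) (eps^-1 `^ _) (zt _) (kp _ _) (eps ^- 2) => a1 a2 a3 a4 a5; ring.
Qed.

Lemma bar_scale (t : R) x : bar (t *: x) = t *: bar x.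
Proof. by rewrite /bar /=; apply: pairP => //=; rewrite scalerN. Qed.

(** The mass-preserving scaling multiplies potentials by [eps^(-2 e)], and [hs] is what turns the
    drift [speed] into [W]. *)
Lemma rescale_stream x : eps `^ (2 * e) * stream e c W rescale x = psi e c kappa L zt (eps^-1 *: x).
Proof.
have E1 : eps `^ (2 * e) * eps `^ (- (2 * e)) = 1.
  by rewrite -powRD ?(gt_eqF ep) ?implybT// subrr powRr0.
rewrite /stream /psi hs /hpot !rescale_pot -bar_scale.
have -> : eps `^ (2 * e + 1) = eps `^ (2 * e) * eps.
  by rewrite powRD ?(gt_eqF ep) ?implybT// powRr1// ltW.
rewrite /= /GRing.scale /=.
have E2 : eps * eps^-1 = 1 by rewrite divff// gt_eqF.
move: E1 E2; move: (eps `^ (2 * e)) (eps `^ (- (2 * e))) (eps^-1) (pot _ _ _) (pot _ _ _) => a b d B A E1 E2.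
have -> : a * (c * (b * A - b * B) - W * x.1) = (a * b) * (c * (A - B)) - W * a * x.1 by ring.
rewrite E1 mul1r; congr (_ - _).
have -> : W * (a * eps) * (d * x.1) = (eps * d) * (W * a * x.1) by ring.
by rewrite E2 mul1r.
Qed.

(** The vorticity function seen by the rescaled density; it inherits monotonicity, zeros and Hoelder
    continuity, so [traveling] applies to it. *)
Definition fhat (t : R) : R := eps ^- 2 * f (eps `^ (2 * e) * t).

Let ea : 0 < eps `^ (2 * e). Proof. exact: powR_gt0. Qed.

Lemma rescale_E x : 0 <= x.1 ->
  rescale x = fhat (stream e c W rescale x - eps `^ (- (2 * e)) * mu).
Proof.
move=> x1; rewrite /fhat mulrBr rescale_stream mulrA.
rewrite -powRD ?(gt_eqF ep) ?implybT// subrr powRr0 mul1r /rescale hE//.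
by rewrite /= mulr_ge0// ltW.
Qed.

Lemma rescale_l x : rescale x != 0 -> D / 2 <= x.1.
Proof.
move=> /rescale_supp[+ _]; rewrite ler_norml => /andP[h _].
have : eps * R2 <= D / 4.
  by have := hR; rewrite -(ler_pM2l ep) /L [eps * (D / eps)]mulrC divfK ?gt_eqF// => h'; lra.
by have := D0; lra.
Qed.

Lemma rescale_out x : 0 <= x.1 -> ~ (D / 2 <= x.1 /\ inbox (2 * D) x) ->
  c * pot e rescale x <= eps `^ (- (2 * e)) * mu.
Proof.
move=> x1 h; have bp : 0 < eps `^ (- (2 * e)) by exact: powR_gt0.
rewrite rescale_pot mulrCA ler_pM2l//; apply: le_trans (_ : mu / 2 <= mu).
  apply: hout; first by rewrite /= mulr_ge0// ltW.
  apply/eqP => /domP/andP[/andP[h1 h2] h3]; apply: h.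
  have en : eps != 0 by rewrite gt_eqF.
  have EL : eps * (L / 2) = D / 2 by rewrite /L; field.
  have EL' : eps * (3 * L / 2) = 3 * D / 2 by rewrite /L; field.
  have q1 : D / 2 <= x.1 by move: h1; rewrite -(ler_pM2l ep) EL /= /GRing.scale /= mulVKf.
  have q2 : x.1 <= 3 * D / 2 by move: h2; rewrite -(ler_pM2l ep) EL' /= /GRing.scale /= mulVKf.
  have q3 : `|x.2| <= D / 2 by rewrite -EL; exact: rescale_abs.
  have := D0; split=> //; split; first by rewrite (ger0_norm x1); lra.
  by apply: le_trans q3 _; lra.
by have := mu0; lra.
Qed.

Lemma fhat_mono (t u : R) : t <= u -> fhat t <= fhat u.
Proof. by move=> tu; rewrite /fhat ler_pM2l// fm// ler_pM2l. Qed.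

Lemma fhat0 (t : R) : t <= 0 -> fhat t = 0.
Proof. by move=> t0; rewrite /fhat fz ?mulr0// pmulr_rle0. Qed.

Lemma fhat_hoelder : (s < 2^-1 -> locally_hoelder (1 - 2 * s) f) ->
  2^-1 < e -> forall B : R, exists2 Cf, 0 <= Cf &
    forall t u : R, `|t| <= B -> `|u| <= B -> `|fhat t - fhat u| <= Cf * `|t - u| `^ (2 * e - 1).
Proof.
move=> hf he B.
have s2 : s < 2^-1 by move: he; rewrite /e; lra.
have a0 : 0 <= 1 - 2 * s by lra.
have [C C0 hC] := hoelder_uniform a0 (hf s2) (eps `^ (2 * e) * B).
exists (eps ^- 2 * (C * (eps `^ (2 * e)) `^ (2 * e - 1))).
  by rewrite mulr_ge0 ?(ltW e2)// mulr_ge0 ?powR_ge0.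
move=> t u tB uB; rewrite /fhat -mulrBr normrM (gtr0_norm e2) -mulrA ler_pM2l//.
have := hC (eps `^ (2 * e) * t) (eps `^ (2 * e) * u).
rewrite !normrM (gtr0_norm ea) !ler_pM2l// -mulrBr normrM (gtr0_norm ea) => /(_ tB uB).
rewrite powRM ?(ltW ea)// mulrA; congr (_ <= _ * _ `^ _ * _ `^ _); rewrite /e; ring.
Qed.

Lemma rescale_traveling : (s < 2^-1 -> locally_hoelder (1 - 2 * s) f) ->
  gsqg_traveling_wave s W (odd_part rescale).
Proof.
move=> hf; apply: (traveling s0 s1 (ltW W0) _ _ _ fhat_mono fhat0 rescale_bsup rescale_ge0 rescale_sdec rescale_l _ rescale_E rescale_out (fhat_hoelder hf)).
- by rewrite mulr_gt0.
- by rewrite divr_gt0.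
- by rewrite mulr_gt0// powR_gt0.
- by rewrite rescale_mass.
Qed.

End Scaling.

(** * The family of vortices *)

Section Family.
Context (R : realType) (s W kappa : R) (f : R -> R).
Context (hs0 : 0 < s) (hs1 : s < 1) (hW : 0 < W) (hkappa : 0 < kappa).
Context (hf_zero : forall t : R, t <= 0 -> f t = 0).
Context (hf_nonneg : forall t : R, 0 < t -> 0 <= f t).
Context (hf_incr : forall t u : R, 0 < t -> t < u -> f t < f u).
Let e := 1 - s.
Let c : R := c_ s.
Let e0 : 0 < e. Proof. by rewrite subr_gt0. Qed.
Let e1 : e < 1. Proof. by rewrite gtrBl. Qed.
Let c0 : 0 < c. Proof. by apply: c_gt0; rewrite hs0. Qed.

Lemma vorticity_mono (t u : R) : t <= u -> f t <= f u.
Proof.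
move=> tu; have [t0|t0] := leP t 0; last first.
  by move: tu; rewrite le_eqVlt => /predU1P[->//|/(hf_incr t0)/ltW].
by rewrite (hf_zero t0); have [u0|u0] := leP u 0; [rewrite hf_zero|exact: hf_nonneg].
Qed.

Lemma growth_at0 : t `^ (- (1 - s)^-1) * f t @[t --> (0 : R)^'+] --> +oo ->
  forall B : R, 0 < B -> exists2 t0 : R, 0 < t0 & forall t : R, 0 < t -> t < t0 -> B * t `^ e^-1 <= f t.
Proof.
move=> /cvgryPge h B _; have [d /= d0 hd] := h B; exists d => // t t0 td.
have := hd t; rewrite /ball /= sub0r normrN (gtr0_norm t0) => /(_ td t0).
by rewrite powRN mulrC ler_pdivlMr// powR_gt0.
Qed.

(* The level [T] beyond which the stream function never climbs, for vorticities bounded by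
   [f T]; it exists because [f] grows slower than the power [1 / (1 - s)]. *)
Lemma stream_cap : t `^ (- (1 - s)^-1) * f t @[t --> +oo] --> (0 : R) ->
  exists2 T : R, 0 < T & forall (r : R) (h : R * R -> R) (x : R * R), bsup (f T) r h ->
    (forall y, 0 <= h y) -> I2 h = kappa -> c * pot e h x <= T / 2.
Proof.
move=> hf; pose q := 4 * c * kappa; pose A := (2 / (1 - e)) ^+ 2.
have q0 : 0 < q by exact: (mulr_gt0 (mulr_gt0 (ltr0n _ 4) c0) hkappa).
have A0 : 0 < A by rewrite exprn_gt0// divr_gt0// subr_gt0.
pose Q := 4 * c * A * q `^ (e^-1 - 1).
have Q0 : 0 < Q by exact: (mulr_gt0 (mulr_gt0 (mulr_gt0 (ltr0n _ 4) c0) A0) (powR_gt0 _ q0)).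
have QV : 0 < Q^-1 by rewrite invr_gt0.
have [N [_ hN]] : \forall t \near +oo, t `^ (- (1 - s)^-1) * f t <= Q^-1 by exact: (cvgr_le 0 hf).
pose T := Num.max 1 (N + 1); have T0 : 0 < T by rewrite lt_max ltr01.
have TN : N < T by rewrite lt_max ltrDl ltr01 orbT.
have hT := hN T TN; exists T => // r h x hb h0 hm.
(* This radius makes the far part in [pot_sup] equal to [T / (4 c)]; the near part is then
   [f T * T^(1 - 1/e)] up to constants collected in [Q], and small growth of [f] brings it below the
   same value. *)
pose rho := (q / T) `^ (2 * e)^-1.
have qT : 0 < q / T by rewrite divr_gt0.
have rho0 : 0 < rho by exact: powR_gt0.
have e2 : 2 * e != 0 by rewrite mulf_neq0// gt_eqF.
have R1 : rho `^ (- (2 * e)) * kappa = T / (4 * c).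
  rewrite /rho -powRrM mulrN mulVf// powRN powRr1 ?(ltW qT)// invf_div /q.
  by field; rewrite !gt_eqF.
have R2 : kbox e rho = A * ((q / T) `^ (e^-1 - 1)).
  rewrite kboxE ?(ltW e0) ?(ltW rho0)// -/A /rho -powRrM; congr (_ * _ `^ _).
  by field; rewrite gt_eqF.
have P : c * (f T * kbox e rho) <= T / 4.
  rewrite R2 powRM ?(ltW q0) ?invr_ge0 ?(ltW T0)//.
  have E : T^-1 `^ (e^-1 - 1) = T `^ (- e^-1) * T.
    rewrite -[T^-1](powR_inv1 (ltW T0)) -powRrM (_ : -1 * (e^-1 - 1) = - e^-1 + 1); last by ring.
    by rewrite powRD ?(gt_eqF T0) ?implybT// powRr1// ltW.
  rewrite E; have -> : c * (f T * (A * (q `^ (e^-1 - 1) * (T `^ (- e^-1) * T)))) =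
      (T `^ (- e^-1) * f T) * Q * (T / 4) by rewrite /Q; field.
  by rewrite ler_piMl ?divr_ge0 ?(ltW T0)// -ler_pdivlMr// mul1r.
have := pot_sup (ltW e0) e1 x hb h0 rho0; rewrite hm R1 => hp.
apply: (@le_trans _ _ (c * (f T * kbox e rho) + c * (T / (4 * c)))).
  by rewrite -mulrDr ler_pM2l.
have -> : c * (T / (4 * c)) = T / 4 by field; rewrite gt_eqF.
by move: P; move: (c * _) => a P; lra.
Qed.

Lemma d0_gt0 : 0 < Defs.d0 s W kappa.
Proof.
apply: powR_gt0; apply: divr_gt0; first exact: (mulr_gt0 (mulr_gt0 e0 c0) hkappa).
by rewrite mulr_gt0// powR_gt0.
Qed.

(** The formula for [d0] is the solution of this equation: [3 - 2 s = 2 e + 1], and the power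
    [2 e + 1] of [d0] is [e c kappa / (2^(2 e) W)]. *)
Lemma d0_speed (eps : R) : 0 < eps ->
  speed e c kappa (Defs.d0 s W kappa / eps) = W * eps `^ (2 * e + 1).
Proof.
move=> ep; have D0 := d0_gt0; set D := Defs.d0 s W kappa in D0 *.
have w0 : 0 < 2 `^ (2 * e) * W by rewrite mulr_gt0// powR_gt0.
have DE : D `^ (2 * e + 1) = e * c * kappa / (2 `^ (2 * e) * W).
  rewrite /D /Defs.d0 -powRrM (_ : (3 - 2 * s)^-1 * (2 * e + 1) = 1).
    rewrite powRr1; first by rewrite (_ : 2 - 2 * s = 2 * e)// /e; ring.
    apply: divr_ge0; first exact: ltW (mulr_gt0 (mulr_gt0 e0 c0) hkappa).
    by rewrite mulr_ge0 ?powR_ge0// ltW.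
  by rewrite /e; field; have := hs1; lra.
have p0 : 0 < 2 `^ (2 * e) by exact: powR_gt0.
have ep0 : 0 < eps `^ (2 * e + 1) by exact: powR_gt0.
have D1 : 0 < D `^ (2 * e + 1) by exact: powR_gt0.
have epV : 0 <= eps^-1 by rewrite invr_ge0 ltW.
rewrite /speed powRN !powRM ?epV ?(ltW ep) ?invr_ge0 ?mulr_ge0 ?(ltW D0) ?(ltW ep)//.
rewrite DE -[eps^-1](powR_inv1 (ltW ep)) -powRrM mulN1r powRN.
rewrite powRD ?pnatr_eq0 ?implybT// powRr1//.
move: p0 ep0; move: (2 `^ _) (eps `^ _) => a b a0 b0.
have cn : c != 0 by rewrite gt_eqF.
have en : e != 0 by rewrite gt_eqF.
move: cn en; move: (e) (c) => e' c' cn en.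
by field; rewrite cn en !gt_eqF.
Qed.

Definition vortex (R2 eps : R) (z : R * R -> R) :=
  [/\ exists M r, bsup M r z, forall x, 0 <= z x, sdec z, I2 z = kappa &
    [/\ 4 * (eps * R2) <= Defs.d0 s W kappa,
        forall x, z x != 0 -> `|x.1 - Defs.d0 s W kappa| <= eps * R2 /\ `|x.2| <= eps * R2,
        exists mu, forall x : R * R, 0 <= x.1 -> eps ^+ 2 * z x = f (eps `^ (2 * e) * stream e c W z x - mu) &
        gsqg_traveling_wave s W (odd_part z)]].

Theorem vortex_family : t `^ (- (1 - s)^-1) * f t @[t --> (0 : R)^'+] --> +oo ->
  t `^ (- (1 - s)^-1) * f t @[t --> +oo] --> (0 : R) ->
  (s < 2^-1 -> locally_hoelder (1 - 2 * s) f) ->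
  exists (eps0 R2 : R) (z : R -> R * R -> R), [/\ 0 < eps0, 0 < R2 &
    forall eps, 0 < eps < eps0 -> vortex R2 eps (z eps)].
Proof.
move=> h0 hoo hh; have fm := vorticity_mono.
have [T T0 hT] := stream_cap hoo.
have [mu0 [L1 [mu00 L10 hcore]]] := core_existence e0 e1 c0 hkappa T0 fm hf_zero (lexx (f T)) hT (growth_at0 h0).
have [R2 [L2 [R20 L20 hloc]]] := localized e0 e1 c0 hkappa T0 fm hf_zero (lexx (f T)) mu00.
have D0 := d0_gt0; set D := Defs.d0 s W kappa in D0 *.
pose L0 := Num.max L1 L2; have L00 : 0 < L0 by rewrite lt_max L10.
(* For [eps] below [D / L0] the scaled distance [D / eps] passes the thresholds of existence and
   localization; other values get the default [0]. *)
have ex (eps : R) : exists z, 0 < eps < D / L0 -> vortex R2 eps z.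
  have [/andP[ep epL]|] := boolP (0 < eps < D / L0); last by exists (fun=> 0).
  have LL : L0 <= D / eps by rewrite ler_pdivlMr// mulrC -ler_pdivlMr// ltW.
  have [LL1 LL2] : L1 <= D / eps /\ L2 <= D / eps by move: LL; rewrite ge_max => /andP[].
  have [zt [mu [za zmu zmax zB]]] := hcore _ LL1.
  have [hR hsup hout hE] := hloc _ _ _ LL2 za zmu zmax zB.
  have mup : 0 < mu by exact: lt_le_trans zmu.
  have hs := d0_speed ep; rewrite -/D in hs.
  exists (rescale eps zt) => _; split.
  - by do 2 eexists; exact: (rescale_bsup ep za).
  - exact: (rescale_ge0 ep za).
  - exact: (rescale_sdec ep za).
  - exact: (rescale_mass ep za).
  - split.
    + rewrite -/D; move: hR; rewrite -(ler_pM2l ep) [eps * (D / eps)]mulrC divfK ?gt_eqF//.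
      by rewrite mulrCA.
    + exact: (rescale_supp ep hsup).
    + exists mu => x x1; rewrite (rescale_stream hs0 hs1 ep hs za).
      by rewrite /rescale mulrA divff ?mul1r ?hE ?expf_neq0 ?gt_eqF//= mulr_ge0// invr_ge0 ltW.
    + exact: (rescale_traveling hs0 hs1 hW hkappa D0 ep mup fm hf_zero hs za hR hsup hout hE hh).
have /choice[z hz] := ex; exists (D / L0), R2, z; split => //; first exact: divr_gt0.
Qed.

End Family.

(** Each half carries mass [kappa] on a set where [eta] stays within [delta] of its value at [p] or
    at [bar p]; this explicit error replaces a convergence theorem. *)
Lemma odd_vortex_pairing (R : realType) (kappa M r delta : R) (z eta : R * R -> R) (p : R * R) :
  bsup M r z -> (forall x, 0 <= z x) -> I2 z = kappa -> continuous eta ->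
  (forall x, z x != 0 -> `|eta x - eta p| <= delta /\ `|eta (bar x) - eta (bar p)| <= delta) ->
  `|I2 (fun x => odd_part z x * eta x) - (kappa * eta p - kappa * eta (bar p))| <= 2 * delta * kappa.
Proof.
move=> zb z0 zk ec hd; have Iz := bsup_ig2 zb.
have [mz zM zr] := zb.
have me := cont2_meas ec; have [B B0 hB] := continuous_box r ec.
have Ize : ig2 (fun x => z x * eta x).
  apply: (@ig2_le R _ (fun x => M * B * ibox r x)); first exact: measurable_funM.
    move=> x; have [->|/zr[x1 x2]] := eqVneq (z x) 0.
      by rewrite mul0r normr0 !mulr_ge0 ?ibox_ge0// (bsup_ge0 zb).
    by rewrite ibox1// mulr1 normrM ler_pM// hB.
  by apply: ig2Z; exact: ig2_ibox.
have Izb : ig2 (fun x => z x * eta (bar x)).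
  apply: (@ig2_le R _ (fun x => M * B * ibox r x)).
  - by apply: measurable_funM mz _; exact: measurableT_comp me (@measurable_bar R).
  - move=> x; have [->|/zr[x1 x2]] := eqVneq (z x) 0.
      by rewrite mul0r normr0 !mulr_ge0 ?ibox_ge0// (bsup_ge0 zb).
    by rewrite ibox1// mulr1 normrM ler_pM// hB//; split; rewrite /= ?normrN.
  - by apply: ig2Z; exact: ig2_ibox.
have [Ib Eb] := I2_bar Izb.
have Ib' : ig2 (fun x => z (bar x) * eta x) by apply: eq_ig2 Ib => x; rewrite barK.
have -> : I2 (fun x => odd_part z x * eta x) = I2 (fun x => z x * eta x) - I2 (fun x => z x * eta (bar x)).
  rewrite -Eb -(I2B Ize Ib); apply: eq_I2 => x; by rewrite barK /odd_part mulrBl.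
have key g q : ig2 (fun x => z x * g x) -> (forall x, z x != 0 -> `|g x - g q| <= delta) ->
    `|I2 (fun x => z x * g x) - kappa * g q| <= delta * kappa.
  move=> Ig hg; have Id := ig2B Ig (ig2Z (g q) Iz).
  have -> : I2 (fun x => z x * g x) - kappa * g q = I2 (fun x => z x * g x - g q * z x).
    by rewrite (I2B Ig (ig2Z (g q) Iz)) (I2Z _ Iz) zk [g q * _]mulrC.
  apply: (le_trans (I2_abs Id)); rewrite -zk -(I2Z _ Iz).
  apply: le_I2; [exact: ig2_abs Id|exact: ig2Z|] => x.
  have [->|zx] := eqVneq (z x) 0; first by rewrite !mulr0 mul0r subr0 normr0.
  by rewrite [g q * _]mulrC -mulrBr normrM (ger0_norm (z0 x)) mulrC ler_wpM2r// hg.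
have K1 := key eta p Ize (fun x zx => (hd x zx).1).
have K2 := key (fun x => eta (bar x)) p Izb (fun x zx => (hd x zx).2).
move: K1 K2; move: (I2 _) (I2 _) (eta p) (eta (bar p)) => a2 a1 b1 b2 K1 K2.
rewrite (_ : _ - _ = (a1 - kappa * b1) - (a2 - kappa * b2)); last by ring.
rewrite (le_trans (ler_normB _ _))// -mulrA mulr_natl mulr2n; exact: lerD.
Qed.

Lemma Rintegral_dirac (R : realType) (a : R * R) (eta : R * R -> R) : continuous eta ->
  \int[\d_a]_x eta x = eta a.
Proof.
move=> ec; rewrite /Rintegral integral_dirac//; first by rewrite diracT mul1e.
by apply/measurable_EFinP; exact: cont2_meas.
Qed.

(** [spt] is a closure, so the localization has to be expressed by a closed set. *)
Lemma closed_box (R : realType) (a b : R) : closed [set x : R * R | `|x.1 - a| <= b /\ `|x.2| <= b].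
Proof.
have c1 : continuous (fun x : R * R => `|x.1 - a|).
  by move=> x; apply: cvg_norm; apply: cvgB; [exact: cvg_fst|exact: cvg_cst].
have c2 : continuous (fun x : R * R => `|x.2|) by move=> x; apply: cvg_norm; exact: cvg_snd.
rewrite (_ : mkset _ = (fun x : R * R => `|x.1 - a|) @^-1` [set t | t <= b] `&`
  (fun x : R * R => `|x.2|) @^-1` [set t | t <= b])//.
by apply: closedI; apply: closed_comp; try exact: closed_le; move=> x _; [exact: c1|exact: c2].
Qed.

Theorem corollary1p9 (R : realType) (s W kappa : R) (f : R -> R)
  (hs0 : 0 < s) (hs1 : s < 1) (hW : 0 < W) (hkappa : 0 < kappa)
  (hf_meas : measurable_fun [set: R] f)
  (hf_zero : forall t : R, t <= 0 -> f t = 0)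
  (hf_nonneg : forall t : R, 0 < t -> 0 <= f t)
  (hf_incr : forall t u : R, 0 < t -> t < u -> f t < f u)
  (hf_at0 : t `^ (- (1 - s)^-1) * f t @[t --> (0 : R)^'+] --> +oo)
  (hf_atoo : t `^ (- (1 - s)^-1) * f t @[t --> +oo] --> (0 : R))
  (hf_hoelder : s < 2^-1 -> locally_hoelder (1 - 2 * s) f) :
  exists (eps0 : R) (omega : R -> R * R -> R),
    [/\ 0 < eps0,
        (forall eps : R, 0 < eps < eps0 ->
          [/\ omega eps \in Lfun (@mu2 R) +oo%E,
              gsqg_traveling_wave s W (omega eps),
              (forall x1 x2 : R,
                 omega eps (- x1, x2) = - omega eps (x1, x2)),
              (forall x1 x2 : R,
                 omega eps (x1, - x2) = omega eps (x1, x2)) &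
              exists mu : R, forall x : R * R, 0 < x.1 ->
                eps ^+ 2 * omega eps x =
                f (eps `^ (2 - 2 * s) * (riesz s (omega eps) x - W * x.1)
                   - mu)]),
        (forall eta : R * R -> R, continuous eta -> compact (spt eta) ->
           (\int[@mu2 R]_x (omega eps x * eta x)) @[eps --> (0 : R)^'+] -->
           kappa * (\int[\d_((d0 s W kappa, 0) : R * R)]_x eta x)
           - kappa * (\int[\d_((- d0 s W kappa, 0) : R * R)]_x eta x)) &
        exists2 r : R, 0 < r & forall eps : R, 0 < eps < eps0 ->
          spt (omega eps) `<=`
            disk (d0 s W kappa, 0) (r * eps) `|`
            disk (- d0 s W kappa, 0) (r * eps)].
Proof.
have [eps0 [R2 [z [ep0 R20 hz]]]] := vortex_family hs0 hs1 hW hkappa hf_zero hf_nonneg hf_incr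
  hf_at0 hf_atoo hf_hoelder.
have D0 := d0_gt0 hs0 hs1 hW hkappa.
exists eps0, (fun eps => odd_part (z eps)); split; [exact: ep0| | |].
- move=> eps /hz[[M [r zb]] z0 sz zm [hR hsup [mu hE] htr]].
  have ob := odd_bsup zb; have [mo oM _] := ob.
  split; [exact: bounded_Lfun mo oM|exact: htr| | |].
  + by move=> x1 x2; exact: (odd_bar (z eps) (x1, x2)).
  + by move=> x1 x2; rewrite /odd_part /bar /= !(sdec_even _ _ sz).
  + exists mu => x x1; rewrite (riesz_odd W hs0 hs1 zb) (_ : 2 - 2 * s = 2 * (1 - s)); last by ring.
    (* On the right the reflected vortex is absent, because [4 eps R2 <= d0] keeps the support of
       [z eps] off the left half-plane. *)
    rewrite -(hE x (ltW x1)) /odd_part (_ : z eps (bar x) = 0) ?subr0//.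
    apply/eqP; apply: contraT => /hsup[+ _]; rewrite ler_norml => /andP[+ _] /=.
    move=> h; exfalso; move: h hR x1 D0; rewrite /bar /=; move: (d0 s W kappa) (eps * R2) (x.1) => D a b.
    by move=> *; lra.
- move=> eta ec _; rewrite !Rintegral_dirac//.
  apply/cvgrPdist_le => /= del del0.
  pose D := d0 s W kappa.
  (* [odd_vortex_pairing] loses a factor [2 kappa]. *)
  have d2 : 0 < del / (2 * kappa) by rewrite divr_gt0// mulr_gt0.
  have /cvgrPdist_le/(_ _ d2)/nbhs_ballP[d1 /= d10 h1] := ec (D, 0).
  have /cvgrPdist_le/(_ _ d2)/nbhs_ballP[d3 /= d30 h3] := ec (- D, 0).
  pose d := Num.min (Num.min d1 d3 / R2) eps0.
  have dp : 0 < d by rewrite lt_min ep0 divr_gt0// lt_min d10.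
  exists d => // eps; rewrite /ball /= sub0r normrN => hd ep; rewrite (gtr0_norm ep) in hd.
  have [hd1 hd2] : eps < Num.min d1 d3 / R2 /\ eps < eps0 by move: hd; rewrite lt_min => /andP[].
  have [|[M [r zb]] z0 sz zm [hR hsup _ _]] := hz eps; first by rewrite ep.
  have hd3 : eps * R2 < Num.min d1 d3 by rewrite -ltr_pdivlMr.
  have := odd_vortex_pairing (p := (D, 0)) (delta := del / (2 * kappa)) zb z0 zm ec.
  rewrite -I2_mu2 distrC (_ : 2 * (del / (2 * kappa)) * kappa = del); last by field; rewrite gt_eqF.
  apply => x /hsup[x1 x2]; move: hd3; rewrite lt_min => /andP[q1 q3].
  split; rewrite distrC.
    apply: h1; split; rewrite /ball /= ?sub0r ?normrN; [rewrite distrC|]; exact: le_lt_trans q1.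
  apply: h3; split; rewrite /ball /= ?sub0r ?normrN; last exact: le_lt_trans q3.
  by rewrite opprK addrC; exact: le_lt_trans q3.
(* The closed square of half-side [eps R2] lies in the closed Euclidean disk of radius [2 eps R2];
   the factor [3] leaves room for the open disk. *)
- exists (3 * R2); first by rewrite mulr_gt0.
  move=> eps /[dup] /andP[ep _] /hz[[M [r zb]] z0 sz zm [hR hsup _ _]].
  pose D := d0 s W kappa.
  have a0 : 0 < eps * R2 by rewrite mulr_gt0.
  have in_disk (a : R) (x : R * R) : `|x.1 - a| <= eps * R2 -> `|x.2| <= eps * R2 -> disk (a, 0) (3 * R2 * eps) x.
    move=> x1 x2; rewrite /disk /=; apply: le_lt_trans (enorm_le_sum _) _ => /=; rewrite subr0.
    by rewrite -mulrA (mulrC R2); move: x1 x2 a0; move: `|_| `|_| (eps * R2) => p q t; lra.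
  have cl : closed ([set x : R * R | `|x.1 - D| <= eps * R2 /\ `|x.2| <= eps * R2] `|`
      [set x : R * R | `|x.1 - - D| <= eps * R2 /\ `|x.2| <= eps * R2]).
    by apply: closedU; exact: closed_box.
  have sub : spt (odd_part (z eps)) `<=` [set x : R * R | `|x.1 - D| <= eps * R2 /\ `|x.2| <= eps * R2] `|`
      [set x : R * R | `|x.1 - - D| <= eps * R2 /\ `|x.2| <= eps * R2].
    rewrite /spt closureE; apply: smallest_sub => // x /= ox.
    have [zx|/hsup] := eqVneq (z eps x) 0; last by left.
    right; have /hsup[] : z eps (bar x) != 0.
      by apply: contra_neq ox; rewrite /odd_part zx => ->; rewrite subrr.
    by rewrite /= -opprD normrN opprK.
  by move=> x /sub[[x1 x2]|[x1 x2]]; [left|right]; exact: in_disk.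
Qed.
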